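(* Let $\mathbb X^n$ be $\mathbb H^n$ or $\mathbb E^n$, let $P\subset\mathbb X^n$ be a compact Coxeter polyhedron with Coxeter system $(W,S)$, let $\Delta$ be a regular (hyperbolic or Euclidean) building of type $(W,S)$, and let $X=\Gamma\backslash\Delta$ be a compact quotient of $\Delta$. Let $W'$ be a finite index torsion-free subgroup of $W$, let $\mathcal A\cong\mathbb X^n$ be an apartment of $\Delta$, let $Y=W'\backslash\mathcal A$, let $\varphi=(\varphi_t)$ be the geodesic flow on the unit tangent bundle $T^1Y$, and let $q$ and $l$ be the functions on $T^1Y$ defined in the context. Then $$h_{\mathrm{vol}}(X)=\sup_{\mu}\left\{h_\mu(\varphi)+\int_{T^1Y}\frac{\ln q}{l}\,d\mu\right\},$$ where the supremum is over all $\varphi$-invariant Borel probability measures $\mu$ on $T^1Y$ and $h_\mu(\varphi)$ is the measure-theoretic entropy of $\mu$ with respect to $\varphi_1$.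
   Context: **Coxeter polyhedra and buildings.** A Coxeter polyhedron $P\subset\mathbb X^n$ is a compact convex polyhedron all of whose dihedral angles are of the form $\pi/m$ with $m\ge 2$ an integer. $S$ is the set of reflections in the $(n-1)$-dimensional faces of $P$ and $W$ is the group of isometries of $\mathbb X^n$ generated by $S$; the $W$-images of $P$ tessellate $\mathbb X^n$. A polyhedral complex of type $(W,S)$ is a CW-complex $\Delta$ with a morphism of CW-complexes $\tau:\Delta\to P$ (the function type) whose restriction to any maximal cell is an isometry. A building of type $(W,S)$ is a polyhedral complex of type $(W,S)$ equipped with a maximal family of subcomplexes (apartments), polyhedrally isometric to the tessellation of $\mathbb X^n$ by $P$ under $W$, such that (1) any two cells lie in a common apartment; (2) for any two apartments $\mathcal A,\mathcal A'$ there is a polyhedral isometry $\mathcal A\to\mathcal A'$ fixing $\mathcal A\cap\mathcal A'$. It carries the length metric induced from the constant curvature metric of $P$. Maximal cells are called chambers, $(n-1)$-dimensional cells are called panels. The thickness $q(F)+1$ of a panel $F$ is the number of chambers containing it (finite, with $q(F)\ge1$). The building is regular if the thickness of a panel depends only on its image in $P$ under $\tau$. For a chamber $C$ and an apartment $\mathcal A\supset C$, the retraction $\rho:\Delta\to\mathcal A$ centered at $C$ is the map fixing $C$ pointwise whose restriction to each apartment containing $C$ is an isometry onto $\mathcal A$ fixing the intersection with $\mathcal A$. **Compact quotient and volume entropy.** $\Gamma$ is a discrete group acting isometrically, properly discontinuously and cocompactly on $\Delta$, and $X=\Gamma\backslash\Delta$. The volume entropy is $h_{\mathrm{vol}}(X)=\lim_{r\to\infty}\frac1r\ln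 \mathrm{vol}(B(x,r))$, where $B(x,r)$ is the ball of radius $r$ about $x\in\Delta$ in $\Delta$ and the volume of a set is the sum over chambers of the $n$-dimensional volumes of its intersections with the chambers; it does not depend on $x$. **The functions $q$ and $l$.** For $v\in T^1\mathcal A$, let $\gamma_v$ be the geodesic of $\mathcal A$ with initial vector $v$. A time $t\in\mathbb R$ is a crossing time of $\gamma_v$ if $\gamma_v(t)$ lies in a panel of $\mathcal A$ which $\gamma_v$ meets transversally (i.e. $\gamma_v$ is not contained in the hyperplane spanned by the panel). For a crossing time $t$, let $N_v(t)$ be the number of geodesic segments $c:[t-\varepsilon,t+\varepsilon]\to\Delta$ with $\rho\circ c=\gamma_v|_{[t-\varepsilon,t+\varepsilon]}$, where $\varepsilon>0$ is small and $\rho$ is the retraction onto $\mathcal A$ centered at a chamber of $\mathcal A$ containing $\gamma_v([t-\varepsilon,t])$; if $\gamma_v(t)$ lies in a single panel $F$ crossed transversally, then $N_v(t)=q(F)$. Let $t_v^+$ be the smallest crossing time $\ge0$ and $t_v^-$ the largest crossing time $<0$. Put $l(v)=t_v^+-t_v^-$ and $q(v)=N_v(t_v^+)$. These functions are $W$-invariant, hence descend to $T^1Y=W'\backslash T^1\mathcal A$. *)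

(* Defs.v *)
From HB Require Import structures.
From mathcomp Require Import all_boot all_order all_algebra.
From mathcomp Require Import all_classical all_reals all_analysis.
From mathcomp Require Import ring lra.
Import Order.TTheory GRing.Theory Num.Theory.
Import numFieldNormedType.Exports.

Set Implicit Arguments.
Unset Strict Implicit.
Unset Printing Implicit Defensive.

Local Open Scope classical_set_scope.
Local Open Scope ring_scope.

(** * The spaces E^d and H^d, d = n.+1 >= 1

    Both live in R^(1+d), with coordinates (x_0, x'):
      E^d = {x_0 = 1}  and  H^d = {x_0^2 - |x'|^2 = 1, x_0 > 0}.
    Isometries are restrictions of linear maps, written as matrices acting on
    the right of row vectors, and hyperplanes are zero sets of linear forms. *)

Variant geometry := Euclidean | Hyperbolic.

Section ModelSpace.
Variables (R : realType) (g : geometry) (n : nat).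
Implicit Types (x y u v : 'rV[R]_n.+2) (t : R).

Definition curv : R := if g is Hyperbolic then -1 else 0.

Definition sdot x y : R :=
  \sum_(i < n.+1) x ord0 (lift ord0 i) * y ord0 (lift ord0 i).

(* Membership in the model is [model_form x x = 1] and [0 < x_0]; the tangent
   space at x is the kernel of [model_form x]. *)
Definition model_form x y : R := x ord0 ord0 * y ord0 ord0 + curv * sdot x y.

(* On tangent vectors this is the Riemannian metric; the same formula gives the
   dual inner product on linear forms. *)
Definition gdot u v : R := sdot u v + curv * (u ord0 ord0 * v ord0 ord0).

Definition model_space : set 'rV[R]_n.+2 :=
  [set x | model_form x x = 1 /\ 0 < x ord0 ord0].

Definition arcosh (a : R) : R := ln (a + Num.sqrt (a ^+ 2 - 1)).

Definition dist x y : R :=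
  if g is Hyperbolic then arcosh (model_form x y)
  else Num.sqrt (sdot (x - y) (x - y)).

Definition lform u x : R := \sum_i u ord0 i * x ord0 i.

(* Gradient of [lform u] with respect to [gdot], for a unit form u. *)
Definition sharp u : 'rV[R]_n.+2 :=
  \row_i (if i == ord0 then curv * u ord0 i else u ord0 i).

(* x |-> x - 2 (lform u x) (sharp u) *)
Definition reflection u : 'M[R]_n.+2 := 1%:M - 2 *: (u^T *m sharp u).

(* A set of dimension at least k: it contains k+1 points in general position,
   i.e. linearly independent in R^(1+d). *)
Definition dim_ge (A : set 'rV[R]_n.+2) (k : nat) : Prop :=
  exists M : 'M[R]_(k.+1, n.+2), row_free M /\ forall i, A (row i M).

(** Riemannian volume, in the chart x |-> x'; its density is 1 / x_0. *)

Fixpoint iterated_integral (d : nat) : ('rV[R]_d -> \bar R) -> \bar R :=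
  match d with
  | 0 => fun f => f 0
  | d'.+1 => fun f =>
      (\int[lebesgue_measure]_(s in [set: R])
         iterated_integral (fun y : 'rV[R]_d' => f (row_mx s%:M y)))%E
  end.

Definition height (y : 'rV[R]_n.+1) : R :=
  Num.sqrt (1 - curv * \sum_i y ord0 i ^+ 2).

Definition volume (A : set 'rV[R]_n.+2) : \bar R :=
  iterated_integral (fun y : 'rV[R]_n.+1 =>
    (\1_A (row_mx (height y)%:M y : 'rV[R]_(1 + n.+1)) / height y)%:E).

(** Unit tangent bundle and geodesic flow *)

Definition unit_tangent_set : set ('rV[R]_n.+2 * 'rV[R]_n.+2) :=
  [set p | [/\ model_space p.1, model_form p.1 p.2 = 0 & gdot p.2 p.2 = 1]].

Definition unit_tangent : Type := set_type unit_tangent_set.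

Definition cosh t : R := (expR t + expR (- t)) / 2.
Definition sinh t : R := (expR t - expR (- t)) / 2.

Definition flow_pair t (p : 'rV[R]_n.+2 * 'rV[R]_n.+2) :=
  if g is Hyperbolic
  then (cosh t *: p.1 + sinh t *: p.2, sinh t *: p.1 + cosh t *: p.2)
  else (p.1 + t *: p.2, p.2).

Lemma sdotDl x y v : sdot (x + y) v = sdot x v + sdot y v.
Proof. by rewrite -big_split; apply: eq_bigr => i _; rewrite mxE mulrDl. Qed.

Lemma sdotZl (a : R) x y : sdot (a *: x) y = a * sdot x y.
Proof. by rewrite mulr_sumr; apply: eq_bigr => i _; rewrite mxE mulrA. Qed.

Lemma sdotC x y : sdot x y = sdot y x.
Proof. by apply: eq_bigr => i _; rewrite mulrC. Qed.

Lemma sdotDr x y v : sdot v (x + y) = sdot v x + sdot v y.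
Proof. by rewrite sdotC sdotDl !(sdotC v). Qed.

Lemma sdotZr (a : R) x y : sdot y (a *: x) = a * sdot y x.
Proof. by rewrite sdotC sdotZl (sdotC y). Qed.

Lemma sdot_ge0 x : 0 <= sdot x x.
Proof. by apply: sumr_ge0 => i _; rewrite -expr2 sqr_ge0. Qed.

End ModelSpace.

Arguments model_space {R} g {n} _.

Lemma flow_unit_tangent (R : realType) (g : geometry) (n : nat) (t : R)
    (p : 'rV[R]_n.+2 * 'rV[R]_n.+2) :
  unit_tangent_set g p -> unit_tangent_set g (flow_pair g t p).
Proof.
case: p => x v; case: g => -[[]];
  rewrite /unit_tangent_set /model_space /model_form /gdot /curv /flow_pair /=.
- rewrite !mul0r !addr0 => xx x0 xv vv.
  have v0 : v ord0 ord0 = 0.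
    by move/eqP: xv; rewrite mulf_eq0 gt_eqF//= => /eqP.
  by rewrite !mxE v0 !mulr0 !addr0.
- rewrite !mulN1r => xx x0 xv vv.
  have cs : cosh t * cosh t = 1 + sinh t * sinh t.
    rewrite /cosh /sinh; have := expRxMexpNx_1 t.
    by move: (expR t) (expR (- t)) => a b ab; field: ab.
  have [c1 c2] : 0 < cosh t + sinh t /\ 0 < cosh t - sinh t.
    rewrite /cosh /sinh; have := expR_gt0 t; have := expR_gt0 (- t).
    by split; lra.
  have := sdot_ge0 (v ord0 ord0 *: x + - x ord0 ord0 *: v).
  rewrite !(sdotDl, sdotDr, sdotZl, sdotZr) !mxE (sdotC v x).
  move: (sdot x x) (sdot x v) (sdot v v) (x ord0 ord0) (v ord0 ord0)
    xx x0 xv vv => X Y V a b xx a0 xv vv.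
  move: (cosh t) (sinh t) cs c1 c2 => c s cs c1 c2.
  have -> : X = a * a - 1 by lra.
  have -> : Y = a * b by lra.
  have -> : V = 1 + b * b by lra.
  move=> ab; have {}ab : b ^+ 2 <= a ^+ 2 by lra.
  have ba : `|b| <= a.
    by rewrite -(ger0_norm (ltW a0)) -ler_sqr ?nnegrE// !real_normK ?num_real.
  have pos : 0 < c * a + s * b.
    move: ba; rewrite ler_norml => /andP[ab1 ab2].
    have h1 : 0 <= (c + s) * (a + b) by apply: mulr_ge0; lra.
    have h2 : 0 <= (c - s) * (a - b) by apply: mulr_ge0; lra.
    have h3 : 0 < (c + s) * a by apply: mulr_gt0.
    have h4 : 0 < (c - s) * a by apply: mulr_gt0.
    by case: (lerP 0 b) => b0; nra.
  by split; [split; [ring: cs | exact: pos] | ring: cs | ring: cs].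
Qed.

HB.instance Definition _ (R : realType) (g : geometry) (n : nat) :=
  Topological.on (unit_tangent R g n).

Definition flow (R : realType) (g : geometry) (n : nat) (t : R)
    (p : unit_tangent R g n) : unit_tangent R g n :=
  exist _ (flow_pair g t (val p))
    (mem_set (flow_unit_tangent t (set_mem (valP p)))).

Lemma unit_tangent_point (R : realType) (g : geometry) (n : nat) :
  unit_tangent_set (R := R) (n := n) g
    (delta_mx ord0 ord0, delta_mx ord0 (lift ord0 ord0)).
Proof.
have sd0 (v : 'rV[R]_n.+2) : sdot (delta_mx ord0 ord0) v = 0.
  by apply: big1 => i _; rewrite mxE /= mul0r.
have sd1 : sdot (delta_mx ord0 (lift ord0 ord0) : 'rV[R]_n.+2)
    (delta_mx ord0 (lift ord0 ord0)) = 1.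
  rewrite /sdot big_ord_recl big1 ?addr0; first by rewrite !mxE !eqxx mulr1.
  by move=> i _; rewrite !mxE /= mul0r.
rewrite /unit_tangent_set /model_space /model_form /gdot /= !sd0 sd1 !mxE /=.
by split; rewrite ?(mulr0, mulr1, addr0).
Qed.

HB.instance Definition _ (R : realType) (g : geometry) (n : nat) :=
  isPointed.Build (unit_tangent R g n)
    (SigSub (mem_set (unit_tangent_point R g n))).

(** * Groups of isometries, as matrix groups *)

Section MatrixGroups.
Variables (R : realType) (n : nat).

Definition is_subgroup (G : set 'M[R]_n.+2) : Prop :=
  [/\ G 1, (forall a b, G a -> G b -> G (a * b)) &
      (forall a, G a -> a \is a GRing.unit /\ G a^-1)].

Record matrix_group := MatrixGroup {
  mgroup_set :> set 'M[R]_n.+2;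
  mgroupP : is_subgroup mgroup_set }.

Definition generated_group (S : set 'M[R]_n.+2) : set 'M[R]_n.+2 :=
  smallest is_subgroup S.

Definition finite_index (H G : set 'M[R]_n.+2) : Prop :=
  exists2 D : set 'M[R]_n.+2, finite_set D /\ D `<=` G &
    forall w, G w -> exists a d, [/\ H a, D d & w = a * d].

Definition torsion_free (H : set 'M[R]_n.+2) : Prop :=
  forall (w : 'M[R]_n.+2) (k : nat), H w -> (0 < k)%N -> w ^+ k = 1 -> w = 1.

End MatrixGroups.

(** * The quotient T^1 Y = H \ T^1 X and its geodesic flow *)

Section QuotientFlow.
Variables (R : realType) (g : geometry) (n : nat) (H : matrix_group R n).

Definition same_orbit : rel (unit_tangent R g n) := fun p q =>
  `[< exists2 w, mgroup_set H w & val q = ((val p).1 *m w, (val p).2 *m w) >].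

Lemma same_orbit_refl : reflexive same_orbit.
Proof.
have [H1 _ _] := mgroupP H.
by move=> p; apply/asboolP; exists 1 => //; rewrite !mulmx1 -surjective_pairing.
Qed.

Lemma same_orbit_imp p q : same_orbit p q -> same_orbit q p.
Proof.
have [_ _ HV] := mgroupP H.
move=> /asboolP[w Hw pq]; have [wU Hw'] := HV _ Hw.
apply/asboolP; exists w^-1 => //; rewrite pq /=.
rewrite -!mulmxA !(mulrV wU : w *m w^-1 = 1).
by rewrite !mulmx1 -surjective_pairing.
Qed.

Lemma same_orbit_sym : symmetric same_orbit.
Proof. by move=> p q; apply/idP/idP; apply: same_orbit_imp. Qed.

Lemma same_orbit_trans : transitive same_orbit.
Proof.
have [_ HM _] := mgroupP H.
move=> q p r /asboolP[w Hw pq] /asboolP[w' Hw' qr]; apply/asboolP.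
by exists (w * w'); [exact: HM | rewrite qr pq /= -!mulmxA].
Qed.

Canonical same_orbit_equiv :=
  EquivRel same_orbit same_orbit_refl same_orbit_sym same_orbit_trans.

Definition T1Y : Type := quotient_topology {eq_quot same_orbit_equiv}%qT.
HB.instance Definition _ := PointedTopological.on T1Y.
HB.instance Definition _ := Quotient.on T1Y.

Definition borel_T1Y := g_sigma_algebraType (@open T1Y).

Definition quotient_flow (t : R) (y : borel_T1Y) : borel_T1Y :=
  \pi_T1Y%qT (flow t (repr (y : T1Y))).

Definition flow_invariant (mu : probability borel_T1Y R) : Prop :=
  forall (t : R) (A : set borel_T1Y), measurable A ->
    mu (quotient_flow t @^-1` A) = mu A.

End QuotientFlow.

(** * Measure-theoretic (Kolmogorov-Sinai) entropy *)

Section Entropy.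
Context d (T : measurableType d) (R : realType).
Variables (mu : probability T R) (f : T -> T).

Definition measurable_partition (k : nat) (xi : 'I_k -> set T) : Prop :=
  [/\ forall i, measurable (xi i), trivIset setT xi &
      \bigcup_(i in setT) xi i = setT].

(* Shannon entropy of the join of f^{-j}(xi), 0 <= j < m *)
Definition join_entropy (k : nat) (xi : 'I_k -> set T) (m : nat) : R :=
  - \sum_(s : {ffun 'I_m -> 'I_k})
      let p := fine (mu (\bigcap_(j in [set: 'I_m])
                           (iter (j : nat) f @^-1` xi (s j)))) in
      p * ln p.

Definition partition_entropy (k : nat) (xi : 'I_k -> set T) : R :=
  limn (fun m => join_entropy xi m / m%:R).

Definition ks_entropy : \bar R :=
  ereal_sup [set h | exists k (xi : 'I_k -> set T),
    measurable_partition xi /\ h = (partition_entropy xi)%:E].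

End Entropy.

(** * Coxeter polyhedra *)

Record coxeter_polyhedron (R : realType) (g : geometry) (n : nat) :=
  CoxeterPolyhedron {
    facets : nat;
    (* outward unit normals, as linear forms *)
    facet_normal : 'I_facets -> 'rV[R]_n.+2;
    polyhedron : set 'rV[R]_n.+2 :=
      [set x | model_space g x /\ forall i, lform (facet_normal i) x <= 0];
    facet (i : 'I_facets) : set 'rV[R]_n.+2 :=
      [set x | polyhedron x /\ lform (facet_normal i) x = 0];
    normal_unit : forall i, gdot g (facet_normal i) (facet_normal i) = 1;
    normal_inj : injective facet_normal;
    poly_compact : compact polyhedron;
    poly_interior : exists x,
      model_space g x /\ forall i, lform (facet_normal i) x < 0;
    facet_dim : forall i, dim_ge (facet i) n;
    (* the dihedral angle at a face of codimension 2 (dimension k, where the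
       ambient dimension is n.+1) *)
    dihedral_angles : forall (i j : 'I_facets) (k : nat),
      i != j -> k.+2 = n.+1 -> dim_ge (facet i `&` facet j) k ->
      exists2 m : nat, (2 <= m)%N &
        pi - acos (gdot g (facet_normal i) (facet_normal j)) = pi / m%:R }.

Arguments facet_normal {R g n} c i.
Arguments facet {R g n} c i _.

Section Buildings.
Variables (R : realType) (g : geometry) (n : nat).
Variable (P : coxeter_polyhedron R g n).

Definition coxeter_group : set 'M[R]_n.+2 :=
  generated_group [set M | exists i, M = reflection g (facet_normal P i)].

Definition tile (w : 'M[R]_n.+2) : set 'rV[R]_n.+2 :=
  mulmxr w @` polyhedron P.

(* A polyhedral complex of type (W, S), presented by its points, its function
   type and its maximal cells; the metric of a maximal cell is pulled back from
   P. The closed cells are the preimages in the maximal cells of the faces of P,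
   and [chamber_glue] says that a cell whose relative interior meets a chamber
   lies in this chamber, i.e. that open cells are disjoint or equal. *)
Record polyhedral_complex := PolyhedralComplex {
  cplx_point : choiceType;
  ctype : cplx_point -> 'rV[R]_n.+2;
  chamber : set (set cplx_point);
  chamber_bij : forall C, chamber C -> set_bij C (polyhedron P) ctype;
  chamber_cover : forall x, exists2 C, chamber C & C x;
  chamber_glue : forall C D x y, chamber C -> chamber D -> C x -> D x -> C y ->
    (forall i, lform (facet_normal P i) (ctype x) = 0 ->
               lform (facet_normal P i) (ctype y) = 0) ->
    D y }.

Section Complex.
Variable (K : polyhedral_complex).
Implicit Types (x y : cplx_point K) (A C F : set (cplx_point K)).

Definition subcell C (I : {set 'I_(facets P)}) : set (cplx_point K) :=
  [set x | C x /\ forall i, i \in I -> lform (facet_normal P i) (ctype x) = 0].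

Definition is_cell F : Prop :=
  F !=set0 /\ exists C I, chamber C /\ F = subcell C I.

Definition is_panel F : Prop :=
  exists C i, chamber C /\ F = subcell C [set i]%SET.

Definition chambers_at F : set (set (cplx_point K)) :=
  [set C | chamber C /\ F `<=` C].

Definition subcomplex A : Prop :=
  forall x, A x -> exists2 F, is_cell F & F x /\ F `<=` A.

(** The length metric: infimum of the lengths of the chains from x to y whose
    consecutive points lie in a common chamber. *)

Definition step : rel (cplx_point K) := fun x y =>
  `[< exists2 C, chamber C & C x /\ C y >].

Definition chain_length x (s : seq (cplx_point K)) : R :=
  \sum_(l <- pairmap (fun a b => dist g (ctype a) (ctype b)) x s) l.

Definition cdist x y : R :=
  inf [set chain_length x s | s in [set s | path step x s /\ last x s = y]].

Definition cball x (r : R) : set (cplx_point K) := [set y | cdist x y < r].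

Definition cvolume A : \bar R :=
  \esum_(C in @chamber K) volume g (@ctype K @` (A `&` C)).

(** Polyhedral isometries: bijections carrying chambers to chambers, and
    isometric on each chamber (they then preserve cells of all dimensions and
    the length metrics). *)

(* from the tessellation of X by P under W *)
Definition tessellation_isometry (f : 'rV[R]_n.+2 -> cplx_point K) A : Prop :=
  set_bij (model_space g) A f /\
  forall w, coxeter_group w ->
    chamber (f @` tile w) /\
    {in tile w &, forall a b, dist g (ctype (f a)) (ctype (f b)) = dist g a b}.

Definition polyhedral_isometry (h : cplx_point K -> cplx_point K) A A' : Prop :=
  set_bij A A' h /\
  forall C, chamber C -> C `<=` A ->
    chamber (h @` C) /\
    {in C &, forall x y,
       dist g (ctype (h x)) (ctype (h y)) = dist g (ctype x) (ctype y)}.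

Definition apartment_system (Ap : set (set (cplx_point K))) : Prop :=
  [/\ forall A, Ap A -> subcomplex A /\ exists f, tessellation_isometry f A,
      (forall F F', is_cell F -> is_cell F' ->
         exists2 A, Ap A & F `<=` A /\ F' `<=` A) &
      (forall A A', Ap A -> Ap A' ->
         exists2 h, polyhedral_isometry h A A' &
           forall x, A x -> A' x -> h x = x)].

End Complex.

Record building := Building {
  bcomplex :> polyhedral_complex;
  apartment : set (set (cplx_point bcomplex));
  apartmentP : apartment_system apartment;
  apartment_max : forall Ap, apartment_system Ap ->
    apartment `<=` Ap -> Ap = apartment;
  thickness : forall F : set (cplx_point bcomplex), is_panel F ->
    exists2 q : nat, (1 <= q)%N & (chambers_at F #= `I_q.+1)%card }.

Arguments apartment : clear implicits.

Definition regular_building (B : building) : Prop :=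
  forall F F' : set (cplx_point B), is_panel F -> is_panel F' ->
    @ctype B @` F = @ctype B @` F' -> (chambers_at F #= chambers_at F')%card.

(** The topology of the length metric *)

Definition bspace (K : polyhedral_complex) : Type := cplx_point K.
HB.instance Definition _ K := Choice.on (bspace K).

Section MetricTopology.
Variable K : polyhedral_complex.

Definition copen : set_system (bspace K) :=
  [set U | forall x, U x -> exists2 r : R, 0 < r & cball x r `<=` U].

Lemma copenT : copen setT.
Proof. by move=> x _; exists 1. Qed.

Lemma copenI : setI_closed copen.
Proof.
move=> U V oU oV x [/oU[r r0 rU] /oV[s s0 sV]].
exists (Num.min r s); first by rewrite lt_min r0.
by move=> y; rewrite /cball /= lt_min => /andP[/rU Uy /sV Vy].
Qed.

Lemma copen_bigcup (I : Type) (U : I -> set (bspace K)) :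
  (forall i, copen (U i)) -> copen (\bigcup_i U i).
Proof.
move=> oU x [i _ /oU[r r0 rU]].
by exists r => // y /rU Uy; exists i.
Qed.

HB.instance Definition _ :=
  isOpenTopological.Build (bspace K) copenT copenI copen_bigcup.

End MetricTopology.

Record geometric_action (B : building) (G : groupType)
    (act : G -> bspace B -> bspace B) : Prop := GeometricAction {
  action_id : forall x, act 1%g x = x;
  action_comp : forall a b x, act (a * b)%g x = act a (act b x);
  act_isometry : forall a x y, cdist (act a x) (act a y) = cdist x y;
  act_proper : forall D : set (bspace B), compact D ->
    finite_set [set a | (act a @` D) `&` D !=set0];
  act_cocompact : exists2 D : set (bspace B), compact D &
    forall x, exists a, D (act a x) }.

(* Includes the existence of the limit defining the volume entropy, for every
   base point. *)
Definition is_volume_entropy (B : building) (h : \bar R) : Prop :=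
  forall x : cplx_point B,
    (r^-1%:E * lne (cvolume (cball x r)))%E @[r --> +oo%R] --> h.

(** * The functions q and l *)

Section CrossingFunctions.
(* [f] is meant to be a polyhedral isometry of the tessellated space onto the
   apartment [A]; geodesics and panels of [A] are read through it. *)
Variables (B : building) (A : set (cplx_point B)).
Variable (f : 'rV[R]_n.+2 -> cplx_point B).
Implicit Types (v : unit_tangent R g n) (t : R).

Definition geodesic v t : 'rV[R]_n.+2 := (val (flow t v)).1.

Definition wall (w : 'M[R]_n.+2) (i : 'I_(facets P)) : set 'rV[R]_n.+2 :=
  mulmxr w @` [set x | model_space g x /\ lform (facet_normal P i) x = 0].

Definition crossing_time v : set R := [set t | exists w i,
  [/\ coxeter_group w, (mulmxr w @` facet P i) (geodesic v t) &
      ~ (range (geodesic v) `<=` wall w i)]].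

Definition next_crossing v : R :=
  get [set t | [/\ crossing_time v t, 0 <= t &
    forall s, crossing_time v s -> 0 <= s -> t <= s]].

Definition last_crossing v : R :=
  get [set t | [/\ crossing_time v t, t < 0 &
    forall s, crossing_time v s -> s < 0 -> s <= t]].

Definition is_retraction (C : set (cplx_point B))
    (rho : cplx_point B -> cplx_point B) : Prop :=
  [/\ forall x, A (rho x), forall x, C x -> rho x = x &
      forall A', apartment B A' -> C `<=` A' ->
        polyhedral_isometry rho A' A /\ forall x, A' x -> A x -> rho x = x].

(* Geodesic segments c : [t - e, t + e] -> B folded by rho onto the geodesic of
   the apartment with initial vector v. *)
Definition folded_segments v t (e : R) (rho : cplx_point B -> cplx_point B) :
    set ([set` `[t - e, t + e]] -> cplx_point B) :=
  [set c | (forall s s', cdist (c s) (c s') = `|val s - val s'|) /\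
           forall s, rho (c s) = f (geodesic v (val s))].

Arguments folded_segments : clear implicits.

(* N_v(t): the count is the same for all small e and all admissible C. *)
Definition branching v t : nat :=
  get [set k : nat | \forall e \near 0^'+, forall C rho,
    chamber C -> C `<=` A ->
    (forall s, t - e <= s <= t -> C (f (geodesic v s))) ->
    is_retraction C rho ->
    (folded_segments v t e rho #= `I_k)%card].

Definition qfun v : nat := branching v (next_crossing v).
Definition lfun v : R := next_crossing v - last_crossing v.

(* ln q / l on T^1 Y: q and l are W-invariant, so the representative of the
   orbit does not matter. *)
Definition log_q_over_l (H : matrix_group R n) (y : borel_T1Y g H) : R :=
  let v := repr (y : T1Y g H) in ln (qfun v)%:R / lfun v.

End CrossingFunctions.

End Buildings.

Arguments apartment {R g n P} _ _.

(* Main.v *)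
(** For the retraction centred at a chamber, the number of chambers lying over a
    tile of the apartment is the product of the [q]'s of the walls separating
    the tile from the centre.  So [h_vol] is the growth rate of the sum over the
    tiles at distance at most [r] of the exponentials of these wall sums of
    [ln q], and the integral of [ln q / l] along a geodesic of the apartment is
    such a wall sum up to a bounded error.

    Upper bound on the measures: words of a given length in a fine partition of
    [T^1 Y] are dominated by the tiles near the endpoints of the orbits, and
    Gibbs' inequality bounds entropy plus integral by the weighted count.
    Lower bound: spread mass on the geodesics from the base tile to the tiles of
    a shell proportionally to their weights, average along the flow and take an
    ultrafilter limit; since [W'] is torsion-free there are no short return
    displacements, so partition words determine tiles up to bounded ambiguity. *)
Require Import Defs.
From HB Require Import structures.
From mathcomp Require Import all_boot all_order all_algebra.
From mathcomp Require Import all_classical all_reals all_analysis measurable_realfun.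
From mathcomp Require Import ring lra.
Import Order.TTheory GRing.Theory Num.Theory.
Import numFieldNormedType.Exports.
Local Open Scope classical_set_scope.
Local Open Scope ring_scope.
Set Implicit Arguments.
Unset Strict Implicit.
Unset Printing Implicit Defensive.

(** The tessellation itself is an output: that open tiles are disjoint, that [W] acts simply
    transitively on tiles and that tiles are locally finite is read off from a chart of one
    apartment, by pulling the gluing axiom of the complex back to the model space. A chart is only
    isometric on each tile, so it may twist types by a symmetry of [P]; faces are therefore
    recognised metrically and thicknesses are read through the chart.

    The function [ln q / l] is in general neither continuous nor bounded, since crossing times come
    close together near faces of codimension two. One inequality reaches it by truncation and
    monotone convergence, the other by Fatou's lemma. What is robust is the wall sum between two
    points: it changes by a bounded amount when the ends move by a bounded amount, and such errors
    vanish after division by the length.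

    The ultrafilter limit of the averages is only finitely additive. It becomes a Borel measure by
    Caratheodory extension from the algebra of sets whose boundary has open neighbourhoods of
    arbitrarily small mass. *)

Module Chord.

(** * Trigonometric functions common to curvature 0 and curvature -1 *)

Section Functions.
Context {R : realType}.
Implicit Types (g : geometry) (s t : R).

Lemma cosh_sinh t : cosh t ^+ 2 - sinh t ^+ 2 = 1.
Proof.
rewrite /cosh /sinh; have := expRxMexpNx_1 t.
by move: (expR t) (expR (- t)) => a b ab; field: ab.
Qed.

Lemma coshD s t : cosh (s + t) = cosh s * cosh t + sinh s * sinh t.
Proof. by rewrite /cosh /sinh opprD !expRD; field. Qed.
Lemma sinhD s t : sinh (s + t) = sinh s * cosh t + cosh s * sinh t.
Proof. by rewrite /cosh /sinh opprD !expRD; field. Qed.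
Lemma coshN t : cosh (- t) = cosh t.
Proof. by rewrite /cosh opprK addrC. Qed.
Lemma sinhN t : sinh (- t) = - sinh t.
Proof. by rewrite /sinh opprK -mulNr opprB. Qed.

Lemma sinh_gt0 t : 0 < t -> 0 < sinh t.
Proof.
move=> t0; apply: divr_gt0 => //; rewrite subr_gt0 ltr_expR.
by apply: (lt_trans _ t0); rewrite oppr_lt0.
Qed.

Lemma cosh_ge1 t : 1 <= cosh t.
Proof.
have h1 := expRxMexpNx_1 t; have h2 := expR_gt0 t; have h3 := expR_gt0 (- t).
have := sqr_ge0 (expR t - expR (- t)); rewrite /cosh.
move: (expR t) (expR (- t)) h1 h2 h3 => a b h1 h2 h3 h4.
have : 0 <= (a + b - 2) * (a + b + 2) by move: h4; rewrite expr2; lra.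
by rewrite pmulr_lge0 => [?|]; lra.
Qed.

Definition geoC g t : R := if g is Hyperbolic then cosh t else 1.
Definition geoS g t : R := if g is Hyperbolic then sinh t else t.

Lemma geoCD g s t :
  geoC g (s + t) = geoC g s * geoC g t - curv R g * (geoS g s * geoS g t).
Proof. by case: g => /=; rewrite ?coshD; ring. Qed.

Lemma geoSD g s t :
  geoS g (s + t) = geoS g s * geoC g t + geoC g s * geoS g t.
Proof. by case: g => /=; rewrite ?sinhD; ring. Qed.
Lemma geoCN g t : geoC g (- t) = geoC g t.
Proof. by case: g => //=; rewrite coshN. Qed.
Lemma geoSN g t : geoS g (- t) = - geoS g t.
Proof. by case: g => //=; rewrite sinhN. Qed.

Lemma geoC2 g t : geoC g t ^+ 2 = 1 - curv R g * geoS g t ^+ 2.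
Proof.
case: g => /=; first by ring.
by have := cosh_sinh t; lra.
Qed.

Lemma geoS0 g : geoS g 0 = 0 :> R.
Proof. by case: g => //=; rewrite /sinh oppr0 subrr mul0r. Qed.
Lemma geoC0 g : geoC g 0 = 1 :> R.
Proof. by case: g => //=; rewrite /cosh oppr0 expR0; field. Qed.
Lemma geoC_ge1 g t : 1 <= geoC g t.
Proof. by case: g => //=; exact: cosh_ge1. Qed.
Lemma geoC_gt0 g t : 0 < geoC g t.
Proof. by apply: lt_le_trans (geoC_ge1 g t). Qed.
Lemma geoS_gt0 g t : 0 < t -> 0 < geoS g t.
Proof. by case: g => //=; exact: sinh_gt0. Qed.

Lemma geoS_ge0 g t : 0 <= t -> 0 <= geoS g t.
Proof.
by rewrite le_eqVlt => /predU1P[<-|/(geoS_gt0 g)/ltW//]; rewrite geoS0.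
Qed.

Lemma geoS_lt g s t : s < t -> geoS g s < geoS g t.
Proof.
case: g => //= st; rewrite /sinh ltr_pM2r ?invr_gt0//.
by rewrite ltrD// ?ltr_expR// ltrN2 ltr_expR ltrN2.
Qed.

Lemma geoS_le g s t : s <= t -> geoS g s <= geoS g t.
Proof. by rewrite le_eqVlt => /predU1P[->//|/(geoS_lt g)/ltW]. Qed.
Lemma geoC_double g t : geoC g t = 1 - 2 * curv R g * geoS g (t / 2) ^+ 2.
Proof. by rewrite {1}[t]splitr geoCD -!expr2 geoC2; ring. Qed.

(** The length, in the ambient form [gdot], of the straight segment joining two points at distance
    [t]: [t] itself in Euclidean space, [2 sinh (t/2)] on the hyperboloid. *)
Definition chord g t : R := 2 * geoS g (t / 2).

Lemma chord_lt g s t : s < t -> chord g s < chord g t.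
Proof. by move=> st; rewrite ltr_pM2l// geoS_lt// ltr_pM2r. Qed.
Lemma chord0 g : chord g 0 = 0 :> R.
Proof. by rewrite /chord mul0r geoS0 mulr0. Qed.
Lemma chord_ge0 g t : 0 <= t -> 0 <= chord g t.
Proof. by move=> t0; rewrite mulr_ge0// geoS_ge0// divr_ge0. Qed.

Lemma chord_le g s t : 0 <= s -> 0 <= t ->
  (chord g s ^+ 2 <= chord g t ^+ 2) = (s <= t).
Proof.
move=> s0 t0; rewrite ler_sqr ?nnegrE ?chord_ge0//.
case: (leP s t) => [|ts]; last by apply/negbTE; rewrite -ltNge chord_lt.
by rewrite le_eqVlt => /predU1P[->|/(chord_lt g)/ltW->]; rewrite ?lexx.
Qed.

Lemma chordN g t : chord g (- t) = - chord g t.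
Proof. by rewrite /chord mulNr geoSN mulrN. Qed.

(** The hypothesis is the Cauchy-Schwarz lower bound for the inner product of the tangent vectors
    along the sides [a] and [b]; its right-hand side is that inner product as given by the law of
    cosines in each geometry. *)
Lemma chord_triangle g a b c :
  - (geoS g a * geoS g b) <=
    (if g is Hyperbolic then geoC g a * geoC g b - geoC g c
     else (chord g a ^+ 2 + chord g b ^+ 2 - chord g c ^+ 2) / 2) ->
  chord g c ^+ 2 <= chord g (a + b) ^+ 2.
Proof.
have := geoC_double g c; have := geoC_double g (a + b).
rewrite geoCD /chord; case: g => /=; last first.
  move: (sinh ((a + b) / 2)) (sinh (c / 2)) (cosh c) (cosh a) (cosh b).
  by move: (sinh a) (sinh b) => *; lra.
by move=> _ _; rewrite !(mulrC 2) !divfK//; lra.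
Qed.

End Functions.

Lemma ifE (T : Type) (g : geometry) (a b : T) : g = Euclidean ->
  (if g is Hyperbolic then a else b) = b.
Proof. by move->. Qed.

Lemma ifH (T : Type) (g : geometry) (a b : T) : g = Hyperbolic ->
  (if g is Hyperbolic then a else b) = a.
Proof. by move->. Qed.

(** * The distance of the model spaces through the ambient quadratic form *)

Section Metric.
Context {R : realType} (g : geometry) {n : nat}.
Implicit Types (x y z u v : 'rV[R]_n.+2) (a t : R).
Notation M := (@model_space R g n).
Notation gdot := (@gdot R g n).
Notation mform := (@model_form R g n).

Lemma gdotDl x y v : gdot (x + y) v = gdot x v + gdot y v.
Proof. by rewrite /Defs.gdot sdotDl !mxE; ring. Qed.
Lemma gdotC x y : gdot x y = gdot y x.
Proof. by rewrite /Defs.gdot sdotC; ring. Qed.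
Lemma gdotDr x y v : gdot v (x + y) = gdot v x + gdot v y.
Proof. by rewrite gdotC gdotDl !(gdotC v). Qed.
Lemma gdotZl a x y : gdot (a *: x) y = a * gdot x y.
Proof. by rewrite /Defs.gdot sdotZl !mxE; ring. Qed.
Lemma gdotZr a x y : gdot y (a *: x) = a * gdot y x.
Proof. by rewrite gdotC gdotZl (gdotC y). Qed.
Lemma gdotNl x y : gdot (- x) y = - gdot x y.
Proof. by rewrite -scaleN1r gdotZl mulN1r. Qed.
Lemma gdotNr x y : gdot x (- y) = - gdot x y.
Proof. by rewrite gdotC gdotNl gdotC. Qed.
Definition gdotE := (gdotDl, gdotDr, gdotNl, gdotNr, gdotZl, gdotZr).

Lemma sdotNl x y : sdot (- x) y = - sdot x y.
Proof. by rewrite -scaleN1r sdotZl mulN1r. Qed.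
Lemma sdotNr x y : sdot x (- y) = - sdot x y.
Proof. by rewrite sdotC sdotNl sdotC. Qed.

Lemma sdot_eq0 x : sdot x x = 0 -> forall i, x ord0 (lift ord0 i) = 0.
Proof.
move=> h i; apply/eqP; rewrite -[_ == 0]orbb -mulf_eq0; apply/eqP.
by apply: (psumr_eq0P _ h) => // j _; rewrite -expr2 sqr_ge0.
Qed.

Lemma sdot_CS x y : sdot x y ^+ 2 <= sdot x x * sdot y y.
Proof.
have [y0|yn0] := eqVneq (sdot y y) 0.
  rewrite (_ : sdot x y = 0) ?y0 ?expr0n ?mulr0//.
  by apply: big1 => i _; rewrite (sdot_eq0 y0) mulr0.
have yp : 0 < sdot y y by rewrite lt_def yn0 sdot_ge0.
have := sdot_ge0 (sdot y y *: x - sdot x y *: y).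
rewrite !(sdotDl, sdotDr, sdotNl, sdotNr, sdotZl, sdotZr) (sdotC y x).
by move: (sdot x x) (sdot x y) (sdot y y) yp => a b c yp h; nra.
Qed.

(** Hyperbolic case: Cauchy-Schwarz for [sdot], combined with [sdot x u = x0 * u0] and
    [sdot x x = x0 ^+ 2 - 1], shows that the Minkowski form is nonnegative on the orthogonal of a
    timelike vector. *)
Lemma gdot_tangent_ge0 x u : M x -> mform x u = 0 -> 0 <= gdot u u.
Proof.
move=> -[xx x0]; rewrite /model_form /Defs.gdot.
have := sdot_ge0 u; have := sdot_CS x u; have := sdot_ge0 x; move: xx x0.
rewrite /model_form; case: g => /=; rewrite ?mul0r ?addr0 ?mulN1r; first by [].
move: (sdot x x) (sdot x u) (sdot u u) (x _ _) (u _ _) => X A U a b.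
move=> xx a0 X0 CS U0 h; have := sqr_ge0 b => b0.
have e : A = a * b by lra.
have e2 : X = a * a - 1 by lra.
have h2 : 0 <= a * a * (U - b * b) - U by rewrite e e2 in CS; lra.
have h3 : 0 < a * a by apply: mulr_gt0.
have h4 : 0 <= a * a * (U - b * b) by lra.
by rewrite pmulr_rge0// in h4; lra.
Qed.

Lemma gdot_tangent_eq0 x u : M x -> mform x u = 0 -> gdot u u = 0 -> u = 0.
Proof.
move=> -[xx x0]; rewrite /model_form /Defs.gdot => h1 h2.
suff [h3 h4] : sdot u u = 0 /\ u ord0 ord0 = 0.
  apply/rowP => i; rewrite mxE.
  have [->//|] := eqVneq i ord0.
  by rewrite eq_sym => /unlift_some[j -> _]; exact: sdot_eq0.
move: h1 h2 (sdot_ge0 u) (sdot_CS x u) (sdot_ge0 x); move: xx x0.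
rewrite /model_form; case: g => /=; rewrite ?mul0r ?addr0 ?mulN1r.
  move=> _ x0 /eqP; rewrite mulf_eq0 gt_eqF//= => /eqP u0 h _ _ _.
  by rewrite u0.
move: (sdot x x) (sdot x u) (sdot u u) (x _ _) (u _ _) => X A U a b.
move=> xx a0 h1 h2 U0 CS X0.
have e : A = a * b by lra.
have e2 : X = a * a - 1 by lra.
have e3 : U = b * b by lra.
have h : b * b <= 0 by rewrite e e2 e3 in CS; lra.
have b0 : b = 0 by apply/eqP; rewrite -sqrf_eq0 eq_le expr2 h -expr2 sqr_ge0.
by rewrite e3 b0 mulr0.
Qed.

(** The squared ambient chord. Distances are compared through it because it is polynomial in the
    coordinates and has the same expression in both geometries. *)
Definition kap x y := gdot (x - y) (x - y).

Lemma kapC x y : kap x y = kap y x.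
Proof. by rewrite /kap -[x - y]opprB gdotNl gdotNr opprK. Qed.

Lemma mform_E : mform = if g is Hyperbolic then fun x y => - gdot x y
  else fun x y => x ord0 ord0 * y ord0 ord0.
Proof.
apply/funext => x; apply/funext => y; rewrite /model_form /Defs.gdot.
by case: g => /=; ring.
Qed.

Lemma mform_kap x y : M x -> M y -> mform x y = 1 - curv R g * kap x y / 2.
Proof.
rewrite /kap !gdotE (gdotC y x) => -[]; rewrite mform_E => xx x0 [yy y0].
move: xx yy; rewrite mform_E; case: g x0 y0 => /= x0 y0 xx yy.
  rewrite !mul0r subr0.
  have /eqP : (x ord0 ord0) ^+ 2 = 1 by rewrite expr2.
  rewrite sqrf_eq1 => /orP[]/eqP ex; last by move: x0; rewrite ex; lra.
  have /eqP : (y ord0 ord0) ^+ 2 = 1 by rewrite expr2.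
  rewrite sqrf_eq1 => /orP[]/eqP ey; last by move: y0; rewrite ey; lra.
  by rewrite ex ey mulr1.
move: xx yy.
move: (Defs.gdot _ x x) (Defs.gdot _ x y) (Defs.gdot _ y y) => a b c h1 h2; lra.
Qed.

Lemma mformDr x y v : mform v (x + y) = mform v x + mform v y.
Proof. by rewrite /Defs.model_form sdotDr !mxE; ring. Qed.
Lemma mformC x y : mform x y = mform y x.
Proof. by rewrite /Defs.model_form sdotC; ring. Qed.
Lemma mformZr a x y : mform y (a *: x) = a * mform y x.
Proof. by rewrite /Defs.model_form sdotZr !mxE; ring. Qed.
Lemma mformNr x y : mform x (- y) = - mform x y.
Proof. by rewrite -scaleN1r mformZr mulN1r. Qed.
Lemma mformDl x y v : mform (x + y) v = mform x v + mform y v.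
Proof. by rewrite mformC mformDr !(mformC v). Qed.
Lemma mformZl a x y : mform (a *: x) y = a * mform x y.
Proof. by rewrite mformC mformZr mformC. Qed.
Definition mformE := (mformDr, mformZr, mformNr, mformDl, mformZl).

Lemma model_coord0 x : g = Euclidean -> M x -> x ord0 ord0 = 1.
Proof.
move=> ge [+ x0]; rewrite mform_E ge => xx.
have /eqP : (x ord0 ord0) ^+ 2 = 1 by rewrite expr2.
by rewrite sqrf_eq1 => /orP[]/eqP// e; move: x0; rewrite e; lra.
Qed.

(** In the hyperbolic case this is the reversed Cauchy-Schwarz inequality [1 <= mform x y]: the
    tangential part of [x] at [y] has square norm [mform x y ^+ 2 - 1], and both points lie on the
    same sheet. *)
Lemma kap_ge0 x y : M x -> M y -> 0 <= kap x y.
Proof.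
move=> Mx My; have [ge|gh] : g = Euclidean \/ g = Hyperbolic by case: g; [left|right].
  rewrite /kap /Defs.gdot (_ : curv R g = 0) ?ge// mul0r addr0.
  exact: sdot_ge0.
have := mform_kap Mx My; rewrite {2}gh /= => e.
suff : 1 <= mform x y by rewrite e; lra.
have [xx x0] := Mx; have [yy y0] := My.
have h : 0 <= gdot (x - mform x y *: y) (x - mform x y *: y).
  by apply: (gdot_tangent_ge0 My); rewrite !mformE yy (mformC y x); ring.
have p : 0 < mform x y.
  move: xx yy (sdot_CS x y) (sdot_ge0 x) (sdot_ge0 y); rewrite /model_form gh /=.
  move: (sdot x x) (sdot x y) (sdot y y) (x _ _) (y _ _) x0 y0.
  move=> X A Y a b a0 b0 hx hy CS X0 Y0.
  have ab : 0 < a * b by apply: mulr_gt0.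
  have : A ^+ 2 < (a * b) ^+ 2.
    apply: le_lt_trans CS _; have -> : X = a * a - 1 by lra.
    have -> : Y = b * b - 1 by lra.
    by rewrite expr2; nra.
  move=> hh; suff : A < a * b by lra.
  by apply: contraTlt hh => hh; rewrite -leNgt ler_sqr ?nnegrE//; lra.
move: h xx yy e; rewrite !gdotE (gdotC y x).
move: p; rewrite mform_E !(ifH _ _ gh).
by move: (Defs.gdot _ x x) (Defs.gdot _ x y) (Defs.gdot _ y y) => a b c; nra.
Qed.

(** Characterises [dist] as the nonnegative number with a prescribed chord; with the monotonicity of
    [chord], every comparison of distances becomes a comparison of values of [kap]. *)
Lemma dist_spec x y : M x -> M y ->
  0 <= dist g x y /\ kap x y = chord g (dist g x y) ^+ 2.
Proof.
move=> Mx My; have k0 := kap_ge0 Mx My; have := mform_kap Mx My.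
rewrite /dist /chord; move: k0; rewrite /kap /model_form /Defs.gdot.
case: g => /=.
  rewrite !mul0r !addr0 => k0 _; rewrite sqrtr_ge0; split=> //.
  by rewrite mulrC divfK// sqr_sqrtr.
rewrite !mulN1r => k0; set m := _ - sdot x y; set k := sdot _ _ - _ in k0 * => e.
have m1 : 1 <= m by lra.
have s0 : 0 <= m ^+ 2 - 1 by nra.
have ss := sqr_sqrtr s0; have sq := sqrtr_ge0 (m ^+ 2 - 1).
rewrite /arcosh; split; first by apply: ln_ge0; lra.
have eC : cosh (ln (m + Num.sqrt (m ^+ 2 - 1))) = m.
  rewrite /cosh expRN lnK ?posrE; last by lra.
  have h : (m + Num.sqrt (m ^+ 2 - 1)) * (m - Num.sqrt (m ^+ 2 - 1)) = 1.
    by move: ss; move: (Num.sqrt _) => q qq; rewrite expr2 in qq; lra.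
  have -> : (m + Num.sqrt (m ^+ 2 - 1))^-1 = m - Num.sqrt (m ^+ 2 - 1).
    by apply: (mulfI (x := m + Num.sqrt (m ^+ 2 - 1))); rewrite ?divff ?h//; lra.
  by field.
have := geoC_double Hyperbolic (ln (m + Num.sqrt (m ^+ 2 - 1))).
by rewrite /= eC; lra.
Qed.

Lemma dist_ge0 x y : M x -> M y -> 0 <= dist g x y.
Proof. by move=> Mx My; case: (dist_spec Mx My). Qed.

Lemma dist_le_kap x y z v : M x -> M y -> M z -> M v ->
  (dist g x y <= dist g z v) = (kap x y <= kap z v).
Proof.
move=> Mx My Mz Mv; have [h1 ->] := dist_spec Mx My.
by have [h2 ->] := dist_spec Mz Mv; rewrite chord_le.
Qed.

Lemma dist_kap x y t : M x -> M y -> 0 <= t -> kap x y = chord g t ^+ 2 ->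
  dist g x y = t.
Proof.
move=> Mx My t0; have [h1 ->] := dist_spec Mx My => e.
by apply/le_anti; rewrite -(chord_le g h1 t0) -(chord_le g t0 h1) e lexx.
Qed.

Lemma distC x y : M x -> M y -> dist g x y = dist g y x.
Proof.
move=> Mx My; apply: dist_kap => //; first exact: dist_ge0.
by rewrite kapC; case: (dist_spec My Mx).
Qed.

Lemma distxx x : M x -> dist g x x = 0.
Proof.
by move=> Mx; apply: dist_kap => //; rewrite chord0 /kap subrr expr0n/= -(scale0r x) gdotZl mul0r.
Qed.

Lemma dist_eq0 x y : M x -> M y -> dist g x y = 0 -> x = y.
Proof.
move=> Mx My d0; have [_] := dist_spec Mx My.
rewrite d0 chord0 expr0n/= /kap => k0.
have [ge|gh] : g = Euclidean \/ g = Hyperbolic by case: g; [left|right].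
  apply/eqP; rewrite -subr_eq0; apply/eqP; apply: (gdot_tangent_eq0 Mx) => //.
  rewrite mform_E ge !mxE !model_coord0//; lra.
have e1 := mform_kap Mx My; rewrite /kap k0 in e1.
apply/eqP; rewrite -subr_eq0; apply/eqP; apply: (gdot_tangent_eq0 Mx) => //.
by rewrite !mformE e1; case: Mx => -> _; lra.
Qed.

Lemma gdot_CS x u v : M x -> mform x u = 0 -> mform x v = 0 ->
  gdot u v ^+ 2 <= gdot u u * gdot v v.
Proof.
move=> Mx xu xv.
have [v0|vn0] := eqVneq (gdot v v) 0.
  rewrite (gdot_tangent_eq0 Mx xv v0) -(scale0r x) !gdotZr !mul0r.
  by rewrite expr0n mulr0.
have vp : 0 < gdot v v by rewrite lt_def vn0 (gdot_tangent_ge0 Mx).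
have : 0 <= gdot (gdot v v *: u - gdot u v *: v) (gdot v v *: u - gdot u v *: v).
  by apply: (gdot_tangent_ge0 Mx); rewrite !mformE xu xv; ring.
rewrite !gdotE (gdotC v u).
move: (gdot u u) (gdot u v) (gdot v v) vp => a b c vp h.
suff : 0 <= c * (a * c - b ^+ 2) by rewrite pmulr_rge0// subr_ge0.
by apply: le_trans h _; rewrite le_eqVlt; apply/orP; left; apply/eqP; ring.
Qed.

(** The unnormalised inverse exponential map at [y]: the tangential part of [x], whose length is
    [geoS] of the distance. *)
Definition logv y x := x - mform x y *: y.

Lemma logv_tangent y x : M y -> mform y (logv y x) = 0.
Proof. by move=> -[yy _]; rewrite /logv !mformE yy (mformC y x); ring. Qed.

Lemma gdot_logv y x z : M x -> M y -> M z ->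
  gdot (logv y x) (logv y z) =
  if g is Hyperbolic then mform x y * mform y z - mform x z
  else (kap x y + kap y z - kap x z) / 2.
Proof.
move=> Mx My Mz; rewrite /logv /kap !gdotE (gdotC y x) (gdotC z x) (gdotC z y).
have [ge|gh] : g = Euclidean \/ g = Hyperbolic by case: g; [left|right].
  by rewrite (ifE _ _ ge) !mform_E !(ifE _ _ ge) !model_coord0//; field.
have [yy _] := My; rewrite (ifH _ _ gh); move: yy.
rewrite mform_E !(ifH _ _ gh) (gdotC z y).
move: (gdot y y) (gdot x y) (gdot y z) (gdot x z).
by move=> a b c d e; rewrite (_ : a = -1); [ring | lra].
Qed.

Lemma mform_dist x y : M x -> M y -> mform x y = geoC g (dist g x y).
Proof.
move=> Mx My; rewrite mform_kap//; have [_ ->] := dist_spec Mx My.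
by rewrite geoC_double /chord; field.
Qed.

Lemma gdot_logv_sq y x : M x -> M y ->
  gdot (logv y x) (logv y x) = geoS g (dist g x y) ^+ 2.
Proof.
move=> Mx My; rewrite gdot_logv//; have [_] := dist_spec Mx My.
have [Mxx _] := Mx; rewrite Mxx (mformC y x).
have := mform_dist Mx My; have := geoC2 g (dist g x y).
rewrite /chord (kapC y x) (_ : kap x x = 0); last first.
  by rewrite /kap subrr -(scale0r x) gdotZl mul0r.
have [ge|gh] : g = Euclidean \/ g = Hyperbolic by case: g; [left|right].
  rewrite (ifE _ _ ge) => _ _ ->; rewrite ge /=; by field.
rewrite (ifH _ _ gh) => h -> _; rewrite -expr2 h gh /=; by ring.
Qed.

Lemma dist_triangle y x z : M x -> M y -> M z ->
  dist g x z <= dist g x y + dist g y z.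
Proof.
move=> Mx My Mz.
have CS := gdot_CS My (logv_tangent x My) (logv_tangent z My).
rewrite !gdot_logv_sq// in CS.
have dzy := distC Mz My.
have a0 := dist_ge0 Mx My; have b0 := dist_ge0 My Mz.
have S0 : 0 <= geoS g (dist g x y) * geoS g (dist g y z).
  by rewrite mulr_ge0// geoS_ge0.
have {CS} h : - (geoS g (dist g x y) * geoS g (dist g y z)) <=
    gdot (logv y x) (logv y z).
  have [|neg] := lerP 0 (gdot (logv y x) (logv y z)).
    by apply: le_trans; rewrite oppr_le0.
  rewrite lerNl -ler_sqr ?nnegrE ?oppr_ge0 ?(ltW neg)// sqrrN.
  by apply: le_trans CS _; rewrite dzy exprMn.
suff : chord g (dist g x z) ^+ 2 <= chord g (dist g x y + dist g y z) ^+ 2.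
  by rewrite chord_le ?addr_ge0 ?dist_ge0.
move: h; rewrite gdot_logv//.
have [_ ->] := dist_spec Mx My; have [_ ->] := dist_spec My Mz.
have [_ e3] := dist_spec Mx Mz.
by rewrite {1}e3 !mform_dist//; exact: chord_triangle.
Qed.

End Metric.

End Chord.
Import Chord.

(** * Geodesics as linear combinations, and strict convexity *)

Module Geodesic.

Section Geodesics.
Context {R : realType} (g : geometry) {n : nat}.
Notation V := 'rV[R]_n.+2.
Implicit Types (x y z u : V) (a b s t : R).
Implicit Types p : (V * V)%type.
Notation M := (@model_space R g n).
Notation mform := (@model_form R g n).
Notation kap := (@kap R g n).
Notation C := (geoC g).
Notation S := (geoS g).

Lemma geoP : g = Euclidean \/ g = Hyperbolic.
Proof. by case: g; [left|right]. Qed.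

Definition geo p t : V := C t *: p.1 + S t *: p.2.
Definition UT p := unit_tangent_set g p.

Lemma flow_pairE p t :
  flow_pair g t p = (geo p t, C t *: p.2 - (curv R g * S t) *: p.1).
Proof.
rewrite /flow_pair /geo; case: g => /=.
  by rewrite !scale1r mul0r scale0r subr0.
by rewrite mulN1r scaleNr opprK [cosh t *: p.2 + _]addrC.
Qed.

Lemma UT_flow p t : UT p -> UT (flow_pair g t p).
Proof. exact: flow_unit_tangent. Qed.

Lemma geo_flow p s t : geo (flow_pair g s p) t = geo p (s + t).
Proof.
rewrite flow_pairE /geo /= geoCD geoSD.
by apply/rowP => i; rewrite !mxE; ring.
Qed.

Lemma geoM p t : UT p -> M (geo p t).
Proof. by move=> /(UT_flow t); rewrite flow_pairE => -[]. Qed.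
Lemma geo0 p : geo p 0 = p.1.
Proof. by rewrite /geo geoC0 geoS0 scale1r scale0r addr0. Qed.

Lemma UT_mform p : UT p -> mform p.2 p.2 = curv R g.
Proof.
move=> [[_ x0] h1]; rewrite /Defs.gdot /model_form; move: h1.
rewrite /model_form; case: g => /=; last by lra.
rewrite !mul0r !addr0 => /eqP; rewrite mulf_eq0 gt_eqF//= => /eqP -> _.
by rewrite mulr0.
Qed.

Lemma mform_geo p s t : UT p -> mform (geo p s) (geo p t) = C (s - t).
Proof.
move=> Up; have vv := UT_mform Up; have [[xx _] xv _] := Up.
rewrite /geo !(mformDl, mformDr, mformZl, mformZr) (mformC g p.2) xx xv vv.
by rewrite geoCD geoCN geoSN; ring.
Qed.

Lemma kap_geo p s t : UT p -> kap (geo p s) (geo p t) = chord g (s - t) ^+ 2.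
Proof.
move=> Up; have [ge|gh] := geoP; last first.
  have := mform_kap (geoM s Up) (geoM t Up); rewrite mform_geo// geoC_double.
  by rewrite /chord gh /=; lra.
have [_ _ vv] := Up; rewrite /kap /geo.
rewrite (_ : _ - _ = (s - t) *: p.2); last first.
  by rewrite ge /= !scale1r scalerBl opprD addrACA subrr add0r.
by rewrite gdotZl gdotZr vv /chord ge /= mulrC mulr1 [2 * _]mulrC divfK.
Qed.

Lemma dist_geo p s t : UT p -> dist g (geo p s) (geo p t) = `|s - t|.
Proof.
move=> Up; apply: dist_kap => //; try exact: geoM.
rewrite kap_geo//; case: (lerP 0 (s - t)) => [/ger0_norm->//|/ltr0_norm->].
by rewrite chordN sqrrN.
Qed.

Lemma log_exists x y : M x -> M y -> x <> y ->
  exists2 p, UT p & p.1 = x /\ geo p (dist g x y) = y.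
Proof.
move=> Mx My xy; have d0 : 0 < dist g x y.
  rewrite lt_def dist_ge0// andbT; apply/eqP => /(dist_eq0 Mx My); exact: xy.
have S0 := geoS_gt0 g d0.
exists (x, (S (dist g x y))^-1 *: logv g x y) => /=.
  split=> //=; first by rewrite mformZr logv_tangent ?mulr0.
  rewrite gdotZl gdotZr gdot_logv_sq// (distC My Mx).
  by rewrite expr2; field; rewrite gt_eqF.
split=> //; rewrite /geo /= scalerA divff ?gt_eqF// scale1r /logv.
by rewrite (mformC g y) mform_dist// addrC subrK.
Qed.

Lemma UT_exists x : M x -> exists2 p, UT p & p.1 = x.
Proof.
move=> Mx; have Ub := @unit_tangent_point R g n; set b := (_, _) in Ub.
have [->|/eqP xb] := eqVneq x b.1; first by exists b.
have Mb : M b.1 by case: Ub.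
by have [p Up [h _]] := log_exists Mx Mb xb; exists p.
Qed.

(** By the addition formulas, three points of a geodesic are linearly dependent, with positive
    coefficients when [a < t < b]. Convexity of half-spaces and the fact that hyperplanes are
    totally geodesic follow from this one identity in both geometries. *)
Lemma geo_combination p a b t : S (b - a) *: geo p t =
  S (b - t) *: geo p a + S (t - a) *: geo p b.
Proof.
rewrite /geo !scalerDr !scalerA addrACA -!scalerDl !geoSD !geoCN !geoSN.
by congr (_ *: _ + _ *: _); ring.
Qed.

Lemma geo_between p a b t : a < t < b ->
  exists l m, [/\ 0 < l, 0 < m & geo p t = l *: geo p a + m *: geo p b].
Proof.
move=> /andP[at_ tb]; have ab := lt_trans at_ tb.
have S0 : 0 < S (b - a) by rewrite geoS_gt0// subr_gt0.
exists (S (b - t) / S (b - a)), (S (t - a) / S (b - a)).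
rewrite !divr_gt0 ?geoS_gt0 ?subr_gt0//; split=> //.
apply: (@scalerI _ _ (S (b - a))); first by rewrite gt_eqF.
have := geo_combination p a b t; move: (geo p a) (geo p b) (geo p t) => x y z ->.
by apply/rowP => i; rewrite !mxE; field; rewrite gt_eqF.
Qed.

Lemma lformD u x y : lform u (x + y) = lform u x + lform u y.
Proof. by rewrite -big_split; apply: eq_bigr => i _; rewrite mxE mulrDr. Qed.
Lemma lformZ u a x : lform u (a *: x) = a * lform u x.
Proof. by rewrite mulr_sumr; apply: eq_bigr => i _; rewrite mxE mulrCA. Qed.
Lemma lformN u x : lform u (- x) = - lform u x.
Proof. by rewrite -scaleN1r lformZ mulN1r. Qed.
Lemma lformE u x : lform u x = u ord0 ord0 * x ord0 ord0 + sdot u x.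
Proof. by rewrite /lform big_ord_recl. Qed.

Lemma form_vanish p u a b t : a != b ->
  lform u (geo p a) = 0 -> lform u (geo p b) = 0 -> lform u (geo p t) = 0.
Proof.
move=> ab ha hb; have /(congr1 (lform u)) := geo_combination p a b t.
rewrite lformD !lformZ ha hb !mulr0 addr0 => /eqP; rewrite mulf_eq0.
suff /negbTE -> : S (b - a) != 0 by move/eqP.
have [ab'|ba|e] := ltgtP a b; last by rewrite e eqxx in ab.
  by rewrite gt_eqF// geoS_gt0// subr_gt0.
by rewrite -opprB geoSN oppr_eq0 gt_eqF// geoS_gt0// subr_gt0.
Qed.

(** The sum of the two points is rescaled back to the model. In Euclidean space the parallelogram
    law gives the strict gain; on the hyperboloid it comes from the normalising factor exceeding
    2. *)
Lemma strict_midpoint z z' : M z -> M z' -> z <> z' -> exists2 m, M m &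
  forall x, M x -> dist g x z = dist g x z' -> dist g x m < dist g x z.
Proof.
move=> Mz Mz' zz'.
have d0 : 0 < dist g z z'.
  rewrite lt_def dist_ge0// andbT; apply/eqP => /(dist_eq0 Mz Mz'); exact: zz'.
have k0 : 0 < kap z z'.
  have [_ ->] := dist_spec Mz Mz'.
  by rewrite exprn_gt0// -(chord0 g) chord_lt.
have eN : mform (z + z') (z + z') = 2 + 2 * mform z z'.
  rewrite !(mformDl, mformDr) (mformC g z'); case: Mz => -> _; case: Mz' => -> _.
  by ring.
have mk := mform_kap Mz Mz'.
have cv : curv R g <= 0 by case: g => //=; rewrite oppr_le0.
set N := Num.sqrt (mform (z + z') (z + z')).
have N2 : N ^+ 2 = 2 + 2 * mform z z'.
  by rewrite sqr_sqrtr ?eN// mk; nra.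
have Nge : 0 <= N by exact: sqrtr_ge0.
have N0 : 0 < N.
  by rewrite lt_def Nge andbT; apply/eqP => e; move: N2; rewrite e mk; nra.
have Mm : M (N^-1 *: (z + z')).
  split; last first.
    by rewrite !mxE mulr_gt0 ?invr_gt0// addr_gt0//; [case: Mz|case: Mz'].
  by rewrite mformZl mformZr eN -N2; field; rewrite gt_eqF.
exists (N^-1 *: (z + z')) => // x Mx e.
have e' : kap x z = kap x z'.
  by have [_ ->] := dist_spec Mx Mz; have [_ ->] := dist_spec Mx Mz'; rewrite e.
rewrite ltNge dist_le_kap// -ltNge.
have [ge|gh] := geoP.
  have N4 : N = 2.
    apply/eqP; rewrite -(eqrXn2 (n := 2))//; apply/eqP; rewrite N2 mk ge /=; lra.
  move: e' k0; rewrite N4 /kap.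
  have -> : z - z' = (x - z') - (x - z).
    by apply/rowP => i; rewrite !mxE; ring.
  have -> : x - 2^-1 *: (z + z') = 2^-1 *: ((x - z') + (x - z)).
    by apply/rowP => i; rewrite !mxE; field.
  move: (x - z') (x - z) => a b; rewrite !gdotE (gdotC g b a).
  by move: (Defs.gdot g a a) (Defs.gdot g b b) (Defs.gdot g a b) => *; lra.
have cvH : curv R g = -1 by rewrite gh.
have := mform_kap Mx Mm; have := mform_kap Mx Mz; have := mform_kap Mx Mz'.
rewrite mformZr mformDr -e'.
have c1 : 1 <= mform x z by rewrite mform_dist// geoC_ge1.
have h2 : N^-1 < 2^-1.
  rewrite ltf_pV2 ?posrE// ltNge; apply/negP => h.
  have : N ^+ 2 <= 2 ^+ 2 by rewrite ler_sqr ?nnegrE.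
  by rewrite N2 mk cvH; lra.
rewrite cvH => e1 e2 e3; have e4 : mform x z' = mform x z by lra.
move: e3 e2; rewrite e4; move: c1 h2; move: (mform x z) (N^-1) (kap x z).
by move=> A B D c1 h2 e2 e3; nra.
Qed.

(** If two different points had the same distances to both ends of a segment and one of them lay on
    it, their midpoint would violate the triangle inequality. *)
Lemma between_unique x y z z' : M x -> M y -> M z -> M z' ->
  dist g x z + dist g z y = dist g x y -> dist g x z' = dist g x z ->
  dist g z' y = dist g z y -> z' = z.
Proof.
move=> Mx My Mz Mz' e1 e2 e3; apply: contrapT => zz'.
have [m Mm h] := strict_midpoint Mz' Mz zz'.
have := h _ Mx e2; have := h _ My; rewrite !(@distC _ g _ y)// => /(_ e3).
have := dist_triangle Mx Mm My; rewrite -e1 e2 e3; lra.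
Qed.

Lemma between_geo p s z : UT p -> 0 <= s -> M z ->
  dist g (geo p 0) z + dist g z (geo p s) = s ->
  z = geo p (dist g (geo p 0) z).
Proof.
move=> Up s0 Mz e; set d := dist g _ z.
have M0 := geoM 0 Up; have Ms := geoM s Up.
have d0 : 0 <= d by exact: dist_ge0.
have d1 : 0 <= dist g z (geo p s) by exact: dist_ge0.
have Md := geoM d Up.
apply: (between_unique M0 Ms Md Mz).
- by rewrite !dist_geo// !sub0r !normrN distrC !ger0_norm//; rewrite -/d in e; lra.
- by rewrite dist_geo// sub0r normrN ger0_norm.
- by rewrite dist_geo// distrC ger0_norm; rewrite -/d in e; lra.
Qed.

End Geodesics.

End Geodesic.
Import Geodesic.

(** * Reflections and linear isometries of the model spaces *)

Section Reflections.
Context {R : realType} (g : geometry) {n : nat}.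
Notation V := 'rV[R]_n.+2.
Implicit Types (x y z u v : V) (a b t : R) (w : 'M[R]_n.+2).
Implicit Types p : (V * V)%type.
Notation M := (@model_space R g n).
Notation gdot := (@gdot R g n).
Notation mform := (@model_form R g n).
Notation kap := (@kap R g n).
Notation rf := (reflection g).

Lemma mul_reflection u x : x *m rf u = x - (2 * lform u x) *: sharp g u.
Proof.
rewrite /reflection mulmxBr mulmx1; congr (_ - _).
rewrite -scalemxAr -scalerA; congr (_ *: _); rewrite mulmxA.
have -> : x *m u^T = (lform u x)%:M.
  apply/matrixP => i j; rewrite !ord1 !mxE eqxx mulr1n.
  by apply: eq_bigr => k _; rewrite mxE mulrC.
by rewrite mul_scalar_mx.
Qed.

Lemma mform_sharp u x : g = Hyperbolic -> mform x (sharp g u) = - lform u x.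
Proof.
move=> gh; rewrite /model_form lformE /sharp !mxE eqxx gh /=.
rewrite (_ : sdot _ _ = sdot u x); first by ring.
by rewrite sdotC; apply: eq_bigr => i _; rewrite !mxE /=.
Qed.

Lemma sdot_sharp u x : sdot x (sharp g u) = sdot u x.
Proof. by rewrite sdotC; apply: eq_bigr => i _; rewrite !mxE /=. Qed.

Lemma gdot_sharp u x : (curv R g = 0 -> x ord0 ord0 = 0) ->
  gdot x (sharp g u) = lform u x.
Proof.
rewrite /Defs.gdot lformE sdot_sharp !mxE eqxx.
case: g => /= [->//|_]; [ring|ring].
Qed.

Lemma gdot_sharp_sq u : gdot u u = 1 -> gdot (sharp g u) (sharp g u) = 1.
Proof.
rewrite /Defs.gdot (_ : sdot (sharp g u) _ = sdot u u); last first.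
  by apply: eq_bigr => i _; rewrite !mxE /=.
by rewrite !mxE eqxx; case: g => /=; lra.
Qed.

Lemma lform_sharp u : gdot u u = 1 -> lform u (sharp g u) = 1.
Proof.
by rewrite /Defs.gdot lformE sdot_sharp !mxE eqxx => <-; ring.
Qed.

(** The last clause governs distances when applied to differences of points. In the Euclidean case
    it is restricted to vectors with [x_0 = 0], the directions of the affine hyperplane that carries
    the model. *)
Definition isom w := [/\ forall x, M x -> M (x *m w),
  forall x y, mform (x *m w) (y *m w) = mform x y &
  forall u, (curv R g = 0 -> u ord0 ord0 = 0) ->
    (curv R g = 0 -> (u *m w) ord0 ord0 = 0) /\
    gdot (u *m w) (u *m w) = gdot u u].

Lemma isom1 : isom 1%:M.
Proof. by split=> [x|x y|u]; rewrite ?mulmx1. Qed.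

Lemma isomM w w' : isom w -> isom w' -> isom (w *m w').
Proof.
move=> [h1 h2 h3] [k1 k2 k3]; split=> [x Mx|x y|u hu]; rewrite !mulmxA.
- exact/k1/h1.
- by rewrite k2 h2.
- have [e1 e2] := h3 _ hu; have [e3 e4] := k3 _ e1.
  by split=> //; rewrite e4.
Qed.

(** The two sheets of the hyperboloid are told apart by the sign of the form against a fixed point
    of one sheet. *)
Lemma Mpos x z : M x -> mform z z = 1 -> 0 < mform x z -> M z.
Proof.
move=> Mx zz p; split=> //; have [xx x0] := Mx.
have [ge|gh] := geoP g.
  by move: p; rewrite mform_E ge pmulr_rgt0.
move: xx zz p (sdot_CS x z) (sdot_ge0 x) (sdot_ge0 z).
rewrite /model_form gh /=; move: (sdot x x) (sdot x z) (sdot z z) (x _ _) (z _ _) x0.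
move=> X A Y a b a0 hx hy p CS X0 Y0.
rewrite ltNge; apply/negP => b0.
have ab : a * b <= 0 by rewrite pmulr_rle0.
have h : (a * b) ^+ 2 <= A ^+ 2.
  by rewrite -[leLHS]sqrrN -[leRHS]sqrrN ler_sqr ?nnegrE; lra.
have : (a * b) ^+ 2 <= (a * a - 1) * (b * b - 1).
  by apply: le_trans h _; apply: le_trans CS _; rewrite le_eqVlt; apply/orP; left; apply/eqP; congr (_ * _); lra.
by rewrite expr2; nra.
Qed.

Lemma isom_refl u : gdot u u = 1 -> isom (rf u).
Proof.
move=> uu; have hm x y : mform (x *m rf u) (y *m rf u) = mform x y.
  rewrite !mul_reflection; have [ge|gh] := geoP g.
    by rewrite mform_E ge !mxE !eqxx /= !(mul0r, mulr0) !subr0.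
  have bil (a b : R) z : mform (x - a *: z) (y - b *: z) =
      mform x y - b * mform x z - a * mform y z + a * b * mform z z.
    rewrite -(scaleNr a z) -(scaleNr b z) !(mformDl, mformDr, mformZl, mformZr) (mformC g z y).
    move: (mform x y) (mform x z) (mform y z) (mform z z) => A B D F; ring.
  by rewrite bil !mform_sharp// lform_sharp//; ring.
split; [move=> x Mx | exact: hm | move=> v hv].
  have [xx _] := Mx; apply: (Mpos Mx); first by rewrite hm.
  rewrite mul_reflection !(mformDr, mformNr, mformZr) xx.
  have [ge|gh] := geoP g; last by rewrite mform_sharp//; have := sqr_ge0 (lform u x); lra.
  by rewrite mform_E ge !mxE eqxx /= mul0r !mulr0 subr0 ltr01.
rewrite mul_reflection; split=> [c0|].
  by rewrite !mxE eqxx hv// c0 !mul0r mulr0 subr0.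
rewrite -scaleNr !(gdotDl, gdotDr, gdotZl, gdotZr) (gdotC g _ v) gdot_sharp//.
by rewrite gdot_sharp_sq//; ring.
Qed.

Lemma sub_coord0 x y : M x -> M y -> curv R g = 0 -> (x - y) ord0 ord0 = 0.
Proof.
move=> Mx My c0; have ge : g = Euclidean.
  by have [//|gh] := geoP g; move: c0; rewrite gh /= => /eqP; rewrite oppr_eq0 oner_eq0.
by rewrite !mxE !(model_coord0 ge)// subrr.
Qed.

Lemma isom_kap w x y : isom w -> M x -> M y -> kap (x *m w) (y *m w) = kap x y.
Proof.
move=> [_ _ h3] Mx My; rewrite /Chord.kap -mulmxBl.
by have [] := h3 (x - y) (sub_coord0 Mx My).
Qed.

Lemma isom_dist w x y : isom w -> M x -> M y ->
  dist g (x *m w) (y *m w) = dist g x y.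
Proof.
move=> iw Mx My; have [h1 _ _] := iw.
have Mxw := h1 _ Mx; have Myw := h1 _ My.
apply: dist_kap => //; first exact: dist_ge0.
by rewrite isom_kap//; case: (dist_spec Mx My).
Qed.

Definition act p w := (p.1 *m w, p.2 *m w).

Lemma isom_UT w p : isom w -> UT g p -> UT g (act p w).
Proof.
move=> [h1 h2 h3] [Mp e1 e2]; split=> /=; [exact: h1|by rewrite h2|].
have [//|_ ->//] := h3 p.2.
move=> c0; move: e1; case: Mp => _ x0; rewrite /model_form c0 mul0r addr0 => /eqP.
by rewrite mulf_eq0 gt_eqF//= => /eqP.
Qed.

Lemma geo_act w p t : geo g (act p w) t = geo g p t *m w.
Proof. by rewrite /geo /= mulmxDl -!scalemxAl. Qed.
Lemma refl_fix u x : lform u x = 0 -> x *m rf u = x.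
Proof. by move=> e; rewrite mul_reflection e mulr0 scale0r subr0. Qed.

Lemma lform_refl u x : gdot u u = 1 -> lform u (x *m rf u) = - lform u x.
Proof.
by move=> uu; rewrite mul_reflection lformD lformN lformZ lform_sharp//; ring.
Qed.

Lemma refl_invol u : gdot u u = 1 -> rf u *m rf u = 1%:M.
Proof.
move=> uu; apply/row_matrixP => i.
have e (x : 'rV_n.+2) : x *m (rf u *m rf u) = x.
  rewrite mulmxA [x *m _ *m _]mul_reflection lform_refl// mul_reflection.
  by apply/rowP => j; rewrite !mxE; ring.
by rewrite !rowE e mulmx1.
Qed.

(** The sign of the product decides whether reflecting [x] brings it closer to [y]: it does exactly
    when the two points lie on opposite sides of the mirror. *)
Lemma kap_refl u x y : gdot u u = 1 -> M x -> M y ->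
  kap y (x *m rf u) = kap y x + 4 * lform u x * lform u y.
Proof.
move=> uu Mx My; rewrite /Chord.kap mul_reflection opprB addrCA addrC.
rewrite !(gdotDl g (y - x), gdotDr g (y - x)).
rewrite !(gdotZl, gdotZr) (gdotC g (sharp g u)) gdot_sharp; last exact: sub_coord0.
by rewrite gdot_sharp_sq// lformD lformN; ring.
Qed.

Lemma dist_refl_lt u x y : gdot u u = 1 -> M x -> M y ->
  lform u x < 0 -> 0 < lform u y -> dist g y (x *m rf u) < dist g y x.
Proof.
move=> uu Mx My h1 h2; have [h _ _] := isom_refl uu.
have Mx' := h _ Mx; rewrite ltNge dist_le_kap// -ltNge kap_refl//.
by rewrite gtrDl; nra.
Qed.

(** The difference of the two squared chords is affine in [y]. Its constant term is absorbed by the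
    coordinate [y_0 = 1] in the Euclidean case and vanishes in the hyperbolic case, so a linear form
    results. *)
Lemma bisector x x' : M x -> M x' -> exists b : V, forall y, M y ->
  lform b y = kap x' y - kap x y.
Proof.
move=> Mx Mx'.
pose z := x - x'.
exists (\row_i (if i == ord0 then gdot x' x' - gdot x x + 2 * curv R g * z ord0 ord0
  else 2 * z ord0 i)) => y My.
rewrite lformE mxE eqxx (_ : sdot _ y = 2 * sdot z y); last first.
  by rewrite mulr_sumr; apply: eq_bigr => i _; rewrite !mxE /= mulrA.
have e : (gdot x' x' - gdot x x) * y ord0 ord0 = gdot x' x' - gdot x x.
  have [ge|gh] := geoP g; first by rewrite (model_coord0 ge My) mulr1.
  have [h _] := Mx; have [h' _] := Mx'; move: h h'.
  by rewrite mform_E (ifH _ _ gh) => h h'; rewrite (_ : _ - _ = 0) ?mul0r//; lra.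
rewrite /Chord.kap !gdotE (gdotC g y x) (gdotC g y x').
have ez : sdot z y + curv R g * (z ord0 ord0 * y ord0 ord0) = gdot x y - gdot x' y.
  by rewrite -/(Defs.gdot g z y) gdotDl gdotNl.
have -> : (gdot x' x' - gdot x x + 2 * curv R g * z ord0 ord0) * y ord0 ord0 =
  (gdot x' x' - gdot x x) * y ord0 ord0 + 2 * (curv R g * (z ord0 ord0 * y ord0 ord0)).
  ring.
rewrite e; clearbody z; move: ez; move: (sdot z y) (curv R g * _) (gdot x x) (gdot x' x') (gdot x y) (gdot x' y) (gdot y y) => *; lra.
Qed.

End Reflections.

(** * Compactness of closed balls and of the unit vectors over them *)

Section Topology.
Context {R : realType} (g : geometry) {n : nat}.
Notation V := 'rV[R]_n.+2.
Implicit Types (x y z u v : V) (a b s t : R).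
Implicit Types p : (V * V)%type.
Notation M := (@model_space R g n).
Notation gdot := (@gdot R g n).
Notation mform := (@model_form R g n).
Notation kap := (@kap R g n).

Section Continuity.
Context {T : topologicalType}.

Lemma continuous_bigsum (k : nat) (F : 'I_k -> T -> R) :
  (forall i, continuous (F i)) -> continuous (fun q => \sum_i F i q).
Proof.
elim: k F => [|k IH] F cF.
  by under eq_fun do rewrite big_ord0; exact: cst_continuous.
under eq_fun do rewrite big_ord_recl.
by move=> q; apply: continuousD; [exact: cF|exact: IH].
Qed.

Lemma continuous_coord (X : T -> V) i : continuous X ->
  continuous (fun q => X q ord0 i).
Proof.
move=> cX q; apply: (@continuous_comp _ _ _ X (fun m : V => m ord0 i)).
  exact: cX.
exact: coord_continuous.
Qed.

Lemma continuous_lform u (X : T -> V) : continuous X ->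
  continuous (fun q => lform u (X q)).
Proof.
move=> cX; apply: continuous_bigsum => i q.
by apply: continuousM; [exact: cst_continuous|exact: continuous_coord].
Qed.

Lemma continuous_sdot (X Y : T -> V) : continuous X -> continuous Y ->
  continuous (fun q => sdot (X q) (Y q)).
Proof.
move=> cX cY; apply: continuous_bigsum => i q.
by apply: continuousM; exact: continuous_coord.
Qed.

Lemma continuous_coordM (X Y : T -> V) (c : R) i j : continuous X -> continuous Y ->
  continuous (fun q => c * (X q ord0 i * Y q ord0 j)).
Proof.
move=> cX cY q; apply: cvgM; first exact: cvg_cst.
by apply: cvgM; exact: continuous_coord.
Qed.

Lemma continuous_gdot (X Y : T -> V) : continuous X -> continuous Y ->
  continuous (fun q => gdot (X q) (Y q)).
Proof.
move=> cX cY q; apply: (continuousD (f := fun q => sdot (X q) (Y q))).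
  exact: continuous_sdot.
exact: continuous_coordM.
Qed.

Lemma continuous_mform (X Y : T -> V) : continuous X -> continuous Y ->
  continuous (fun q => mform (X q) (Y q)).
Proof.
move=> cX cY q; apply: (continuousD (f := fun q => X q ord0 ord0 * Y q ord0 ord0)).
  by apply: continuousM; exact: continuous_coord.
apply: continuousM; [exact: cst_continuous|exact: continuous_sdot].
Qed.

Lemma continuous_kap (X Y : T -> V) : continuous X -> continuous Y ->
  continuous (fun q => kap (X q) (Y q)).
Proof.
move=> cX cY; apply: continuous_gdot => q; apply: continuousB;
  first [exact: cX|exact: cY].
Qed.

End Continuity.

Lemma closed_model_space : closed M.
Proof.
rewrite (_ : M = [set x | mform x x = 1] `&` [set x | 0 <= x ord0 ord0]).
  apply: closedI.
    apply: (@closed_comp _ _ (fun x => mform x x) [set 1]); last exact: closed_eq.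
    by move=> x _; apply: continuous_mform => ?; exact: cvg_id.
  apply: (@closed_comp _ _ (fun x : V => x ord0 ord0) [set t | 0 <= t]).
    by move=> x _; apply: continuous_coord => ?; exact: cvg_id.
  exact: closed_ge.
apply/seteqP; split=> x [h1 h2]; split=> //; first exact: ltW.
rewrite /= lt_def h2 andbT; apply/eqP => x0; move: h1; rewrite /= /model_form x0.
have := sdot_ge0 x; case: g => /=; rewrite ?mul0r ?addr0 ?add0r.
  by move=> _ /eqP; rewrite eq_sym oner_eq0.
by rewrite mulN1r; lra.
Qed.

Definition basept : V := delta_mx ord0 ord0.

Lemma M_basept : M basept.
Proof. by have [] := @unit_tangent_point R g n. Qed.
Lemma sdot_basept x : sdot basept x = 0.
Proof. by apply: big1 => i _; rewrite mxE /= mul0r. Qed.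

(** On the hyperboloid [kap basept y] equals twice [y_0 - 1], so a bounded distance bounds the
    height and with it all coordinates. *)
Lemma sdot_bound y r : M y -> dist g basept y <= r ->
  sdot y y <= chord g r ^+ 2 * (1 + chord g r ^+ 2) /\
  y ord0 ord0 <= 1 + chord g r ^+ 2.
Proof.
move=> My dr; have Mb := M_basept.
have d0 := dist_ge0 Mb My; have r0 := le_trans d0 dr.
have [_ e] := dist_spec Mb My.
have : chord g (dist g basept y) ^+ 2 <= chord g r ^+ 2 by rewrite chord_le.
rewrite -e; have c0 := sqr_ge0 (chord g r).
move: (chord g r ^+ 2) c0 => c c0.
have k0 := kap_ge0 Mb My; move: My k0 => [+ y0].
rewrite /Chord.kap /Defs.gdot /model_form.
have -> : sdot (basept - y) (basept - y) = sdot y y.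
  rewrite !(sdotDl, sdotDr, sdotNl, sdotNr) sdot_basept.
  by rewrite (sdotC y basept) !sdot_basept; ring.
rewrite !mxE /=; move: (sdot y y) (sdot_ge0 y) (y ord0 ord0) y0 => S S0 a a0.
have [->|->] := geoP g; rewrite /=.
  by rewrite !mul0r !addr0 => h _ h2; split; nra.
move=> h h1 h2; have e1 : S = a ^+ 2 - 1 by rewrite expr2; lra.
have h3 : a <= 1 + c by move: h2; rewrite e1 expr2 /=; lra.
split=> //; have h4 : a <= 1 + c / 2 by move: h2; rewrite e1 expr2 /=; lra.
by rewrite e1; nra.
Qed.

Lemma coord_bound x (B : R) : 0 <= B -> sdot x x <= B ^+ 2 ->
  `|x ord0 ord0| <= B -> forall i, `|x ord0 i| <= B.
Proof.
move=> B0 h h0 i; have [->//|] := eqVneq i ord0.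
rewrite eq_sym => /unlift_some[j -> _].
rewrite -ler_sqr ?nnegrE// real_normK ?num_real//; apply: le_trans h.
rewrite /sdot (bigD1 j)//= -expr2 lerDl sumr_ge0// => k _.
by rewrite -expr2 sqr_ge0.
Qed.

Lemma norm_rV_le x (B : R) : 0 <= B -> (forall i, `|x ord0 i| <= B) -> `|x| <= B.
Proof.
move=> B0 h; rewrite [`|x|]mx_normrE.
by apply/bigmax_leP; split=> //= -[i j] _ /=; rewrite ord1.
Qed.

Definition ballM r : set V := [set y | M y /\ dist g basept y <= r].

Lemma bounded_setP (A : set V) (B : R) :
  (forall x, A x -> `|x| <= B) -> bounded_set A.
Proof.
move=> h; exists B; split; first exact: num_real.
by move=> C BC x Ax; apply: le_trans (ltW BC); exact: h.
Qed.

Lemma dist_basept_kap r y : 0 <= r -> M y ->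
  (dist g basept y <= r) = (kap basept y <= chord g r ^+ 2).
Proof.
move=> r0 My; have d0 := dist_ge0 M_basept My.
by have [_ ->] := dist_spec M_basept My; rewrite chord_le.
Qed.

Lemma compact_ballM r : compact (ballM r).
Proof.
have [r0|r0] := ltP r 0.
  rewrite (_ : ballM r = set0); first exact: compact0.
  apply/seteqP; split=> // y [My h].
  by have := dist_ge0 M_basept My; lra.
apply: bounded_closed_compact.
  set c := chord g r ^+ 2; have c0 : 0 <= c by exact: sqr_ge0.
  apply: (@bounded_setP _ (1 + c)) => y [My dy].
  have [h1 h2] := sdot_bound My dy; rewrite -/c in h1 h2.
  apply: norm_rV_le; first by lra.
  apply: coord_bound; [by lra| by rewrite expr2; nra |].
  by case: My => _ y0; rewrite ger0_norm// ltW.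
rewrite (_ : ballM r = M `&` [set y | kap basept y <= chord g r ^+ 2]).
  apply: closedI; first exact: closed_model_space.
  apply: (@closed_comp _ _ (fun y => kap basept y) [set t | t <= chord g r ^+ 2]).
    move=> y _; apply: continuous_kap => ?; [exact: cst_continuous|exact: cvg_id].
  exact: closed_le.
by apply/seteqP; split=> y [My h]; split=> //; move: h; rewrite /= dist_basept_kap.
Qed.

Lemma tangent_bound p r : UT g p -> dist g basept p.1 <= r ->
  forall i, `|p.2 ord0 i| <= 2 + chord g r ^+ 2.
Proof.
move=> [Mx xv vv] dr; have [h1 h2] := sdot_bound Mx dr.
set c := chord g r ^+ 2 in h1 h2 *; have c0 : 0 <= c by exact: sqr_ge0.
have : `|p.2 ord0 ord0| <= 1 + c /\ sdot p.2 p.2 <= (2 + c) ^+ 2.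
  move: Mx xv vv (sdot_CS p.1 p.2) (sdot_ge0 p.2) (sdot_ge0 p.1) => [].
  rewrite /model_form /Defs.gdot.
  move: (sdot p.1 p.1) (sdot p.1 p.2) (sdot p.2 p.2) (p.1 ord0 ord0) (p.2 ord0 ord0) h1 h2.
  move=> X A U a b; have [->|->] := geoP g; rewrite /= ?mul0r ?addr0.
    move=> h1 h2 h3 a0 /eqP; rewrite mulf_eq0 gt_eqF//= => /eqP -> h4 _ _ _.
    by rewrite normr0; split; [lra|rewrite expr2; nra].
  move=> h1 h2 xx a0 xv vv CS U0 X0.
  have eA : A = a * b by lra.
  have eU : U = 1 + b ^+ 2 by rewrite expr2; lra.
  have eX : X = a ^+ 2 - 1 by rewrite expr2; lra.
  have hb : b ^+ 2 <= a ^+ 2 - 1.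
    by move: CS; rewrite eA eU eX exprMn; move: (a ^+ 2) (b ^+ 2) => *; nra.
  have hb2 : b ^+ 2 <= (1 + c) ^+ 2.
    by apply: le_trans hb _; rewrite !expr2; nra.
  split; last by rewrite eU; move: hb2; rewrite !expr2; nra.
  by rewrite -ler_sqr ?nnegrE ?real_normK ?num_real//; lra.
move=> [hb hU] i; apply: coord_bound => //; first by lra.
by lra.
Qed.

Definition ballUT r : set (V * V) := [set p | UT g p /\ ballM r p.1].

Lemma compact_ballUT r : compact (ballUT r).
Proof.
set B := 2 + chord g r ^+ 2; have B0 : 0 <= B by rewrite addr_ge0// sqr_ge0.
have cB : compact [set v : V | forall i, `|v ord0 i| <= B].
  apply: bounded_closed_compact.
    by apply: (@bounded_setP _ B) => v h; exact: norm_rV_le.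
  rewrite (_ : [set _ | _] = \bigcap_i [set v : V | `|v ord0 i| <= B]).
    apply: closed_bigI => i _.
    apply: (@closed_comp _ _ (fun v : V => `|v ord0 i|) [set t | t <= B]).
      move=> v _; apply: (@continuous_comp _ _ _ (fun v : V => v ord0 i) Num.norm).
        by apply: continuous_coord => ?; exact: cvg_id.
      exact: norm_continuous.
    exact: closed_le.
  by apply/seteqP; split=> v h i //=; exact: h.
apply: (subclosed_compact _ (compact_setX (compact_ballM (r := r)) cB)).
  have c1 : continuous (fun p : V * V => p.1) by move=> p; exact: cvg_fst.
  have c2 : continuous (fun p : V * V => p.2) by move=> p; exact: cvg_snd.
  rewrite (_ : ballUT r = (fst @^-1` ballM r) `&`
    ([set p | mform p.1 p.2 = 0] `&` [set p | gdot p.2 p.2 = 1])).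
    apply: closedI; last apply: closedI.
    - apply: closed_comp; first by move=> p _; exact: c1.
      by apply: compact_closed; [exact: norm_hausdorff|exact: compact_ballM].
    - apply: (@closed_comp _ _ (fun p : V * V => mform p.1 p.2) [set 0]); last exact: closed_eq.
      by move=> p _; exact: continuous_mform.
    - apply: (@closed_comp _ _ (fun p : V * V => gdot p.2 p.2) [set 1]); last exact: closed_eq.
      by move=> p _; exact: continuous_gdot.
  apply/seteqP; split=> p /=; first by move=> [[h1 h2 h3] h4].
  by move=> [[h1 h1'] [h2 h3]]; split.
by move=> p [Up [Mp dp]]; split=> //= i; exact: tangent_bound Up dp i.
Qed.

Lemma kap_lt_dist x y e : M x -> M y -> 0 <= e ->
  (kap x y < chord g e ^+ 2) = (dist g x y < e).
Proof.
move=> Mx My e0; have [d0 ->] := dist_spec Mx My.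
by rewrite ltNge chord_le// -ltNge.
Qed.

(** Sublevel sets of the polynomial [kap] are open in the ambient space and serve as the balls of an
    open cover. *)
Lemma totally_bounded (K : set V) e : compact K -> K `<=` M -> 0 < e ->
  exists2 s : seq V, {in s, forall z, K z} &
    forall y, K y -> exists2 z, z \in s & dist g z y < e.
Proof.
move=> cK KM e0; move: cK; rewrite compact_cover => cK.
have [||D' sD hD] := cK V K (fun z => [set y | kap z y < chord g e ^+ 2]).
- move=> z _; apply: (@open_comp _ _ (fun y => kap z y) [set t | t < chord g e ^+ 2]).
    by move=> y _; apply: continuous_kap => ?; [exact: cst_continuous|exact: cvg_id].
  exact: open_lt.
- move=> y Ky; exists y => //=; rewrite kap_lt_dist ?(ltW e0) ?distxx//; exact: KM.
exists (finmap.enum_fset D') => [z zD|y Ky]; first exact/set_mem/sD.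
have [z zD /= h] := hD _ Ky; exists z => //.
have Kz : K z by exact/set_mem/sD.
by rewrite -kap_lt_dist ?(ltW e0)//; exact: KM.
Qed.

End Topology.

(** * The Coxeter group, its tiles, and rigidity of facets *)

Module Tile.

Section GroupElements.
Context {R : realType} {g : geometry} {n : nat} (P : coxeter_polyhedron R g n).
Notation V := 'rV[R]_n.+2.
Implicit Types (x y z u v : V) (w : 'M[R]_n.+2).
Notation M := (@model_space R g n).
Notation W := (coxeter_group P).
Notation nrm := (facet_normal P).
Notation rfl i := (reflection g (facet_normal P i)).

Definition isom_group : set 'M[R]_n.+2 :=
  [set w | [/\ w \is a GRing.unit, isom g w & isom g w^-1]].

Lemma is_subgroup_isom : is_subgroup isom_group.
Proof.
split.
- by split; rewrite ?unitr1 ?invr1//; exact: isom1.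
- move=> a b [ua ia ia'] [ub ib ib']; split.
  + by rewrite unitrMl.
  + exact: isomM.
  + by rewrite invrM//; exact: isomM.
- by move=> a [ua ia ia']; split=> //; split; rewrite ?unitrV ?invrK.
Qed.

Lemma nrm_unit i : gdot g (nrm i) (nrm i) = 1.
Proof. exact: normal_unit. Qed.
Lemma reflM i : rfl i * rfl i = 1.
Proof. exact: (refl_invol (nrm_unit i)). Qed.
Lemma refl_unit i : rfl i \is a GRing.unit.
Proof. by apply/unitrP; exists (rfl i); rewrite reflM. Qed.
Lemma reflV i : (rfl i)^-1 = rfl i.
Proof. by apply: (mulrI (refl_unit i)); rewrite divrr ?reflM// refl_unit. Qed.
Lemma W_sub G : is_subgroup G -> (forall i, G (rfl i)) -> W `<=` G.
Proof. by move=> sG h w Ww; apply: Ww; split=> // _ [i ->]. Qed.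

Lemma W_isom_group w : W w -> isom_group w.
Proof.
apply: W_sub => [|i]; first exact: is_subgroup_isom.
have ir := isom_refl (nrm_unit i).
by split; rewrite ?reflV ?refl_unit.
Qed.

Lemma W_isom w : W w -> isom g w.
Proof. by move/W_isom_group => []. Qed.
Lemma W_unit w : W w -> w \is a GRing.unit.
Proof. by move/W_isom_group => []. Qed.
Lemma W1 : W 1.
Proof. by move=> G [[]]. Qed.

Lemma WM a b : W a -> W b -> W (a * b).
Proof.
move=> Wa Wb G GS; have [[_ h _] _] := GS.
by apply: h; [exact: Wa|exact: Wb].
Qed.

Lemma WV a : W a -> W a^-1.
Proof.
move=> Wa G GS; have [[_ _ h] _] := GS.
by have [] := h _ (Wa G GS).
Qed.

Lemma W_refl i : W (rfl i).
Proof. by move=> G [_]; apply; exists i. Qed.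

(** Closure under inverses is the only issue: the auxiliary set asks that left multiplication by
    both [a] and [a^-1] preserve [Q], and each reflection is its own inverse. *)
Lemma W_ind (Q : 'M[R]_n.+2 -> Prop) : Q 1 ->
  (forall w i, W w -> Q w -> Q (rfl i * w)) -> forall w, W w -> Q w.
Proof.
move=> Q1 QM w Ww.
pose G : set 'M[R]_n.+2 := [set a | [/\ W a, forall b, W b -> Q b -> Q (a * b) &
  forall b, W b -> Q b -> Q (a^-1 * b)]].
suff [_ h _] : G w by rewrite -[w]mulr1; apply: h => //; exact: W1.
apply: (@W_sub G) => // [|i]; last first.
  by split; [exact: W_refl| |rewrite reflV] => v Wv Qv; exact: QM.
split.
- by split; [exact: W1| |] => v _; rewrite ?invr1 mul1r.
- move=> a b [Wa ha ha'] [Wb hb hb']; split; first exact: WM.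
    by move=> v Wv Qv; rewrite -mulrA; apply: ha; [exact: WM|exact: hb].
  move=> v Wv Qv; rewrite invrM ?(W_unit Wa) ?(W_unit Wb)// -mulrA.
  by apply: hb'; [apply: WM => //; exact: WV|exact: ha'].
- move=> a [Wa ha ha']; split; first exact: W_unit.
  by split; [exact: WV|by []|rewrite invrK].
Qed.

Lemma WK w x : W w -> x *m w *m w^-1 = x.
Proof. by move=> /W_unit uw; rewrite -mulmxA (mulrV uw : w *m _ = 1%:M) mulmx1. Qed.
Lemma WVK w x : W w -> x *m w^-1 *m w = x.
Proof. by move=> /W_unit uw; rewrite -mulmxA (mulVr uw : _ *m w = 1%:M) mulmx1. Qed.
Lemma WMM w x : W w -> M x -> M (x *m w).
Proof. by move=> /W_isom[h _ _]; exact: h. Qed.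
Lemma W_dist w x y : W w -> M x -> M y -> dist g (x *m w) (y *m w) = dist g x y.
Proof. by move=> /W_isom; exact: isom_dist. Qed.

Lemma W_distV w x y : W w -> M x -> M y ->
  dist g (x *m w) y = dist g x (y *m w^-1).
Proof.
move=> Ww Mx My; rewrite -[in RHS](W_dist Ww)// ?WVK//.
by apply: WMM => //; exact: WV.
Qed.

Definition tform w i x : R := lform (nrm i) (x *m w^-1).
Definition intile w x := M x /\ forall i, tform w i x < 0.

Lemma tileP w x : W w -> tile P w x <-> M x /\ forall i, tform w i x <= 0.
Proof.
move=> Ww; split=> [[p [Mp hp] <-]|[Mx hx]] /=.
  by split=> [|i]; [exact: WMM|rewrite /tform WK].
exists (x *m w^-1) => /=; last by rewrite WVK.
by split=> //; apply: WMM => //; exact: WV.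
Qed.

Lemma tileM w x : W w -> tile P w x -> M x.
Proof. by move=> Ww /tileP[]. Qed.
Lemma intile_tile w x : W w -> intile w x -> tile P w x.
Proof. by move=> Ww [Mx h]; apply/tileP => //; split=> // i; exact/ltW. Qed.

Lemma tile_mul w w' x : W w -> W w' -> tile P (w * w') (x *m w') <-> tile P w x.
Proof.
move=> Ww Ww'; have Wm := WM Ww Ww'.
split=> /tileP => [/(_ Wm)|/(_ Ww)] [Mx h]; apply/tileP => //.
  split=> [|i]; first by rewrite -(WK x Ww'); apply: WMM => //; exact: WV.
  have := h i; rewrite /tform invrM ?(W_unit Ww) ?(W_unit Ww')//.
  by rewrite (mulmxA _ (w'^-1)) WK.
split=> [|i]; first exact: WMM.
rewrite /tform invrM ?(W_unit Ww) ?(W_unit Ww')//.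
by rewrite (mulmxA _ (w'^-1)) WK//; exact: h.
Qed.

Lemma tform_mul w w' i x : W w -> W w' -> tform (w * w') i (x *m w') = tform w i x.
Proof.
move=> Ww Ww'; rewrite /tform invrM ?(W_unit Ww) ?(W_unit Ww')//.
by rewrite (mulmxA _ (w'^-1)) WK.
Qed.

(** Matrices act on row vectors from the right, so [rfl i * w] is the tile adjacent to [w] across
    the facet [i] of [w]; the two tiles see their common wall with opposite signs. *)
Lemma tform_refl w i x : W w -> tform (rfl i * w) i x = - tform w i x.
Proof.
move=> Ww; rewrite /tform invrM ?(W_unit Ww) ?refl_unit// reflV mulmxA.
by rewrite lform_refl// nrm_unit.
Qed.

Lemma tform_between w i p a b t : a < t < b -> exists l m, [/\ 0 < l, 0 < m &
  tform w i (geo g p t) = l * tform w i (geo g p a) + m * tform w i (geo g p b)].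
Proof.
move=> /(geo_between g p)[l [m [l0 m0 ->]]]; exists l, m.
by rewrite /tform mulmxDl -!scalemxAl lformD !lformZ.
Qed.

Lemma tform_vanish w i p a b t : a != b ->
  tform w i (geo g p a) = 0 -> tform w i (geo g p b) = 0 -> tform w i (geo g p t) = 0.
Proof. by rewrite /tform -!geo_act; exact: form_vanish. Qed.

Definition base_point : V := xget 0 [set x | intile 1 x].

Lemma base_point_in : intile 1 base_point.
Proof.
rewrite /base_point; case: xgetP => [x _ //|/=]; have [x [Mx hx]] := poly_interior P.
by move=> /(_ x); case; split=> // i; rewrite /tform invr1 mulmx1.
Qed.

Lemma base_point_M : M base_point.
Proof. by case: base_point_in. Qed.
Lemma base_point_lt0 i : lform (nrm i) base_point < 0.
Proof. by have [_ /(_ i)] := base_point_in; rewrite /tform invr1 mulmx1. Qed.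

Definition ctr w := base_point *m w.

Lemma ctr_in w : W w -> intile w (ctr w).
Proof.
move=> Ww; split=> [|i]; first by apply: WMM => //; exact: base_point_M.
by rewrite /tform WK//; exact: base_point_lt0.
Qed.

Lemma ctr_M w : W w -> M (ctr w).
Proof. by move/ctr_in => []. Qed.

(* A point at distance [d] from a wall cannot be moved across it by less than [d]:
   [2 d] is the distance to its mirror image. *)
Lemma tform_ball w x : W w -> M x -> exists2 e, 0 < e &
  forall z, M z -> dist g x z < e -> forall i, tform w i x < 0 -> tform w i z < 0.
Proof.
move=> Ww Mx; have WVw := WV Ww.
pose x' := x *m w^-1; have Mx' : M x' by exact: WMM.
have MR i : M (x' *m rfl i) by have [h _ _] := isom_refl (nrm_unit i); exact: h.
pose F i := if tform w i x < 0 then dist g x' (x' *m rfl i) / 2 else 1.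
exists (\big[Num.min/1]_i F i).
  apply/bigmin_gtP; split=> // i _; rewrite /F; case: ifPn => // hi.
  rewrite divr_gt0// lt_def dist_ge0// andbT.
  apply/eqP => /(dist_eq0 Mx' (MR i)) e.
  have := lform_refl x' (nrm_unit i); rewrite -e.
  by move: hi; rewrite /tform -/x'; lra.
move=> z Mz xz i hi; rewrite ltNge; apply/negP => hy.
have Mz' : M (z *m w^-1) by exact: WMM.
have : dist g x' (z *m w^-1) < dist g x' (x' *m rfl i) / 2.
  rewrite (W_dist WVw)//; apply: lt_le_trans xz _.
  by have := @bigmin_le_cond _ _ _ 1 i xpredT F isT; rewrite {2}/F hi.
suff : dist g (z *m w^-1) (x' *m rfl i) <= dist g (z *m w^-1) x'.
  have := dist_triangle Mx' Mz' (MR i); rewrite (distC Mz' Mx'); lra.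
rewrite dist_le_kap// kap_refl ?nrm_unit// gerDl.
by move: hi hy; rewrite /tform -/x'; nra.
Qed.

Lemma intile_ball w x : W w -> intile w x ->
  exists2 e, 0 < e & forall y, M y -> dist g x y < e -> intile w y.
Proof.
move=> Ww [Mx hx]; have [e e0 he] := tform_ball Ww Mx.
by exists e => // y My xy; split=> // i; exact: (he y).
Qed.

(** The [n.+1] independent points leave a one-dimensional space of forms that vanish on them. *)
Lemma form_unique_mx i b (Mx : 'M[R]_(n.+1, n.+2)) : row_free Mx ->
  (forall k, lform (nrm i) (row k Mx) = 0) -> (forall k, lform b (row k Mx) = 0) ->
  exists a, b = a *: nrm i.
Proof.
move=> rf hn hb.
have ker v : (forall k, lform v (row k Mx) = 0) -> (v <= kermx Mx^T)%MS.
  move=> hv; apply/sub_kermxP/rowP => k; rewrite !mxE -[RHS](hv k).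
  by apply: eq_bigr => j _; rewrite !mxE.
have n0 : nrm i != 0.
  by apply/eqP => e; have := nrm_unit i; rewrite e -(scale0r 0) gdotZl mul0r => /eqP;
    rewrite eq_sym oner_eq0.
have rk : \rank (kermx Mx^T) = 1%N.
  by rewrite mxrank_ker mxrank_tr (eqP rf) subSnn.
apply/sub_rVP; apply: submx_trans (ker _ hb) _.
by rewrite -(geq_leqif (mxrank_leqif_sup (ker _ hn))) rk rank_rV n0.
Qed.

Lemma form_unique i b : (forall m, facet P i m -> lform b m = 0) ->
  exists a, b = a *: nrm i.
Proof.
move=> hb; have [Mx [rf hM]] := facet_dim i.
by apply: (form_unique_mx rf) => k; [case: (hM k)|exact: hb].
Qed.

(** The bisector of [p] and [q] contains the facet, hence is its hyperplane, and the bisector form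
    takes opposite values at [p] and [q]. This pins down isometries of a tile that fix a facet. *)
Lemma facet_rigid i p q : M p -> M q -> p <> q ->
  (forall m, facet P i m -> dist g p m = dist g q m) ->
  lform (nrm i) p * lform (nrm i) q < 0.
Proof.
move=> Mp Mq pq h; have [b hb] := bisector Mp Mq.
have [a ea] : exists a, b = a *: nrm i.
  apply: form_unique => m fm; have Mm : M m by case: fm => -[].
  rewrite hb//; have [_ ->] := dist_spec Mp Mm; have [_ ->] := dist_spec Mq Mm.
  by rewrite h// subrr.
have kxx x : kap g x x = 0 by rewrite /kap subrr -(scale0r x) gdotZl mul0r.
have d0 : 0 < dist g p q.
  by rewrite lt_def dist_ge0// andbT; apply/eqP => /(dist_eq0 Mp Mq).
have k0 : 0 < kap g p q.
  have [_ ->] := dist_spec Mp Mq.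
  by rewrite exprn_gt0// -(chord0 g) chord_lt.
have h1 := hb _ Mp; have h2 := hb _ Mq.
have lZ x : lform b x = a * lform (nrm i) x.
  by rewrite ea /lform mulr_sumr; apply: eq_bigr => k _; rewrite mxE mulrA.
move: h1 h2; rewrite !lZ !kxx (kapC g q p) subr0 sub0r.
move: (lform _ p) (lform _ q) (kap g p q) k0 => A B k k0 h1 h2.
have : (a * A) * (a * B) < 0 by rewrite h1 h2; nra.
have -> : a * A * (a * B) = a ^+ 2 * (A * B) by ring.
have := sqr_ge0 a; move: (a ^+ 2) (A * B) => c D; nra.
Qed.

(** Each column of [w - w'] is a linear form vanishing on the facet, so a multiple of its normal;
    vanishing at an interior point kills it. *)
Lemma mulmx_facet_eq i w w' : (forall m, facet P i m -> m *m w = m *m w') ->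
  base_point *m w = base_point *m w' -> w = w'.
Proof.
move=> hm hc; apply/eqP; rewrite -subr_eq0; apply/eqP; apply/matrixP => k j.
pose b : V := \row_k (w - w') k j.
have lb x : lform b x = (x *m (w - w')) ord0 j.
  by rewrite mxE; apply: eq_bigr => l _; rewrite mxE mulrC.
have [a ea] : exists a, b = a *: nrm i.
  by apply: form_unique => m fm; rewrite lb mulmxBr hm// subrr mxE.
have a0 : a = 0.
  have := lb base_point; rewrite mulmxBr hc subrr mxE ea.
  rewrite (_ : lform _ _ = a * lform (nrm i) base_point); last first.
    by rewrite /lform mulr_sumr; apply: eq_bigr => l _; rewrite mxE mulrA.
  by move=> /eqP; rewrite mulf_eq0 (lt_eqF (base_point_lt0 i)) orbF => /eqP.
have : b ord0 k = 0 by rewrite ea a0 scale0r mxE.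
by rewrite !mxE.
Qed.

Lemma compact_dist_bounded (K : set V) : compact K -> K `<=` M ->
  exists r, forall y, K y -> dist g (basept (n := n)) y <= r.
Proof.
move=> cK KM; have [s sK hs] := totally_bounded cK KM (ltr01 (R := R)).
exists (\big[Num.max/0]_(z <- s) dist g (basept (n := n)) z + 1) => y Ky.
have [z zs zy] := hs _ Ky; have Mb := @M_basept R g n.
apply: le_trans (dist_triangle Mb (KM _ (sK _ zs)) (KM _ Ky)) _.
apply: lerD; last exact: ltW.
exact: le_bigmax_seq zs _.
Qed.

Lemma polyhedron_bounded : exists r, forall y, polyhedron P y ->
  dist g (basept (n := n)) y <= r.
Proof. by apply: compact_dist_bounded; [exact: poly_compact|move=> y []]. Qed.

(** Without facets the polyhedron would contain a whole geodesic, which compactness forbids. *)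
Lemma facet_exists : exists i : 'I_(facets P), True.
Proof.
apply: contrapT => no; have [r hr] := polyhedron_bounded.
have Mb := @M_basept R g n; have [p Up pb] := UT_exists Mb.
have p0 : geo g p 0 = basept by rewrite geo0.
have Pt : polyhedron P (geo g p (`|r| + 1)).
  by split=> [|i]; [exact: geoM|case: no; exists i].
have := hr _ Pt; rewrite -p0 dist_geo// sub0r normrN ger0_norm ?addr_ge0//.
by have := ler_norm r; lra.
Qed.

Lemma lform_mulmx u x w : lform u (x *m w) = lform (u *m w^T) x.
Proof.
rewrite /lform; under eq_bigr do rewrite mxE mulr_sumr.
rewrite exchange_big; apply: eq_bigr => k _; rewrite mxE mulr_suml.
by apply: eq_bigr => j _; rewrite mxE; ring.
Qed.

Lemma midpoint x y : M x -> M y -> exists2 z, M z & forall w i, W w ->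
  (tform w i x <= 0 -> tform w i y <= 0 -> tform w i z <= 0) /\
  (tform w i x <= 0 -> tform w i y <= 0 -> tform w i z = 0 ->
   tform w i x = 0 /\ tform w i y = 0).
Proof.
move=> Mx My; have [->|/eqP xy] := eqVneq x y; first by exists y.
have [p Up [px py]] := log_exists Mx My xy.
have d0 : 0 < dist g x y.
  by rewrite lt_def dist_ge0// andbT; apply/eqP => /(dist_eq0 Mx My).
exists (geo g p (dist g x y / 2)); first exact: geoM.
move=> w i Ww; have h : 0 < dist g x y / 2 < dist g x y.
  by apply/andP; split; [exact: divr_gt0|lra].
have [l [m [l0 m0 ->]]] := tform_between w i p h.
rewrite py geo0 px; split=> [hx hy|hx hy e]; first by nra.
by split; apply/le_anti; rewrite ?hx ?hy/=; nra.
Qed.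

(** Iterated midpoints of a basis of the facet: a form that vanishes at a midpoint of points of [P]
    vanishes at both ends, so a form [j] vanishing at the result vanishes on the whole basis. It is
    then [nrm i] up to sign; distinct normals exclude one sign and the interior point excludes the
    other. *)
Lemma facet_relint i : exists p, facet P i p /\ forall j, j != i -> lform (nrm j) p < 0.
Proof.
have E v j : lform (nrm j) v = tform 1 j v by rewrite /tform invr1 mulmx1.
have [Mx [rf hM]] := facet_dim i.
have [p fp hp] : exists2 p, facet P i p & forall j, lform (nrm j) p = 0 ->
    forall k, lform (nrm j) (row k Mx) = 0.
  suff h (s : seq 'I_n.+1) : exists2 p, facet P i p &
      forall j, lform (nrm j) p = 0 -> {in s, forall k, lform (nrm j) (row k Mx) = 0}.
    have [p fp hp] := h (enum 'I_n.+1); exists p => // j pj k.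
    by apply: (hp j pj); rewrite mem_enum.
  elim: s => [|k s [p [Pp p0] hp]]; first by exists (row ord0 Mx).
  have [Pk k0] := hM k; have [Mp lp] := Pp; have [Mk lk] := Pk.
  have [z Mz hz] := midpoint Mp Mk; exists z.
    split; first by split=> // j; have [h _] := hz _ j W1; rewrite E; apply: h; rewrite -E.
    have [h _] := hz _ i W1; have [_ h'] := hz (rfl i) i (W_refl i).
    have E' v : tform (rfl i) i v = - lform (nrm i) v.
      by have := tform_refl i v W1; rewrite mulr1 -E.
    have := h; rewrite -!E p0 k0 !lexx => /(_ isT isT) z0.
    have [h2 _] := hz (rfl i) i (W_refl i).
    move: h2; rewrite !E' p0 k0 oppr0 lexx => /(_ isT isT); rewrite oppr_le0 => z1.
    by apply/le_anti; rewrite z0 z1.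
  move=> j; have [_ h] := hz _ j W1; rewrite E => zj.
  have [e1 e2] : tform 1 j p = 0 /\ tform 1 j (row k Mx) = 0.
    by apply: h => //; rewrite -E.
  move=> k'; rewrite inE => /predU1P[->|k's]; first by rewrite E.
  by apply: hp => //; rewrite E.
exists p; split=> // j ji; have [[Mp lp] p0] := fp.
rewrite lt_neqAle lp andbT; apply/eqP => pj.
have kj := hp _ pj.
have [a ea] : exists a, nrm j = a *: nrm i.
  by apply: (form_unique_mx rf) => // k; case: (hM k).
have a2 : a ^+ 2 = 1.
  have := nrm_unit j; rewrite ea gdotZl gdotZr nrm_unit mulr1 => <-; exact: expr2.
have := base_point_lt0 j; have := base_point_lt0 i; rewrite ea.
rewrite (_ : lform (a *: _) _ = a * lform (nrm i) base_point); last first.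
  by rewrite /lform mulr_sumr; apply: eq_bigr => l _; rewrite mxE mulrA.
move/eqP: a2; rewrite sqrf_eq1 => /orP[]/eqP a1; last by rewrite a1; lra.
by move: ji; rewrite (normal_inj (x1 := j) (x2 := i)) ?eqxx// ea a1 scale1r.
Qed.

End GroupElements.

End Tile.
Import Tile.

(** * The tessellation recovered from an apartment chart *)

Section Tessellation.
Context {R : realType} {g : geometry} {n : nat} {P : coxeter_polyhedron R g n}.
Context {K : polyhedral_complex P} {A : set (cplx_point K)}.
Context {f : 'rV[R]_n.+2 -> cplx_point K} (fA : tessellation_isometry f A).
Implicit Types (x y z v : 'rV[R]_n.+2) (w : 'M[R]_n.+2).
Notation M := (@model_space R g n).
Notation W := (coxeter_group P).
Notation nrm := (facet_normal P).
Notation rfl i := (reflection g (facet_normal P i)).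
Notation tile := (tile P).
Notation tform := (@tform R g n P).
Notation intile := (intile P).
Notation ctr := (ctr P).
Notation tau x := (ctype (f x)).

Lemma tile1 : tile 1 = polyhedron P.
Proof.
apply/seteqP; split=> x; first by case=> p Pp <-; rewrite /= mulmx1.
by exists x => //=; rewrite mulmx1.
Qed.

Lemma base_point_P : polyhedron P (base_point P).
Proof.
rewrite -tile1; apply: intile_tile; [exact: (@W1 R g n P)|exact: (base_point_in P)].
Qed.

Lemma f_inj x y : M x -> M y -> f x = f y -> x = y.
Proof.
by move=> Mx My e; have [[_ h _] _] := fA; apply: h; rewrite ?inE.
Qed.

Lemma f_chamber w : W w -> chamber (f @` tile w).
Proof. by move=> Ww; have [_ /(_ _ Ww)[]] := fA. Qed.

Lemma tau_dist w x y : W w -> tile w x -> tile w y ->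
  dist g (tau x) (tau y) = dist g x y.
Proof.
by move=> Ww tx ty; have [_ /(_ _ Ww)[_]] := fA; apply; rewrite inE.
Qed.

Lemma tau_P w x : W w -> tile w x -> polyhedron P (tau x).
Proof.
move=> Ww tx; have [h _ _] := chamber_bij (f_chamber Ww).
by apply: h; exists x.
Qed.

Lemma tau_surj w q : W w -> polyhedron P q -> exists2 x, tile w x & tau x = q.
Proof.
move=> Ww Pq; have [_ _ h] := chamber_bij (f_chamber Ww).
by have [_ [x tx <-] <-] := h _ Pq; exists x.
Qed.

(* Metric characterisation of the faces of a tile: [y] lies in the smallest face
   containing [x] iff the segment from [y] to [x] extends beyond [x]. *)
Lemma face_extend w x y : W w -> tile w x -> tile w y -> x <> y ->
  (forall i, tform w i x = 0 -> tform w i y = 0) ->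
  exists z, [/\ tile w z, z <> x & dist g y x + dist g x z = dist g y z].
Proof.
move=> Ww tx ty xy h; have Mx := tileM Ww tx; have My := tileM Ww ty.
have [p Up [py px]] := log_exists My Mx (nesym xy).
set d := dist g y x in px; have d0 : 0 < d.
  by rewrite lt_def dist_ge0// andbT; apply/eqP => /(dist_eq0 My Mx) /esym.
have p0 : geo g p 0 = y by rewrite geo0.
have hx i : tform w i x <= 0 by have /tileP[//|_] := tx.
have [t [dt ht]] : exists t, d < t /\ forall i, tform w i (geo g p t) <= 0.
  have [e e0 he] : exists2 e, 0 < e & forall z, M z -> dist g x z < e ->
      forall i, tform w i x < 0 -> tform w i z < 0.
    exact: tform_ball.
  exists (d + e / 2); split; first by rewrite ltrDl divr_gt0.
  move=> i; have [hi|hi] := ltP (tform w i x) 0.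
    apply/ltW/he => //; first exact: geoM.
    by rewrite -px dist_geo// opprD addrA subrr sub0r normrN gtr0_norm ?divr_gt0//; lra.
  have e1 : tform w i x = 0 by apply/le_anti; rewrite hx hi.
  by rewrite (tform_vanish (a := 0) (b := d)) ?p0 ?px ?h// ?lt_eqF.
have d00 := ltW d0.
exists (geo g p t); split.
- by apply/tileP => //; split; [exact: geoM|].
- move=> e; have := dist_geo t d Up; rewrite px e distxx// => /esym/eqP.
  by rewrite normr_eq0 subr_eq0 (gt_eqF dt).
- rewrite -px -p0 !dist_geo// !sub0r !normrN (gtr0_norm d0) (gtr0_norm (lt_trans d0 dt)).
  by rewrite distrC gtr0_norm ?subr_gt0//; lra.
Qed.

Lemma face_of_extend w x y z : W w -> tile w x -> tile w y -> tile w z ->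
  z <> x -> dist g y x + dist g x z = dist g y z ->
  forall i, tform w i x = 0 -> tform w i y = 0.
Proof.
move=> Ww tx ty tz zx e i hx.
have [Mx My Mz] := And3 (tileM Ww tx) (tileM Ww ty) (tileM Ww tz).
have [<-//|/eqP xy] := eqVneq x y.
have yz : y <> z.
  move=> yz; move: e; rewrite -yz distxx// (distC Mx My) => e.
  by apply: xy; apply: (dist_eq0 Mx My); rewrite (distC Mx My); have := dist_ge0 My Mx; lra.
have [p Up [py pz]] := log_exists My Mz yz.
have p0 : geo g p 0 = y by rewrite geo0.
set t := dist g y x in e.
have t0 : 0 < t.
  by rewrite lt_def dist_ge0// andbT; apply/eqP => /(dist_eq0 My Mx) /esym.
have u0 : 0 < dist g x z.
  by rewrite lt_def dist_ge0// andbT; apply/eqP => /(dist_eq0 Mx Mz) /esym.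
have ex : x = geo g p t.
  have := @between_geo _ g _ p (dist g y z) x Up; rewrite p0 pz; apply => //.
  by rewrite -e; lra.
have tT : 0 < t < dist g y z by rewrite t0 -e ltrDl.
have [l [m [l0 m0]]] := tform_between w i p tT.
rewrite -ex hx p0 pz => e1.
have hy : tform w i y <= 0 by have /tileP[//|_] := ty.
have hz : tform w i z <= 0 by have /tileP[//|_] := tz.
by apply/eqP; rewrite eq_le hy/=; nra.
Qed.

Lemma tform1E v i : lform (nrm i) v = tform 1 i v.
Proof. by rewrite /Tile.tform invr1 mulmx1. Qed.

Lemma type_face w x y : W w -> tile w x -> tile w y ->
  (forall i, tform w i x = 0 -> tform w i y = 0) <->
  (forall i, lform (nrm i) (tau x) = 0 -> lform (nrm i) (tau y) = 0).
Proof.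
move=> Ww tx ty; have W1' := @W1 R g n P.
have t1 z : tile w z -> tile 1 (tau z) by move=> tz; rewrite tile1; exact: tau_P tz.
have [<-//|/eqP xy] := eqVneq x y.
split=> h i.
  have [z [tz zx e]] := face_extend Ww tx ty xy h; rewrite !tform1E.
  apply: (@face_of_extend 1 _ _ (tau z)); rewrite ?(tau_dist Ww)//; try exact: t1.
  move=> e2; apply: zx; apply: (dist_eq0 (tileM Ww tz) (tileM Ww tx)).
  by rewrite -(tau_dist Ww)// e2 distxx//; exact: (tileM W1' (t1 _ tx)).
have txy : tau x <> tau y.
  move=> e; apply: xy; apply: (dist_eq0 (tileM Ww tx) (tileM Ww ty)).
  by rewrite -(tau_dist Ww)// e distxx//; exact: (tileM W1' (t1 _ ty)).
have h' k : tform 1 k (tau x) = 0 -> tform 1 k (tau y) = 0 by rewrite -!tform1E; exact: h.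
have [z' [tz' zx e]] := face_extend W1' (t1 _ tx) (t1 _ ty) txy h'.
rewrite tile1 in tz'; have [z tz ez] := tau_surj Ww tz'; rewrite -ez in zx e.
move: e; rewrite (tau_dist Ww ty tx) (tau_dist Ww tx tz) (tau_dist Ww ty tz) => e.
apply: (@face_of_extend w _ _ z) => //.
by move=> zx'; apply: zx; rewrite zx'.
Qed.

(** The gluing axiom of the complex, read in the model space; it is the source of the disjointness
    of open tiles. *)
Lemma glue_tile w x y C : W w -> tile w x -> tile w y ->
  (forall i, tform w i x = 0 -> tform w i y = 0) -> chamber C -> C (f x) -> C (f y).
Proof.
move=> Ww tx ty /(type_face Ww tx ty) h cC Cx.
by apply: (chamber_glue (f_chamber Ww) cC (x := f x) _ Cx _ h); [exists x|exists y].
Qed.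

Lemma tile_face w w' x y : W w -> W w' -> tile w x -> tile w' x -> tile w y ->
  (forall i, tform w i x = 0 -> tform w i y = 0) -> tile w' y.
Proof.
move=> Ww Ww' tx tx' ty h.
have [|y' ty' e] := glue_tile Ww tx ty h (f_chamber Ww'); first by exists x.
by rewrite -(f_inj (tileM Ww' ty') (tileM Ww ty) e).
Qed.

Lemma intile_sub w w' x : W w -> W w' -> intile w x -> tile w' x ->
  tile w `<=` tile w'.
Proof.
move=> Ww Ww' ix tx y ty; apply: (tile_face Ww Ww' (x := x)) => //.
  exact: intile_tile.
by move=> i hi; have [_ /(_ i)] := ix; rewrite hi ltxx.
Qed.

(** Gluing gives one inclusion. For the other, a point moved slightly from [x] towards the centre of
    [w'] is interior to both tiles, so gluing applies with the roles exchanged. *)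
Lemma intile_eq w w' x : W w -> W w' -> intile w x -> tile w' x -> tile w = tile w'.
Proof.
move=> Ww Ww' ix tx; have s1 := intile_sub Ww Ww' ix tx.
have Mx := tileM Ww' tx; have ic := ctr_in Ww'; have Mc := ctr_M Ww'.
have [xc|/eqP xc] := eqVneq x (ctr w').
  apply/seteqP; split=> //; rewrite xc in ix.
  exact: (intile_sub Ww' Ww ic (intile_tile Ww ix)).
have [p Up [px pc]] := log_exists Mx Mc xc.
have [e e0 he] := intile_ball Ww ix.
have p0 : geo g p 0 = x by rewrite geo0.
have d0 : 0 < dist g x (ctr w').
  by rewrite lt_def dist_ge0// andbT; apply/eqP => /(dist_eq0 Mx Mc).
set d := dist g x _ in d0 pc.
pose t := Num.min (e / 2) (d / 2).
have t0 : 0 < t by rewrite lt_min !divr_gt0.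
have td : 0 < t < d by rewrite t0 /= gt_min; apply/orP; right; lra.
have te : t < e by rewrite gt_min; apply/orP; left; lra.
have i1 : intile w (geo g p t).
  by apply: he; [exact: geoM|rewrite -p0 dist_geo// sub0r normrN gtr0_norm].
have i2 : intile w' (geo g p t).
  split=> [|i]; first exact: geoM.
  have [l [m [l0 m0 ->]]] := tform_between w' i p td.
  rewrite p0 pc; have [_ /(_ i) h2] := ic.
  have h1 : tform w' i x <= 0 by have /tileP[//|_] := tx.
  by nra.
apply/seteqP; split=> //; exact: (intile_sub Ww' Ww i2 (intile_tile Ww i1)).
Qed.

Lemma facet_tile w i m : W w -> facet P i m -> tile w (m *m w).
Proof. by move=> Ww [Pm _]; exists m. Qed.

(** Induction across facets shows that the twist of types is the same on all tiles. The point [q] of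
    [P] whose image in the inner tile has the type of [p *m (rfl i * w)] has the same distances to
    the facet as [p]; if it differed from [p], rigidity would put the two on opposite sides of the
    facet, while both lie in [P]. *)
Lemma tau_W w p : W w -> polyhedron P p -> tau (p *m w) = tau p.
Proof.
move=> Ww; move: w Ww p; apply: W_ind => [p _|w i Ww IH p Pp].
  by rewrite mulmx1.
have Wr := W_refl i; have Wrw := WM Wr Ww.
have tp : tile (rfl i * w) (p *m (rfl i * w)) by exists p.
have [_ [q Pq <-] /= eq] := tau_surj Ww (tau_P Wrw tp).
have Mp : M p by case: Pp. have Mq : M q by case: Pq.
rewrite -eq IH//; congr (ctype (f _)); apply: contrapT => qp.
have tq : tile w (q *m w) by exists q.
have := @facet_rigid _ _ _ P i q p Mq Mp qp.
suff h m : facet P i m -> dist g q m = dist g p m.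
  move=> /(_ h); have [_ /(_ i)] := Pq; have [_ /(_ i)] := Pp; nra.
move=> fm; have Mm : M m by case: fm => -[].
have mr : m *m (rfl i * w) = m *m w.
  by case: fm => _ m0; rewrite mulmxA refl_fix.
rewrite -(W_dist Ww Mq Mm) -(W_dist Wrw Mp Mm).
rewrite -(tau_dist Ww tq (facet_tile Ww fm)) eq mr.
by rewrite -mr -(tau_dist Wrw tp)//; exact: (facet_tile Wrw fm).
Qed.

(** Types are constant along orbits and injective on a chamber, so [w] and [w'] agree on [P], which
    contains enough points to determine a matrix. *)
Lemma tile_inj w w' : W w -> W w' -> tile w = tile w' -> w = w'.
Proof.
move=> Ww Ww' tt.
have h p : polyhedron P p -> p *m w = p *m w'.
  move=> Pp; have : tile w' (p *m w) by rewrite -tt; exists p.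
  move=> [q Pq /= e]; suff pq : p = q by rewrite -e pq.
  have := tau_W Ww Pp; rewrite -e tau_W// => eqp.
  have [_ I _] := chamber_bij (f_chamber (@W1 R g n P)).
  have Mp : M p by case: Pp. have Mq : M q by case: Pq.
  apply: f_inj => //; apply: I; rewrite ?inE; last by rewrite eqp.
    by exists p => //; rewrite tile1.
  by exists q => //; rewrite tile1.
have [i0 _] := facet_exists P.
apply: (@mulmx_facet_eq _ _ _ P i0) => [m fm|]; first by apply: h; case: fm.
by apply: h; rewrite -tile1; apply: intile_tile; [exact: W1|exact: base_point_in].
Qed.

Lemma intile_uniq w w' x : W w -> W w' -> intile w x -> tile w' x -> w = w'.
Proof. by move=> Ww Ww' ix tx; apply: tile_inj => //; exact: intile_eq ix tx. Qed.

End Tessellation.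

Lemma finite_set_net (T : choiceType) (U : eqType) (A : set T) (s : seq U)
    (r : T -> U -> Prop) :
  (forall a, A a -> exists2 z, z \in s & r a z) ->
  (forall a a' z, A a -> A a' -> r a z -> r a' z -> a = a') -> finite_set A.
Proof.
move=> h1 h2; have [->|/set0P[a0 Aa0]] := eqVneq A set0; first exact: finite_set0.
pose F z := xget a0 [set a | A a /\ r a z].
apply: (@sub_finite_set _ _ (F @` [set` s])).
  move=> a Aa; have [z zs raz] := h1 _ Aa; exists z => //=.
  rewrite /F; case: xgetP => [b _ [Ab rbz]|/(_ a)[]]//; exact: h2 rbz raz.
exact/finite_image/finite_seq.
Qed.

Lemma finite_argmin (R : realType) (T : choiceType) (A : set T) (F : T -> R) a0 :
  finite_set A -> A a0 -> exists2 a, A a & forall b, A b -> F a <= F b.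
Proof.
move=> /finite_seqP[s ->] a0s.
suff : s != [::] -> exists2 a, a \in s & {in s, forall b, F a <= F b}.
  by case=> [|a as_ h]; [case: s a0s|exists a].
move: s {a0s} => [|a s] // _; elim: s a => [|b s IH] a.
  by exists a; rewrite ?mem_head// => b; rewrite inE => /eqP->.
have [c cs hc] := IH b; have [ac|ca] := leP (F a) (F c).
  exists a; rewrite ?mem_head// => d; rewrite inE => /predU1P[->//|/hc].
  exact: le_trans.
exists c; first by rewrite inE cs orbT.
by move=> d; rewrite inE => /predU1P[->|/hc//]; exact: ltW.
Qed.

Section GeoContinuity.
Context {R : realType} {g : geometry} {n : nat}.
Implicit Type p : ('rV[R]_n.+2 * 'rV[R]_n.+2)%type.

Lemma continuous_expRN : continuous (fun t : R => expR (- t)).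
Proof.
move=> t; apply: (@continuous_comp _ _ _ (fun t : R => - t) expR).
  exact: opp_continuous.
exact: continuous_expR.
Qed.

Lemma continuous_geoC : continuous (geoC g : R -> R).
Proof.
case: g => /= t; first exact: cst_continuous.
apply: cvgMl; apply: cvgD; [exact: continuous_expR|exact: continuous_expRN].
Qed.

Lemma continuous_geoS : continuous (geoS g : R -> R).
Proof.
case: g => /= t; first exact: cvg_id.
apply: cvgMl; apply: cvgB; [exact: continuous_expR|exact: continuous_expRN].
Qed.

Lemma continuous_lform_geo u p : continuous (fun t => lform u (geo g p t)).
Proof.
under eq_fun do rewrite lformD !lformZ.
by move=> t; apply: cvgD; apply: cvgMl;
  [exact: continuous_geoC|exact: continuous_geoS].
Qed.

Lemma form_zero u p (a b : R) : a <= b ->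
  lform u (geo g p a) * lform u (geo g p b) <= 0 ->
  exists2 t, a <= t <= b & lform u (geo g p t) = 0.
Proof.
move=> ab h.
have [||t] := @IVT R (fun t => lform u (geo g p t)) a b 0 ab.
- by apply: continuous_subspaceT => t; exact: continuous_lform_geo.
- rewrite minEle maxEle; case: ifPn; [|rewrite -ltNge]; nra.
by rewrite in_itv /= => tab e; exists t.
Qed.

End GeoContinuity.

(** * Local finiteness, walls and separation *)

Section Walls.
Context {R : realType} {g : geometry} {n : nat} {P : coxeter_polyhedron R g n}.
Notation V := 'rV[R]_n.+2.
Context {K : polyhedral_complex P} {A : set (cplx_point K)}.
Context {f : V -> cplx_point K} (fA : tessellation_isometry f A).
Implicit Types (x y z v : V) (w : 'M[R]_n.+2) (H : set V).
Notation M := (@model_space R g n).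
Notation W := (coxeter_group P).
Notation nrm := (facet_normal P).
Notation rfl i := (reflection g (facet_normal P i)).
Notation tile := (tile P).
Notation tform := (@tform R g n P).
Notation intile := (intile P).
Notation ctr := (ctr P).
Notation wall := (@wall R g n P).

Lemma intile_mul w w' x : W w -> W w' -> intile (w * w') (x *m w') <-> intile w x.
Proof.
move=> Ww Ww'; split=> -[Mx h]; split=> [|i].
- by rewrite -(WK x Ww'); apply: (WMM (WV Ww')).
- by rewrite -(tform_mul _ _ Ww Ww').
- exact: (WMM Ww').
- by rewrite tform_mul.
Qed.

Lemma ctr_mul w w' : ctr (w * w') = ctr w *m w'.
Proof. exact: mulmxA. Qed.

Lemma ctr_separated : exists2 e, 0 < e & forall w w', W w -> W w' ->
  dist g (ctr w) (ctr w') < e -> w = w'.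
Proof.
have [e e0 he] := intile_ball (@W1 R g n P) (base_point_in P).
exists e => // w w' Ww Ww' h; apply: (intile_uniq fA Ww Ww' (x := ctr w')).
  have Mc' := ctr_M Ww'.
  have Mv : M (ctr w' *m w^-1) by apply: (WMM (WV Ww)).
  have := he (ctr w' *m w^-1) Mv.
  rewrite -(W_distV Ww)//; last exact: base_point_M.
  move=> /(_ h) /(intile_mul _ (@W1 R g n P) Ww); by rewrite mul1r (WVK _ Ww).
by apply: intile_tile => //; exact: ctr_in.
Qed.

(** Centres of distinct tiles are uniformly separated, so a point of a finite net of the ball is
    close to at most one of them. *)
Lemma finite_ctr y r : M y -> finite_set [set w | W w /\ dist g y (ctr w) <= r].
Proof.
move=> My; have [e e0 he] := ctr_separated.
have Mb := @M_basept R g n.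
have bM : ballM (n := n) g (dist g basept y + r) `<=` M by move=> z [].
have e20 : 0 < e / 2 by exact: divr_gt0.
have [s sb hs] := totally_bounded (compact_ballM (r := _)) bM e20.
apply: (@finite_set_net _ _ _ s (fun w z => dist g z (ctr w) < e / 2 /\ M z)).
  move=> w [Ww h]; have Mw := ctr_M Ww.
  have [|z zs hz] := hs (ctr w).
    by split=> //; have := dist_triangle Mb My Mw; lra.
  by exists z => //; split=> //; apply: bM; exact: sb.
move=> w w' z [Ww _] [Ww' _] [h1 Mz] [h2 _]; apply: he => //.
have Mw := ctr_M Ww; have Mw' := ctr_M Ww'.
by have := dist_triangle Mw Mz Mw'; rewrite (distC Mw Mz); lra.
Qed.

Lemma tile_diam : exists2 D, 0 < D & forall w x, W w -> tile w x ->
  dist g x (ctr w) <= D.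
Proof.
have [r hr] := polyhedron_bounded P; have Mb := @M_basept R g n.
have Mc := base_point_M P.
have h w x : W w -> tile w x -> dist g x (ctr w) <= r + dist g basept (base_point P).
  move=> Ww [p Pp <-] /=; have Mp : M p by case: Pp.
  rewrite /Tile.ctr (W_dist Ww)//; have := dist_triangle Mp Mb Mc; have := hr _ Pp.
  by rewrite (distC Mp Mb); lra.
exists (`|r + dist g basept (base_point P)| + 1); first by rewrite ltr_wpDl.
move=> w x Ww tx; apply: le_trans (h w x Ww tx) _.
by have := ler_norm (r + dist g basept (base_point P)); lra.
Qed.

(** Take the tile with nearest centre: a violated facet inequality would make the centre of the
    adjacent tile strictly nearer. *)
Lemma tile_cover y : M y -> exists2 w, W w & tile w y.
Proof.
move=> My; have W1' := @W1 R g n P.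
have [w [Ww hw] min] := @finite_argmin R _ _ (fun w => dist g y (ctr w)) 1
  (finite_ctr (dist g y (ctr 1)) My) (conj W1' (lexx _)).
exists w => //; apply/tileP => //; split=> // i; rewrite leNgt; apply/negP => hi.
have Wr := W_refl i; have Wrw := WM Wr Ww.
have My' : M (y *m w^-1) by apply: (WMM (WV Ww)).
have Mc := base_point_M P.
have : dist g y (ctr (rfl i * w)) < dist g y (ctr w).
  have [Mr _ _] := isom_refl (nrm_unit (P := P) i).
  have e v : M v -> dist g y (v *m w) = dist g (y *m w^-1) v.
    move=> Mv; rewrite (distC My (WMM Ww Mv)) (W_distV Ww Mv My).
    by rewrite distC.
  rewrite /Tile.ctr mulmxA !e//; last exact: Mr.
  by apply: dist_refl_lt => //; [exact: nrm_unit|exact: base_point_lt0].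
move=> lt; have := min (rfl i * w); rewrite leNgt lt => h; apply: (notF (h _)).
by split=> //; apply: le_trans (ltW lt) hw.
Qed.

Lemma refl1 i : rfl i <> 1.
Proof.
move=> e; have := lform_refl (base_point P) (nrm_unit (P := P) i).
by rewrite e mulmx1; have := base_point_lt0 (P := P) i; lra.
Qed.

Lemma wallP w i x : W w -> wall w i x <-> M x /\ tform w i x = 0.
Proof.
move=> Ww; split=> [[p [Mp hp] <-]|[Mx hx]] /=.
  by split; [exact: (WMM Ww)|by rewrite /Tile.tform (WK _ Ww)].
exists (x *m w^-1) => /=; last by rewrite (WVK _ Ww).
by split=> //; apply: (WMM (WV Ww)).
Qed.

(** The reflection in the wall belongs to [W]; if it fixed [x] it would preserve the tile with [x]
    in its interior, and so be trivial. *)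
Lemma intile_wall w w' i x : W w -> W w' -> intile w x -> tform w' i x <> 0.
Proof.
move=> Ww Ww' ix hx; pose r := w'^-1 * rfl i * w'.
have Wr : W r by apply: WM => //; apply: WM; [exact: WV|exact: W_refl].
have xr : x *m r = x by rewrite /r !mulmxA refl_fix// (WVK _ Ww').
have : tile (w * r) x.
  by rewrite -[X in _ X]xr; apply/tile_mul => //; exact: intile_tile.
move=> /(intile_uniq fA Ww (WM Ww Wr) ix) e.
have r1 : r = 1 by apply: (mulrI (W_unit Ww)); rewrite mulr1 -e.
apply: (@refl1 i); have uw := W_unit Ww'.
apply: (mulIr uw); apply: (mulrI (W_unit (WV Ww'))).
by rewrite mul1r mulVr// -r1 /r !mulrA.
Qed.

Lemma tform_zero_between w i x y : W w -> M x -> M y ->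
  tform w i x * tform w i y <= 0 ->
  exists z, [/\ M z, tform w i z = 0 & dist g x z + dist g z y = dist g x y].
Proof.
move=> Ww Mx My h; have [xy|/eqP xy] := eqVneq x y.
  exists x; split=> //; first by move: h; rewrite -xy; nra.
  by rewrite xy distxx// addr0.
have [p Up [px py]] := log_exists Mx My xy.
have p0 : geo g p 0 = x by rewrite geo0.
have d0 := dist_ge0 Mx My; set d := dist g x y in py d0 *.
have := @form_zero _ g _ (nrm i) (act p w^-1) 0 d d0.
rewrite !geo_act p0 py => /(_ h)[t /andP[t0 td]]; rewrite geo_act => e.
exists (geo g p t); split=> //; first exact: geoM.
rewrite -p0 -py !dist_geo// sub0r normrN ger0_norm// distrC ger0_norm ?subr_ge0//.
by lra.
Qed.

Lemma tform_between_sign w x y z : W w -> M x -> M y -> M z ->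
  dist g x z + dist g z y = dist g x y -> z <> x -> z <> y ->
  exists l m, [/\ 0 < l, 0 < m & forall w' j,
    tform w' j z = l * tform w' j x + m * tform w' j y].
Proof.
move=> Ww Mx My Mz e zx zy.
have a0 : 0 < dist g x z.
  by rewrite lt_def dist_ge0// andbT; apply/eqP => /(dist_eq0 Mx Mz)/esym.
have b0 : 0 < dist g z y.
  by rewrite lt_def dist_ge0// andbT; apply/eqP => /(dist_eq0 Mz My).
have xy : x <> y.
  by move=> xy; move: b0 e; rewrite -xy distxx// => b0 e; have := addr_gt0 a0 b0; rewrite e ltxx.
have [p Up [px py]] := log_exists Mx My xy.
have p0 : geo g p 0 = x by rewrite geo0.
have d0 := dist_ge0 Mx My.
have ez : z = geo g p (dist g x z).
  by have := @between_geo _ g _ p (dist g x y) z Up; rewrite p0 py; apply.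
have h : 0 < dist g x z < dist g x y by rewrite a0 -e ltrDl.
have [l [m [l0 m0 h2]]] := geo_between g p h; exists l, m; split=> // w' j.
by rewrite {1}ez h2 p0 py /Tile.tform mulmxDl -!scalemxAl lformD !lformZ.
Qed.

(** Separation is stated for point sets because a wall is carried by many tiles and must be counted
    once, whichever pair [(w, i)] describes it. *)
Definition sep H x y := [/\ ~ H x, ~ H y &
  exists2 z, H z & dist g x z + dist g z y = dist g x y].

Lemma sepE w i x y : W w -> M x -> M y ->
  sep (wall w i) x y <-> tform w i x * tform w i y < 0.
Proof.
move=> Ww Mx My; split.
  move=> [hx hy [z /wallP[//|Mz hz] e]].
  have zx : z <> x by move=> zx; apply: hx; apply/wallP => //; rewrite -zx.
  have zy : z <> y by move=> zy; apply: hy; apply/wallP => //; rewrite -zy.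
  have [l [m [l0 m0 /(_ w i)]]] := tform_between_sign Ww Mx My Mz e zx zy.
  have hx' : tform w i x != 0 by apply/eqP => h; apply: hx; apply/wallP.
  rewrite hz => h; have h2 : tform w i y = - (l / m) * tform w i x.
    by apply: (mulfI (lt0r_neq0 m0)); rewrite -[LHS](addKr (l * tform w i x)) -h; field; exact: lt0r_neq0.
  rewrite h2 mulrCA -expr2 mulNr oppr_lt0 mulr_gt0 ?divr_gt0//.
  by rewrite lt_def sqrf_eq0 hx' sqr_ge0.
move=> h; split; [move=> /wallP[//|_ e]|move=> /wallP[//|_ e]|].
- by move: h; rewrite e mul0r ltxx.
- by move: h; rewrite e mulr0 ltxx.
have [z [Mz hz e]] := tform_zero_between Ww Mx My (ltW h).
by exists z => //; apply/wallP.
Qed.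

Lemma sepC H x y : M x -> M y -> H `<=` M -> sep H x y -> sep H y x.
Proof.
move=> Mx My HM [hx hy [z Hz e]]; split=> //; exists z => //.
by have Mz := HM _ Hz; rewrite addrC (distC My Mz) (distC Mz Mx) e distC.
Qed.

Lemma intile_sep w w' i x y : W w -> W w' -> intile w x -> tile w y ->
  ~ sep (wall w' i) x y.
Proof.
move=> Ww Ww' ix ty; have Mx : M x by case: ix. have My := tileM Ww ty.
move=> /(sepE i Ww' Mx My) h.
have [z [Mz hz e]] := tform_zero_between Ww' Mx My (ltW h).
apply: (intile_wall Ww Ww' _ hz).
have zx : z <> x by move=> zx; move: h; rewrite -zx hz mul0r ltxx.
have zy : z <> y by move=> zy; move: h; rewrite -zy hz mulr0 ltxx.
have [l [m [l0 m0 h2]]] := tform_between_sign Ww Mx My Mz e zx zy.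
split=> // j; rewrite h2; have [_ /(_ j) h3] := ix.
by have /tileP[//|_ /(_ j) h4] := ty; nra.
Qed.

Lemma tile_sign w w' i x : W w -> W w' -> tile w x ->
  0 <= tform w' i (ctr w) * tform w' i x.
Proof.
move=> Ww Ww' tx; rewrite leNgt; apply/negP => /(sepE i Ww' (ctr_M Ww) (tileM Ww tx)).
exact: (intile_sep Ww Ww' (ctr_in Ww) tx).
Qed.

Lemma ctr_neq0 w w' i : W w -> W w' -> tform w' i (ctr w) != 0.
Proof. by move=> Ww Ww'; apply/eqP; exact: (intile_wall Ww Ww' (ctr_in Ww)). Qed.

Lemma wall_prop w w' i j a : W w -> W w' ->
  (forall x, M x -> tform w' j x = a * tform w i x) -> wall w' j = wall w i.
Proof.
move=> Ww Ww' h.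
have a0 : a != 0.
  apply/eqP => a0; have := ctr_neq0 j Ww Ww'.
  by rewrite h ?a0 ?mul0r ?eqxx//; exact: ctr_M.
apply/seteqP; split=> x /wallP[//|Mx e]; apply/wallP => //; split=> //.
  by move/eqP: e; rewrite h// mulf_eq0 (negbTE a0) => /eqP.
by rewrite h// e mulr0.
Qed.

Lemma wall_facet w w' i j : W w -> W w' ->
  (forall m, facet P i m -> tform w' j (m *m w) = 0) -> wall w' j = wall w i.
Proof.
move=> Ww Ww' h.
pose b := nrm j *m (w * w'^-1)^T.
have hb x : lform b x = tform w' j (x *m w) by rewrite /b -lform_mulmx mulmxA.
have [a ea] : exists a, b = a *: nrm i by apply: form_unique => m fm; rewrite hb h.
apply: (@wall_prop _ _ _ _ a) => // x Mx.
rewrite -{1}(WVK x Ww) -hb ea /Tile.tform /lform mulr_sumr.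
by apply: eq_bigr => k _; rewrite mxE mulrA.
Qed.

(** The wall form has opposite signs at the two centres and keeps its sign on each tile, so it
    vanishes on the common facet, which determines it up to a factor. *)
Lemma adjacent_sep w w' i j : W w -> W w' ->
  tform w' j (ctr w) * tform w' j (ctr (rfl i * w)) < 0 -> wall w' j = wall w i.
Proof.
move=> Ww Ww' h; have Wrw := WM (W_refl i) Ww.
apply: wall_facet => // m fm.
have h1 := tile_sign j Ww Ww' (facet_tile Ww fm).
have tm : tile (rfl i * w) (m *m w).
  have [_ m0] := fm; have <- : m *m (rfl i * w) = m *m w by rewrite mulmxA refl_fix.
  exact: (facet_tile Wrw fm).
have h2 := tile_sign j Wrw Ww' tm.
have gen (a b c : R) : a * b < 0 -> 0 <= a * c -> 0 <= b * c -> c = 0.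
  move=> k1 k2 k3; have := mulr_ge0 k2 k3; rewrite mulrACA nmulr_rge0// => k4.
  by apply/eqP; rewrite -sqrf_eq0 eq_le sqr_ge0 andbT expr2.
exact: gen h h1 h2.
Qed.

Lemma panel_tiles w w' i p : W w -> W w' -> facet P i p ->
  (forall j, j != i -> lform (nrm j) p < 0) -> tile w' (p *m w) ->
  w' = w \/ w' = rfl i * w.
Proof.
move=> Ww Ww' [[Mp lp] p0] hp tp.
have Wr := W_refl i; have Wrw := WM Wr Ww.
pose x := p *m w; have Mx : M x by exact: (WMM Ww).
have [e e0 he] := tform_ball Ww Mx; have [e' e'0 he'] := tform_ball Wrw Mx.
have xE : x = p *m (rfl i * w) by rewrite mulmxA refl_fix.
have [xc|/eqP xc] := eqVneq x (ctr w').
  have := ctr_neq0 i Ww' Ww; by rewrite -xc /Tile.tform (WK _ Ww) p0 eqxx.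
have Mc := ctr_M Ww'.
have [q Uq [qx qc]] := log_exists Mx Mc xc.
have q0 : geo g q 0 = x by rewrite geo0.
have d0 : 0 < dist g x (ctr w').
  by rewrite lt_def dist_ge0// andbT; apply/eqP => /(dist_eq0 Mx Mc).
set d := dist g x _ in d0 qc.
pose t := Num.min (Num.min (e / 2) (e' / 2)) (d / 2).
have t0 : 0 < t by rewrite !lt_min !divr_gt0.
have td : 0 < t < d by rewrite t0 /= gt_min; apply/orP; right; lra.
have te : t < e by rewrite !gt_min; apply/orP; left; apply/orP; left; lra.
have te' : t < e' by rewrite !gt_min; apply/orP; left; apply/orP; right; lra.
have Mq := geoM t Uq.
have dq : dist g x (geo g q t) = t by rewrite -q0 dist_geo// sub0r normrN gtr0_norm.
have i2 : intile w' (geo g q t).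
  split=> // j; have [l [m [l0 m0 ->]]] := tform_between w' j q td.
  rewrite q0 qc; have [_ /(_ j) h2] := ctr_in Ww'.
  have h1 : tform w' j x <= 0 by have /tileP[//|_] := tp.
  by nra.
have tneg j : j != i -> tform w j x < 0 by move=> ji; rewrite /Tile.tform (WK _ Ww)//; exact: hp.
have tneg' j : j != i -> tform (rfl i * w) j x < 0.
  by move=> ji; rewrite /Tile.tform xE (WK _ Wrw)//; exact: hp.
have := intile_wall Ww' Ww i2 (i := i); have [neg _|pos _|//] := ltgtP (tform w i (geo g q t)) 0.
  left; apply: (intile_uniq fA Ww' Ww i2); apply/tileP => //; split=> // j.
  have [->|ji] := eqVneq j i; first exact: ltW.
  by apply/ltW/he; rewrite ?dq//; exact: tneg.
right; apply: (intile_uniq fA Ww' Wrw i2); apply/tileP => //; split=> // j.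
have [->|ji] := eqVneq j i; first by rewrite tform_refl// oppr_le0 ltW.
by apply/ltW/he'; rewrite ?dq//; exact: tneg'.
Qed.

End Walls.

Lemma finite_radius (R : realType) (T : choiceType) (A : set T)
    (Q : T -> R -> Prop) : finite_set A ->
  (forall a r s, Q a r -> s <= r -> Q a s) ->
  (forall a, A a -> exists2 e, 0 < e & Q a e) ->
  exists2 e, 0 < e & forall a, A a -> Q a e.
Proof.
move=> /finite_seqP[s ->] mono; elim: s => [|a s IH] h; first by exists 1.
have [e e0 he] : exists2 e, 0 < e & forall a, [set` s] a -> Q a e.
  by apply: IH => b bs; apply: h; rewrite /= inE bs orbT.
have [e' e'0 he'] := h a (mem_head _ _).
exists (Num.min e e'); first by rewrite lt_min e0.
move=> b /=; rewrite inE => /predU1P[->|bs].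
  by apply: mono he' _; rewrite ge_min lexx orbT.
by apply: mono (he _ bs) _; rewrite ge_min lexx.
Qed.

(** * Charts of apartments: local structure and uniqueness *)

Section Charts.
Context {R : realType} {g : geometry} {n : nat} {P : coxeter_polyhedron R g n} {K : polyhedral_complex P}.
Implicit Types (x y z v : 'rV[R]_n.+2) (w : 'M[R]_n.+2)
  (A C D : set (cplx_point K)) (f : 'rV[R]_n.+2 -> cplx_point K).
Notation M := (@model_space R g n).
Notation W := (coxeter_group P).
Notation nrm := (facet_normal P).
Notation rfl i := (reflection g (facet_normal P i)).
Notation tile := (tile P).
Notation tform := (@tform R g n P).
Notation intile := (intile P).

(** Only finitely many tiles come near [x]; each of them that misses [x] violates some facet
    inequality strictly there, and this persists on a ball. *)
Lemma star f A x : tessellation_isometry f A -> M x -> exists2 e, 0 < e &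
  forall z, M z -> dist g x z < e -> forall w, W w -> tile w z -> tile w x.
Proof.
move=> fA Mx; have [D D0 hD] := @tile_diam R g n P.
pose Q w e := forall z, M z -> dist g x z < e -> tile w z -> tile w x.
have [||e e0 he] := @finite_radius R _ _ Q (finite_ctr fA (1 + D) Mx).
- by move=> w r s h sr z Mz xz; apply: h => //; exact: lt_le_trans sr.
- move=> w [Ww _]; have [tx|ntx] := pselect (tile w x); first by exists 1.
  have [i hi] : exists i, 0 < tform w i x.
    apply: contrapT => h; apply: ntx; apply/tileP => //; split=> // i.
    by rewrite leNgt; apply/negP => hi; apply: h; exists i.
  have [e e0 he] := tform_ball (WM (W_refl i) Ww) Mx; exists e => // z Mz xz.
  move=> /tileP[//|_ /(_ i)]; have := he z Mz xz i.
  by rewrite !tform_refl// !oppr_lt0 => /(_ hi); rewrite leNgt => ->.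
exists (Num.min e 1) => [|z Mz]; first by rewrite lt_min e0 ltr01.
rewrite lt_min => /andP[ze z1] w Ww tz; apply: (he w _ z) => //; split=> //.
have Mw := ctr_M Ww; apply: le_trans (dist_triangle Mx Mz Mw) _.
by apply: lerD; [exact: ltW|exact: hD].
Qed.

Lemma chamber_eq C D (x : cplx_point K) : chamber C -> chamber D -> C x -> D x ->
  (forall i, lform (nrm i) (ctype x) <> 0) -> C = D.
Proof.
move=> cC cD Cx Dx h; apply/seteqP; split=> y hy.
  by apply: (chamber_glue cC cD Cx Dx hy) => i /h.
by apply: (chamber_glue cD cC Dx Cx hy) => i /h.
Qed.

Lemma intile_type f A w x : tessellation_isometry f A -> W w -> intile w x ->
  forall i, lform (nrm i) (ctype (f x)) <> 0.
Proof.
move=> fA Ww ix i e; have tx := intile_tile Ww ix.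
have [c Pc] : exists c, polyhedron P c /\ lform (nrm i) c < 0.
  by exists (base_point P); split; [exact: base_point_P|exact: base_point_lt0].
move: Pc => [Pc ci]; have [y ty ey] := tau_surj fA Ww Pc.
have h j : tform w j x = 0 -> tform w j y = 0.
  by have [_ /(_ j) hx] := ix; move=> hj; rewrite hj ltxx in hx.
by have /(type_face fA Ww tx ty)/(_ i e) := h; rewrite ey; lra.
Qed.

(** The point of [D] whose type is interior to [P] lies in the image of some tile, and such a point
    determines its chamber. *)
Lemma tess_chamber f A D : tessellation_isometry f A -> chamber D -> D `<=` A ->
  exists2 w, W w & D = f @` tile w.
Proof.
move=> fA cD DA; have [_ _ hs] := chamber_bij cD.
have Pc := @base_point_P R g n P.
have [d Dd ed] := hs _ Pc.
have [_ _ hf] : set_bij M A f by case: fA.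
have [x Mx fx] := hf _ (DA _ Dd).
have [w Ww tx] := tile_cover fA Mx; exists w => //.
apply: (@chamber_eq _ _ d) => //; first exact: (f_chamber fA Ww).
  by exists x.
by move=> i; rewrite ed; have := base_point_lt0 i; lra.
Qed.

Lemma tess_in f A x : tessellation_isometry f A -> M x -> A (f x).
Proof. by move=> [[h _ _] _]; exact: h. Qed.
Lemma tess_tile_sub f A w : tessellation_isometry f A -> W w -> f @` tile w `<=` A.
Proof. by move=> fA Ww _ [x tx <-]; exact: (tess_in fA (tileM Ww tx)). Qed.

Lemma refl_neq w i : W w -> rfl i * w <> w.
Proof.
move=> Ww e; apply: (@refl1 R g n P i).
by apply: (mulIr (W_unit Ww)); rewrite mul1r.
Qed.

Lemma panel_point w i m : W w -> facet P i m -> m *m (rfl i * w) = m *m w.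
Proof. by move=> Ww [_ m0]; rewrite mulmxA refl_fix. Qed.

(** Agreement propagates across a facet. The next tile of [f'] is a tile of [f] through a relative
    interior point of the facet, so one of two, and injectivity excludes the old one; inside it,
    equal distances to the facet and rigidity force equality of points. *)
Lemma tess_unique f f' A w0 : tessellation_isometry f A ->
  tessellation_isometry f' A -> W w0 -> (forall x, tile w0 x -> f x = f' x) ->
  forall x, M x -> f x = f' x.
Proof.
move=> fA f'A Ww0 h0.
suff h w : W w -> forall x, tile (w * w0) x -> f x = f' x.
  move=> x Mx; have [w Ww tx] := tile_cover fA Mx.
  apply: (h (w * w0^-1)); first by apply: WM => //; exact: WV.
  by rewrite -mulrA mulVr ?mulr1//; exact: W_unit Ww0.
move: w; apply: W_ind => [|w i Ww IH]; first by rewrite mul1r.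
rewrite -mulrA; have Wv := WM Ww Ww0; move: (w * w0) Wv IH => v Wv IH {w Ww} x tx.
have Wsv := WM (W_refl i) Wv.
have [p [fp hp]] := facet_relint (P := P) i.
have [w'' Ww'' ew''] := tess_chamber fA (f_chamber f'A Wsv) (tess_tile_sub f'A Wsv).
have tpv := facet_tile Wv fp; have ps := panel_point Wv fp.
have tps : tile (rfl i * v) (p *m v) by rewrite -ps; exact: (facet_tile Wsv fp).
have tpw'' : tile w'' (p *m v).
  have : (f' @` tile (rfl i * v)) (f' (p *m v)) by exists (p *m v).
  rewrite ew'' => -[y ty ey]; rewrite -IH// in ey.
  by rewrite -(f_inj fA (tileM Ww'' ty) (tileM Wv tpv) ey).
have [e|e] := panel_tiles fA Wv Ww'' fp hp tpw''; rewrite e in ew''.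
  exfalso; apply: (refl_neq (i := i) Wv); apply: (tile_inj f'A) => //.
  have : f' @` tile (rfl i * v) = f' @` tile v.
    rewrite ew''; apply/seteqP; split=> _ [y ty <-]; exists y => //; rewrite IH//.
  move=> e2; apply/seteqP; split=> y ty.
    have : (f' @` tile (rfl i * v)) (f' y) by exists y.
    rewrite e2 => -[y' ty' ey].
    by rewrite -(f_inj f'A (tileM Wv ty') (tileM Wsv ty) ey).
  have : (f' @` tile v) (f' y) by exists y.
  rewrite -e2 => -[y' ty' ey].
  by rewrite -(f_inj f'A (tileM Wsv ty') (tileM Wv ty) ey).
have : (f' @` tile (rfl i * v)) (f' x) by exists x.
rewrite ew'' => -[y ty ey]; rewrite -ey; congr (f _); apply: contrapT => xy.
have Mx := tileM Wsv tx; have My := tileM Wsv ty.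
have Wi := WV Wsv.
pose x' := x *m (rfl i * v)^-1; pose y' := y *m (rfl i * v)^-1.
have Mx' : M x' := WMM Wi Mx; have My' : M y' := WMM Wi My.
have xy' : x' <> y'.
  by move=> e3; apply: xy; rewrite -(WVK x Wsv) -/x' e3 /y' (WVK _ Wsv).
have := facet_rigid (i := i) Mx' My' xy'.
suff hm m : facet P i m -> dist g x' m = dist g y' m.
  move=> /(_ hm); have /tileP[//|_ /(_ i)] := tx; have /tileP[//|_ /(_ i)] := ty.
  by rewrite /Tile.tform -/x' -/y'; nra.
move=> fm; have Mm : M m by case: fm => -[].
have tm : tile (rfl i * v) (m *m (rfl i * v)) by exact: (facet_tile Wsv fm).
have fm' : f (m *m (rfl i * v)) = f' (m *m (rfl i * v)).
  by rewrite (panel_point Wv fm) IH//; exact: (facet_tile Wv fm).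
have e1 : dist g x' m = dist g x (m *m (rfl i * v)).
  by rewrite -(W_dist Wsv Mx' Mm) /x' (WVK _ Wsv).
have e2 : dist g y' m = dist g y (m *m (rfl i * v)).
  by rewrite -(W_dist Wsv My' Mm) /y' (WVK _ Wsv).
by rewrite e1 e2 -(tau_dist f'A Wsv tx tm) -(tau_dist fA Wsv ty tm) ey fm'.
Qed.

Lemma tess_comp f A A' (h : cplx_point K -> cplx_point K) :
  tessellation_isometry f A -> polyhedral_isometry h A A' ->
  tessellation_isometry (h \o f) A'.
Proof.
move=> fA [[h1 h2 h3] hC]; split.
  split=> [x Mx|x y xM yM e|z /h3[y Ay <-]].
  - by apply: h1; exact: (tess_in fA).
  - have Mx : M x by rewrite inE in xM. have My : M y by rewrite inE in yM.
    apply: (f_inj fA) => //; apply: h2 => //; rewrite inE; exact: (tess_in fA).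
  - have [[_ _ s] _] := fA; have [x Mx <-] := s _ Ay; by exists x.
move=> w Ww; have [c hd] := hC _ (f_chamber fA Ww) (tess_tile_sub fA Ww).
split; first by rewrite image_comp in c.
move=> a b; rewrite !inE => ta tb.
rewrite hd ?inE; [|by exists a|by exists b].
exact: (tau_dist fA Ww).
Qed.

Lemma tess_type f f' A A' w0 : tessellation_isometry f A ->
  tessellation_isometry f' A' -> W w0 -> (forall x, tile w0 x -> f x = f' x) ->
  forall x, M x -> ctype (f x) = ctype (f' x).
Proof.
move=> fA f'A Ww0 h x Mx; have [w Ww [p Pp <-]] := tile_cover fA Mx.
rewrite /= (tau_W fA Ww Pp) (tau_W f'A Ww Pp).
by rewrite -(tau_W fA Ww0 Pp) -(tau_W f'A Ww0 Pp) h//; exists p.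
Qed.

End Charts.

(** * The retraction centred at a chamber, and the length metric *)

Section Retraction.
Context {R : realType} {g : geometry} {n : nat} {P : coxeter_polyhedron R g n} {B : building P}.
Implicit Types (x y z : 'rV[R]_n.+2) (w : 'M[R]_n.+2)
  (a b c : cplx_point B) (C D : set (cplx_point B)).
Notation M := (@model_space R g n).
Notation W := (coxeter_group P).
Notation tile := (tile P).
Notation ap := (apartment B).

Lemma ap_tess A : ap A -> exists f, tessellation_isometry f A.
Proof. by have [h _ _] := apartmentP B; move=> /h[]. Qed.

Lemma chamber_cell C : chamber C -> is_cell C.
Proof.
move=> cC; split.
  have [_ _ s] := chamber_bij cC; have [c Cc _] := s _ (@base_point_P R g n P).
  by exists c.
exists C, (@finset.set0 _); split=> //; apply/seteqP; split=> a; last by case.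
by move=> Ca; split=> // i; rewrite inE.
Qed.

Lemma ap_chambers C D : chamber C -> chamber D ->
  exists2 A, ap A & C `<=` A /\ D `<=` A.
Proof.
by move=> cC cD; have [_ h _] := apartmentP B; apply: h; exact: chamber_cell.
Qed.

Section Center.
Variables (A : set (cplx_point B)) (f : 'rV[R]_n.+2 -> cplx_point B).
Variable (w0 : 'M[R]_n.+2).

(* Charts of the apartments containing the chamber [f (P w0)], normalised there. *)
Definition chart A' f' := [/\ ap A', tessellation_isometry f' A' &
  forall x, tile w0 x -> f' x = f x].

Hypotheses (apA : ap A) (fA : tessellation_isometry f A) (Ww0 : W w0).

Lemma chart_self : chart A f.
Proof. by []. Qed.

Lemma chart_exists A' : ap A' -> f @` tile w0 `<=` A' -> exists f', chart A' f'.
Proof.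
move=> apA' sub; have [_ _ h] := apartmentP B.
have [k ik hk] := h _ _ apA apA'; exists (k \o f); split=> //.
  exact: tess_comp ik.
move=> x tx /=; apply: hk; first exact: (tess_in fA (tileM Ww0 tx)).
by apply: sub; exists x.
Qed.

(** The isometry between the two apartments that fixes their intersection carries one chart to the
    other, by uniqueness from the base tile, and it fixes the common point. Hence a point of the
    building has a single position. *)
Lemma chart_agree A1 f1 A2 f2 x y : chart A1 f1 -> chart A2 f2 -> M x -> M y ->
  f1 x = f2 y -> x = y.
Proof.
move=> [ap1 t1 h1] [ap2 t2 h2] Mx My e; have [_ _ h] := apartmentP B.
have [k ik hk] := h _ _ ap1 ap2.
have tk := tess_comp t1 ik.
have ek z : M z -> (k \o f1) z = f2 z.
  apply: (tess_unique tk t2 Ww0) => {}z tz; have Mz := tileM Ww0 tz.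
  rewrite /= hk ?h1 ?h2// -?(h1 _ tz); first exact: tess_in t1 Mz.
  by rewrite h1// -h2//; exact: tess_in t2 Mz.
apply: (f_inj t2 Mx My); rewrite -e -(ek _ Mx) /=; apply: hk.
  exact: (tess_in t1 Mx).
rewrite e; exact: (tess_in t2 My).
Qed.

(** The retraction with values in the model space; composed with [f] it is the usual one. Every
    point lies in some chart, so the default 0 is never taken. *)
Definition rc a : 'rV[R]_n.+2 :=
  xget 0 [set x | M x /\ exists A' f', chart A' f' /\ f' x = a].

Lemma rc_chart A' f' x : chart A' f' -> M x -> rc (f' x) = x.
Proof.
move=> ch Mx; rewrite /rc; case: xgetP => [y _ [My [A1 [f1 [ch1 e]]]]|/(_ x)[]].
  exact: chart_agree ch1 ch My Mx e.
by split=> //; exists A', f'.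
Qed.

Lemma chamber_chart D : chamber D -> exists A' f' w,
  [/\ chart A' f', W w & D = f' @` tile w].
Proof.
move=> cD; have [A' apA' [s1 s2]] := ap_chambers (f_chamber fA Ww0) cD.
have [f' ch] := chart_exists apA' s1; have [_ t' _] := ch.
by have [w Ww e] := tess_chamber t' cD s2; exists A', f', w.
Qed.

Lemma rc_exists a : exists A' f' x, [/\ chart A' f', M x & f' x = a].
Proof.
have [D cD Da] := chamber_cover a.
have [A' [f' [w [ch Ww e]]]] := chamber_chart cD.
by move: Da; rewrite e => -[x tx ex]; exists A', f', x; split=> //; exact: tileM tx.
Qed.

Lemma rcM a : M (rc a).
Proof. by have [A' [f' [x [ch Mx <-]]]] := rc_exists a; rewrite (rc_chart ch). Qed.

Lemma rc_fix a : tile w0 (rc a) -> a = f (rc a).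
Proof.
have [A' [f' [x [ch Mx <-]]]] := rc_exists a; rewrite (rc_chart ch)// => tx.
by have [_ _ h] := ch; exact: h.
Qed.

Lemma chart_type A' f' x : chart A' f' -> M x -> ctype (f' x) = ctype (f x).
Proof. by move=> [_ t' h] Mx; exact: (tess_type t' fA Ww0). Qed.

Lemma rc_type a : ctype a = ctype (f (rc a)).
Proof.
have [A' [f' [x [ch Mx <-]]]] := rc_exists a; rewrite (rc_chart ch)//.
exact: (chart_type ch Mx).
Qed.

Lemma rc_step D a b : chamber D -> D a -> D b ->
  dist g (rc a) (rc b) = dist g (ctype a) (ctype b).
Proof.
move=> cD; have [A' [f' [w [ch Ww ->]]]] := chamber_chart cD.
move=> [x tx <-] [y ty <-]; have [_ t' _] := ch.
have Mx := tileM Ww tx; have My := tileM Ww ty.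
by rewrite !(rc_chart ch) ?(tau_dist t' Ww).
Qed.

Lemma rc_chain a s : path (@step R g n P B) a s ->
  dist g (rc a) (rc (last a s)) <= chain_length a s.
Proof.
elim: s a => [|b s IH] a /=.
  by rewrite /chain_length big_nil distxx//; exact: rcM.
move=> /andP[/asboolP[D cD [Da Db]] /IH h]; rewrite /chain_length /= big_cons.
rewrite -(rc_step cD Da Db); apply: le_trans (dist_triangle (rcM a) (rcM b) (rcM _)) _.
by rewrite lerD2l.
Qed.

Lemma retraction_rc : is_retraction A (f @` tile w0) (f \o rc).
Proof.
split=> [a|_ [x tx <-]|A' apA' sub].
- exact: (tess_in fA (rcM a)).
- by rewrite /= (rc_chart chart_self)//; exact: tileM tx.
have [f' ch] := chart_exists apA' sub; have [_ t' h'] := ch.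
have [[s1 s2 s3] hc'] := t'; have [[r1 r2 r3] hc] := fA.
have e x : M x -> (f \o rc) (f' x) = f x by move=> Mx; rewrite /= (rc_chart ch).
split; last first.
  move=> a /s3[x Mx <-] /r3[y My ey].
  by rewrite e// -ey (chart_agree chart_self ch My Mx ey).
split; first split.
- by move=> a /s3[x Mx <-]; rewrite e//; exact: r1.
- move=> a b; rewrite !inE => /s3[x Mx <-] /s3[y My <-]; rewrite !e// => /(f_inj fA Mx My).
  by move->.
- by move=> a /r3[x Mx <-]; exists (f' x); [exact: s1|exact: e].
move=> D cD /(tess_chamber t' cD)[w Ww ->]; split.
  rewrite (_ : (f \o rc) @` _ = f @` tile w); first exact: (f_chamber fA Ww).
  rewrite image_comp; apply/seteqP; split=> _ [x tx <-]; exists x => //=;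
    by rewrite (rc_chart ch)//; exact: (tileM Ww tx).
move=> a b; rewrite !inE => Da Db; rewrite /= -!rc_type//.
Qed.

(** Gives meaning to the quantification over retractions in [branching]: for each chamber of the
    apartment there is exactly one. *)
Lemma retraction_unique rho : is_retraction A (f @` tile w0) rho -> rho = f \o rc.
Proof.
move=> [h1 h2 h3]; apply/funext => a.
have [A' [f' [x [ch Mx <-]]]] := rc_exists a; have [apA' t' h'] := ch.
have sub : f @` tile w0 `<=` A'.
  by move=> _ [y ty <-]; rewrite -h'//; exact: (tess_in t' (tileM Ww0 ty)).
have [ir _] := h3 _ apA' sub; have tr := tess_comp t' ir.
rewrite /= (rc_chart ch)//; apply: (tess_unique tr fA Ww0) => // y ty /=.
by rewrite h'//; apply: h2; exists y.
Qed.

End Center.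

Lemma chain_length_rcons a s b : chain_length a (rcons s b) =
  chain_length a s + dist g (ctype (last a s)) (ctype b).
Proof.
elim: s a => [|c s IH] a; first by rewrite /chain_length /= big_cons !big_nil addrC.
by rewrite /= /chain_length /= !big_cons -addrA; congr (_ + _); exact: IH.
Qed.

(** A supremum argument along the geodesic: by [star], every tile met close to a given time also
    contains the point at that time, so one more step inside a common chamber reaches this time or
    goes past it. *)
Lemma chain_geo A f p (T : R) : tessellation_isometry f A -> UT g p -> 0 <= T ->
  exists s, [/\ path (@step R g n P B) (f (geo g p 0)) s,
    last (f (geo g p 0)) s = f (geo g p T) & chain_length (f (geo g p 0)) s = T].
Proof.
move=> fA Up T0; pose a0 := f (geo g p 0).
pose S := [set t | [/\ 0 <= t, t <= T & exists s,
  [/\ path (@step R g n P B) a0 s, last a0 s = f (geo g p t) & chain_length a0 s = t]]].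
have S0 : S 0 by split=> //; exists [::]; split=> //; rewrite /chain_length big_nil.
have ubS : ubound S T by move=> t [].
have supS : has_sup S by split; [exists 0|exists T].
pose t := sup S.
have tT : t <= T by apply: ge_sup => //; exists 0.
have t0 : 0 <= t by apply: ub_le_sup => //; exists T.
have Mt := geoM t Up.
have [e e0 he] := star fA Mt.
have ext s s' : S s -> s <= s' -> s' <= T -> (exists2 w, W w & tile w (geo g p s) /\ tile w (geo g p s')) -> S s'.
  move=> [s0 sT [l [h1 h2 h3]]] ss' s'T [w Ww [ts ts']]; split=> //; first exact: le_trans ss'.
  exists (rcons l (f (geo g p s'))); split.
  - rewrite rcons_path h1 h2 /=; apply/asboolP; exists (f @` tile w); first exact: (f_chamber fA Ww).
    by split; [exists (geo g p s)|exists (geo g p s')].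
  - by rewrite last_rcons.
  - rewrite chain_length_rcons h3 h2 (tau_dist fA Ww)// dist_geo// distrC.
    by rewrite ger0_norm ?subr_ge0// addrC subrK.
have St : S t.
  have [s Ss ts] : exists2 s, S s & t - e < s by apply: sup_adherent.
  have st : s <= t by apply: ub_le_sup => //; exists T.
  have Ms := geoM s Up.
  have [w Ww tw] := tile_cover fA Ms.
  apply: (ext s) => //; exists w => //; split=> //; apply: (he (geo g p s)) => //.
  by rewrite dist_geo// ger0_norm ?subr_ge0//; lra.
suff -> : T = t by case: St.
apply/eqP; rewrite eq_le tT andbT leNgt; apply/negP => tT'.
pose s := Num.min T (t + e / 2).
have ts : t < s by rewrite lt_min tT' ltrDl divr_gt0.
have sT : s <= T by rewrite ge_min lexx.
have st : s <= t + e / 2 by rewrite ge_min lexx orbT.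
have Ms := geoM s Up.
have [w Ww tw] := tile_cover fA Ms.
have : S s.
  apply: (ext t) => //; first exact: ltW.
  exists w => //; split=> //; apply: (he (geo g p s)) => //.
  by rewrite dist_geo// distrC ger0_norm ?subr_ge0 ?(ltW ts)//; lra.
by move=> Ss; have := ub_le_sup (ex_intro _ T ubS) Ss; rewrite leNgt ts.
Qed.

Lemma chain_exists A f x y : tessellation_isometry f A -> M x -> M y ->
  exists s, [/\ path (@step R g n P B) (f x) s, last (f x) s = f y &
    chain_length (f x) s = dist g x y].
Proof.
move=> fA Mx My; have [<-|/eqP xy] := eqVneq x y.
  by exists [::]; split=> //; rewrite /chain_length big_nil distxx.
have [p Up [px py]] := log_exists Mx My xy.
have := chain_geo fA Up (dist_ge0 Mx My).
by rewrite py geo0 px.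
Qed.

Definition chains a b := [set chain_length a s | s in
  [set s | path (@step R g n P B) a s /\ last a s = b]].

Lemma chain_ge0 a s : path (@step R g n P B) a s -> 0 <= chain_length a s.
Proof.
elim: s a => [|b s IH] a /=; first by rewrite /chain_length big_nil.
move=> /andP[/asboolP[D cD [Da Db]] /IH h]; rewrite /chain_length /= big_cons.
rewrite addr_ge0//; have [h1 _ _] := chamber_bij cD.
by have [Ma _] := h1 _ Da; have [Mb _] := h1 _ Db; exact: dist_ge0.
Qed.

Lemma chains_lb a b : has_lbound (chains a b).
Proof. by exists 0 => _ [s [h _] <-]; exact: chain_ge0. Qed.

Lemma common_ap a b : exists A f x y, [/\ ap A, tessellation_isometry f A,
  M x /\ M y, f x = a & f y = b].
Proof.
have [C cC Ca] := chamber_cover a; have [D cD Db] := chamber_cover b.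
have [A apA [s1 s2]] := ap_chambers cC cD; have [f fA] := ap_tess apA.
have [[_ _ h] _] := fA.
have [x Mx ex] := h _ (s1 _ Ca); have [y My ey] := h _ (s2 _ Db).
by exists A, f, x, y.
Qed.

Lemma chains_neq0 a b : chains a b !=set0.
Proof.
have [A [f [x [y [_ fA [Mx My] <- <-]]]]] := common_ap a b.
have [s [h1 h2 h3]] := chain_exists fA Mx My.
by exists (chain_length (f x) s), s.
Qed.

Lemma rc_cdist A f w0 a b : ap A -> tessellation_isometry f A -> W w0 ->
  dist g (rc f w0 a) (rc f w0 b) <= cdist a b.
Proof.
move=> apA fA Ww0; apply: lb_le_inf; first exact: chains_neq0.
by move=> _ [s [h1 <-] <-]; exact: (rc_chain apA fA Ww0).
Qed.

(** Chains inside the apartment realise the model distance, and the retraction cannot lengthen a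
    chain, so no detour outside is shorter. *)
Lemma cdist_chart A f x y : ap A -> tessellation_isometry f A -> M x -> M y ->
  cdist (f x) (f y) = dist g x y.
Proof.
move=> apA fA Mx My; have W1' := @W1 R g n P.
apply/le_anti/andP; split.
  have [s [h1 h2 h3]] := chain_exists fA Mx My.
  by apply: (ge_inf (chains_lb _ _)); exists s.
have := rc_cdist (f x) (f y) apA fA W1'.
by rewrite !(rc_chart W1' (chart_self 1 apA fA)).
Qed.

(* Apartments are convex: fold onto [A] from a chamber of [A] containing the
   expected intermediate point. *)
Lemma between_ap A f x y b : ap A -> tessellation_isometry f A -> M x -> M y ->
  cdist (f x) b + cdist b (f y) = cdist (f x) (f y) ->
  exists2 z, M z & [/\ b = f z, dist g x z = cdist (f x) b & dist g z y = cdist b (f y)].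
Proof.
move=> apA fA Mx My; rewrite (cdist_chart apA fA Mx My) => e.
have p1 : 0 <= cdist (f x) b.
  by apply: lb_le_inf; [exact: chains_neq0|move=> _ [s [h _] <-]; exact: chain_ge0].
have p2 : 0 <= cdist b (f y).
  by apply: lb_le_inf; [exact: chains_neq0|move=> _ [s [h _] <-]; exact: chain_ge0].
have [z [Mz ez1 ez2]] : exists z, [/\ M z, dist g x z = cdist (f x) b &
    dist g z y = cdist b (f y)].
  have [xy|/eqP xy] := eqVneq x y.
    move: e p2; rewrite -xy distxx// => e p2.
    by exists x; rewrite distxx//; split=> //; lra.
  have [p Up [px py]] := log_exists Mx My xy.
  have p0 : geo g p 0 = x by rewrite geo0.
  exists (geo g p (cdist (f x) b)); split; first exact: geoM.
    by rewrite -[X in dist g X _]p0 dist_geo// sub0r normrN ger0_norm.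
  rewrite -[X in dist g _ X]py dist_geo// -e opprD addrA subrr sub0r normrN.
  by rewrite ger0_norm.
have [w Ww tw] := tile_cover fA Mz.
have Mr := rcM apA fA Ww b.
have ch := chart_self w apA fA.
have h1 := rc_cdist (f x) b apA fA Ww; have h2 := rc_cdist b (f y) apA fA Ww.
rewrite (rc_chart Ww ch Mx) in h1; rewrite (rc_chart Ww ch My) in h2.
have h3 := dist_triangle Mx Mr My.
have er : rc f w b = z.
  by apply: (between_unique Mx My Mz Mr); lra.
exists z => //; split=> //; have := @rc_fix _ _ _ apA fA Ww b.
by rewrite er => /(_ tw).
Qed.

End Retraction.

Lemma card_eqD1 (T : Type) (A : set T) x q : (A #= `I_q.+1)%card -> A x ->
  (A `\ x #= `I_q)%card.
Proof.
move=> h Ax; have [m hm] : finite_set (A `\ x).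
  apply: (@sub_finite_set _ _ A); first by move=> y [].
  by exists q.+1.
have : (A #= `I_m.+1)%card by apply/eq_cardSP; exists x.
by rewrite card_eq_sym in h; move=> /(card_eq_trans h)/card_eq_II[->].
Qed.

Lemma card_fibers (T : Type) (U : pointedType) (A : set T) (B : set U) (phi : T -> U) m q :
  (forall a, A a -> B (phi a)) -> (B #= `I_m)%card ->
  (forall b, B b -> ([set a | A a /\ phi a = b] #= `I_q)%card) ->
  (A #= `I_(q * m))%card.
Proof.
move=> hphi /card_set_bijP[be [be1 be2 be3]] hf.
have /choice[al hal] : forall b, exists al : T -> nat,
    B b -> set_bij [set a | A a /\ phi a = b] `I_q al.
  move=> b; have [Bb|nBb] := pselect (B b); last by exists (fun=> 0%N).
  by have /card_set_bijP[al] := hf _ Bb; exists al.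
apply/card_set_bijP; exists (fun a => (q * be (phi a) + al (phi a) a)%N).
have hal1 a : A a -> (al (phi a) a < q)%N.
  by move=> Aa; have [h _ _] := hal _ (hphi _ Aa); exact: (h a).
split=> [a Aa|a a'|k /= kqm].
- have := hal1 _ Aa; have := be1 _ (hphi _ Aa); rewrite /= => h1 h2.
  apply: (@leq_trans (q * be (phi a) + q)%N); first by rewrite ltn_add2l.
  by rewrite -mulnSr leq_mul2l h1 orbT.
- rewrite !inE => Aa Aa' e; have h1 := hal1 _ Aa; have h2 := hal1 _ Aa'.
  have q0 : (0 < q)%N by exact: leq_ltn_trans h1.
  have e1 : be (phi a) = be (phi a').
    by have /(congr1 (fun x => x %/ q)%N) := e; rewrite !(mulnC q) !divnMDl// !divn_small// !addn0.
  have e2 : phi a = phi a' by apply: be2 => //; rewrite inE; exact: hphi.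
  have e3 : al (phi a) a = al (phi a) a' by move: e; rewrite e1 e2 => /addnI.
  have [_ h _] := hal _ (hphi _ Aa); apply: h => //; rewrite inE//.
- have q0 : (0 < q)%N by case: q kqm {hf hal hal1} => //; rewrite mul0n.
  have [|b Bb eb] := be3 (k %/ q)%N; first by rewrite /= ltn_divLR// mulnC.
  have [_ _ h] := hal _ Bb; have [|a [Aa pa] ea] := h (k %% q)%N; first exact: ltn_pmod.
  by exists a => //; rewrite pa eb ea mulnC -divn_eq.
Qed.

(** * Panels and their thickness seen through a chart *)

Section Counting.
Context {R : realType} {g : geometry} {n : nat} {P : coxeter_polyhedron R g n} {B : building P}.
Implicit Types (x y z : 'rV[R]_n.+2) (w : 'M[R]_n.+2) (D : set (cplx_point B))
  (f : 'rV[R]_n.+2 -> cplx_point B).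
Notation M := (@model_space R g n).
Notation W := (coxeter_group P).
Notation nrm := (facet_normal P).
Notation tile := (tile P).
Notation tform := (@tform R g n P).
Notation intile := (intile P).
Notation ctr := (ctr P).

Definition panel f w i : set (cplx_point B) := f @` (mulmxr w @` facet P i).

(** The index [j] witnessing the panel may differ from [i], since a chart may twist types. It is the
    facet on which the type of a relative interior point lies; the metric description of faces then
    matches the two facets. *)
Lemma panel_is_panel A f w i : tessellation_isometry f A -> W w ->
  is_panel (panel f w i).
Proof.
move=> fA Ww; have [p [fp hp]] := facet_relint (P := P) i.
have tp := facet_tile Ww fp.
have pi0 : tform w i (p *m w) = 0 by rewrite /Tile.tform (WK _ Ww); case: fp.
have zero_i k x : tform w k (p *m w) = 0 -> (mulmxr w @` facet P i) x -> tform w k x = 0.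
  rewrite /Tile.tform (WK _ Ww) => pk [m [_ m0] <-]; rewrite /= (WK _ Ww).
  by have [->//|/hp] := eqVneq k i; rewrite pk ltxx.
have tfac x : (mulmxr w @` facet P i) x <-> tile w x /\ tform w i x = 0.
  split=> [[m fm <-]|[[m Pm <-]]]; rewrite /= /Tile.tform ?(WK _ Ww).
    by split; [exact: (facet_tile Ww fm)|case: fm].
  by exists m.
have tc := intile_tile Ww (ctr_in Ww).
have [j hj] : exists j, lform (nrm j) (ctype (f (p *m w))) = 0.
  apply: contrapT => no.
  have /(type_face fA Ww tp tc)/(_ i pi0) : forall k, lform (nrm k) (ctype (f (p *m w))) = 0 ->
      lform (nrm k) (ctype (f (ctr w))) = 0 by move=> k hk; case: no; exists k.
  by apply: (intile_wall fA Ww Ww); exact: ctr_in.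
exists (f @` tile w), j; split; first exact: (f_chamber fA Ww).
have [q [[Pq q0] hq]] := facet_relint (P := P) j.
have [z tz ez] := tau_surj fA Ww Pq.
have hz : tform w i z = 0.
  have /(type_face fA Ww tz tp) h : forall k, lform (nrm k) (ctype (f z)) = 0 ->
      lform (nrm k) (ctype (f (p *m w))) = 0.
    by rewrite ez => k; have [->|/hq + e] := eqVneq k j; rewrite ?e ?ltxx.
  have [k hk] : exists k, tform w k z = 0.
    apply: contrapT => no; have : intile w z.
      have /tileP[//|Mz lz] := tz; split=> // k; rewrite lt_neqAle lz andbT.
      by apply/eqP => e; apply: no; exists k.
    by move=> /(intile_type fA Ww)/(_ j); rewrite ez q0.
  have := h _ hk; rewrite /Tile.tform (WK _ Ww).
  by have [<-//|/hp + e] := eqVneq k i; rewrite e ltxx.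
apply/seteqP; split=> [_ [x /tfac[tx xi] <-]|_ [[x tx <-] hx]].
  split; first by exists x.
  move=> k; rewrite inE => /eqP ->.
  have /(type_face fA Ww tp tx) : forall k, tform w k (p *m w) = 0 -> tform w k x = 0.
    by move=> l hl; apply: (zero_i l) => //; apply/tfac.
  exact.
exists x => //; apply/tfac; split=> //.
have /(type_face fA Ww tz tx) : forall k, lform (nrm k) (ctype (f z)) = 0 ->
    lform (nrm k) (ctype (f x)) = 0.
  rewrite ez => k; have [-> _|/hq + e] := eqVneq k j; last by rewrite e ltxx.
  by apply: hx; rewrite inE.
exact.
Qed.

Lemma panel_type f f' A A' w w' i : tessellation_isometry f A ->
  tessellation_isometry f' A' -> W w -> W w' ->
  (forall x, M x -> ctype (f x) = ctype (f' x)) ->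
  @ctype _ _ _ P B @` panel f w i = @ctype _ _ _ P B @` panel f' w' i.
Proof.
move=> fA f'A Ww Ww' h.
have e w1 m : W w1 -> facet P i m -> ctype (f' (m *m w1)) = ctype (f' m).
  by move=> Ww1 [Pm _]; exact: (tau_W f'A Ww1 Pm).
have Mm w1 m : W w1 -> facet P i m -> M (m *m w1).
  by move=> Ww1 [[Mm _] _]; exact: (WMM Ww1).
apply/seteqP; split=> [_ [_ [_ [m fm <-] <-] <-]|_ [_ [_ [m fm <-] <-] <-]] /=.
  exists (f' (m *m w')); first by exists (m *m w') => //; exists m.
  by rewrite (e _ _ Ww' fm) (h _ (Mm _ _ Ww fm)) (e _ _ Ww fm).
exists (f (m *m w)); first by exists (m *m w) => //; exists m.
by rewrite (e _ _ Ww' fm) (h _ (Mm _ _ Ww fm)) (e _ _ Ww fm).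
Qed.

Lemma chambers_at_panel f A w i p D : tessellation_isometry f A -> W w ->
  facet P i p -> (forall j, j != i -> lform (nrm j) p < 0) -> chamber D ->
  panel f w i `<=` D <-> D (f (p *m w)).
Proof.
move=> fA Ww fp hp cD; split=> [|Dp _ [_ [m fm <-] <-]].
  by apply; exists (p *m w) => //; exists p.
apply: (glue_tile fA Ww (facet_tile Ww fp) (facet_tile Ww fm)) => // k.
rewrite /Tile.tform /= !(WK _ Ww) => pk.
by have [->|/hp] := eqVneq k i; [case: fm|rewrite pk ltxx].
Qed.

(** The chart is a parameter because it may permute facet types. The value is taken at the base
    tile; regularity makes it the same at every tile, see [qtype_panel]. *)
Definition qtype f i : nat :=
  get [set q | (1 <= q)%N /\ (chambers_at (panel f 1 i) #= `I_q.+1)%card].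

Lemma qtypeP f A i : tessellation_isometry f A ->
  (1 <= qtype f i)%N /\ (chambers_at (panel f 1 i) #= `I_(qtype f i).+1)%card.
Proof.
move=> fA; rewrite /qtype; case: xgetP => [q _ //|/=].
have [q q1 hq] := thickness (panel_is_panel i fA (@W1 R g n P)).
by move=> /(_ q); case.
Qed.

Hypothesis regB : regular_building B.

Lemma qtype_panel f f' A A' w i : tessellation_isometry f A ->
  tessellation_isometry f' A' -> W w ->
  (forall x, M x -> ctype (f x) = ctype (f' x)) ->
  (chambers_at (panel f' w i) #= `I_(qtype f i).+1)%card.
Proof.
move=> fA f'A Ww h; have [_ hq] := qtypeP i fA; apply: card_eq_trans hq.
apply: regB; [exact: panel_is_panel f'A Ww|exact: panel_is_panel fA (@W1 _ _ _ _)|].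
by symmetry; apply: panel_type; eauto using (@W1 R g n P).
Qed.

(** Since [x] lies on no wall, no wall contains the segment from [x] to [z]; just before [z] it
    therefore passes through the interior of a tile that contains [z]. *)
Lemma approach_tile f A w0 x z : tessellation_isometry f A -> W w0 -> intile w0 x ->
  M z -> exists w y, [/\ W w, tile w z, intile w y &
    dist g x y + dist g y z = dist g x z].
Proof.
move=> fA Ww0 ix Mz; have Mx : M x by case: ix.
have [xz|/eqP xz] := eqVneq x z.
  exists w0, x; rewrite -xz distxx ?add0r//; split=> //; exact: intile_tile.
have [p Up [pz px]] := log_exists Mz Mx (nesym xz).
have p0 : geo g p 0 = z by rewrite geo0.
have d0 : 0 < dist g z x.
  by rewrite lt_def dist_ge0// andbT; apply/eqP => /(dist_eq0 Mz Mx)/esym.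
have [e e0 he] := star fA Mz; set d := dist g z x in d0 px *.
pose t := Num.min (e / 2) (d / 2).
have t0 : 0 < t by rewrite lt_min !divr_gt0.
have te : t < e by rewrite gt_min; apply/orP; left; lra.
have td : t < d by rewrite gt_min; apply/orP; right; lra.
have Mt := geoM t Up; have [w Ww tw] := tile_cover fA Mt.
have tz : tile w z.
  by apply: (he (geo g p t)) => //; rewrite -p0 dist_geo// sub0r normrN gtr0_norm.
have t2 : 0 < t / 2 < t by apply/andP; split; [exact: divr_gt0|lra].
exists w, (geo g p (t / 2)); split=> //.
  split=> [|j]; first exact: geoM.
  have [l [m [l0 m0 e1]]] := tform_between w j p t2.
  have /tileP[//|_ /(_ j) h1] := tz; have /tileP[//|_ /(_ j) h2] := tw.
  rewrite lt_neqAle; apply/andP; split; last by rewrite e1 p0; nra.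
  apply/eqP => e2; apply: (intile_wall fA Ww0 Ww ix (i := j)).
  have tz0 : tform w j (geo g p 0) = 0.
    by apply/le_anti; rewrite p0 h1/=; move: e1; rewrite e2 p0; nra.
  rewrite -px; apply: (tform_vanish _ _ tz0 e2).
  by case/andP: t2 => /lt_eqF ->.
have t20 : 0 < t / 2 by case/andP: t2.
have e1 : dist g x (geo g p (t / 2)) = d - t / 2.
  by rewrite -px dist_geo// ger0_norm//; lra.
have e2 : dist g (geo g p (t / 2)) z = t / 2.
  by rewrite -p0 dist_geo// subr0 gtr0_norm.
by rewrite e1 e2 (distC Mx Mz) subrK.
Qed.

End Counting.

(** * Counting the chambers over a tile of the apartment *)

Section CountingChambers.
Context {R : realType} {g : geometry} {n : nat} {P : coxeter_polyhedron R g n} {B : building P}.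
Implicit Types (x y z u v : 'rV[R]_n.+2) (w : 'M[R]_n.+2)
  (a b : cplx_point B) (D : set (cplx_point B)).
Notation M := (@model_space R g n).
Notation W := (coxeter_group P).
Notation nrm := (facet_normal P).
Notation rfl i := (reflection g (facet_normal P i)).
Notation tile := (tile P).
Notation tform := (@tform R g n P).
Notation intile := (intile P).
Notation ctr := (ctr P).
Notation wall := (@wall R g n P).
Notation ap := (apartment B).
Notation sep := (@sep R g n).
Hypothesis regB : regular_building B.
Variables (A : set (cplx_point B)) (f : 'rV[R]_n.+2 -> cplx_point B).
Hypotheses (apA : ap A) (fA : tessellation_isometry f A).

(* the chambers lying over [f (P w)] for the retraction centered at [f (P w0)] *)
Definition lifts w0 w : set (set (cplx_point B)) :=
  [set D | exists A' f', chart f w0 A' f' /\ D = f' @` tile w].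

(** Apartments are convex and positions are unique, so two charts that agree at both ends of a
    segment agree along it. *)
Lemma charts_geodesic w0 A1 f1 A2 f2 x y z : W w0 -> chart f w0 A1 f1 ->
  chart f w0 A2 f2 -> tile w0 x -> M y -> M z -> f1 z = f2 z ->
  dist g x y + dist g y z = dist g x z -> f1 y = f2 y.
Proof.
move=> Ww0 ch1 ch2 tx My Mz ez e; have Mx := tileM Ww0 tx.
have [ap1 t1 h1] := ch1; have [ap2 t2 h2] := ch2.
have [|u Mu [eu _ _]] := between_ap ap1 t1 Mx Mz (b := f2 y).
  rewrite ez h1// -(h2 _ tx) !(cdist_chart ap2 t2)//.
by rewrite eu (chart_agree Ww0 ch2 ch1 My Mu eu).
Qed.

Lemma charts_tile w0 w A1 f1 A2 f2 y : W w0 -> W w -> chart f w0 A1 f1 ->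
  chart f w0 A2 f2 -> intile w y -> f1 y = f2 y -> f1 @` tile w = f2 @` tile w.
Proof.
move=> Ww0 Ww [_ t1 _] [_ t2 _] iy e; have ty := intile_tile Ww iy.
apply: (chamber_eq (x := f1 y)).
- exact: (f_chamber t1 Ww).
- exact: (f_chamber t2 Ww).
- by exists y.
- by rewrite e; exists y.
- exact: (intile_type t1 Ww iy).
Qed.

Lemma chart_rc_mem w0 w A' f' a : W w0 -> W w -> chart f w0 A' f' ->
  (f' @` tile w) a -> tile w (rc f w0 a) /\ f' (rc f w0 a) = a.
Proof.
move=> Ww0 Ww ch [x tx <-].
by rewrite (rc_chart Ww0 ch)//; exact: tileM Ww tx.
Qed.

Lemma lifts_uniq w0 w w' D : W w0 -> W w -> W w' -> lifts w0 w D -> lifts w0 w' D -> w = w'.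
Proof.
move=> Ww0 Ww Ww' [A1 [f1 [ch1 ->]]] [A2 [f2 [ch2 e]]].
have ic := ctr_in Ww; apply: (intile_uniq fA Ww Ww' ic).
have : (f1 @` tile w) (f1 (ctr w)) by exists (ctr w) => //; exact: intile_tile.
rewrite e => /(chart_rc_mem Ww0 Ww' ch2)[+ _].
by rewrite (rc_chart Ww0 ch1)//; case: ic.
Qed.

Lemma lifts_chamber w0 w D : W w -> lifts w0 w D -> chamber D.
Proof. by move=> Ww [A1 [f1 [[_ t1 _] ->]]]; exact: (f_chamber t1 Ww). Qed.

Lemma lifts_self w0 : W w0 -> (lifts w0 w0 #= `I_1)%card.
Proof.
move=> Ww0; apply/eq_cardSP; exists (f @` tile w0).
  by exists A, f; split=> //; exact: chart_self.
rewrite (_ : _ `\ _ = set0) ?II0//.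
apply/seteqP; split=> // D [[A1 [f1 [[_ _ h1] ->]]]]; case.
by apply/seteqP; split=> _ [x tx <-]; exists x => //; rewrite h1.
Qed.

Section Step.
Variables (w0 w : 'M[R]_n.+2) (i : 'I_(facets P)).
Hypotheses (Ww0 : W w0) (Ww : W w) (near : tform w i (ctr w0) < 0).
Let sw := rfl i * w.
Let Wsw : W sw := WM (W_refl i) Ww.

(** The segment from the centre to the panel point arrives through the near tile [w], and charts
    agreeing at that point agree along the segment; so the panel point determines the chamber over
    [w]. *)
Lemma step_near_unique p A1 f1 A2 f2 : facet P i p ->
  (forall j, j != i -> lform (nrm j) p < 0) -> chart f w0 A1 f1 ->
  chart f w0 A2 f2 -> f1 (p *m w) = f2 (p *m w) -> f1 @` tile w = f2 @` tile w.
Proof.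
move=> fp hp ch1 ch2 e; have Mp := tileM Ww (facet_tile Ww fp).
have ic := ctr_in Ww0; have Mc := ctr_M Ww0.
have [w' [y [Ww' tp iy ey]]] := approach_tile fA Ww0 ic Mp.
have My : M y by case: iy.
have p0 : tform w i (p *m w) = 0 by rewrite /Tile.tform (WK _ Ww); case: fp.
have ww' : w' = w.
  have [//|ew] := panel_tiles fA Ww Ww' fp hp tp.
  have [_ /(_ i)] := iy; rewrite ew tform_refl// oppr_lt0 => py.
  have yp : y <> p *m w by move=> yp; move: py; rewrite yp p0 ltxx.
  have [yc|/eqP yc] := eqVneq y (ctr w0).
    by exfalso; move: py near; rewrite yc; lra.
  have [l [m [l0 m0 /(_ w i)]]] := tform_between_sign Ww Mc Mp My ey yc yp.
  by rewrite p0 => e3; exfalso; move: e3 py near; nra.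
rewrite ww' in iy.
apply: (charts_tile Ww0 Ww ch1 ch2 iy).
by apply: (charts_geodesic Ww0 ch1 ch2 (intile_tile Ww0 ic) My Mp e ey).
Qed.

(** Each chamber over the far tile shares the panel with exactly one chamber over the near tile.
    Conversely the other [q] chambers at that panel lie over the far tile, because only two tiles
    contain the panel and the near lift is unique. *)
Lemma lifts_step m : (lifts w0 w #= `I_m)%card ->
  (lifts w0 sw #= `I_(qtype f i * m))%card.
Proof.
move=> hm; have [p [fp hp]] := facet_relint (P := P) i.
have tp := facet_tile Ww fp; have ps := panel_point Ww fp.
have tps : tile sw (p *m w) by rewrite -ps; exact: (facet_tile Wsw fp).
have Mp := tileM Ww tp.
(* Adjacency through the panel, expressed by a common point over [p *m w] so that it does not refer
   to a chart. *)
pose rel E D := lifts w0 w D /\ exists2 y, E y /\ D y & rc f w0 y = p *m w.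
pose phi E := xget set0 [set D | rel E D].
have relP A' f' : chart f w0 A' f' -> forall D, rel (f' @` tile sw) D <-> D = f' @` tile w.
  move=> ch D; split=> [[[A2 [f2 [ch2 ->]]] [y [Ey Dy] ry]]|->].
    have [_ e1] := chart_rc_mem Ww0 Wsw ch Ey; have [_ e2] := chart_rc_mem Ww0 Ww ch2 Dy.
    by apply: (step_near_unique fp hp ch2 ch); rewrite -ry e1 e2.
  split; first by exists A', f'.
  exists (f' (p *m w)); last by rewrite (rc_chart Ww0 ch).
  by split; exists (p *m w).
have phiE A' f' : chart f w0 A' f' -> phi (f' @` tile sw) = f' @` tile w.
  move=> ch; rewrite /phi; case: xgetP => [D _ /(relP _ _ ch)//|/(_ (f' @` tile w))[]].
  by apply/(relP _ _ ch).
apply: (@card_fibers _ _ _ (lifts w0 w) phi) => //.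
  by move=> _ [A' [f' [ch ->]]]; rewrite (phiE _ _ ch); exists A', f'.
move=> D [A1 [f1 [ch1 ->]]]; have [ap1 t1 h1] := ch1.
have hq : (chambers_at (panel f1 w i) #= `I_(qtype f i).+1)%card.
  by apply: (qtype_panel regB _ fA t1 Ww) => x Mx; rewrite (chart_type fA Ww0 ch1).
have D1 : chambers_at (panel f1 w i) (f1 @` tile w).
  split; first exact: (f_chamber t1 Ww).
  apply/(chambers_at_panel t1 Ww fp hp); first exact: (f_chamber t1 Ww).
  by exists (p *m w).
apply: card_eq_trans (card_eqD1 hq D1).
rewrite (_ : [set _ | _] = chambers_at (panel f1 w i) `\ (f1 @` tile w)) //.
apply/seteqP; split=> E.
  move=> [[A' [f' [ch ->]]]]; rewrite (phiE _ _ ch) => e.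
  have [_ t' _] := ch.
  have ep : f' (p *m w) = f1 (p *m w).
    have : (f1 @` tile w) (f' (p *m w)) by rewrite -e; exists (p *m w).
    by move=> /(chart_rc_mem Ww0 Ww ch1)[_]; rewrite (rc_chart Ww0 ch).
  split; first split.
  - exact: (f_chamber t' Wsw).
  - apply/(chambers_at_panel t1 Ww fp hp); first exact: (f_chamber t' Wsw).
    by rewrite -ep; exists (p *m w).
  - rewrite /= -e => e2; apply: (refl_neq (i := i) Ww).
    by apply: (lifts_uniq (D := f' @` tile w) Ww0 Wsw Ww); [rewrite -e2|]; exists A', f'.
move=> [[cE /(chambers_at_panel t1 Ww fp hp cE) Ep] /= nE].
have [A' [f' [w'' [ch Ww'' eE]]]] := chamber_chart apA fA Ww0 cE.
have [tw'' e''] : tile w'' (p *m w) /\ f' (p *m w) = f1 (p *m w).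
  rewrite eE in Ep; have := chart_rc_mem Ww0 Ww'' ch Ep.
  by rewrite (rc_chart Ww0 ch1).
have e1 := step_near_unique fp hp ch ch1 e''.
have [ew|ew] := panel_tiles fA Ww Ww'' fp hp tw''.
  by case: nE; rewrite eE ew.
by rewrite eE ew (phiE _ _ ch); split=> //; exists A', f'.
Qed.

End Step.

Definition nover w0 w : nat := get [set m | (lifts w0 w #= `I_m)%card].

Lemma ctr_closer w i x : W w -> M x -> 0 < tform w i x ->
  dist g x (ctr (rfl i * w)) < dist g x (ctr w).
Proof.
move=> Ww Mx hi.
have e u : M u -> dist g x (u *m w) = dist g (x *m w^-1) u.
  move=> Mu; rewrite (distC Mx (WMM Ww Mu)) (W_distV Ww Mu Mx).
  by rewrite distC//; exact: (WMM (WV Ww)).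
have Mb := base_point_M P; have [Mr _ _] := isom_refl (nrm_unit (P := P) i).
have -> : ctr (rfl i * w) = base_point P *m rfl i *m w by rewrite /Tile.ctr mulmxA.
rewrite e; last exact: Mr.
rewrite (e (base_point P))//.
apply: dist_refl_lt => //; [exact: nrm_unit|exact: (WMM (WV Ww))|exact: base_point_lt0].
Qed.

(** A tile other than [w0] has a facet beyond which the centre of [w0] lies, and the adjacent tile
    there is closer to [w0]. A counterexample nearest to [w0], which exists by local finiteness, is
    therefore impossible. *)
Lemma near_ind w0 (Q : 'M[R]_n.+2 -> Prop) : W w0 -> Q w0 ->
  (forall w i, W w -> tform w i (ctr w0) < 0 -> Q w -> Q (rfl i * w)) ->
  forall w, W w -> Q w.
Proof.
move=> Ww0 Q0 Qs w Ww; apply: contrapT => nQ; have Mc0 := ctr_M Ww0.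
have fin : finite_set [set v | [/\ W v, ~ Q v & dist g (ctr w0) (ctr v) <= dist g (ctr w0) (ctr w)]].
  apply: sub_finite_set (finite_ctr fA (dist g (ctr w0) (ctr w)) Mc0).
  by move=> v [].
have [v [Wv nQv hv] minv] := @finite_argmin R _ _ (fun w1 => dist g (ctr w0) (ctr w1)) w fin (And3 Ww nQ (lexx _)).
have [i hi] : exists i, 0 < tform v i (ctr w0).
  apply: contrapT => no; apply: nQv; suff <- : w0 = v by [].
  apply: (intile_uniq fA Ww0 Wv (ctr_in Ww0)); apply/tileP => //; split=> // i.
  by rewrite leNgt; apply/negP => hi; apply: no; exists i.
pose v' := rfl i * v; have Wv' : W v' := WM (W_refl i) Wv.
have ev : v = rfl i * v' by rewrite /v' mulrA reflM mul1r.
have lt : dist g (ctr w0) (ctr v') < dist g (ctr w0) (ctr v) by exact: ctr_closer.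
have nQ' : ~ Q v'.
  move=> Qv'; apply: nQv; rewrite ev; apply: Qs => //.
  by rewrite /v' tform_refl// oppr_lt0.
have := minv v' (And3 Wv' nQ' (ltW (lt_le_trans lt hv))).
by rewrite leNgt lt.
Qed.

Lemma noverP w0 w : W w0 -> W w -> (lifts w0 w #= `I_(nover w0 w))%card.
Proof.
move=> Ww0 Ww; suff [m hm] : exists m, (lifts w0 w #= `I_m)%card.
  by rewrite /nover; case: xgetP => [k _ //|/(_ m)].
move: w Ww; apply: (near_ind Ww0) => [|w i Ww near [m hm]].
  by exists 1%N; exact: lifts_self.
by exists (qtype f i * m)%N; exact: lifts_step.
Qed.

Lemma nover_self w0 : W w0 -> nover w0 w0 = 1%N.
Proof.
move=> Ww0; have := noverP Ww0 Ww0; rewrite card_eq_sym => h.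
by apply/card_eq_II; apply: card_eq_trans h (lifts_self Ww0).
Qed.

Lemma nover_step w0 w i : W w0 -> W w -> tform w i (ctr w0) < 0 ->
  nover w0 (rfl i * w) = (qtype f i * nover w0 w)%N.
Proof.
move=> Ww0 Ww near; have h1 := lifts_step Ww0 Ww near (noverP Ww0 Ww).
have := noverP Ww0 (WM (W_refl i) Ww); rewrite card_eq_sym => h.
by apply/card_eq_II; exact: card_eq_trans h h1.
Qed.

Lemma nover_gt0 w0 w : W w0 -> W w -> (0 < nover w0 w)%N.
Proof.
move=> Ww0; move: w; apply: (near_ind Ww0) => [|w i Ww near h].
  by rewrite nover_self.
by rewrite nover_step// muln_gt0 h andbT; have [] := qtypeP i fA.
Qed.

Lemma nover_mul w0 w (v : 'M[R]_n.+2) : W w0 -> W w -> W v ->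
  nover (w0 * v) (w * v) = nover w0 w.
Proof.
move=> Ww0 + Wv; move: w; apply: (near_ind Ww0) => [|w i Ww near h].
  by rewrite !nover_self//; exact: WM.
rewrite -mulrA !nover_step ?h//; try exact: WM.
by rewrite ctr_mul tform_mul.
Qed.

Lemma tform_ctr w i : W w -> tform w i (ctr w) < 0.
Proof. by move=> Ww; have [_] := ctr_in Ww. Qed.

Lemma tform_ctr_refl w i : W w -> 0 < tform w i (ctr (rfl i * w)).
Proof.
move=> Ww; have := tform_ctr i (WM (W_refl i) Ww).
by rewrite tform_refl// oppr_lt0.
Qed.

Lemma wall_refl w i : W w -> wall (rfl i * w) i = wall w i.
Proof.
move=> Ww; have Wsw := WM (W_refl i) Ww.
by apply/seteqP; split=> x /wallP[//|Mx hx]; apply/wallP => //; split=> //;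
  move: hx; rewrite tform_refl// => /eqP; rewrite ?oppr_eq0 => /eqP //= ->; rewrite ?oppr0.
Qed.

Lemma sep_adjacent w w' i j : W w -> W w' ->
  sep (wall w' j) (ctr w) (ctr (rfl i * w)) <-> wall w' j = wall w i.
Proof.
move=> Ww Ww'; have Wsw := WM (W_refl i) Ww.
have Mc := ctr_M Ww; have Mcs := ctr_M Wsw.
split=> [/(sepE j Ww' Mc Mcs) h|->]; first exact: (adjacent_sep fA Ww Ww' h).
by apply/(sepE i Ww Mc Mcs); rewrite pmulr_llt0 ?tform_ctr_refl ?tform_ctr.
Qed.

Lemma sep_trans w j x y z : W w -> M x -> M y -> M z -> tform w j y <> 0 ->
  sep (wall w j) x z -> sep (wall w j) x y \/ sep (wall w j) y z.
Proof.
move=> Ww Mx My Mz y0 /(sepE j Ww Mx Mz) h.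
have [yn|yp|//] := ltgtP (tform w j y) 0.
  have [xn|xp] := ltP (tform w j x) 0.
    right; apply/(sepE j Ww My Mz); move: h; rewrite nmulr_rlt0// => zp.
    by rewrite nmulr_rlt0.
  left; apply/(sepE j Ww Mx My); rewrite nmulr_llt0// lt_def xp andbT.
  by apply/eqP => x0; move: h; rewrite x0 mul0r ltxx.
have [xn|xp] := ltP (tform w j x) 0.
  by left; apply/(sepE j Ww Mx My); rewrite nmulr_rlt0.
right; apply/(sepE j Ww My Mz); rewrite pmulr_rlt0//.
rewrite ltNge; apply/negP => zp; move: h; rewrite ltNge => /negP; apply.
exact: mulr_ge0.
Qed.

Lemma sepNE w j x y : W w -> M x -> M y -> tform w j x < 0 -> tform w j y <> 0 ->
  ~ sep (wall w j) x y <-> tform w j y < 0.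
Proof.
move=> Ww Mx My hx hy; split=> [h|h /(sepE j Ww Mx My)].
  rewrite ltNge; apply/negP => yp; apply: h; apply/(sepE j Ww Mx My).
  by rewrite nmulr_rlt0// lt_def yp andbT; exact/eqP.
by rewrite nmulr_rlt0// ltNge (ltW h).
Qed.

Lemma ctr_ne w w' j : W w -> W w' -> tform w' j (ctr w) <> 0.
Proof. by move=> Ww Ww'; apply/eqP; exact: (ctr_neq0 fA j Ww Ww'). Qed.

Lemma same_side w w' i j : W w -> W w' -> wall w' j <> wall w i ->
  tform w' j (ctr w) < 0 -> tform w' j (ctr (rfl i * w)) < 0.
Proof.
move=> Ww Ww' nw h; have Wsw := WM (W_refl i) Ww.
apply/(sepNE Ww' (ctr_M Ww) (ctr_M Wsw) h (@ctr_ne _ _ j Wsw Ww')).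
by move=> /(sep_adjacent _ _ Ww Ww').
Qed.

Lemma same_sideV w w' i j : W w -> W w' -> wall w' j <> wall w i ->
  tform w' j (ctr (rfl i * w)) < 0 -> tform w' j (ctr w) < 0.
Proof.
move=> Ww Ww' nw h; have Wsw := WM (W_refl i) Ww.
have := @same_side (rfl i * w) w' i j Wsw Ww'.
by rewrite mulrA reflM mul1r wall_refl//; apply.
Qed.

(** Moving the centre of the retraction across one of its own facets, away from [w], multiplies the
    count by the [q] of that facet. The induction on [w] uses that adjacent tiles lie on the same
    side of every wall but their common one. *)
Lemma nover_left w0 w i : W w0 -> W w -> tform w0 i (ctr w) < 0 ->
  nover (rfl i * w0) w = (qtype f i * nover w0 w)%N.
Proof.
move=> Ww0; have Wsw0 := WM (W_refl i) Ww0.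
move: w; apply: (near_ind Ww0) => [_|w j Ww near IH h].
  have -> : nover (rfl i * w0) w0 = nover (rfl i * w0) (rfl i * (rfl i * w0)).
    by rewrite mulrA reflM mul1r.
  by rewrite nover_step ?tform_ctr// !nover_self.
have Wsw := WM (W_refl j) Ww.
have nw : wall w0 i <> wall w j.
  move=> e; have : sep (wall w0 i) (ctr w0) (ctr w).
    have s1 : sep (wall w0 i) (ctr w) (ctr (rfl j * w)) by apply/sep_adjacent.
    apply/(sepE i Ww0 (ctr_M Ww0) (ctr_M Ww)).
    move: s1 => /(sepE i Ww0 (ctr_M Ww) (ctr_M Wsw)).
    by rewrite nmulr_llt0// nmulr_rlt0// tform_ctr.
  rewrite e => /(sepE j Ww (ctr_M Ww0) (ctr_M Ww)).
  by rewrite nmulr_rlt0// ltNge (ltW (tform_ctr j Ww)).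
rewrite !nover_step//; last first.
  by apply: same_side => //; exact: nesym.
rewrite (IH (same_sideV Ww Ww0 nw h)).
exact: mulnCA.
Qed.

(** The count from [w1] to the tile behind the wall is computed twice. Crossing the wall at [w2]
    contributes [qtype f i2]; crossing it at the centre [w1] contributes [qtype f i1], and what
    remains is the count from [w1] to [w2] translated by the reflection [r]. So [q] is a function of
    the wall. *)
Lemma wall_qtype_side w1 w2 i1 i2 : W w1 -> W w2 -> wall w1 i1 = wall w2 i2 ->
  tform w2 i2 (ctr w1) < 0 -> qtype f i1 = qtype f i2.
Proof.
move=> Ww1 Ww2 e h.
have Ws1 := WM (W_refl i1) Ww1; have Ws2 := WM (W_refl i2) Ww2.
have h' : tform w1 i1 (ctr w2) < 0.
  apply/(sepNE Ww1 (ctr_M Ww1) (ctr_M Ww2) (tform_ctr i1 Ww1) (@ctr_ne _ _ i1 Ww2 Ww1)).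
  rewrite e; apply/(sepNE Ww2 (ctr_M Ww1) (ctr_M Ww2) h (@ctr_ne _ _ i2 Ww2 Ww2)).
  exact: tform_ctr.
pose r := w1^-1 * rfl i1 * w1.
have Wr : W r by apply: WM => //; apply: WM; [exact: (WV Ww1)|exact: W_refl].
have e1 : w1 * r = rfl i1 * w1 by rewrite /r !mulrA mulrV ?mul1r//; exact: W_unit Ww1.
(* The reflection [r] fixes a relative interior point of the facet, so it sends [w2] to itself or
   across; the first would make [r] trivial. *)
have e2 : w2 * r = rfl i2 * w2.
  have [p [fp hp]] := facet_relint (P := P) i2.
  have tp := facet_tile Ww2 fp; have Mp := tileM Ww2 tp.
  have pr : p *m w2 *m r = p *m w2.
    have : wall w2 i2 (p *m w2).
      by apply/wallP => //; split=> //; rewrite /Tile.tform (WK _ Ww2); case: fp.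
    rewrite -e => /wallP[//|_ h3].
    by rewrite /r !mulmxA [p *m w2 *m w1^-1 *m rfl i1]refl_fix// (WVK _ Ww1).
  have tpr : tile (w2 * r) (p *m w2) by rewrite -pr; apply/tile_mul.
  have [e3|//] := panel_tiles fA Ww2 (WM Ww2 Wr) fp hp tpr.
  exfalso; apply: (@refl1 R g n P i1).
  have r1 : r = 1 by apply: (mulrI (W_unit Ww2)); rewrite mulr1.
  apply: (mulIr (W_unit Ww1)); apply: (mulrI (W_unit (WV Ww1))).
  by rewrite mul1r mulVr ?(W_unit Ww1)// -r1 /r !mulrA.
have c1 : nover w1 (rfl i2 * w2) = (qtype f i2 * nover w1 w2)%N by exact: nover_step.
have c2 : nover w1 (rfl i2 * w2) = (qtype f i1 * nover w1 w2)%N.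
  have -> : nover w1 (rfl i2 * w2) = nover (rfl i1 * (rfl i1 * w1)) (rfl i2 * w2).
    by rewrite mulrA reflM mul1r.
  rewrite nover_left//; first by rewrite -e1 -e2 nover_mul.
  rewrite tform_refl// oppr_lt0.
  have : sep (wall w1 i1) (ctr w2) (ctr (rfl i2 * w2)) by rewrite e; apply/sep_adjacent.
  move=> /(sepE i1 Ww1 (ctr_M Ww2) (ctr_M Ws2)).
  by rewrite nmulr_rlt0.
apply/eqP; rewrite -(eqn_pmul2r (nover_gt0 Ww1 Ww2)); apply/eqP.
by rewrite -c1 -c2.
Qed.

Lemma wall_qtype w1 w2 i1 i2 : W w1 -> W w2 -> wall w1 i1 = wall w2 i2 ->
  qtype f i1 = qtype f i2.
Proof.
move=> Ww1 Ww2 e; have := @ctr_ne _ _ i2 Ww1 Ww2.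
have [neg _|pos _|//] := ltgtP (tform w2 i2 (ctr w1)) 0.
  exact: wall_qtype_side e neg.
apply: (@wall_qtype_side w1 (rfl i2 * w2) i1 i2) => //.
- exact: WM (W_refl i2) Ww2.
- by rewrite wall_refl.
- by rewrite tform_refl// oppr_lt0.
Qed.

End CountingChambers.

(** * Sums of weights over separating walls *)

Module WallSum.

Section Separation.
Context {R : realType} {g : geometry} {n : nat} {P : coxeter_polyhedron R g n} {B : building P}.
Notation V := 'rV[R]_n.+2.
Implicit Types (x y z : V) (w u v : 'M[R]_n.+2) (a b c : cplx_point B) (D : set (cplx_point B)).
Notation M := (@model_space R g n).
Notation W := (coxeter_group P).
Notation rfl i := (reflection g (facet_normal P i)).
Notation tile := (tile P).
Notation tform := (@tform R g n P).
Notation ctr := (ctr P).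
Notation wall := (@wall R g n P).
Notation ap := (apartment B).
Notation sep := (@sep R g n).
Hypothesis regB : regular_building B.
Variables (A : set (cplx_point B)) (f : V -> cplx_point B).
Hypotheses (apA : ap A) (fA : tessellation_isometry f A).
Notation nover := (nover f).
Implicit Types (H : set V) (X Y Z : set (set V)).

Definition iswall H := exists w i, W w /\ H = wall w i.

Definition lq H : R :=
  xget 0 [set r | exists w i, [/\ W w, H = wall w i & r = ln (qtype f i)%:R]].

Lemma lq_wall w i : W w -> lq (wall w i) = ln (qtype f i)%:R.
Proof.
move=> Ww; rewrite /lq; case: xgetP => [r _ [w' [i' [Ww' e ->]]]|/(_ (ln (qtype f i)%:R))].
  by rewrite (wall_qtype regB apA fA Ww Ww' e).
by case; exists w, i.
Qed.

Lemma lq_ge0 H : 0 <= lq H.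
Proof.
rewrite /lq; case: xgetP => // r _ [w [i [Ww _ ->]]].
by have [q1 _] := qtypeP i fA; rewrite ln_ge0// ler1n.
Qed.

Lemma wallM w i x : W w -> wall w i x -> M x.
Proof. by move=> Ww /wallP[]. Qed.
Lemma iswallM H : iswall H -> H `<=` M.
Proof. by move=> [w [i [Ww ->]]] x /wallM; apply. Qed.

Definition hmul H (v : 'M[R]_n.+2) := mulmxr v @` H.

Lemma hmul_wall w i (v : 'M[R]_n.+2) : hmul (wall w i) v = wall (w * v) i.
Proof.
apply/seteqP; split=> [_ [_ [x hx <-] <-]|_ [x hx <-]].
  by exists x => //=; rewrite mulmxA.
by exists (x *m w); [exists x|rewrite /= mulmxA].
Qed.

Lemma iswall_hmul H v : W v -> iswall H -> iswall (hmul H v).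
Proof. by move=> Wv [w [i [Ww ->]]]; exists (w * v), i; rewrite hmul_wall; split=> //; exact: WM. Qed.

Lemma hmulK H v : W v -> hmul (hmul H v) v^-1 = H.
Proof.
move=> Wv; apply/seteqP; split=> [_ [_ [x hx <-] <-]|x hx] /=; first by rewrite (WK _ Wv).
by exists (x *m v); [exists x|rewrite /= (WK _ Wv)].
Qed.

Lemma hmulVK H v : W v -> hmul (hmul H v^-1) v = H.
Proof. by move=> Wv; have := hmulK H (WV Wv); rewrite invrK. Qed.

Lemma lq_hmul H v : W v -> iswall H -> lq (hmul H v) = lq H.
Proof.
move=> Wv [w [i [Ww ->]]]; rewrite hmul_wall !lq_wall//; exact: WM.
Qed.

(** Used for the weight [lq] and for the constant 1; the latter counts crossings and controls error
    terms. *)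
Definition wt_ok (wt : set V -> R) := (forall H, 0 <= wt H) /\
  forall H v, W v -> iswall H -> wt (hmul H v) = wt H.

Lemma lq_ok : wt_ok lq.
Proof. by split; [exact: lq_ge0|exact: lq_hmul]. Qed.
Lemma one_ok : wt_ok (fun=> 1).
Proof. by split. Qed.

Definition wsum (wt : set V -> R) X := \sum_(H \in X) wt H.

Lemma wsumU wt X Y : finite_set X -> finite_set Y -> X `&` Y = classical_sets.set0 ->
  wsum wt (X `|` Y) = wsum wt X + wsum wt Y.
Proof. by move=> fX fY XY; rewrite /wsum fsbigU// => H HXY; have : (X `&` Y) H by []; rewrite XY. Qed.
Lemma wsum0 wt : wsum wt classical_sets.set0 = 0.
Proof. exact: fsbig_set0. Qed.
Lemma wsum1 wt H : wsum wt [set H] = wt H.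
Proof. exact: fsbig_set1. Qed.

Section Weight.
Variables (wt : set 'rV[R]_n.+2 -> R) (ok : wt_ok wt).

Lemma wsum_ge0 X : 0 <= wsum wt X.
Proof. by apply: fsumr_ge0 => H _; case: ok. Qed.

Lemma wsum_le X Y : finite_set Y -> X `<=` Y -> wsum wt X <= wsum wt Y.
Proof.
move=> fY XY; have -> : Y = X `|` (Y `\` X) by rewrite setDUK.
rewrite wsumU; first by rewrite lerDl wsum_ge0.
- exact: sub_finite_set fY.
- exact: finite_setD.
- by rewrite setDIK.
Qed.

Lemma wsum_leU X Y Z : finite_set Y -> finite_set Z -> X `<=` Y `|` Z ->
  wsum wt X <= wsum wt Y + wsum wt Z.
Proof.
move=> fY fZ h; apply: le_trans (wsum_le _ h) _; first by rewrite finite_setU.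
have -> : Y `|` Z = Y `|` (Z `\` Y).
  by apply/seteqP; split=> x /=; have := EM (Y x); tauto.
have fZY : finite_set (Z `\` Y) by exact: finite_setD.
rewrite wsumU ?setDIK// lerD2l; apply: wsum_le => //; exact: subDsetl.
Qed.

Lemma wsum_hmul X v : W v -> X `<=` iswall -> wsum wt ((hmul^~ v) @` X) = wsum wt X.
Proof.
move=> Wv hX; rewrite /wsum (@reindex_fsbig _ _ _ _ _ (hmul^~ v) X).
  by apply: eq_fsbigr => H; rewrite inE => /hX; case: ok => _; apply.
by apply: inj_bij => H1 H2 _ _ e; rewrite -(hmulK H1 Wv) e (hmulK H2 Wv).
Qed.

End Weight.

Definition wsep x y := [set H | iswall H /\ sep H x y].

Definition Sep x y := wsum lq (wsep x y).

Lemma wsep_ctr w : W w -> wsep (ctr w) (ctr w) = classical_sets.set0.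
Proof.
move=> Ww; apply/seteqP; split=> // H [[w' [j [Ww' ->]]]].
by move=> /(sepE j Ww' (ctr_M Ww) (ctr_M Ww)); rewrite -expr2 ltNge sqr_ge0.
Qed.

Lemma wsep_step w0 w i : W w0 -> W w -> tform w i (ctr w0) < 0 ->
  wsep (ctr w0) (ctr (rfl i * w)) = wsep (ctr w0) (ctr w) `|` [set wall w i] /\
  wsep (ctr w0) (ctr w) `&` [set wall w i] = classical_sets.set0.
Proof.
move=> Ww0 Ww near; have Wsw := WM (W_refl i) Ww.
have Mc0 := ctr_M Ww0; have Mc := ctr_M Ww; have Mcs := ctr_M Wsw.
split; last first.
  apply/seteqP; split=> // H [[_ s] e]; move: s; rewrite e => /(sepE i Ww Mc0 Mc).
  by rewrite nmulr_rlt0// ltNge (ltW (tform_ctr i Ww)).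
apply/seteqP; split=> // H.
  move=> [wH s]; have [w' [j [Ww' eH]]] := wH; rewrite eH in s wH *.
  have [s'|] := @sep_trans _ _ _ _ w' j _ _ _ Ww' Mc0 Mc Mcs (@ctr_ne _ _ _ _ _ _ _ fA _ _ j Ww Ww') s.
    by left.
  by move=> /(sep_adjacent fA _ _ Ww Ww') ->; right.
move=> [[wH s]|->]; last first.
  split; first by exists w, i.
  by apply/(sepE i Ww Mc0 Mcs); rewrite nmulr_rlt0//; exact: tform_ctr_refl.
split=> //; have [w' [j [Ww' eH]]] := wH; rewrite eH in s *.
have [//|s'] := @sep_trans _ _ _ _ w' j _ _ _ Ww' Mc0 Mcs Mc (@ctr_ne _ _ _ _ _ _ _ fA _ _ j Wsw Ww') s.
have := s' => /(sepC Mcs Mc); rewrite -eH => /(_ (iswallM wH)).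
rewrite eH => /(sep_adjacent fA _ _ Ww Ww') e.
move: s; rewrite e => /(sepE i Ww Mc0 Mc).
by rewrite nmulr_rlt0// ltNge (ltW (tform_ctr i Ww)).
Qed.

Lemma wsep_ctr_finite w0 w : W w0 -> W w -> finite_set (wsep (ctr w0) (ctr w)).
Proof.
move=> Ww0; move: w; apply: (near_ind fA Ww0) => [|w i Ww near h].
  by rewrite wsep_ctr//; exact: finite_set0.
by have [-> _] := wsep_step Ww0 Ww near; rewrite finite_setU; split=> //; exact: finite_set1.
Qed.

Lemma ln_nover w0 w : W w0 -> W w -> ln (nover w0 w)%:R = Sep (ctr w0) (ctr w).
Proof.
move=> Ww0; move: w; apply: (near_ind fA Ww0) => [|w i Ww near h].
  by rewrite (nover_self regB apA fA Ww0)// ln1 /Sep wsep_ctr// wsum0.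
have [e e0] := wsep_step Ww0 Ww near.
rewrite (nover_step regB apA fA Ww0 Ww near) /Sep e wsumU//; last exact: wsep_ctr_finite.
have q0 : (0 < qtype f i)%N by have [] := qtypeP i fA.
rewrite natrM lnM ?posrE ?ltr0n ?(nover_gt0 regB apA fA)// h addrC; congr (_ + _).
by rewrite wsum1 lq_wall.
Qed.

Lemma wsep_tile w w' x y : W w -> W w' -> tile w x -> tile w' y ->
  wsep x y `<=` wsep (ctr w) (ctr w').
Proof.
move=> Ww Ww' tx ty H [wH s]; split=> //; have [u [j [Wu eH]]] := wH; rewrite eH in s *.
apply/(sepE j Wu (ctr_M Ww) (ctr_M Ww')).
move: s => /(sepE j Wu (tileM Ww tx) (tileM Ww' ty)).
have h1 := tile_sign fA j Ww Wu tx; have h2 := tile_sign fA j Ww' Wu ty.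
have := ctr_neq0 fA j Ww Wu; have := ctr_neq0 fA j Ww' Wu.
move: h1 h2; move: (tform u j x) (tform u j y) (tform u j (ctr w)) (tform u j (ctr w')).
move=> a b c d h1 h2 d0 c0 ab; rewrite lt_neqAle mulf_neq0//=.
rewrite leNgt; apply/negP => cd.
by have := mulr_ge0 h1 h2; rewrite mulrACA pmulr_rge0// leNgt ab.
Qed.

Lemma wsep_finite x y : M x -> M y -> finite_set (wsep x y).
Proof.
move=> Mx My; have [w Ww tx] := tile_cover fA Mx; have [w' Ww' ty] := tile_cover fA My.
by apply: sub_finite_set (wsep_tile Ww Ww' tx ty) _; exact: wsep_ctr_finite.
Qed.

(** Reflecting a tile [E] at [z] in the wall gives a tile [E * r] at [z] on the other side. Among
    the tiles at [z] still separated from [E * r], the one with nearest centre has a facet through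
    [z] that faces it; by minimality, crossing that facet crosses the wall, so the facet lies in the
    wall. *)
Lemma wall_panel H z : iswall H -> H z -> exists u j, [/\ W u, H = wall u j & tile u z].
Proof.
move=> [w [i [Ww eH]]] Hz; rewrite eH in Hz *; have [Mz z0] : M z /\ tform w i z = 0 by move: Hz => /wallP; apply.
have [E WE tE] := tile_cover fA Mz.
pose r := w^-1 * rfl i * w.
have Wr : W r by apply: WM => //; apply: WM; [exact: (WV Ww)|exact: W_refl].
have zr : z *m r = z.
  by rewrite /r !mulmxA [z *m w^-1 *m rfl i]refl_fix// (WVK _ Ww).
have tEr : tile (E * r) z by rewrite -zr; apply/tile_mul.
have WEr := WM WE Wr; set c := ctr (E * r); have Mc : M c := ctr_M WEr.
have sE : sep (wall w i) (ctr E) c.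
  apply/(sepE i Ww (ctr_M WE) Mc).
  have -> : tform w i c = - tform w i (ctr E).
    rewrite /c ctr_mul /Tile.tform /r !mulmxA (WK _ Ww) lform_refl//; exact: nrm_unit.
  by rewrite mulrN oppr_lt0 -expr2 lt_def sqrf_eq0 (ctr_neq0 fA i WE Ww) sqr_ge0.
pose U := [set u | [/\ W u, tile u z & sep (wall w i) (ctr u) c]].
have fin : finite_set (U `&` [set u | dist g c (ctr u) <= dist g c (ctr E)]).
  apply: sub_finite_set (finite_ctr fA (dist g c (ctr E)) Mc).
  by move=> u [[]].
have [u [[Wu tu su] hu] minu] := @finite_argmin R _ _ (fun u => dist g c (ctr u)) E fin (conj (And3 WE tE sE) (lexx _)).
have [j hj] : exists j, 0 < tform u j c.
  apply: contrapT => no.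
  have e : E * r = u.
    apply: (intile_uniq fA WEr Wu (ctr_in WEr)); apply/tileP => //; split=> // j.
    by rewrite leNgt; apply/negP => hj; apply: no; exists j.
  move: su; rewrite -e => /(sepE i Ww Mc Mc).
  by rewrite -expr2 ltNge sqr_ge0.
exists u, j; split=> //.
have uz : tform u j z = 0.
  apply/eqP; rewrite eq_le; have /tileP[//|_ ->] := tu.
  by have := tile_sign fA j WEr Wu tEr; rewrite pmulr_rge0.
have Wu' := WM (W_refl j) Wu.
have tu' : tile (rfl j * u) z.
  have [q Pq ez] := tu; rewrite -ez /=; exists q => //=.
  rewrite mulmxA refl_fix//; move: uz; rewrite -ez /Tile.tform /= (WK _ Wu) //.
have lt := ctr_closer Wu Mc hj.
apply: contrapT => ne.
have nadj : ~ sep (wall w i) (ctr u) (ctr (rfl j * u)).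
  by move=> /(sep_adjacent fA _ _ Wu Ww).
have [//|s'] := @sep_trans _ _ _ _ w i _ _ _ Ww (ctr_M Wu) (ctr_M Wu') Mc (@ctr_ne _ _ _ _ _ _ _ fA _ _ i Wu' Ww) su.
have := minu _ (conj (And3 Wu' tu' s') (ltW (lt_le_trans lt hu))).
by rewrite leNgt lt.
Qed.

Definition wnear r x := [set H | iswall H /\ exists2 z, H z & dist g x z <= r].

Lemma wnear_finite r x : M x -> finite_set (wnear r x).
Proof.
move=> Mx; have [D D0 hD] := @tile_diam R g n P.
pose fw (p : 'M[R]_n.+2 * 'I_(facets P)) := wall p.1 p.2.
apply: (@sub_finite_set _ _ (fw @` ([set w | W w /\ dist g x (ctr w) <= r + D] `*` setT))).
  move=> H [wH [z Hz xz]]; have [u [j [Wu eH tu]]] := wall_panel wH Hz.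
  have Mz := tileM Wu tu.
  exists (u, j) => //; split=> //=; split=> //.
  apply: le_trans (dist_triangle Mx Mz (ctr_M Wu)) _.
  by apply: lerD => //; exact: hD.
apply: finite_image; apply: finite_setX; first exact: (finite_ctr fA (r + D) Mx).
exact: finite_finset.
Qed.

(** Translating [x] into the base tile by the group reduces the bound to one finite set of walls. *)
Lemma wnear_bound wt r : wt_ok wt ->
  exists2 c, 0 <= c & forall x, M x -> wsum wt (wnear r x) <= c.
Proof.
move=> ok; have [D D0 hD] := @tile_diam R g n P.
have W1 := @W1 R g n P; have Mb := ctr_M W1.
exists (wsum wt (wnear (r + D) (ctr 1))); first exact: (wsum_ge0 ok).
move=> x Mx; have [w Ww tx] := tile_cover fA Mx.
rewrite -(wsum_hmul ok (WV Ww)); last by move=> H [].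
apply: (wsum_le ok); first exact: wnear_finite.
move=> _ [H [wH [z Hz xz]] <-]; split; first exact: (iswall_hmul (WV Ww)).
exists (z *m w^-1); first by exists z.
have Mz := iswallM wH Hz.
have Mcw := ctr_M Ww.
have -> : dist g (ctr 1) (z *m w^-1) = dist g (ctr w) z.
  by rewrite -(W_distV Ww Mb Mz) -ctr_mul mul1r.
apply: le_trans (dist_triangle Mcw Mx Mz) _.
by rewrite addrC; apply: lerD => //; rewrite distC//; exact: hD.
Qed.

Lemma wsep_near r x y x' y' : M x -> M y -> M x' -> M y' ->
  dist g x x' <= r -> dist g y y' <= r ->
  wsep x y `<=` wsep x' y' `|` (wnear r x `|` wnear r y).
Proof.
move=> Mx My Mx' My' dx dy H [wH s]; have [w [i [Ww eH]]] := wH; rewrite eH in s wH *.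
have key (u u' : 'rV[R]_n.+2) : M u -> M u' -> dist g u u' <= r -> tform w i u * tform w i u' <= 0 ->
    wnear r u (wall w i).
  move=> Mu Mu' du h; have [z [Mz hz e]] := tform_zero_between Ww Mu Mu' h.
  split=> //; exists z; first exact/wallP.
  by apply: le_trans du; rewrite -e lerDl dist_ge0.
have [h1|h1] := leP (tform w i x * tform w i x') 0; first by right; left; exact: key Mx'  dx h1.
have [h2|h2] := leP (tform w i y * tform w i y') 0; first by right; right; exact: key My' dy h2.
left; split=> //; apply/(sepE i Ww Mx' My').
move: s => /(sepE i Ww Mx My) s.
rewrite ltNge; apply/negP => h3.
have := mulr_gt0 h1 h2; rewrite mulrACA ltNge => /negP; apply.
by rewrite nmulr_rle0.
Qed.

(** A wall separating one pair of endpoints and not the other passes between an endpoint and its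
    displaced copy, hence near it. Since [c] depends on [r] only, endpoints may be replaced by tile
    centres at bounded cost. *)
Lemma Sep_close r : exists2 c, 0 <= c & forall x y x' y', M x -> M y -> M x' -> M y' ->
  dist g x x' <= r -> dist g y y' <= r -> Sep x y <= Sep x' y' + c.
Proof.
have [c c0 hc] := wnear_bound r lq_ok; exists (c + c); first exact: addr_ge0.
move=> x y x' y' Mx My Mx' My' dx dy.
have fx := wnear_finite r Mx; have fy := wnear_finite r My.
apply: le_trans (wsum_leU lq_ok _ _ (wsep_near Mx My Mx' My' dx dy)) _.
- exact: wsep_finite.
- by rewrite finite_setU.
rewrite lerD2l; apply: le_trans (wsum_leU lq_ok fx fy _) _ => //.
by apply: lerD; exact: hc.
Qed.

Lemma wsep_hmul x y v : M x -> M y -> W v ->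
  wsep (x *m v) (y *m v) = (hmul^~ v) @` wsep x y.
Proof.
have key u (a b : 'rV[R]_n.+2) : M a -> M b -> W u -> (hmul^~ u) @` wsep a b `<=` wsep (a *m u) (b *m u).
  move=> Ma Mb Wu _ [_ [[w [i [Ww ->]]] s] <-]; split.
    by apply: (iswall_hmul Wu); exists w, i.
  rewrite hmul_wall; apply/(sepE i (WM Ww Wu) (WMM Wu Ma) (WMM Wu Mb)).
  by rewrite !tform_mul//; apply/(sepE i Ww Ma Mb).
move=> Mx My Wv; apply/seteqP; split; last exact: key.
move=> H h; exists (hmul H v^-1); last exact: hmulVK.
have := key v^-1 _ _ (WMM Wv Mx) (WMM Wv My) (WV Wv).
by rewrite !(WK _ Wv); apply; exists H.
Qed.

Lemma nover_Sep w0 w : W w0 -> W w -> (nover w0 w)%:R = expR (Sep (ctr w0) (ctr w)).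
Proof. by move=> Ww0 Ww; rewrite -ln_nover// lnK// posrE ltr0n (nover_gt0 regB apA fA). Qed.

End Separation.

End WallSum.
Import WallSum.

Lemma telescope_upper (R : realType) (c1 c2 d1 d2 s0 sm s1 S0 r kb : R) :
  S0 <= sm - s0 + c1 + kb * d1 -> r <= s1 - sm + c2 + kb * d2 ->
  S0 + r <= s1 - s0 + (c1 + c2) + kb * (d1 + d2).
Proof. by rewrite mulrDr => ? ?; lra. Qed.

Lemma telescope_lower (R : realType) (c1 c2 d1 d2 s0 sm s1 S0 r kb : R) :
  c1 + sm - s0 <= S0 + kb * d1 -> c2 + s1 - sm <= r + kb * d2 ->
  c1 + c2 + s1 - s0 <= S0 + r + kb * (d1 + d2).
Proof. by rewrite mulrDr => ? ?; lra. Qed.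

(** * Wall crossings of a geodesic, and the functions q and l *)

Section Crossings.
Context {R : realType} {g : geometry} {n : nat} {P : coxeter_polyhedron R g n} {B : building P}.
Notation V := 'rV[R]_n.+2.
Implicit Types (x y z : V) (p : V * V) (w u v : 'M[R]_n.+2)
  (C D : set (cplx_point B)) (H : set V) (s t : R).
Notation M := (@model_space R g n).
Notation W := (coxeter_group P).
Notation tile := (tile P).
Notation tform := (@tform R g n P).
Notation intile := (intile P).
Notation ctr := (ctr P).
Notation wall := (@wall R g n P).
Hypothesis regB : regular_building B.
Variables (A : set (cplx_point B)) (f : V -> cplx_point B).
Hypotheses (apA : apartment B A) (fA : tessellation_isometry f A).
Notation UT := (@unit_tangent_set R g n).
Notation geo := (@geo R g n).
Notation Fl := (@flow_pair R g n).
Notation iswall := (@iswall R g n P).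
Notation wsep := (@wsep R g n P).
Notation Sep := (@Sep R g n P B f).
Notation lq := (@lq R g n P B f).
Notation wt_ok := (@wt_ok R g n P).
Notation hmul := (@hmul R n).
Notation folded v t e rho := (@folded_segments R g n P B f v t e rho).
Notation one := (fun=> 1).
Let lqok : wt_ok lq := lq_ok regB apA fA.

Definition cross p H t := [/\ iswall H, H (geo p t) & ~ (range (geo p) `<=` H)].

Definition ctimes p := [set t | exists H, cross p H t].

Lemma geodesicE (v : unit_tangent R g n) t : geodesic v t = geo (val v) t.
Proof. by rewrite /geodesic /= flow_pairE. Qed.

Lemma wall_zero w i p t : W w -> UT p -> wall w i (geo p t) <-> tform w i (geo p t) = 0.
Proof.
move=> Ww Up; split=> [/wallP[]//|h]; apply/wallP => //; split=> //; exact: geoM.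
Qed.

Lemma transversal_cross w i p t s : W w -> UT p -> tform w i (geo p t) = 0 ->
  tform w i (geo p s) <> 0 -> cross p (wall w i) t.
Proof.
move=> Ww Up t0 s0; split; [by exists w, i|exact/wall_zero|].
by move=> h; apply/s0/wall_zero => //; apply: h; exists s.
Qed.

Lemma cross_neq0 w i p t s : W w -> UT p -> cross p (wall w i) t -> s != t ->
  tform w i (geo p s) != 0.
Proof.
move=> Ww Up [_ /(wall_zero _ _ Ww Up) h1 h2] st; apply/eqP => h3; apply: h2.
by move=> _ [r _ <-]; apply/wall_zero => //; exact: tform_vanish st h3 h1.
Qed.

Lemma cross_uniq p H s t : UT p -> cross p H s -> cross p H t -> s = t.
Proof.
move=> Up; have [/[swap]|nH] := EM (iswall H); last by case.
move=> cs [w [i [Ww eH]]]; move: cs; rewrite eH => cs ct; apply/eqP.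
apply: contraT => /(cross_neq0 Ww Up ct); have [_ /(wall_zero _ _ Ww Up)-> _] := cs.
by rewrite eqxx.
Qed.

Lemma cross_sign w i p a b t : W w -> UT p -> cross p (wall w i) t -> a < t < b ->
  tform w i (geo p a) * tform w i (geo p b) < 0.
Proof.
move=> Ww Up ct atb; have [l [m [l0 m0 e]]] := tform_between w i p atb.
have [at_ tb] := andP atb; have ha := cross_neq0 Ww Up ct (negbT (lt_eqF at_)).
have [_ /(wall_zero _ _ Ww Up) t0 _] := ct; move: ha e; rewrite t0.
move: (tform w i (geo p a)) (tform w i (geo p b)) => x y x0 e.
have -> : y = - (l / m) * x.
  by apply: (mulfI (lt0r_neq0 m0)); rewrite -[LHS](addKr (l * x)) -e; field; exact: lt0r_neq0.
by rewrite mulrCA -expr2 mulNr oppr_lt0 mulr_gt0 ?divr_gt0// lt_def sqrf_eq0 x0 sqr_ge0.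
Qed.

Lemma tform_geo_zero w i p a b : a <= b ->
  tform w i (geo p a) * tform w i (geo p b) <= 0 ->
  exists2 t, a <= t <= b & tform w i (geo p t) = 0.
Proof.
move=> ab; rewrite /Tile.tform -!geo_act => /(form_zero ab)[t tab e].
by exists t; rewrite // -geo_act.
Qed.

Lemma wsep_cross p a b : UT p -> a < b ->
  wsep (geo p a) (geo p b) = [set H | exists2 t, a < t < b & cross p H t].
Proof.
move=> Up ab; have Ma := geoM a Up; have Mb := geoM b Up.
apply/seteqP; split=> H.
  move=> [[w [i [Ww ->]]] /(sepE i Ww Ma Mb) h].
  have [t /andP[at_ tb] t0] := tform_geo_zero (ltW ab) (ltW h).
  have a0 : tform w i (geo p a) <> 0 by move=> e; move: h; rewrite e mul0r ltxx.
  have ct := transversal_cross Ww Up t0 a0.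
  exists t => //; rewrite !lt_neqAle at_ tb !andbT; apply/andP; split.
    by apply/eqP => e; rewrite e in a0.
  by apply/eqP => e; move: h; rewrite -e t0 mulr0 ltxx.
move=> [t atb ct]; have [wH _ _] := ct; split=> //; have [w [i [Ww e]]] := wH.
by rewrite e in ct *; apply/(sepE i Ww Ma Mb); exact: cross_sign ct atb.
Qed.

Lemma cross_flow p s H t : cross (flow_pair g s p) H t <-> cross p H (s + t).
Proof.
have e : range (geo (flow_pair g s p)) = range (geo p).
  apply/seteqP; split=> _ [r _ <-]; first by exists (s + r) => //; rewrite geo_flow.
  by exists (r - s) => //; rewrite geo_flow addrC subrK.
by rewrite /cross e geo_flow.
Qed.

Lemma ctimes_flow p s t : ctimes (flow_pair g s p) t <-> ctimes p (s + t).
Proof. by split=> -[H] /cross_flow h; exists H => //; apply/cross_flow. Qed.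

Lemma cross_act p (w : 'M[R]_n.+2) H t : W w -> cross p H t -> cross (act p w) (hmul H w) t.
Proof.
move=> Ww [wH h1 h2]; split; first exact: iswall_hmul.
  by rewrite geo_act; exists (geo p t).
move=> h; apply: h2 => _ [r _ <-].
have : hmul H w (geo (act p w) r) by apply: h; exists r.
by rewrite geo_act => -[x hx /(congr1 (mulmx^~ w^-1))]; rewrite /= !(WK _ Ww) => <-.
Qed.

Lemma act1 p : act p 1 = p.
Proof. by case: p => x y; rewrite /act /= !mulmx1. Qed.
Lemma actM p (w w' : 'M[R]_n.+2) : act (act p w) w' = act p (w * w').
Proof. by rewrite /act /= !mulmxA. Qed.
Lemma actK p (w : 'M[R]_n.+2) : W w -> act (act p w) w^-1 = p.
Proof. by move=> Ww; rewrite actM mulrV ?act1//; exact: W_unit Ww. Qed.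

Lemma cross_actE p (w : 'M[R]_n.+2) t : W w -> cross (act p w) ^~ t = (hmul^~ w) @` (cross p ^~ t).
Proof.
move=> Ww; apply/seteqP; split=> [H h|_ [H h <-]]; last exact: cross_act.
exists (hmul H w^-1); last exact: (hmulVK H Ww).
by have := cross_act (WV Ww) h; rewrite actK.
Qed.

Lemma ctimes_act p (w : 'M[R]_n.+2) : W w -> ctimes (act p w) = ctimes p.
Proof.
have h q u t : W u -> ctimes q t -> ctimes (act q u) t.
  by move=> Wu [H c]; exists (hmul H u); exact: cross_act.
move=> Ww; apply/seteqP; split=> t; last exact: h.
by move=> /(h _ _ _ (WV Ww)); rewrite actK.
Qed.

(** Half-open intervals make the sums additive under concatenation, at the price of end terms in the
    comparison with [Sep]. *)
Definition crossed p a b := [set H | exists2 t, a <= t < b & cross p H t].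

Lemma crossed_finite p a b : UT p -> finite_set (crossed p a b).
Proof.
move=> Up; have [ab|ba] := ltP a b; last first.
  suff -> : crossed p a b = classical_sets.set0 by exact: finite_set0.
  by apply/seteqP; split=> // H [t /andP[at_ tb]]; move: (le_lt_trans at_ tb); rewrite ltNge ba.
have ab' : a - 1 < b by lra.
apply: sub_finite_set (wsep_finite fA (geoM (a - 1) Up) (geoM b Up)).
rewrite (wsep_cross Up ab') => H [t /andP[at_ tb] ct]; exists t => //.
by apply/andP; split=> //; lra.
Qed.

Definition Csum (wt : set V -> R) p a b := wsum wt (crossed p a b).

Lemma Csum_ge0 wt p a b : wt_ok wt -> 0 <= Csum wt p a b.
Proof. by move=> ok; exact: (wsum_ge0 ok). Qed.

Lemma CsumD wt p a b c : UT p -> a <= b <= c ->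
  Csum wt p a c = Csum wt p a b + Csum wt p b c.
Proof.
move=> Up /andP[ab bc]; rewrite /Csum -wsumU; try exact: crossed_finite.
  congr wsum; apply/seteqP; split=> H.
    move=> [t /andP[at_ tc] ct]; have [tb|bt] := ltP t b; [left|right];
      by exists t => //; apply/andP; split.
  by case=> -[t /andP[h1 h2] ct]; exists t => //; apply/andP; split=> //; lra.
apply/seteqP; split=> // H [[t /andP[h1 h2] ct] [t' /andP[h1' h2'] ct']].
by move: h2; rewrite (cross_uniq Up ct ct') ltNge h1'.
Qed.

Lemma Csum_flow wt p s a b : Csum wt (flow_pair g s p) a b = Csum wt p (s + a) (s + b).
Proof.
congr wsum; apply/seteqP; split=> H [t tab].
  by move=> /cross_flow ct; exists (s + t) => //; rewrite lerD2l ltrD2l.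
move=> ct; exists (t - s); first by move: tab => /andP[]; lra.
by apply/cross_flow; rewrite addrC subrK.
Qed.

Lemma Csum_Sep p a b a' b' : UT p -> a' < a -> b <= b' -> a' < b' ->
  Csum lq p a b <= Sep (geo p a') (geo p b').
Proof.
move=> Up aa bb ab; apply: (wsum_le (lq_ok regB apA fA)).
  exact: (wsep_finite fA (geoM a' Up) (geoM b' Up)).
rewrite (wsep_cross Up ab) => H [t /andP[h1 h2] ct]; exists t => //.
by apply/andP; split; lra.
Qed.

Lemma Sep_Csum p a b : UT p -> a < b -> Sep (geo p a) (geo p b) <= Csum lq p a b.
Proof.
move=> Up ab; apply: (wsum_le (lq_ok regB apA fA)); first exact: crossed_finite.
by rewrite (wsep_cross Up ab) => H [t /andP[/ltW h1 h2] ct]; exists t => //; apply/andP.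
Qed.

Lemma Csum_bound wt r : wt_ok wt -> exists2 c, 0 <= c &
  forall p a b, UT p -> b <= a + r -> Csum wt p a b <= c.
Proof.
move=> ok; have [c c0 hc] := wnear_bound fA r ok; exists c => // p a b Up ab.
apply: le_trans (hc _ (geoM a Up)); apply: (wsum_le ok).
  exact: (wnear_finite fA r (geoM a Up)).
move=> H [t /andP[h1 h2] [wH Ht _]]; split=> //; exists (geo p t) => //.
by rewrite dist_geo// distrC ger0_norm; lra.
Qed.

Lemma ctimes_finite p a b : UT p -> finite_set (ctimes p `&` [set t | a <= t < b]).
Proof.
move=> Up; pose tm H := xget 0 [set t | cross p H t].
apply: sub_finite_set (finite_image tm (crossed_finite a b Up)) => t [[H ct] tab].
exists H; first by exists t.
by rewrite /tm; case: xgetP => [s _ /= cs|/(_ t)//]; exact: cross_uniq cs ct.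
Qed.

(* Every geodesic segment longer than twice the diameter of a tile leaves its
   first tile through a wall. *)
Lemma ctimes_exists : exists2 L, 0 < L & forall p a, UT p ->
  exists2 t, a < t < a + L & ctimes p t.
Proof.
have [D D0 hD] := @tile_diam R g n P; exists (D + D + 2); first by lra.
move=> p a Up; pose b := a + (D + D + 1); pose a' := a + 2^-1.
have Ma := geoM a' Up; have Mb := geoM b Up.
have [w Ww ta] := tile_cover fA Ma.
have [i hi] : exists i, 0 < tform w i (geo p b).
  apply: contrapT => no.
  have tb : tile w (geo p b).
    by apply/tileP => //; split=> // i; rewrite leNgt; apply/negP => hi; apply: no; exists i.
  have h : b - a' <= D + D.
    apply: le_trans (ler_norm _) _; rewrite distrC -(dist_geo a' b Up).
    apply: le_trans (dist_triangle Ma (ctr_M Ww) Mb) _; rewrite (distC (ctr_M Ww) Mb).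
    by apply: lerD; exact: hD.
  have e : b - a' = D + D + 2^-1 by rewrite /b /a'; field.
  by move: h; rewrite e gerDl leNgt invr_gt0 ltr0n.
have ha : tform w i (geo p a') <= 0 by have /tileP[//|_ ->] := ta.
have ab : a' <= b by rewrite /a' /b; lra.
have [|t /andP[t1 t2] t0] := @tform_geo_zero w i p a' b ab.
  by rewrite mulr_le0_ge0// ltW.
exists t; first by move: t1 t2; rewrite /a' /b => ? ?; apply/andP; split; lra.
by exists (wall w i); apply: (transversal_cross (s := b) Ww Up t0) => e; move: hi; rewrite e ltxx.
Qed.

Definition nxt p : R := get [set t | [/\ ctimes p t, 0 <= t &
    forall s, ctimes p s -> 0 <= s -> t <= s]].

Definition lst p : R := get [set t | [/\ ctimes p t, t < 0 &
    forall s, ctimes p s -> s < 0 -> s <= t]].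

Lemma nxt_exists p : UT p -> exists t, [/\ ctimes p t, 0 <= t &
    forall s, ctimes p s -> 0 <= s -> t <= s].
Proof.
move=> Up; have [L L0 hL] := ctimes_exists.
have [t /andP[t0 tL] ct] := hL p 0 Up; rewrite add0r in tL.
have At : (ctimes p `&` [set t | 0 <= t < L]) t by split=> //=; rewrite ltW.
have [r [cr /andP[r0 rL]] min] := @finite_argmin R _ _ id t (ctimes_finite 0 L Up) At.
exists r; split=> // s cs s0; have [sL|Ls] := ltP s L; last exact: le_trans (ltW rL) Ls.
by apply: min; split=> //=; rewrite s0.
Qed.

Lemma lst_exists p : UT p -> exists t, [/\ ctimes p t, t < 0 &
    forall s, ctimes p s -> s < 0 -> s <= t].
Proof.
move=> Up; have [L L0 hL] := ctimes_exists.
have [t /andP[t0 tL] ct] := hL p (- L) Up; rewrite addNr in tL.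
have At : (ctimes p `&` [set t | - L <= t < 0]) t by split=> //=; rewrite ltW.
have [r [cr /andP[r0 rL]] min] := @finite_argmin R _ _ -%R t (ctimes_finite (- L) 0 Up) At.
exists r; split=> // s cs s0; have [Ls|sL] := leP (- L) s; last exact: le_trans (ltW sL) r0.
by rewrite -lerN2; apply: min; split=> //=; rewrite s0 Ls.
Qed.

Lemma nxtP p : UT p -> [/\ ctimes p (nxt p), 0 <= nxt p &
    forall s, ctimes p s -> 0 <= s -> nxt p <= s].
Proof. by move=> /nxt_exists; rewrite /nxt => -[t ht]; case: xgetP => [s _ //|/(_ t)]. Qed.

Lemma lstP p : UT p -> [/\ ctimes p (lst p), lst p < 0 &
    forall s, ctimes p s -> s < 0 -> s <= lst p].
Proof. by move=> /lst_exists; rewrite /lst => -[t ht]; case: xgetP => [s _ //|/(_ t)]. Qed.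

Lemma nxt_uniq p t : UT p -> ctimes p t -> 0 <= t ->
  (forall s, ctimes p s -> 0 <= s -> t <= s) -> nxt p = t.
Proof.
move=> Up ct t0 h; have [c1 c2 c3] := nxtP Up.
by apply/le_anti; rewrite c3//= h.
Qed.

Lemma lst_uniq p t : UT p -> ctimes p t -> t < 0 ->
  (forall s, ctimes p s -> s < 0 -> s <= t) -> lst p = t.
Proof.
move=> Up ct t0 h; have [c1 c2 c3] := lstP Up.
by apply/le_anti; rewrite c3//= h.
Qed.

(** Crossing times are defined through panels, [ctimes] through walls; by [wall_panel] every point
    of a wall lies in a panel of that wall. *)
Lemma crossing_timeE (v : unit_tangent R g n) : crossing_time P v = ctimes (val v).
Proof.
have Up : UT (val v) by exact: set_mem (valP v).
have eg : geodesic v = geo (val v) by apply/funext => t; exact: geodesicE.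
apply/seteqP; split=> t.
  move=> [w [i [Ww h1 h2]]]; exists (wall w i); split; first by exists w, i.
    by rewrite -eg; move: h1 => [x [[Mx _] x0] <-]; exists x.
  by rewrite -eg.
move=> [H [wH h1 h2]]; have [u [j [Wu eH tu]]] := wall_panel fA wH h1.
exists u, j; split=> //; last by rewrite eg -eH.
rewrite eg; have [x Px ex] := tu; exists x => //; split=> //.
have := h1; rewrite eH => /(wall_zero _ _ Wu Up).
by rewrite -ex /Tile.tform /= (WK _ Wu).
Qed.

Lemma next_crossingE (v : unit_tangent R g n) : next_crossing P v = nxt (val v).
Proof. by rewrite /next_crossing crossing_timeE. Qed.
Lemma period_lfunE (v : unit_tangent R g n) : lfun P v = nxt (val v) - lst (val v).
Proof. by rewrite /lfun next_crossingE /last_crossing crossing_timeE. Qed.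

(** All walls crossed at the time [t] together: a geodesic may pass through a face of codimension
    two or more. By [ln_branching] this is [ln] of the number of folded segments. *)
Definition jump p t := wsum lq (cross p ^~ t).

Lemma cross_finite p t : UT p -> finite_set (cross p ^~ t).
Proof.
move=> Up; apply: sub_finite_set (crossed_finite t (t + 1) Up) => H ct.
by exists t => //; rewrite lexx/=; lra.
Qed.

Lemma jump_ge0 p t : 0 <= jump p t.
Proof. exact: (wsum_ge0 (lq_ok regB apA fA)). Qed.

Lemma jump_Csum p a b t : UT p -> a <= t < b -> jump p t <= Csum lq p a b.
Proof.
move=> Up tab; apply: (wsum_le (lq_ok regB apA fA)); first exact: crossed_finite.
by move=> H ct; exists t.
Qed.

Lemma jump_flow p s t : jump (flow_pair g s p) t = jump p (s + t).
Proof. by congr wsum; apply/seteqP; split=> H /cross_flow. Qed.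

Lemma jump_act p (w : 'M[R]_n.+2) t : W w -> jump (act p w) t = jump p t.
Proof.
by move=> Ww; rewrite /jump cross_actE// (wsum_hmul (lq_ok regB apA fA) Ww)// => H [].
Qed.

Definition rate p := jump p (nxt p) / (nxt p - lst p).

Lemma rate_act p (w : 'M[R]_n.+2) : W w -> rate (act p w) = rate p.
Proof. by move=> Ww; rewrite /rate /nxt /lst ctimes_act// jump_act. Qed.
Lemma period_gt0 p : UT p -> 0 < nxt p - lst p.
Proof. by move=> Up; have [_ ? _] := nxtP Up; have [_ ? _] := lstP Up; lra. Qed.
Lemma rate_ge0 p : UT p -> 0 <= rate p.
Proof. by move=> Up; rewrite divr_ge0 ?jump_ge0// ltW// period_gt0. Qed.

Lemma ctimes_isolated p t : UT p -> exists2 e, 0 < e &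
  forall r, ctimes p r -> `|r - t| < e -> r = t.
Proof.
move=> Up; pose F := ctimes p `&` [set r | t - 1 <= r < t + 1] `\ t.
have fF : finite_set F by apply: finite_setD; exact: (ctimes_finite).
have in1 r : `|r - t| < 1 -> t - 1 <= r < t + 1.
  by rewrite ltr_norml => /andP[h1 h2]; apply/andP; split; lra.
have [[a0 Fa0]|no] := EM (exists a, F a).
  have [a [[ca _] /= /eqP at_] min] := @finite_argmin R _ _ (fun r => `|r - t|) a0 fF Fa0.
  exists (Num.min 1 `|a - t|); first by rewrite lt_min ltr01 normr_gt0 subr_eq0.
  move=> r cr; rewrite lt_min => /andP[/in1 r1]; rewrite ltNge => /negP h.
  by apply: contrapT => rt; apply/h/min.
exists 1 => // r cr /in1 r1; apply: contrapT => rt; apply: no.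
by exists r.
Qed.

Lemma rc_tile w0 b : W w0 -> tile w0 (rc f w0 b) -> b = f (rc f w0 b).
Proof.
move=> Ww0; have [A' [f' [x [ch Mx <-]]]] := rc_exists apA fA Ww0 b.
by rewrite (rc_chart Ww0 ch Mx) => tx; have [_ _ ->] := ch.
Qed.

(** A point over [z] determines a chamber over [w], the tile through which the segment from [x]
    arrives, because charts agreeing at [z] agree along that segment. *)
Lemma fibre_card w0 w x y z : W w0 -> W w -> tile w0 x -> M z -> tile w z ->
  intile w y -> dist g x y + dist g y z = dist g x z ->
  ([set b | rc f w0 b = z] #= lifts f w0 w)%card.
Proof.
move=> Ww0 Ww tx Mz tz iy e; have My : M y by case: iy.
pose psi (D : set (cplx_point B)) := xget (f z) [set b | D b /\ rc f w0 b = z].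
have psiE A' f' : chart f w0 A' f' -> psi (f' @` tile w) = f' z.
  move=> ch; rewrite /psi; case: xgetP => [b _ [[u tu <-]]|/(_ (f' z))[]].
    by rewrite (rc_chart Ww0 ch (tileM Ww tu)) => ->.
  by split; [exists z|rewrite (rc_chart Ww0 ch Mz)].
have -> : [set b | rc f w0 b = z] = psi @` lifts f w0 w.
  apply/seteqP; split=> [b /= bz|_ [D [A' [f' [ch ->]]] <-]]; last first.
    by rewrite /= (psiE _ _ ch) (rc_chart Ww0 ch Mz).
  have [A' [f' [u [ch Mu eu]]]] := rc_exists apA fA Ww0 b.
  have uz : u = z by rewrite -bz -eu (rc_chart Ww0 ch Mu).
  by exists (f' @` tile w); [exists A', f'|rewrite (psiE _ _ ch) -uz eu].
apply: inj_card_eq => D1 D2; rewrite !inE => -[A1 [f1 [ch1 ->]]] [A2 [f2 [ch2 ->]]].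
rewrite (psiE _ _ ch1) (psiE _ _ ch2) => ez.
apply: (charts_tile Ww0 Ww ch1 ch2 iy).
exact: (charts_geodesic Ww0 ch1 ch2 tx My Mz ez e).
Qed.

(** A folded segment starts in the base chamber, where the position determines the point; by
    convexity of apartments its final point then determines the whole segment. *)
Lemma folded_card (v : unit_tangent R g n) t e w0 rho : W w0 -> 0 < e ->
  (forall s, t - e <= s <= t -> tile w0 (geo (val v) s)) ->
  is_retraction A (f @` tile w0) rho ->
  (folded v t e rho #= [set b | rc f w0 b = geo (val v) (t + e)])%card.
Proof.
move=> Ww0 e0 ht /(retraction_unique apA fA Ww0) ->; set p := val v.
have Up : UT p by exact: set_mem (valP v).
have me : t + e \in `[t - e, t + e] by rewrite in_itv /= lexx andbT; lra.
have ml : t - e \in `[t - e, t + e] by rewrite in_itv /= lexx /=; lra.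
pose se : [set` `[t - e, t + e]] := exist _ (t + e) (mem_set me).
pose sl : [set` `[t - e, t + e]] := exist _ (t - e) (mem_set ml).
pose ev (c : [set` `[t - e, t + e]] -> cplx_point B) := c se.
have rcE c k : (folded v t e (f \o rc f w0)) c -> rc f w0 (c k) = geo p (val k).
  move=> [_ /(_ k)]; rewrite geodesicE /= => h.
  exact: (f_inj fA (rcM apA fA Ww0 (c k)) (geoM _ Up) h).
have ar (r : R) : t - e <= r -> r <= t + e ->
    `|t - e - r| + `|r - (t + e)| = `|t - e - (t + e)|.
  by move=> r1 r2; rewrite !ler0_norm; lra.
have cE c k A' f' : (folded v t e (f \o rc f w0)) c ->
    chart f w0 A' f' -> f' (geo p (t + e)) = c se -> c k = f' (geo p (val k)).
  move=> hc ch eb; have [ap' t' h'] := ch; have [h1 h2] := hc.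
  have cl : c sl = f' (geo p (t - e)).
    have tl : tile w0 (geo p (t - e)) by apply: ht; rewrite lexx/=; lra.
    by rewrite h'// -[geo p (t - e)](rcE c sl hc); apply: rc_tile => //; rewrite rcE.
  have /andP[s1 s2] : t - e <= val k <= t + e by have := set_mem (valP k); rewrite /= in_itv.
  have [|z Mz [ez _ _]] := between_ap ap' t' (geoM (t - e) Up) (geoM (t + e) Up) (b := c k).
    rewrite -cl eb !h1; exact: ar.
  by rewrite -(rcE c k hc) ez (rc_chart Ww0 ch Mz).
rewrite (_ : [set b | _] = ev @` folded v t e (f \o rc f w0)).
  rewrite card_eq_sym; apply: inj_card_eq => c1 c2; rewrite !inE => h1 h2 e12.
  have [A' [f' [u [ch Mu eu]]]] := rc_exists apA fA Ww0 (c1 se).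
  have eu' : u = geo p (t + e) by rewrite -[RHS](rcE c1 se h1) -eu (rc_chart Ww0 ch Mu).
  apply/funext => s; rewrite (cE c1 s _ _ h1 ch) -?eu'// (cE c2 s _ _ h2 ch) -?eu'//.
  by rewrite eu.
apply/seteqP; split=> [b /= hb|_ [c hc <-]]; last by rewrite /= /ev (rcE c se hc).
have [A' [f' [u [ch Mu eu]]]] := rc_exists apA fA Ww0 b; have [ap' t' h'] := ch.
have eu' : u = geo p (t + e) by rewrite -hb -eu (rc_chart Ww0 ch Mu).
exists (fun k => f' (geo p (val k))); last by rewrite /ev /= -eu'.
split=> [s s'|s]; first by rewrite (cdist_chart ap' t') ?dist_geo//; exact: geoM.
by rewrite geodesicE /= (rc_chart Ww0 ch)//; exact: geoM.
Qed.

Lemma tile_segment w p a b : W w -> UT p -> tile w (geo p a) -> tile w (geo p b) ->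
  forall s, a <= s <= b -> tile w (geo p s).
Proof.
move=> Ww Up ta tb s /andP[as_ sb]; apply/tileP => //; split; first exact: geoM.
move=> i; have [<-|/eqP sa] := eqVneq a s; first by have /tileP[] := ta.
have [->|/eqP sb'] := eqVneq s b; first by have /tileP[] := tb.
have ltab : a < s < b by rewrite !lt_neqAle as_ sb !andbT; apply/andP; split; exact/eqP.
have [l [m [l0 m0 ->]]] := tform_between w i p ltab.
have /tileP[//|_ /(_ i) h1] := ta; have /tileP[//|_ /(_ i) h2] := tb.
by rewrite -oppr_ge0 opprD -!mulrN addr_ge0// mulr_ge0 ?oppr_ge0// ltW.
Qed.

(** For a wall separating the two tiles the form is, up to sign, nonpositive at [t] and positive at
    [t + e]; the geodesic crosses it in between, and by isolation at [t] itself. *)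
Lemma wsep_jump p t e w0 w y : UT p -> 0 < e ->
  (forall r, ctimes p r -> `|r - t| <= e -> r = t) -> W w0 -> W w ->
  tile w0 (geo p (t - e)) -> tile w0 (geo p t) -> tile w (geo p (t + e)) ->
  intile w y -> dist g (ctr w0) y + dist g y (geo p (t + e)) = dist g (ctr w0) (geo p (t + e)) ->
  wsep (ctr w0) (ctr w) = cross p ^~ t.
Proof.
move=> Up e0 iso Ww0 Ww tl tt tr iy ey.
have ab : t - e < t < t + e by apply/andP; split; lra.
have ab' : t - e < t + e by lra.
have Mr := geoM (t + e) Up; have Mc := ctr_M Ww0; have My : M y by case: iy.
apply/seteqP; split=> H; last first.
  move=> ct; have [wH _ _] := ct.
  have : wsep (geo p (t - e)) (geo p (t + e)) H.
    by rewrite (wsep_cross Up ab'); exists t.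
  by move=> /(wsep_tile fA Ww0 Ww tl tr).
move=> [wH s]; have [u [i [Wu eH]]] := wH; rewrite eH in s *.
have key v : tform v i (ctr w0) < 0 -> wall v i = wall u i -> W v -> cross p (wall v i) t.
  move=> n0 ev Wv; rewrite -ev in s.
  have cw : 0 < tform v i (ctr w).
    by move: s => /(sepE i Wv Mc (ctr_M Ww)); rewrite nmulr_rlt0.
  have hy : 0 < tform v i y.
    rewrite lt_def; apply/andP; split; first exact/eqP/(intile_wall fA Ww Wv iy).
    have := tile_sign fA i Ww Wv (intile_tile Ww iy); by rewrite pmulr_rge0.
  have hr : 0 < tform v i (geo p (t + e)).
    have yc : y <> ctr w0 by move=> yc; move: hy; rewrite yc ltNge (ltW n0).
    have [yr|/eqP yr] := eqVneq y (geo p (t + e)); first by rewrite -yr.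
    have [l [m [l0 m0 h]]] := tform_between_sign Wv Mc Mr My ey yc yr.
    move: hy; rewrite h ltNge => hy; rewrite ltNge; apply: contra hy => hr.
    rewrite -oppr_ge0 opprD -!mulrN addr_ge0// mulr_ge0 ?oppr_ge0// ltW//.
  have ht : tform v i (geo p t) <= 0.
    by have := tile_sign fA i Ww0 Wv tt; rewrite nmulr_rge0.
  have [||r /andP[r1 r2] r0] := @tform_geo_zero v i p t (t + e); first lra.
    by rewrite mulr_le0_ge0// ltW.
  have cr : cross p (wall v i) r.
    by apply: (transversal_cross (s := t + e) Wv Up r0) => h; move: hr; rewrite h ltxx.
  suff <- : r = t by [].
  by apply: iso; [exists (wall v i)|rewrite ger0_norm; lra].
have [neg|pos|z0] := ltgtP (tform u i (ctr w0)) 0.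
- exact: key.
- rewrite -(wall_refl i Wu); apply: key; first by rewrite tform_refl// oppr_lt0.
    exact: wall_refl.
  exact: WM (W_refl i) Wu.
- by have := ctr_neq0 fA i Ww0 Wu; rewrite z0 eqxx.
Qed.

Lemma branching_local (v : unit_tangent R g n) t : exists2 e0, 0 < e0 &
  forall e, 0 < e < e0 ->
  (exists2 w0, W w0 & forall s, t - e <= s <= t -> tile w0 (geo (val v) s)) /\
  forall w0 rho, W w0 -> (forall s, t - e <= s <= t -> tile w0 (geo (val v) s)) ->
    is_retraction A (f @` tile w0) rho ->
    exists k, [/\ (0 < k)%N, ln k%:R = jump (val v) t &
      (folded v t e rho #= `I_k)%card].
Proof.
set p := val v; have Up : UT p by exact: set_mem (valP v).
have [e1 e10 h1] := ctimes_isolated t Up; have [e2 e20 h2] := star fA (geoM t Up).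
exists (Num.min e1 e2); first by rewrite lt_min e10.
move=> e /andP[e0]; rewrite lt_min => /andP[ee1 ee2]; split.
  have [w0 Ww0 tl] := tile_cover fA (geoM (t - e) Up); exists w0 => //.
  apply: tile_segment => //; apply: (h2 _ (geoM (t - e) Up)) tl => //.
  by rewrite dist_geo// opprB addrCA subrr addr0 gtr0_norm.
move=> w0 rho Ww0 hs hr.
have [w [y [Ww tz iy ey]]] := approach_tile fA Ww0 (ctr_in Ww0) (geoM (t + e) Up).
have tc := intile_tile Ww0 (ctr_in Ww0).
exists (nover f w0 w); split.
- exact: (nover_gt0 regB apA fA).
- rewrite (ln_nover regB apA fA Ww0 Ww) /WallSum.Sep; congr wsum.
  apply: (wsep_jump Up e0 _ Ww0 Ww _ _ tz iy ey).
  + by move=> r cr re; apply: h1 => //; exact: le_lt_trans re ee1.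
  + by apply: hs; rewrite lexx/=; lra.
  + by apply: hs; rewrite lexx andbT; lra.
- apply: card_eq_trans (folded_card Ww0 e0 hs hr) _.
  apply: card_eq_trans (fibre_card Ww0 Ww tc (geoM (t + e) Up) tz iy ey) _.
  exact: (noverP regB apA fA).
Qed.

Lemma ln_natr_inj k k' : (0 < k)%N -> (0 < k')%N -> ln (k%:R : R) = ln k'%:R -> k = k'.
Proof.
move=> k0 k0' /(congr1 expR); rewrite !lnK ?posrE ?ltr0n// => /eqP.
by rewrite eqr_nat => /eqP.
Qed.

(** The count of [branching_local] is the same for all small [e] and all admissible chambers, since
    its logarithm is the jump and [ln] is injective on positive integers. So [get] has a value to
    find, and any value it returns has this logarithm. *)
Lemma ln_branching (v : unit_tangent R g n) t :
  ln (branching A f v t)%:R = jump (val v) t.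
Proof.
have [e0 e00 he] := branching_local v t.
have adm e : 0 < e < e0 -> exists w0 rho, [/\ W w0,
    (forall s, t - e <= s <= t -> (f @` tile w0) (f (geodesic v s))),
    is_retraction A (f @` tile w0) rho & exists k, [/\ (0 < k)%N, ln k%:R = jump (val v) t &
      (folded v t e rho #= `I_k)%card]].
  move=> /he[[w0 Ww0 h1] h2]; exists w0, (f \o rc f w0).
  have hr := retraction_rc apA fA Ww0; split=> //; last exact: (h2 w0 _ Ww0 h1 hr).
  by move=> s hs; exists (geo (val v) s); rewrite ?geodesicE//; exact: h1.
have [|w0 [rho [Ww0 _ _ [k [k0 lk _]]]]] := adm (e0 / 2); first by apply/andP; split; lra.
have sub w1 : W w1 -> f @` tile w1 `<=` A.
  by move=> Ww1 _ [x tx <-]; exact: (tess_in fA (tileM Ww1 tx)).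
rewrite /branching; case: xgetP => [k1 _ hk1|/(_ k) no].
  have [e [e10 ee]] : exists e, 0 < e < e0 /\ forall C rho, chamber C -> C `<=` A ->
    (forall s, t - e <= s <= t -> C (f (geodesic v s))) -> is_retraction A C rho ->
    (folded v t e rho #= `I_k1)%card.
    have : \forall e \near 0^'+, 0 < e < e0.
      near=> e; apply/andP; split; near: e; [exact: nbhs_right_gt|exact: nbhs_right_lt].
    by move=> /(filterI hk1)/filter_ex[e [h1 h2]]; exists e.
  have [w1 [rho1 [Ww1 h1 h2 [k2 [k20 lk2 h3]]]]] := adm _ e10.
  suff -> : k1 = k2 by [].
  apply/card_eq_II; apply: card_eq_trans h3; rewrite card_eq_sym.
  by apply: ee h1 h2; [exact: (f_chamber fA Ww1)|exact: sub].
exfalso; apply: no; near=> e => C rho1 cC CA hs hr.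
have e10 : 0 < e < e0.
  apply/andP; split; near: e; [exact: nbhs_right_gt|exact: nbhs_right_lt].
have [w1 Ww1 eC] := tess_chamber fA cC CA; rewrite eC in hs hr.
have [_ /(_ w1 rho1 Ww1 _ hr)] := he _ e10.
case=> [s hs1|k2 [k20 lk2 h3]].
  have [x tx /(f_inj fA) ex] := hs s hs1.
  by rewrite -geodesicE -ex//; [exact: tileM tx|rewrite geodesicE; apply: geoM; exact: set_mem (valP v)].
by rewrite (_ : k = k2)//; apply: ln_natr_inj => //; rewrite lk.
Unshelve. all: by end_near. Qed.

Lemma log_q_over_lE (W' : matrix_group R n) (y : borel_T1Y g W') :
  log_q_over_l A f y = rate (val (repr (y : T1Y g W'))).
Proof.
by rewrite /log_q_over_l /qfun ln_branching (next_crossingE) (period_lfunE).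
Qed.

Lemma flowD p s t : Fl s (Fl t p) = Fl (t + s) p.
Proof.
rewrite [LHS]flow_pairE geo_flow flow_pairE [RHS]flow_pairE; congr pair.
rewrite geoCD geoSD /Geodesic.geo; case: g => /=;
  by apply/rowP => i; rewrite !mxE /=; ring.
Qed.

Lemma flow0 p : Fl 0 p = p.
Proof.
rewrite flow_pairE geo0; case: p => x y /=; congr pair.
by apply/rowP => i; rewrite !mxE geoC0 geoS0; ring.
Qed.

Lemma one_wt : wt_ok (one : set V -> R).
Proof. exact: one_ok. Qed.

Lemma Csum1_ge1 p a b t : UT p -> ctimes p t -> a <= t < b -> 1 <= Csum one p a b.
Proof.
move=> Up [H ct] tab; rewrite -[leLHS](wsum1 one H).
apply: (wsum_le one_wt); first exact: (crossed_finite).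
by move=> _ ->; exists t.
Qed.

Lemma jump_bound : exists2 c, 0 <= c & forall p t, UT p -> jump p t <= c.
Proof.
have [c c0 hc] := Csum_bound 1 lqok; exists c => // p t Up.
apply: le_trans (hc p t (t + 1) Up (lexx _)); apply: (jump_Csum) => //.
by rewrite lexx ltrDl ltr01.
Qed.

Lemma nxt_lst_bound : exists2 L, 0 < L & forall p, UT p -> nxt p < L /\ - L < lst p.
Proof.
have [L L0 hL] := ctimes_exists; exists L => // p Up; split.
  have [t /andP[t0 tL] ct] := hL p 0 Up; have [_ _ h] := nxtP Up.
  by rewrite add0r in tL; apply: le_lt_trans tL; apply: h => //; exact: ltW.
have [t /andP[t0 tL] ct] := hL p (- L) Up; have [_ _ h] := lstP Up.
by rewrite addNr in tL; apply: lt_le_trans t0 _; exact: h.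
Qed.

Lemma nxt_back p k : UT p -> 0 <= k ->
  (forall t, ctimes p t -> - k <= t < 0 -> False) -> nxt (Fl (- k) p) = nxt p + k.
Proof.
move=> Up k0 no; have [c1 c2 c3] := nxtP Up.
apply: (nxt_uniq (UT_flow _ Up)).
- by apply/ctimes_flow; rewrite addrCA addNr addr0.
- exact: addr_ge0.
- move=> s /ctimes_flow cs s0; rewrite -lerBrDr addrC; apply: c3 => //.
  by rewrite leNgt; apply/negP => h; apply: (no _ cs); rewrite h andbT lerDl.
Qed.

Lemma lst_back p k : UT p -> 0 <= k ->
  (forall t, ctimes p t -> - k <= t < 0 -> False) -> lst (Fl (- k) p) = lst p + k.
Proof.
move=> Up k0 no; have [c1 c2 c3] := lstP Up.
apply: (lst_uniq (UT_flow _ Up)).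
- by apply/ctimes_flow; rewrite addrCA addNr addr0.
- rewrite ltNge; apply/negP => h; apply: (no _ c1); rewrite c2 andbT; lra.
- move=> s /ctimes_flow cs s0; rewrite -lerBlDr addrC; apply: c3 => //; lra.
Qed.

(* [jump] spread linearly over the interval preceding the crossing *)
Definition saw p := rate p * - lst p.

Lemma saw_ge0 p : UT p -> 0 <= saw p.
Proof.
move=> Up; rewrite mulr_ge0 ?(rate_ge0)//.
by have [_ /ltW h _] := lstP Up; rewrite oppr_ge0.
Qed.

Lemma jump_rate p : UT p -> jump p (nxt p) = rate p * nxt p + saw p.
Proof.
by move=> /(period_gt0) h; rewrite /saw -mulrDr /rate divfK ?lt0r_neq0.
Qed.

Lemma saw_jump p : UT p -> saw p <= jump p (nxt p).
Proof.
move=> Up; rewrite jump_rate// lerDr mulr_ge0 ?(rate_ge0)//.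
by have [_ h _] := nxtP Up.
Qed.

Lemma saw_back p k : UT p -> 0 <= k ->
  (forall t, ctimes p t -> - k <= t < 0 -> False) ->
  rate (Fl (- k) p) = rate p /\ saw p - saw (Fl (- k) p) = k * rate p.
Proof.
move=> Up k0 no; have en := nxt_back Up k0 no; have el := lst_back Up k0 no.
have er : rate (Fl (- k) p) = rate p.
  rewrite /rate en el jump_flow addrCA addNr addr0; congr (_ / _).
  by rewrite opprD addrACA subrr addr0.
by split=> //; rewrite /saw er el; ring.
Qed.

Lemma Csum_none wt p a b : (forall t, ctimes p t -> a <= t < b -> False) -> Csum wt p a b = 0.
Proof.
move=> no; rewrite /Csum (_ : crossed _ _ _ = classical_sets.set0) ?wsum0//.
by apply/seteqP; split=> // H [t tab ct]; apply: (no t) => //; exists H.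
Qed.

Lemma back_nxt p k t : UT p -> ctimes p t -> - k <= t < 0 ->
  nxt (Fl (- k) p) <= t + k.
Proof.
move=> Up ct /andP[h1 h2]; have [_ _ h] := nxtP (UT_flow (- k) Up).
by apply: h; [apply/ctimes_flow; rewrite addrCA addNr addr0|lra].
Qed.

(** Between crossings [saw] grows with slope [rate]; a crossing resets it and contributes its jump
    to the wall sum. A step free of crossings is exact, and a step with crossings is charged [k * b]
    for each, which is possible because the sampled rate is truncated at [b]. *)
Lemma step_upper p k b : UT p -> 0 <= k -> 0 <= b ->
  k * Num.min (rate p) b <=
  saw p - saw (Fl (- k) p) + Csum lq p (- k) 0 + k * b * Csum one p (- k) 0.
Proof.
move=> Up k0 b0; have Up' := UT_flow (- k) Up.
have [[t [ct tk]]|no] := EM (exists t, ctimes p t /\ - k <= t < 0).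
  have h1 := Csum1_ge1 Up ct tk.
  have h2 : saw (Fl (- k) p) <= Csum lq p (- k) 0.
    apply: le_trans (saw_jump Up') _; rewrite jump_flow.
    apply: (jump_Csum) => //; have := back_nxt Up ct tk.
    by have [_ h _] := nxtP Up'; move: tk => /andP[_ t0] h3; apply/andP; split; lra.
  have h3 := saw_ge0 Up.
  have h4 : k * b <= k * b * Csum one p (- k) 0.
    by rewrite ler_peMr// mulr_ge0.
  have h5 : k * Num.min (rate p) b <= k * b by rewrite ler_wpM2l// ge_min lexx orbT.
  lra.
have {}no t : ctimes p t -> - k <= t < 0 -> False by move=> ct tk; apply: no; exists t.
have [_ ->] := saw_back Up k0 no; rewrite !(Csum_none _ no) mulr0 !addr0.
by rewrite ler_wpM2l// ge_min lexx.
Qed.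

(** With at most one crossing time in the step, the jump there splits into the value of [saw]
    already accumulated at the start and at most [k * b] gained inside the step. *)
Lemma step_lower p k b : UT p -> 0 <= k -> 0 <= b -> rate (Fl (- k) p) <= b ->
  (forall s t, ctimes p s -> ctimes p t -> - k <= s < 0 -> - k <= t < 0 -> s = t) ->
  Csum lq p (- k) 0 + saw p - saw (Fl (- k) p) <=
  k * rate p + k * b * Csum one p (- k) 0.
Proof.
move=> Up k0 b0 hb un; have Up' := UT_flow (- k) Up.
have [[t [ct tk]]|no] := EM (exists t, ctimes p t /\ - k <= t < 0); last first.
  have {}no t : ctimes p t -> - k <= t < 0 -> False by move=> ct tk; apply: no; exists t.
  by have [_ e] := saw_back Up k0 no; rewrite !(Csum_none _ no) mulr0 addr0 add0r e.
have /andP[t1 t2] := tk.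
have h1 := Csum1_ge1 Up ct tk.
have [n1 n2 n3] := nxtP Up'; have [l1 l2 l3] := lstP Up.
have n4 := back_nxt Up ct tk.
have en : nxt (Fl (- k) p) = t + k.
  have : - k + nxt (Fl (- k) p) = t by apply: un ct _ tk; [exact/ctimes_flow|apply/andP; split; lra].
  lra.
have el : t <= lst p by exact: l3.
have e1 : Csum lq p (- k) 0 = jump p t.
  congr wsum; apply/seteqP; split=> H; last by move=> c; exists t.
  by move=> [s sk cs]; rewrite -(un s t) //; exists H.
have e2 : jump p t = rate (Fl (- k) p) * (t + k) + saw (Fl (- k) p).
  by rewrite -en -jump_rate// jump_flow en addrCA addNr addr0.
have e3 : saw p <= k * rate p.
  rewrite /saw mulrC ler_wpM2r ?(rate_ge0)//; lra.
have e4 : rate (Fl (- k) p) * (t + k) <= b * k.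
  apply: ler_pM => //; [exact: (rate_ge0)|lra|lra].
have e5 : k * b <= k * b * Csum one p (- k) 0 by rewrite ler_peMr// mulr_ge0.
rewrite e1 e2; lra.
Qed.

Lemma sum_upper p k b m : UT p -> 0 <= k -> 0 <= b ->
  \sum_(j < m) k * Num.min (rate (Fl (j.+1%:R * k) p)) b <=
  saw (Fl (m%:R * k) p) - saw p + Csum lq p 0 (m%:R * k) +
  k * b * Csum one p 0 (m%:R * k).
Proof.
move=> Up k0 b0; elim: m => [|m IH].
  rewrite big_ord0 mul0r flow0 subrr add0r addr_ge0 ?(Csum_ge0 _ _ _ lqok)//.
  by rewrite mulr_ge0 ?(Csum_ge0 _ _ _ one_wt)// mulr_ge0.
rewrite big_ord_recr /=.
have := step_upper (UT_flow (m.+1%:R * k) Up) k0 b0.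
have e : m.+1%:R * k - k = m%:R * k by rewrite -natr1; ring.
rewrite flowD !Csum_flow addr0 e.
have h : 0 <= m%:R * k <= m.+1%:R * k.
  by rewrite mulr_ge0//= ler_wpM2r// ler_nat.
rewrite !(@CsumD _ p 0 (m%:R * k) (m.+1%:R * k) Up h).
move=> hs; exact: (telescope_upper IH hs).
Qed.

Lemma sum_lower p k b m : UT p -> 0 <= k -> 0 <= b ->
  (forall j, (j <= m)%N -> rate (Fl (j%:R * k) p) <= b) ->
  (forall j s t, (j < m)%N -> ctimes p s -> ctimes p t ->
    j%:R * k <= s < j.+1%:R * k -> j%:R * k <= t < j.+1%:R * k -> s = t) ->
  Csum lq p 0 (m%:R * k) + saw (Fl (m%:R * k) p) - saw p <=
  \sum_(j < m) k * rate (Fl (j.+1%:R * k) p) + k * b * Csum one p 0 (m%:R * k).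
Proof.
move=> Up k0 b0; elim: m => [|m IH] hb un.
  rewrite big_ord0 mul0r flow0 add0r !Csum_none; try by move=> t _ /andP[h1 h2]; lra.
  by rewrite mulr0 add0r subrr.
have {}IH := IH (fun j jm => hb j (leqW jm)) (fun j s t jm => un j s t (leqW jm)).
rewrite big_ord_recr /=.
have e : m.+1%:R * k - k = m%:R * k by rewrite -natr1; ring.
have := @step_lower (Fl (m.+1%:R * k) p) k b (UT_flow (m.+1%:R * k) Up) k0 b0.
rewrite flowD !Csum_flow addr0 e => /(_ (hb m (leqnSn m))) hs0.
have hs : Csum lq p (m%:R * k) (m.+1%:R * k) + saw (Fl (m.+1%:R * k) p) -
   saw (Fl (m%:R * k) p) <= k * rate (Fl (m.+1%:R * k) p) +
   k * b * Csum one p (m%:R * k) (m.+1%:R * k).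
  apply: hs0 => s t /ctimes_flow cs /ctimes_flow ct /andP[s1 s2] /andP[t1 t2].
  apply: (addrI (m.+1%:R * k)); apply: (un m) => //; rewrite -e; apply/andP; split; lra.
have h : 0 <= m%:R * k <= m.+1%:R * k.
  by rewrite mulr_ge0//= ler_wpM2r// ler_nat.
rewrite !(@CsumD _ p 0 (m%:R * k) (m.+1%:R * k) Up h).
exact: (telescope_lower IH hs).
Qed.

Lemma finite_gap (F : set R) : finite_set F ->
  exists2 d, 0 < d & forall s t, F s -> F t -> `|s - t| < d -> s = t.
Proof.
move=> fF; pose G := (F `*` F) `&` [set q | q.1 <> q.2].
have fG : finite_set G by apply: finite_setIl; exact: finite_setX.
have [[q0 Gq]|no] := EM (exists q, G q).
  have [q [[Fq1 Fq2] /= nq] min] := @finite_argmin R _ _ (fun q : R * R => `|q.1 - q.2|) q0 fG Gq.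
  exists `|q.1 - q.2|; first by rewrite normr_gt0 subr_eq0; exact/eqP.
  move=> s t Fs Ft; rewrite ltNge => /negP h; apply: contrapT => st.
  by apply/h/(min (s, t)).
exists 1 => // s t Fs Ft _; apply: contrapT => st; apply: no.
by exists (s, t).
Qed.

(** On a compact piece of one geodesic there are finitely many crossing times, so their gaps, the
    denominators of [rate], are bounded below. The bound depends on [p]. *)
Lemma rate_segment_bounded p a b : UT p -> exists2 d, 0 < d &
  (exists2 c, 0 <= c & forall s, a <= s <= b -> rate (Fl s p) <= c) /\
  forall s t, ctimes p s -> ctimes p t -> a <= s < b -> a <= t < b -> `|s - t| < d -> s = t.
Proof.
move=> Up; have [L L0 hL] := nxt_lst_bound; have [c c0 hc] := jump_bound.
have [d d0 hd] := finite_gap (ctimes_finite (a - L) (b + L) Up).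
exists d => //; split; last first.
  move=> s t cs ct /andP[s1 s2] /andP[t1 t2]; apply: hd; split=> //=; apply/andP; split; lra.
exists (c / d); first by rewrite divr_ge0// ltW.
move=> s /andP[s1 s2]; have Us := UT_flow s Up; have [hn hl] := hL _ Us.
have [/ctimes_flow n1 n2 _] := nxtP Us; have [/ctimes_flow l1 l2 _] := lstP Us.
have dl : d <= nxt (Fl s p) - lst (Fl s p).
  rewrite leNgt; apply/negP => h.
  have : s + nxt (Fl s p) = s + lst (Fl s p).
    apply: hd; try (split=> //=; apply/andP; split; lra).
    by rewrite opprD addrACA subrr add0r ger0_norm; lra.
  lra.
rewrite /rate ler_pM//; first exact: (jump_ge0).
- by rewrite invr_ge0; lra.
- exact: hc.
- by rewrite lef_pV2 ?posrE//; exact: (period_gt0 Us).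
Qed.

(** The error is [b / N.+1] times the number of crossings in time [T], which is bounded uniformly in
    [p]; so [N] depends on [b] and [T] only. *)
Lemma riemann_upper : exists2 c, 0 <= c & forall b (T : nat), 0 <= b -> exists N : nat,
  forall p, UT p ->
  \sum_(j < T * N.+1) N.+1%:R^-1 * Num.min (rate (Fl (j.+1%:R / N.+1%:R) p)) b <=
  Csum lq p 0 T%:R + c.
Proof.
have [c c0 hc] := jump_bound; exists (c + 1); first exact: addr_ge0.
move=> b T b0; have [c1 c10 hc1] := Csum_bound T%:R one_wt.
exists (Num.truncn (b * c1)); set N := Num.truncn _.
move=> p Up; have k0 : 0 <= N.+1%:R^-1 :> R by [].
have e : (T * N.+1)%:R * N.+1%:R^-1 = T%:R :> R by rewrite natrM mulfK.
apply: le_trans (sum_upper (T * N.+1) Up k0 b0) _; rewrite e.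
have h1 := saw_ge0 Up; have h2 := le_trans (saw_jump (UT_flow T%:R Up)) (hc _ _ (UT_flow T%:R Up)).
have h3 : N.+1%:R^-1 * b * Csum one p 0 T%:R <= 1.
  rewrite -mulrA ler_pdivrMl// mulr1 (le_trans _ (ltW (truncnS_gt _)))// ler_wpM2l//.
  by apply: hc1; rewrite ?add0r.
move: h1 h2 h3; move: (saw p) (saw _) (Csum lq _ _ _) (_ * Csum _ _ _ _) => x1 x2 x3 x4; lra.
Qed.

(** The mesh is adapted to the geodesic: it must separate the crossing times and beat the bound of
    [rate] along this segment. This is why [N] comes after [p]. *)
Lemma riemann_lower : exists2 c, 0 <= c & forall p (T : nat) e, UT p -> 0 < e ->
  \forall N \near \oo, Csum lq p 0 T%:R - c - e <=
  \sum_(j < T * N.+1) N.+1%:R^-1 * rate (Fl (j.+1%:R / N.+1%:R) p).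
Proof.
have [c c0 hc] := jump_bound; exists c => // p T e Up e0.
have [c1 c10 hc1] := Csum_bound T%:R one_wt.
have [d d0 [[b b0 hb] hd]] := rate_segment_bounded 0 T%:R Up.
near=> N; have N0 : 0 < N.+1%:R :> R by [].
have k0 : 0 <= N.+1%:R^-1 :> R by [].
have eT : (T * N.+1)%:R * N.+1%:R^-1 = T%:R :> R by rewrite natrM mulfK.
have jT j : (j <= T * N.+1)%N -> j%:R * N.+1%:R^-1 <= T%:R :> R.
  by move=> jm; rewrite -eT ler_wpM2r// ler_nat.
have Nd : N.+1%:R^-1 < d by near: N; exact: near_infty_natSinv_lt (PosNum d0).
have Ne : N.+1%:R^-1 < e / (b * c1 + 1).
  near: N; have p1 : 0 < e / (b * c1 + 1) by rewrite divr_gt0// ltr_wpDl// mulr_ge0.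
  exact: near_infty_natSinv_lt (PosNum p1).
have h1 : forall j, (j <= T * N.+1)%N -> rate (Fl (j%:R * N.+1%:R^-1) p) <= b.
  by move=> j jm; apply: hb; rewrite mulr_ge0//= jT.
have h2 : forall j s t, (j < T * N.+1)%N -> ctimes p s -> ctimes p t ->
    j%:R * N.+1%:R^-1 <= s < j.+1%:R * N.+1%:R^-1 ->
    j%:R * N.+1%:R^-1 <= t < j.+1%:R * N.+1%:R^-1 -> s = t.
  move=> j s t jm cs ct /andP[s1 s2] /andP[t1 t2].
  have p1 : 0 <= j%:R * N.+1%:R^-1 :> R by rewrite mulr_ge0.
  have p2 := jT _ jm.
  apply: hd => //; try by apply/andP; split; [exact: le_trans p1 _|exact: lt_le_trans p2].
  rewrite -natr1 mulrDl mul1r in s2 t2.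
  move: s1 t1 s2 t2 Nd; move: (N.+1%:R^-1) (j%:R * _) => y x; move=> s1 t1 s2 t2 Nd.
  by rewrite ltr_norml; apply/andP; split; lra.
have := sum_lower Up k0 b0 h1 h2; rewrite eT => h3.
have h4 := saw_ge0 (UT_flow T%:R Up); have h5 := le_trans (saw_jump Up) (hc _ _ Up).
have h6 : N.+1%:R^-1 * b * Csum one p 0 T%:R <= e.
  apply: (@le_trans _ _ (N.+1%:R^-1 * (b * c1 + 1))).
    rewrite -mulrA ler_wpM2l// ler_wpDr// ler_wpM2l//.
    by apply: hc1 => //; rewrite add0r.
  by rewrite -ler_pdivlMr ?ltW// ltr_wpDl// mulr_ge0.
move: h3 h4 h5 h6; move: (saw p) (saw _) (Csum lq _ _ _) (_ * Csum _ _ _ _) (\sum_(_ < _) _) => x1 x2 x3 x4 x5; lra.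
Unshelve. all: by end_near. Qed.

End Crossings.

Section CompactPositive.

Lemma compact_pos (R : realType) (T : topologicalType) (K : set T) (h : T -> R) :
  compact K -> (forall a, open [set x | a < h x]) -> (forall x, K x -> 0 < h x) ->
  exists2 e, 0 < e & forall x, K x -> e <= h x.
Proof.
move=> /compact_near_coveringP cK oh h0.
have [|k _ hk] := cK nat \oo (fun k x => k.+1%:R^-1 < h x) _.
  move=> x /h0 hx; have [k _ hk] := near_infty_natSinv_lt (PosNum hx).
  exists ([set y | k.+1%:R^-1 < h y], [set m | (k <= m)%N]); first split.
  - by apply: open_nbhs_nbhs; split; [exact: oh|exact: (hk k (leqnn k))].
  - by exists k.
  move=> [y m] [/= hy km]; apply: le_lt_trans hy.
  by rewrite lef_pV2 ?posrE// ler_nat ltnS.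
by exists k.+1%:R^-1; rewrite ?invr_gt0// => x /(hk k (leqnn k))/ltW.
Qed.

End CompactPositive.

(** * A metric on unit vectors, and stability of geodesic segments *)

Section VectorMetric.
Context {R : realType} {g : geometry} {n : nat}.
Notation V := 'rV[R]_n.+2.
Implicit Types (x y z : V) (p q r : V * V) (w : 'M[R]_n.+2).
Notation M := (@model_space R g n).
Notation UT := (@unit_tangent_set R g n).
Notation geo := (@geo R g n).
Notation Fl := (@flow_pair R g n).
Notation C := (@geoC R g).
Notation S := (@geoS R g).
Notation kap := (@kap R g n).

(** Comparing the geodesics at times 0 and 1 gives an isometry-invariant metric for the topology of
    unit vectors, built from [dist] alone. *)
Definition rho p q := dist g p.1 q.1 + dist g (geo p 1) (geo q 1).

Lemma UT_M p : UT p -> M p.1.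
Proof. by case. Qed.
Lemma rho_ge0 p q : UT p -> UT q -> 0 <= rho p q.
Proof. by move=> Up Uq; apply: addr_ge0; apply: dist_ge0; by [exact: UT_M|exact: geoM]. Qed.
Lemma rhoC p q : UT p -> UT q -> rho p q = rho q p.
Proof. by move=> Up Uq; congr (_ + _); apply: distC; by [exact: UT_M|exact: geoM]. Qed.
Lemma rhoxx p : UT p -> rho p p = 0.
Proof. by move=> Up; rewrite /rho !distxx ?addr0//; by [exact: UT_M|exact: geoM]. Qed.

Lemma rho_triangle p q r : UT p -> UT q -> UT r -> rho p r <= rho p q + rho q r.
Proof.
move=> Up Uq Ur; rewrite /rho addrACA; apply: lerD; apply: dist_triangle;
  by [exact: UT_M|exact: geoM].
Qed.

Lemma rho_eq0 p q : UT p -> UT q -> rho p q = 0 -> p = q.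
Proof.
move=> Up Uq /eqP; rewrite paddr_eq0 ?dist_ge0//; try by [exact: UT_M|exact: geoM].
move=> /andP[/eqP/(dist_eq0 (UT_M Up) (UT_M Uq)) e1 /eqP/(dist_eq0 (geoM 1 Up) (geoM 1 Uq))].
rewrite /Geodesic.geo e1 => /addrI/(scalerI _) e2.
rewrite [p]surjective_pairing [q]surjective_pairing e1 e2//.
by rewrite lt0r_neq0// geoS_gt0.
Qed.

Lemma rho_act p q w : isom g w -> UT p -> UT q -> rho (act p w) (act q w) = rho p q.
Proof.
move=> iw Up Uq; rewrite /rho !geo_act /= !(isom_dist iw)//; by [exact: UT_M|exact: geoM].
Qed.

Lemma flow_act t p w : Fl t (act p w) = act (Fl t p) w.
Proof.
rewrite !flow_pairE geo_act /act /=; congr pair.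
by rewrite mulmxBl -!scalemxAl.
Qed.

Lemma rho_flow p s t : UT p -> rho (Fl s p) (Fl t p) = `|s - t| *+ 2.
Proof.
move=> Up; have e u : (Fl u p).1 = geo p u by rewrite flow_pairE.
rewrite /rho !e !geo_flow !dist_geo// mulr2n; congr (_ + `|_|).
by rewrite opprD addrACA subrr addr0.
Qed.

Lemma continuous_geo t : continuous (fun p => geo p t).
Proof.
move=> p; rewrite /Geodesic.geo; apply: cvgD.
  by apply: cvgZl_tmp; exact: cvg_fst.
by apply: cvgZl_tmp; exact: cvg_snd.
Qed.

Lemma continuous_flow t : continuous (Fl t).
Proof.
have c2 : continuous (fun p : V * V => C t *: p.2 - (curv R g * S t) *: p.1).
  move=> p; apply: cvgB; first by apply: cvgZl_tmp; exact: cvg_snd.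
  by apply: cvgZl_tmp; exact: cvg_fst.
rewrite (_ : Fl t = fun p => (geo p t, C t *: p.2 - (curv R g * S t) *: p.1)); last first.
  by apply/funext => p; rewrite flow_pairE.
by move=> p; apply: (cvg_pair (@continuous_geo t p) (c2 p)).
Qed.

Lemma continuous_mulmx w : continuous (fun x : V => x *m w).
Proof.
rewrite (_ : (fun x : V => x *m w) = fun x => \sum_i x ord0 i *: row i w); last first.
  by apply/funext => x; rewrite mulmx_sum_row.
apply: continuous_big; first exact: add_continuous.
have c i : continuous (fun x : V => x ord0 i) by apply: continuous_coord => ?; exact: cvg_id.
by move=> i _ x; apply: (cvgZr_tmp (c i x)).
Qed.

Lemma small_arg (h : R -> R) e : continuous h -> h 0 = 0 -> 0 < e ->
  exists2 d, 0 < d <= 1 & h d < e.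
Proof.
move=> ch h0 e0.
have h1 : \forall x \near 0, h x < e.
  have : \forall y \near h 0, y < e by rewrite h0; exact: lt_nbhsl.
  exact: ch.
have [d /= d0 hd] := h1; exists (Num.min (d / 2) 1).
  by rewrite lt_min ltr01 andbT ge_min lexx orbT andbT divr_gt0.
apply: hd => /=; rewrite sub0r normrN ger0_norm ?le_min ?ler01 ?divr_ge0// ?(ltW d0)//.
rewrite gt_min; apply/orP; left; lra.
Qed.

Lemma continuous_chord2 (c : R) : continuous (fun d : R => c * chord g d ^+ 2).
Proof.
have cs : continuous (fun d : R => S (d / 2)).
  move=> d; apply: (@continuous_comp _ _ _ (fun d : R => d / 2) S).
    by apply: cvgM; [exact: cvg_id|exact: cvg_cst].
  exact: continuous_geoS.
rewrite (_ : (fun d : R => _) = fun d => 4 * c * (S (d / 2) * S (d / 2))); last first.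
  by apply/funext => d; rewrite /chord; ring.
by move=> d; apply: cvgM; [exact: cvg_cst|apply: cvgM; exact: cs].
Qed.

Lemma chord2_0 (c : R) : c * chord g 0 ^+ 2 = 0.
Proof. by rewrite chord0 expr0n mulr0. Qed.

Lemma kap_geo_combination p q (T t : R) :
  S T ^+ 2 * kap (geo p t) (geo q t) =
  S (T - t) ^+ 2 * kap (geo p 0) (geo q 0) + S t ^+ 2 * kap (geo p T) (geo q T) +
  2 * (S (T - t) * S t) * gdot g (geo p 0 - geo q 0) (geo p T - geo q T).
Proof.
have e : S T *: (geo p t - geo q t) =
    S (T - t) *: (geo p 0 - geo q 0) + S t *: (geo p T - geo q T).
  have := geo_combination g p 0 T t; have := geo_combination g q 0 T t.
  rewrite !subr0 scalerBr => -> ->.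
  by apply/rowP => i; rewrite !mxE; ring.
rewrite /Chord.kap.
transitivity (gdot g (S T *: (geo p t - geo q t)) (S T *: (geo p t - geo q t))).
  by rewrite gdotZl gdotZr mulrA expr2.
rewrite e; move: (geo p 0 - geo q 0) (geo p T - geo q T) => a b.
by rewrite !(gdotDl, gdotDr, gdotZl, gdotZr) (gdotC _ b a); ring.
Qed.

Lemma geoC_le u v : 0 <= u -> u <= v -> C u <= C v.
Proof.
move=> u0 uv; rewrite !geoC_double lerD2l lerN2.
have h : S (u / 2) ^+ 2 <= S (v / 2) ^+ 2.
  rewrite ler_sqr ?nnegrE ?geoS_ge0// ?divr_ge0//; last exact: le_trans uv.
  by apply: geoS_le; rewrite ler_pM2r.
by move: h; case: g => /= h; [rewrite mulr0 !mul0r|rewrite mulrN1 !mulNr lerN2 ler_pM2l].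
Qed.

Lemma geoC2_hyp u : g = Hyperbolic -> C u ^+ 2 = 1 + S u ^+ 2.
Proof. by move=> gh; rewrite geoC2 gh /= mulN1r opprK. Qed.

Lemma geoS_le_C u : g = Hyperbolic -> 0 <= u -> S u <= C u.
Proof.
move=> gh u0; rewrite -ler_sqr ?nnegrE ?geoS_ge0//; last exact/ltW/geoC_gt0.
by rewrite geoC2_hyp// lerDr.
Qed.

Lemma geoSS_le_C s t : g = Hyperbolic -> 0 <= s - t -> 0 <= t -> 2 * (S (s - t) * S t) <= C s.
Proof.
move=> gh s0 t0; have -> : C s = C (s - t) * C t + S (s - t) * S t.
  by rewrite -{1}(subrK t s) geoCD gh /= mulN1r opprK.
rewrite mulr_natl mulr2n lerD2r; apply: ler_pM; rewrite ?geoS_ge0//; exact: geoS_le_C.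
Qed.

(** The mixed term equals [C] of the two diagonals minus [2 * C T]. A diagonal is at most [T + d],
    and [C (T + d)] exceeds [C T] by at most [C T * (C d - 1 + S d)]. *)
Lemma gdot_chords p q T d : g = Hyperbolic -> UT p -> UT q -> 0 <= T -> 0 <= d ->
  dist g (geo p 0) (geo q 0) <= d -> dist g (geo p T) (geo q T) <= d ->
  gdot g (geo p 0 - geo q 0) (geo p T - geo q T) <= 2 * (C T * (C d - 1 + S d)).
Proof.
move=> gh Up Uq T0 d0 d1 d2.
have M0 := geoM 0 Up; have M0' := geoM 0 Uq; have MT := geoM T Up; have MT' := geoM T Uq.
have dT r : UT r -> dist g (geo r 0) (geo r T) = T.
  by move=> Ur; rewrite dist_geo// sub0r normrN ger0_norm.
have m1 : dist g (geo p 0) (geo q T) <= T + d.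
  by apply: le_trans (dist_triangle M0 MT MT') _; rewrite dT// lerD2l.
have m2 : dist g (geo q 0) (geo p T) <= T + d.
  apply: le_trans (dist_triangle M0' M0 MT) _; rewrite (dT _ Up) addrC lerD2l (distC M0' M0); exact: d1.
have gm u v : gdot g u v = - model_form g u v by rewrite mform_E gh opprK.
have -> : gdot g (geo p 0 - geo q 0) (geo p T - geo q T) =
    C (dist g (geo p 0) (geo q T)) + C (dist g (geo q 0) (geo p T)) - 2 * C T.
  rewrite -(mform_dist M0 MT') -(mform_dist M0' MT).
  have := mform_dist M0 MT; have := mform_dist M0' MT'; rewrite !dT//.
  move: (geo p 0) (geo p T) (geo q 0) (geo q T) (C T) => x y z t c e1 e2.
  rewrite !(gdotDl, gdotDr, gdotNl) !(gdotC g _ (- _)) !gdotNl !gm.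
  rewrite (mformC g t z) (mformC g t x) e1 e2; ring.
have := geoC_le (dist_ge0 M0 MT') m1; have := geoC_le (dist_ge0 M0' MT) m2.
have : C (T + d) <= C T * C d + C T * S d.
  have cu : curv R g = -1 by rewrite gh.
  by rewrite geoCD cu mulN1r opprK lerD2l ler_wpM2r ?geoS_ge0// geoS_le_C.
rewrite !mulrDr mulrN1.
move: (C T * C d) (C T * S d) (C T) (C (T + d)) (C (dist _ _ _)) (C (dist _ _ _)) => *; lra.
Qed.

Lemma gdot_euclid x y (b : R) : g = Euclidean -> gdot g x x <= b -> gdot g y y <= b ->
  gdot g x y <= b.
Proof.
move=> ge; have := sdot_ge0 (x - y).
have gs u v : sdot u v = gdot g u v by rewrite /Defs.gdot ge mul0r addr0.
by rewrite gs !(gdotDl, gdotDr, gdotNl) !(gdotC g _ (- y)) !gdotNl (gdotC g y x); lra.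
Qed.

(** The bound is independent of the length [T]. In the hyperbolic case the mixed term carries
    [2 * (S (T - t) * S t) <= C T], which the division by [S T ^+ 2] compensates; [1 <= T] keeps
    [C T / S T] bounded, whence the constant with [S 1]. *)
Lemma geodesics_kap p q T t d : UT p -> UT q -> 1 <= T -> 0 <= t <= T -> 0 <= d ->
  dist g (geo p 0) (geo q 0) <= d -> dist g (geo p T) (geo q T) <= d ->
  kap (geo p t) (geo q t) <=
  4 * chord g d ^+ 2 + 2 * (1 + (S 1 ^+ 2)^-1) * (C d - 1 + S d).
Proof.
move=> Up Uq T1 /andP[t0 tT] d0 d1 d2.
have M0 := geoM 0 Up; have M0' := geoM 0 Uq; have MT := geoM T Up; have MT' := geoM T Uq.
have kle x y : M x -> M y -> dist g x y <= d -> kap x y <= chord g d ^+ 2.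
  by move=> Mx My dx; have [x0 ->] := dist_spec Mx My; rewrite chord_le.
have k0 := kle _ _ M0 M0' d1; have kT := kle _ _ MT MT' d2.
have T0 : 0 < T by exact: lt_le_trans T1.
have sT : 0 < S T by exact: geoS_gt0.
have s1 : 0 < S 1 by exact: geoS_gt0.
have sd : 0 <= S d by exact: geoS_ge0.
have cd := geoC_ge1 g d.
have a0 : 0 <= S (T - t) by apply: geoS_ge0; rewrite subr_ge0.
have b0 : 0 <= S t by exact: geoS_ge0.
have aT : S (T - t) <= S T by apply: geoS_le; rewrite gerBl.
have bT : S t <= S T by exact: geoS_le.
rewrite -(ler_pM2l (exprn_gt0 2 sT)) (kap_geo_combination p q T t).
set G := gdot g _ _; set X := chord g d ^+ 2 in k0 kT *.
have X0 : 0 <= X by exact: sqr_ge0.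
have h1 : S (T - t) ^+ 2 * kap (geo p 0) (geo q 0) <= S T ^+ 2 * X.
  apply: (@le_trans _ _ (S (T - t) ^+ 2 * X)); first by rewrite ler_wpM2l ?sqr_ge0.
  by rewrite ler_wpM2r// ler_sqr ?nnegrE// ltW.
have h2 : S t ^+ 2 * kap (geo p T) (geo q T) <= S T ^+ 2 * X.
  apply: (@le_trans _ _ (S t ^+ 2 * X)); first by rewrite ler_wpM2l ?sqr_ge0.
  by rewrite ler_wpM2r// ler_sqr ?nnegrE// ltW.
set E := C d - 1 + S d; set K := 1 + (S 1 ^+ 2)^-1.
have E0 : 0 <= E by rewrite /E addr_ge0// subr_ge0.
have K0 : 0 <= K by rewrite addr_ge0// invr_ge0 sqr_ge0.
have ab0 : 0 <= S (T - t) * S t by exact: mulr_ge0.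
suff h3 : 2 * (S (T - t) * S t) * G <= S T ^+ 2 * (2 * X) + S T ^+ 2 * (2 * K * E).
  have -> : S T ^+ 2 * (4 * X + 2 * K * E) = S T ^+ 2 * X + S T ^+ 2 * X +
      (S T ^+ 2 * (2 * X) + S T ^+ 2 * (2 * K * E)) by ring.
  by apply: lerD => //; exact: lerD.
have p1 : 0 <= S T ^+ 2 * (2 * X) by rewrite mulr_ge0 ?sqr_ge0// mulr_ge0.
have p2 : 0 <= S T ^+ 2 * (2 * K * E) by rewrite mulr_ge0 ?sqr_ge0// mulr_ge0// mulr_ge0.
have [ge|gh] := geoP g.
  apply: (@le_trans _ _ (S T ^+ 2 * (2 * X))); last by rewrite lerDl.
  have GX : G <= X.
    exact: gdot_euclid ge k0 kT.
  have [G0|G0] := leP G 0.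
    by apply: le_trans p1; rewrite mulr_ge0_le0// mulr_ge0.
  rewrite [leRHS]mulrA [S T ^+ 2 * 2]mulrC; apply: ler_pM => //; rewrite ?mulr_ge0 ?(ltW G0)//.
  by rewrite ler_wpM2l// expr2; exact: ler_pM.
apply: (@le_trans _ _ (S T ^+ 2 * (2 * K * E))); last by rewrite lerDr.
have CT0 := geoC_gt0 g T.
have GE : G <= 2 * (C T * E) := gdot_chords gh Up Uq (ltW T0) d0 d1 d2.
have CS2 := geoC2_hyp T gh.
have ab : 2 * (S (T - t) * S t) <= C T.
  by apply: geoSS_le_C => //; rewrite subr_ge0.
apply: (@le_trans _ _ (2 * (S (T - t) * S t) * (2 * (C T * E)))).
  by rewrite ler_wpM2l// mulr_ge0.
apply: (@le_trans _ _ (C T * (2 * (C T * E)))).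
  by rewrite ler_wpM2r// mulr_ge0// mulr_ge0// ltW.
have -> : C T * (2 * (C T * E)) = C T ^+ 2 * (2 * E) by ring.
have -> : S T ^+ 2 * (2 * K * E) = S T ^+ 2 * K * (2 * E) by ring.
rewrite ler_wpM2r ?mulr_ge0// CS2 /K mulrDr mulr1 addrC lerD2l.
rewrite ler_pdivlMr ?exprn_gt0// mul1r ler_sqr ?nnegrE ?(ltW s1) ?(ltW sT)//.
exact: geoS_le.
Qed.

Lemma geodesics_close e : 0 < e -> exists2 d, 0 < d & forall p q T t, UT p -> UT q ->
  1 <= T -> 0 <= t <= T -> dist g (geo p 0) (geo q 0) <= d ->
  dist g (geo p T) (geo q T) <= d -> dist g (geo p t) (geo q t) < e.
Proof.
move=> e0; pose K : R := 2 * (1 + (S 1 ^+ 2)^-1).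
pose h (d : R) := 4 * chord g d ^+ 2 + K * (C d - 1 + S d).
have ch : continuous h.
  move=> d; apply: cvgD; first exact: continuous_chord2.
  apply: cvgM; first exact: cvg_cst.
  apply: cvgD; last exact: continuous_geoS.
  by apply: cvgB; [exact: continuous_geoC|exact: cvg_cst].
have h0 : h 0 = 0 by rewrite /h chord2_0 geoC0 geoS0 subrr addr0 mulr0 addr0.
have X0 : 0 < chord g e ^+ 2 by rewrite exprn_gt0// -(chord0 g) chord_lt.
have [d /andP[d0 _] hd] := small_arg ch h0 X0.
exists d => // p q T t Up Uq T1 tT d1 d2.
rewrite -kap_lt_dist ?(ltW e0)//; try exact: geoM.
by apply: le_lt_trans (geodesics_kap Up Uq T1 tT (ltW d0) d1 d2) hd.
Qed.

(** The ball is cut out by the polynomial [kap], continuous on the whole ambient space, as a union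
    over the ways of sharing [e] between the two footpoints. *)
Lemma rho_lt_open p e : UT p -> exists2 O : set (V * V), open O &
  forall q, UT q -> (O q <-> rho p q < e).
Proof.
move=> Up; exists (\bigcup_(a in [set a | 0 < a < e])
  ([set q | kap p.1 q.1 < chord g a ^+ 2] `&`
   [set q | kap (geo p 1) (geo q 1) < chord g (e - a) ^+ 2])).
  apply: bigcup_open => a _; apply: openI.
    apply: (@open_comp _ _ (fun q => kap p.1 q.1) [set t | t < chord g a ^+ 2]).
      by move=> q _; apply: continuous_kap => ?; [exact: cst_continuous|exact: cvg_fst].
    exact: open_lt.
  apply: (@open_comp _ _ (fun q => kap (geo p 1) (geo q 1)) [set t | t < chord g (e - a) ^+ 2]).
    by move=> q _; apply: continuous_kap => ?; [exact: cst_continuous|exact: continuous_geo].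
  exact: open_lt.
move=> q Uq; have M1 := UT_M Up; have M2 := UT_M Uq; have M3 := geoM 1 Up; have M4 := geoM 1 Uq.
have d1 := dist_ge0 M1 M2; have d2 := dist_ge0 M3 M4; rewrite /rho; split.
  move=> [a /andP[a0 ae] /= []].
  rewrite !kap_lt_dist ?(ltW a0) ?subr_ge0 ?(ltW ae)//; lra.
move=> h; exists ((e + dist g p.1 q.1 - dist g (geo p 1) (geo q 1)) / 2).
  by apply/andP; split; lra.
by split; rewrite /= kap_lt_dist//; lra.
Qed.

(** Outside [U], in a compact ball of unit vectors, the continuous function [h] is bounded away from
    0. *)
Lemma rho_nbhs p (U : set (V * V)) : UT p -> open U -> U p ->
  exists2 e, 0 < e & forall q, UT q -> rho p q < e -> U q.
Proof.
move=> Up oU Uxp; pose h q : R := kap p.1 q.1 + kap (geo p 1) (geo q 1).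
have ch : continuous h.
  have c1 : continuous (fun q : V * V => kap p.1 q.1).
    by apply: continuous_kap => ?; [exact: cst_continuous|exact: cvg_fst].
  have c2 : continuous (fun q : V * V => kap (geo p 1) (geo q 1)).
    by apply: continuous_kap => ?; [exact: cst_continuous|exact: continuous_geo].
  by move=> q; apply: cvgD; [exact: c1|exact: c2].
have kap0 x y : M x -> M y -> 0 <= kap x y.
  by move=> Mx My; have [_ ->] := dist_spec Mx My; exact: sqr_ge0.
have kapE x y : M x -> M y -> kap x y = 0 -> x = y.
  move=> Mx My; have [d0 ->] := dist_spec Mx My => /eqP; rewrite sqrf_eq0 => /eqP h0.
  apply/(dist_eq0 Mx My)/le_anti; rewrite d0 andbT leNgt; apply/negP => d1.
  by move: (chord_lt g d1); rewrite h0 chord0 ltxx.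
have [|||e e0 he] := @compact_pos R _ (ballUT g (dist g basept p.1 + 1) `\` U) h.
- apply: compact_closedI; first exact: compact_ballUT.
  exact: open_closedC.
- move=> a; apply: (@open_comp _ _ h [set t | a < t]); last exact: open_gt.
  by move=> q _; exact: ch.
- move=> q [[Uq _] nUq]; have k1 := kap0 _ _ (UT_M Up) (UT_M Uq).
  have k2 := kap0 _ _ (geoM 1 Up) (geoM 1 Uq).
  rewrite lt_def addr_ge0// andbT; apply/eqP => /eqP; rewrite paddr_eq0//.
  move=> /andP[/eqP/(kapE _ _ (UT_M Up) (UT_M Uq)) e1 /eqP/(kapE _ _ (geoM 1 Up) (geoM 1 Uq)) e2].
  apply: nUq; rewrite -(rho_eq0 Up Uq)// /rho e1 e2 !distxx ?addr0//; by [exact: UT_M|exact: geoM].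
have [d d0 [d1 hd]] : exists2 d, 0 < d & d <= 1 /\ 2 * chord g d ^+ 2 < e.
  have [d /andP[d0 d1] hd] := small_arg (@continuous_chord2 2) (chord2_0 2) e0.
  by exists d.
exists d => // q Uq hq.
have M1 := UT_M Up; have M2 := UT_M Uq; have M3 := geoM 1 Up; have M4 := geoM 1 Uq.
have k1 := dist_ge0 M1 M2; have k2 := dist_ge0 M3 M4.
apply: contrapT => nUq; have /he : (ballUT g (dist g basept p.1 + 1) `\` U) q.
  split=> //; split=> //; split=> //.
  apply: le_trans (dist_triangle (@M_basept R g n) M1 M2) _.
  by rewrite lerD2l; apply: le_trans d1; move: hq; rewrite /rho; lra.
apply/negP; rewrite -ltNge; apply: lt_trans hd.
have h1 : kap p.1 q.1 < chord g d ^+ 2.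
  by rewrite kap_lt_dist ?(ltW d0)//; move: hq; rewrite /rho; lra.
have h2 : kap (geo p 1) (geo q 1) < chord g d ^+ 2.
  by rewrite kap_lt_dist ?(ltW d0)//; move: hq; rewrite /rho; lra.
by rewrite /h; lra.
Qed.

End VectorMetric.

(** * The quotient T^1 Y: lifts, topology, compactness *)

Section QuotientMetric.
Context {R : realType} {g : geometry} {n : nat} {P : coxeter_polyhedron R g n}.
Context {W' : matrix_group R n} {K : polyhedral_complex P}.
Context {A : set (cplx_point K)} {f : 'rV[R]_n.+2 -> cplx_point K}.
Notation V := 'rV[R]_n.+2.
Implicit Types (p q r : V * V) (w : 'M[R]_n.+2) (s t e : R).
Notation W := (coxeter_group P).
Notation UT := (@unit_tangent_set R g n).
Notation ut := (unit_tangent R g n).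
Notation Fl := (@flow_pair R g n).
Notation rho := (@rho R g n).
Notation Y := (T1Y g W').
Implicit Types (a : Y) (C D O : set Y).
Hypotheses (fA : tessellation_isometry f A) (W'sub : W' `<=` W) (W'fin : finite_index W' W).

Lemma W'_isom w : mgroup_set W' w -> isom g w.
Proof. by move=> /W'sub; exact: W_isom. Qed.

Definition lft a : V * V := val (repr a).

Definition toUT p : ut := insubd (point : ut) p.

(** Defined on all pairs of vectors, with a junk value outside the unit tangent set, so that lifts
    can be handled as plain pairs. *)
Definition prj p : Y := \pi_Y%qT (toUT p).

Lemma valUT (u : ut) : UT (val u).
Proof. exact: set_mem (valP u). Qed.
Lemma toUTK p : UT p -> val (toUT p) = p.
Proof. by move=> Up; rewrite /toUT val_insubd mem_set. Qed.
Lemma toUT_val (u : ut) : toUT (val u) = u.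
Proof. by apply: val_inj; rewrite toUTK//; exact: valUT. Qed.
Lemma UT_lft a : UT (lft a).
Proof. exact: valUT. Qed.
Lemma prj_lft a : prj (lft a) = a.
Proof. by rewrite /prj toUT_val reprK. Qed.
Lemma prj_val (u : ut) : prj (val u) = \pi_Y%qT u.
Proof. by rewrite /prj toUT_val. Qed.

Lemma prj_eq p q : UT p -> UT q ->
  prj p = prj q <-> exists2 w, mgroup_set W' w & q = act p w.
Proof.
move=> Up Uq; have E : reflect (prj p = prj q) (same_orbit W' (toUT p) (toUT q)).
  exact: (@eqmodP _ (same_orbit_equiv g W')).
split.
  by move=> /E/asboolP[w Ww]; rewrite !toUTK// => ->; exists w.
by move=> [w Ww e]; apply/E/asboolP; exists w; rewrite // !toUTK.
Qed.

Lemma prj_act p w : mgroup_set W' w -> UT p -> prj (act p w) = prj p.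
Proof.
move=> Ww Up; apply/esym/prj_eq => //; last by exists w.
exact: isom_UT (W'_isom Ww) Up.
Qed.

Lemma quotient_flow_prj t p : UT p -> quotient_flow t (prj p : borel_T1Y g W') = prj (Fl t p).
Proof.
move=> Up; have [w Ww e] := (prj_eq Up (UT_lft (prj p))).1 (esym (prj_lft _)).
rewrite /quotient_flow -prj_val /= -/(lft (prj p)) e flow_act prj_act//.
exact: UT_flow.
Qed.

Lemma quotient_flowE t a : quotient_flow t (a : borel_T1Y g W') = prj (Fl t (lft a)).
Proof. by rewrite -{1}(prj_lft a) quotient_flow_prj//; exact: UT_lft. Qed.

Lemma quotient_flowD s t a :
  quotient_flow s (quotient_flow t (a : borel_T1Y g W')) = quotient_flow (t + s) (a : borel_T1Y g W').
Proof.
rewrite (quotient_flowE t) quotient_flow_prj ?flowD ?quotient_flowE//.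
by apply: UT_flow; exact: UT_lft.
Qed.

Lemma quotient_flow0 a : quotient_flow 0 (a : borel_T1Y g W') = a.
Proof. by rewrite quotient_flowE flow0 prj_lft. Qed.

Lemma open_prj O : open O <-> exists2 U : set (V * V), open U &
  forall p, UT p -> (U p <-> O (prj p)).
Proof.
split.
  move=> [U oU eU]; exists U => // p Up.
  have : (set_val @^-1` U) (toUT p) <-> (\pi_Y%qT @^-1` O) (toUT p) by rewrite eU.
  by rewrite /= set_valE toUTK.
move=> [U oU eU]; exists U => //; apply/seteqP; split=> u /=.
  by move=> Uu; rewrite -prj_val; apply/eU => //; exact: valUT.
by rewrite -prj_val => /eU; apply; exact: valUT.
Qed.

Lemma open_rho O : (forall p, UT p -> O (prj p) -> exists2 e, 0 < e &
  forall q, UT q -> rho p q < e -> O (prj q)) -> open O.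
Proof.
move=> h; apply/open_prj.
exists (\bigcup_(U in [set U : set (V * V) | open U /\ forall q, UT q -> U q -> O (prj q)]) U).
  by apply: bigcup_open => U [].
move=> p Up; split; first by move=> [U [_ hU] Uxp]; exact: hU.
move=> Op; have [e e0 he] := h p Up Op; have [U oU hU] := rho_lt_open e Up.
exists U; last by apply/hU => //; rewrite rhoxx.
by split=> // q Uq /(hU q Uq); exact: he.
Qed.

Lemma rho_open O p : open O -> UT p -> O (prj p) -> exists2 e, 0 < e &
  forall q, UT q -> rho p q < e -> O (prj q).
Proof.
move=> /open_prj[U oU hU] Up /(hU p Up) Uxp; have [e e0 he] := rho_nbhs Up oU Uxp.
by exists e => // q Uq /he -/(_ Uq)/(hU q Uq).
Qed.

(** Distance to [C] in the quotient, cut off at 1 so that it makes sense for empty [C]. Its sublevel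
    sets are the balls and neighbourhoods used on T^1 Y. *)
Definition dset C a : R :=
  inf ([set 1] `|` [set d | exists q, [/\ UT q, C (prj q) & d = rho (lft a) q]]).

Lemma dset_lb C a : has_lbound ([set 1] `|`
  [set d | exists q, [/\ UT q, C (prj q) & d = rho (lft a) q]]).
Proof.
exists 0 => d [->//|[q [Uq _ ->]]]; apply: rho_ge0 => //; exact: UT_lft.
Qed.

Lemma dset_ge0 C a : 0 <= dset C a.
Proof.
apply: lb_le_inf; first by exists 1; left.
by move=> d [->//|[q [Uq _ ->]]]; apply: rho_ge0 => //; exact: UT_lft.
Qed.

Lemma dset_le1 C a : dset C a <= 1.
Proof. by apply: ge_inf; [exact: dset_lb|left]. Qed.

Lemma dset_le C p q : UT p -> UT q -> C (prj q) -> dset C (prj p) <= rho p q.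
Proof.
move=> Up Uq Cq; apply: ge_inf; first exact: dset_lb.
have [w Ww e] := (prj_eq Up (UT_lft (prj p))).1 (esym (prj_lft _)).
right; exists (act q w); split; first exact: isom_UT (W'_isom Ww) Uq.
  by rewrite prj_act.
by rewrite e (rho_act (W'_isom Ww)).
Qed.

Lemma dset_lt C p e : UT p -> dset C (prj p) < e -> e <= 1 ->
  exists q, [/\ UT q, C (prj q) & rho p q < e].
Proof.
move=> Up h e1; have := inf_lt _ h; case.
  by exists 1; left.
move=> d [->|[q [Uq Cq ->]]] de; first by rewrite ltNge e1 in de.
have [w Ww ep] := (prj_eq (UT_lft (prj p)) Up).1 (prj_lft _).
exists (act q w); split; first exact: isom_UT (W'_isom Ww) Uq.
  by rewrite prj_act.
by rewrite ep (rho_act (W'_isom Ww))//; exact: UT_lft.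
Qed.

Lemma dset_lip C p q : UT p -> UT q -> dset C (prj p) <= dset C (prj q) + rho p q.
Proof.
move=> Up Uq; rewrite leNgt; apply/negP => h.
pose e := dset C (prj p) - rho p q.
have e1 : e <= 1 by rewrite lerBlDr; apply: le_trans (dset_le1 C _) _; rewrite lerDl rho_ge0.
have he : dset C (prj q) < e by rewrite ltrBrDr.
have [r [Ur Cr qr]] := dset_lt Uq he e1.
have h1 := rho_triangle Up Uq Ur; have h2 := dset_le Up Ur Cr.
have : dset C (prj p) < dset C (prj p).
  apply: le_lt_trans h2 _; apply: le_lt_trans h1 _.
  by rewrite addrC -ltrBrDr.
by rewrite ltxx.
Qed.

Lemma dset_lt_open C e : open [set a | dset C a < e].
Proof.
apply: open_rho => p Up /= h; exists (e - dset C (prj p)); first by rewrite subr_gt0.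
move=> q Uq hq; apply: le_lt_trans (dset_lip C Uq Up) _.
by rewrite addrC -ltrBrDr rhoC.
Qed.

Lemma dset_gt_open C e : open [set a | e < dset C a].
Proof.
apply: open_rho => p Up /= h; exists (dset C (prj p) - e); first by rewrite subr_gt0.
move=> q Uq; rewrite ltrBrDr addrC -ltrBrDr => hq; apply: lt_le_trans hq _.
by rewrite lerBlDr; exact: dset_lip.
Qed.

Lemma dset_in C a : C a -> dset C a = 0.
Proof.
move=> Ca; apply/le_anti; rewrite dset_ge0 andbT -{1}(prj_lft a).
by rewrite -(rhoxx (UT_lft a)); apply: dset_le; rewrite ?prj_lft//; exact: UT_lft.
Qed.

Lemma dset_gt0 C a : closed C -> ~ C a -> 0 < dset C a.
Proof.
move=> cC nCa; rewrite lt_def dset_ge0 andbT; apply/eqP => d0.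
have oC : open (~` C) by exact: closed_openC.
have [|e e0 he] := rho_open (p := lft a) oC (UT_lft a); first by rewrite prj_lft.
have [||q [Uq Cq]] := @dset_lt C (lft a) (Num.min e 1) (UT_lft a).
- by rewrite prj_lft d0 lt_min e0 ltr01.
- by rewrite ge_min lexx orbT.
by rewrite lt_min => /andP[/(he _ Uq)].
Qed.

(** Finite index: if [w] is the tile of [p] and [w^-1 = a * d] with [d] among finitely many
    representatives, then [a] moves [p] into the tile [d^-1]. *)
Lemma lft_bounded : exists r : R, forall p, UT p ->
  exists2 w, mgroup_set W' w & ballUT g r (act p w).
Proof.
have [D [fD DW] hD] := W'fin; have [d0 d00 hd] := @tile_diam R g n P.
have [_ [d1 [_ Dd1 _]]] := hD _ (@W1 R g n P).
have Mb := @M_basept R g n.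
pose F d := - dist g basept (ctr P d^-1).
have [dm Ddm hm] := @finite_argmin R _ D F d1 fD Dd1.
exists (d0 + dist g basept (ctr P dm^-1)) => p Up.
have [w Ww tw] := tile_cover fA (UT_M Up).
have [a [d [Wa Dd e]]] := hD _ (WV Ww).
have Wd := DW _ Dd; have WaW := W'sub Wa.
have ew : w = d^-1 * a^-1.
  by rewrite -[w]invrK e invrM//; [exact: W_unit WaW|exact: W_unit Wd].
exists a => //; have Ua := isom_UT (W'_isom Wa) Up; split=> //; split; first exact: UT_M.
have tp : tile P d^-1 (act p a).1.
  have -> : d^-1 = w * a by rewrite ew -mulrA mulVr ?mulr1//; exact: W_unit WaW.
  exact/tile_mul.
apply: le_trans (dist_triangle Mb (ctr_M (WV Wd)) (UT_M Ua)) _; rewrite addrC; apply: lerD.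
  by rewrite (distC (ctr_M (WV Wd)) (UT_M Ua)); exact: (hd _ _ (WV Wd) tp).
by rewrite -lerN2; exact: hm.
Qed.

Lemma compact_Y : compact [set: Y].
Proof.
apply/compact_near_coveringP => I F Q FF h.
have [r hr] := lft_bounded.
have /compact_near_coveringP := @compact_ballUT R g n r.
move=> nc; have : F [set i | ballUT g r `<=` fun p => UT p -> Q i (prj p)].
  apply: (nc I F (fun i p => UT p -> Q i (prj p)) FF).
  move=> p [Up Bp]; have [[A1 B1] /= [nA FB] hAB] := h (prj p) Logic.I.
  move: nA; rewrite nbhsE; case=> U1 [oU1 Uxp1] UA1.
  have /open_prj[U oU hU] := oU1.
  exists (U, B1); first by split=> //=; apply: open_nbhs_nbhs; split=> //; exact/hU.
  move=> [q i] /= [Uq Bi] UTq; apply: (hAB (prj q, i)); split=> //=.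
  by apply: UA1; exact/hU.
apply: filterS => i hO a _.
have [w Ww [Uw Bw]] := hr _ (UT_lft a).
rewrite -(prj_lft a) -(prj_act Ww (UT_lft a)).
by apply: hO => //.
Qed.

Lemma closed_separated C D : closed C -> closed D -> C `&` D = set0 ->
  exists2 e, 0 < e & forall p q, UT p -> UT q -> C (prj p) -> D (prj q) -> e <= rho p q.
Proof.
move=> cC cD CD.
have [|||e e0 he] := @compact_pos R Y C (dset D).
- by apply: (subclosed_compact cC compact_Y).
- by move=> e; exact: dset_gt_open.
- move=> a Ca; apply: dset_gt0 => // Da.
  by have : (C `&` D) a by []; rewrite CD.
by exists e => // p q Up Uq Cp Dq; apply: le_trans (he _ Cp) (dset_le _ _ _).
Qed.

Lemma continuous_quotient_flow t : continuous (quotient_flow t : Y -> Y).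
Proof.
apply/continuousP => O /open_prj[U oU hU]; apply/open_prj.
exists (Fl t @^-1` U); first by apply: open_comp => // p _; exact: continuous_flow.
move=> p Up; rewrite /= quotient_flow_prj//; apply: hU; exact: UT_flow.
Qed.

End QuotientMetric.

(** * Measurability of the crossing functions *)

Section RateMeasurable.
Context {R : realType} {g : geometry} {n : nat} {P : coxeter_polyhedron R g n} {B : building P}.
Notation V := 'rV[R]_n.+2.
Implicit Types (x y : V) (p : V * V) (w : 'M[R]_n.+2).
Notation W := (coxeter_group P).
Notation nrm := (facet_normal P).
Notation tform := (@tform R g n P).
Notation ap := (apartment B).
Hypothesis regB : regular_building B.
Variables (A : set (cplx_point B)) (f : V -> cplx_point B).
Hypotheses (apA : ap A) (fA : tessellation_isometry f A).
Notation UT := (@unit_tangent_set R g n).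
Notation geo := (@geo R g n).
Notation wsep := (@wsep R g n P).
Notation wt_ok := (@wt_ok R g n P).
Notation ctimes := (@ctimes R g n P).
Notation jump := (@jump R g n P B f).
Notation lq := (@lq R g n P B f).
Notation nxt := (@nxt R g n P).
Notation lst := (@lst R g n P).
Notation rate := (@rate R g n P B f).
Notation rho := (@rho R g n).
Notation one := (fun=> 1).
Context {W' : matrix_group R n}.
Hypothesis W'sub : W' `<=` W.
Notation Y := (T1Y g W').
Notation bY := (borel_T1Y g W').
Notation lft := (@lft R g n W').
Notation prj := (@prj R g n W').
Implicit Types (H : set V) (s t a b e : R) (wt : set V -> R).

(** Being separated by a wall is an open condition on the geodesic, so these sums are lower
    semicontinuous; the crossing times and the jump are recovered from them by countable
    operations. *)
Definition Gsum wt a b p := wsum wt (wsep (geo p a) (geo p b)).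

Lemma Gsum_act wt a b p w : wt_ok wt -> W w -> UT p ->
  Gsum wt a b (act p w) = Gsum wt a b p.
Proof.
move=> ok Ww Up; rewrite /Gsum !geo_act wsep_hmul//; try exact: geoM.
by rewrite (wsum_hmul ok Ww)// => H [].
Qed.

Lemma lft_prj p : UT p -> exists2 w, mgroup_set W' w & lft (prj p) = act p w.
Proof. by move=> Up; apply/(prj_eq Up (UT_lft _)); rewrite prj_lft. Qed.

Lemma Gsum_lft wt a b p : wt_ok wt -> UT p -> Gsum wt a b (lft (prj p)) = Gsum wt a b p.
Proof.
move=> ok Up; have [w Ww ->] := lft_prj Up; apply: Gsum_act => //; exact: W'sub.
Qed.

Lemma sep_rho_open p w i a b : UT p -> W w ->
  tform w i (geo p a) * tform w i (geo p b) < 0 -> exists2 e, 0 < e &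
  forall q, UT q -> rho p q < e -> tform w i (geo q a) * tform w i (geo q b) < 0.
Proof.
move=> Up Ww h.
have ct s : continuous (fun q : V * V => tform w i (geo q s)).
  have := @continuous_lform R n _ (nrm i) (fun q : V * V => geo q s *m w^-1); apply.
  move=> q; apply: (@continuous_comp _ _ _ (fun q : V * V => geo q s) (fun x : V => x *m w^-1)).
    exact: continuous_geo.
  exact: continuous_mulmx.
pose U := [set q : V * V | tform w i (geo q a) * tform w i (geo q b) < 0].
have oU : open U.
  apply: (@open_comp _ _ (fun q : V * V => tform w i (geo q a) * tform w i (geo q b)) [set t | t < 0]).
    by move=> q _; apply: cvgM; exact: ct.
  exact: open_lt.
have [e e0 he] := rho_nbhs Up oU h.
by exists e.
Qed.

Lemma Gsum_open wt a b beta : wt_ok wt -> open [set y | beta < Gsum wt a b (lft y)].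
Proof.
move=> ok; apply: open_rho => p Up /= hb.
have e1 : Gsum wt a b (lft (prj p)) = Gsum wt a b p by exact: Gsum_lft.
rewrite e1 in hb; clear e1.
pose Q H e := forall q, UT q -> rho p q < e -> wsep (geo q a) (geo q b) H.
have [|||e e0 he] := @finite_radius R _ (wsep (geo p a) (geo p b)) Q.
- exact: (wsep_finite fA (geoM a Up) (geoM b Up)).
- by move=> H s t h st q Uq pq; apply: h => //; exact: lt_le_trans st.
- move=> H [[w [i [Ww eH]]] s]; rewrite eH in s *.
  move: s => /(sepE i Ww (geoM a Up) (geoM b Up))/(sep_rho_open Up Ww)[e e0 he].
  exists e => // q Uq pq; split; first by exists w, i.
  by apply/(sepE i Ww (geoM a Uq) (geoM b Uq)); exact: he.
exists e; first exact: e0.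
move=> q Uq pq /=; have -> : Gsum wt a b (lft (prj q)) = Gsum wt a b q by exact: Gsum_lft.
refine (lt_le_trans hb _).
apply: (wsum_le ok); first exact: (wsep_finite fA (geoM a Uq) (geoM b Uq)).
by move=> H /he; exact.
Qed.

Lemma measurable_open (O : set bY) : @open Y O -> measurable O.
Proof. exact: sub_sigma_algebra. Qed.

Lemma measurable_gt (h : bY -> R) :
  (forall a, measurable [set y | a < h y]) -> measurable_fun setT h.
Proof.
move=> mh mD; apply: (measurability _ (RGenOInfty.measurableE R)) => //.
by move=> /= _ [_ [x ->] <-]; rewrite preimage_itvoy setTI; exact: mh.
Qed.

Lemma measurable_lt (h : bY -> R) :
  (forall a, measurable [set y | h y < a]) -> measurable_fun setT h.
Proof.
move=> mh mD; apply: (measurability _ (RGenInftyO.measurableE R)) => //.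
by move=> /= _ [_ [x ->] <-]; rewrite preimage_itvNyo setTI; exact: mh.
Qed.

Lemma measurable_Gsum wt a b : wt_ok wt -> measurable_fun setT (fun y : bY => Gsum wt a b (lft y)).
Proof. by move=> ok; apply: measurable_gt => c; apply: measurable_open; exact: Gsum_open. Qed.

Lemma crossing_measurable a b :
  measurable [set y : bY | exists2 t, a < t < b & ctimes (lft y) t].
Proof.
have [ab|ba] := ltP a b; last first.
  rewrite (_ : [set y | _] = classical_sets.set0)//; apply/seteqP; split=> // y [t /andP[h1 h2]].
  by move: (lt_trans h1 h2); rewrite ltNge ba.
rewrite (_ : [set y | _] = [set y : bY | 0 < Gsum one a b (lft y)]).
  by apply: measurable_open; apply: Gsum_open; exact: one_ok.
apply/seteqP; split=> y /=; have Uy := UT_lft y; rewrite /Gsum (wsep_cross Uy ab).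
  move=> [t tab [H ct]]; apply: lt_le_trans ltr01 _; rewrite -[leLHS](wsum1 one H).
  apply: (wsum_le (one_ok (P := P))); last by move=> _ ->; exists t.
  by rewrite -(wsep_cross Uy ab); exact: (wsep_finite fA (geoM a Uy) (geoM b Uy)).
move=> pos; have [hex|no] := EM (exists H, exists2 t : R, a < t < b & cross (P := P) (lft y) H t).
  by have [H [t tab ct]] := hex; exists t => //; exists H.
exfalso; move: pos; rewrite (_ : [set H | _] = classical_sets.set0) ?wsum0 ?ltxx//.
by apply/seteqP; split=> // H h; apply: no; exists H.
Qed.

Lemma measurable_lst : measurable_fun setT (fun y : bY => lst (lft y)).
Proof.
apply: measurable_gt => a.
rewrite (_ : [set y | _] = [set y : bY | exists2 t, a < t < 0 & ctimes (lft y) t]).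
  exact: crossing_measurable.
apply/seteqP; split=> y /=; have [c1 c2 c3] := lstP fA (UT_lft y).
  by move=> h; exists (lst (lft y)) => //; rewrite h.
by move=> [t /andP[h1 h2] ct]; apply: lt_le_trans h1 _; exact: c3.
Qed.

(** A crossing at time 0 itself has to be included, hence open intervals starting slightly before 0;
    as the last crossing is strictly negative, they eventually contain no earlier one. *)
Lemma nxt_lt p b : UT p -> nxt p < b <->
  forall m : nat, exists2 t, - m.+1%:R^-1 < t < b & ctimes p t.
Proof.
move=> Up; have [c1 c2 c3] := nxtP fA Up; have [l1 l2 l3] := lstP fA Up; split.
  move=> h m; exists (nxt p) => //; rewrite h andbT; apply: lt_le_trans c2.
  by rewrite oppr_lt0 invr_gt0.
have l0 : 0 < - lst p by rewrite oppr_gt0.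
have [k _ hk] := near_infty_natSinv_lt (PosNum l0).
move=> /(_ k)[t /andP[h1 h2] ct]; apply: le_lt_trans h2; apply: c3 => //.
rewrite leNgt; apply/negP => t0; have := l3 _ ct t0.
have h3 : k.+1%:R^-1 < - lst p := hk k (leqnn k).
by apply/negP; rewrite -ltNge; apply: lt_trans h1; rewrite ltrNr.
Qed.

Lemma measurable_nxt : measurable_fun setT (fun y : bY => nxt (lft y)).
Proof.
apply: measurable_lt => b.
rewrite (_ : [set y | _] = \bigcap_m [set y : bY |
    exists2 t, - m.+1%:R^-1 < t < b & ctimes (lft y) t]).
  by apply: bigcapT_measurable => m; exact: crossing_measurable.
apply/seteqP; split=> y /=; first by move=> /(nxt_lt _ (UT_lft y)) h m _; exact: h.
by move=> h; apply/(nxt_lt _ (UT_lft y)) => m; exact: h.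
Qed.

(** The jump is the least wall sum over open intervals around the next crossing; a rational right
    end and a left end [- m.+1%:R^-1] make the description countable. *)
Lemma jump_lt p beta : UT p -> jump p (nxt p) < beta <->
  exists (r : rat) (m : nat), nxt p < ratr r /\ Gsum lq (- m.+1%:R^-1) (ratr r) p < beta.
Proof.
move=> Up; have [c1 c2 c3] := nxtP fA Up; split; last first.
  move=> [r [m [h1 h2]]]; apply: le_lt_trans h2.
  have m0 : - m.+1%:R^-1 < 0 :> R by rewrite oppr_lt0 invr_gt0.
  have ab := lt_trans (lt_le_trans m0 c2) h1.
  rewrite /Gsum (wsep_cross Up ab); apply: (wsum_le (lq_ok regB apA fA)).
    by rewrite -(wsep_cross Up ab); exact: (wsep_finite fA (geoM _ Up) (geoM _ Up)).
  by move=> H ct; exists (nxt p) => //; rewrite h1 andbT; exact: lt_le_trans m0 c2.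
move=> h; have [e e0 he] := ctimes_isolated fA (nxt p) Up.
have [|r] := @rat_in_itvoo R (nxt p) (nxt p + e); first by rewrite ltrDl.
rewrite in_itv /= => /andP[r1 r2].
have [l1 l2 l3] := lstP fA Up; have l0 : 0 < - lst p by rewrite oppr_gt0.
have [k _ hk] := near_infty_natSinv_lt (PosNum l0).
have hk' : k.+1%:R^-1 < - lst p := hk k (leqnn k).
exists r, k; split=> //; apply: le_lt_trans h.
have m0 : - k.+1%:R^-1 < 0 :> R by rewrite oppr_lt0 invr_gt0.
have ab := lt_trans (lt_le_trans m0 c2) r1.
rewrite /Gsum (wsep_cross Up ab); apply: (wsum_le (lq_ok regB apA fA)).
  exact: (cross_finite fA).
move=> H [t /andP[t1 t2] ct]; have cct : ctimes p t by exists H.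
have t0 : 0 <= t.
  rewrite leNgt; apply/negP => t0; have := l3 _ cct t0.
  by apply/negP; rewrite -ltNge; apply: lt_trans t1; rewrite ltrNr.
have nt := c3 _ cct t0.
suff <- : t = nxt p by [].
by apply: he => //; rewrite ger0_norm ?subr_ge0// ltrBlDl; exact: lt_trans r2.
Qed.

Lemma measurable_jump : measurable_fun setT (fun y : bY => jump (lft y) (nxt (lft y))).
Proof.
apply: measurable_lt => beta.
rewrite (_ : [set y | _] = \bigcup_(r : rat) \bigcup_(m : nat)
  ([set y : bY | nxt (lft y) < ratr r] `&` [set y : bY | Gsum lq (- m.+1%:R^-1) (ratr r) (lft y) < beta])).
  apply: bigcupT_measurable_rat => r; apply: bigcupT_measurable => m; apply: measurableI.
    rewrite -[X in measurable X]setTI -preimage_itvNyo.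
    by apply: measurable_nxt => //; exact: measurable_itv.
  rewrite -[X in measurable X]setTI -preimage_itvNyo.
  by apply: (measurable_Gsum _ _ (lq_ok regB apA fA)) => //; exact: measurable_itv.
apply/seteqP; split=> y /=.
  by move=> /(jump_lt _ (UT_lft y))[r [m [h1 h2]]]; exists r => //; exists m.
by move=> [r _ [m _ [h1 h2]]]; apply/(jump_lt _ (UT_lft y)); exists r, m.
Qed.

Lemma measurable_rate : measurable_fun setT (fun y : bY => rate (lft y)).
Proof.
rewrite (_ : (fun y : bY => rate (lft y)) = (fun y : bY => jump (lft y) (nxt (lft y))) \*
    (fun y : bY => (nxt (lft y) - lst (lft y)) `^ (- 1))).
  apply: measurable_funM; first exact: measurable_jump.
  apply: (@measurableT_comp _ _ _ _ _ _ (fun x : R => x `^ (- 1))).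
    exact: measurable_powR.
  by apply: measurable_funB; [exact: measurable_nxt|exact: measurable_lst].
apply/funext => y; rewrite /= powR_inv1// ltW//; exact: (period_gt0 fA (UT_lft y)).
Qed.

End RateMeasurable.

(** * Entropy of finite codings for finitely additive probabilities *)

Module Entropy.

Section FiniteEntropy.
Context {R : realType}.

(** The log-sum inequality, from [ln x <= x - 1] at [x = q i * Ps / (p i * Qs)]. Stated for
    arbitrary total masses so as to apply to parts of a distribution. *)
Lemma gibbs (I : finType) (p q : I -> R) :
  (forall i, 0 <= p i) -> (forall i, 0 <= q i) -> (forall i, 0 < p i -> 0 < q i) ->
  \sum_i p i * (ln (q i) - ln (p i)) <=
  (\sum_i p i) * (ln (\sum_i q i) - ln (\sum_i p i)).
Proof.
move=> p0 q0 pq; set Ps := \sum_i p i; set Qs := \sum_i q i.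
have Ps0 : 0 <= Ps by exact: sumr_ge0.
have [Pz|Pn] := eqVneq Ps 0.
  rewrite Pz mul0r big1// => i _.
  by move/eqP: Pz; rewrite psumr_eq0// => /allP/(_ i)/(_ (mem_index_enum _))/eqP->; rewrite mul0r.
have {Pn}P1 : 0 < Ps by rewrite lt_def Pn.
have Q1 : 0 < Qs.
  have [i _ pi] : exists2 i, true & 0 < p i.
    apply: contrapT => no; move: P1; rewrite /Ps big1 ?ltxx// => i _.
    by apply/le_anti; rewrite p0 andbT leNgt; apply/negP => pi; apply: no; exists i.
  apply: lt_le_trans (pq _ pi) _; rewrite /Qs (bigD1 i)//= lerDl; exact: sumr_ge0.
have term i : p i * (ln (q i) - ln (p i)) <= p i * (ln Qs - ln Ps) + (q i * (Ps / Qs) - p i).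
  have [pz|pn] := eqVneq (p i) 0.
    by rewrite pz !mul0r add0r subr0 mulr_ge0// divr_ge0// ltW.
  have pi : 0 < p i by rewrite lt_def pn p0.
  have qi := pq _ pi.
  rewrite -lerBlDl -mulrBr.
  have -> : ln (q i) - ln (p i) - (ln Qs - ln Ps) = ln (q i * Ps / (p i * Qs)).
    by rewrite ln_div ?posrE ?mulr_gt0// !lnM ?posrE//; ring.
  have x0 : 0 < q i * Ps / (p i * Qs) by rewrite divr_gt0// mulr_gt0.
  have := @le_ln1Dx R (q i * Ps / (p i * Qs) - 1).
  rewrite ltrBrDr addNr => /(_ x0); rewrite addrC subrK => h.
  apply: (@le_trans _ _ (p i * (q i * Ps / (p i * Qs) - 1))); first by rewrite ler_wpM2l.
  by rewrite le_eqVlt; apply/orP; left; apply/eqP; field; rewrite !lt0r_neq0.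
apply: le_trans (ler_sum _ (fun i _ => term i)) _.
rewrite big_split /= -mulr_suml sumrB -mulr_suml -/Ps -/Qs mulrCA divff ?lt0r_neq0//.
by rewrite mulr1 subrr addr0.
Qed.

Definition ent (I : finType) (p : I -> R) := - \sum_i p i * ln (p i).

Lemma ent_cross (I : finType) (p q : I -> R) :
  (forall i, 0 <= p i) -> (forall i, 0 <= q i) -> (forall i, 0 < p i -> 0 < q i) ->
  \sum_i p i = 1 -> \sum_i q i <= 1 -> ent p <= - \sum_i p i * ln (q i).
Proof.
move=> p0 q0 pq p1 q1; have := gibbs p0 q0 pq; rewrite p1 mul1r ln1 subr0.
have q2 : ln (\sum_i q i) <= 0 by apply: ln_le0.
under eq_bigr do rewrite mulrBr; rewrite sumrB /ent => h.
by rewrite lerNr opprK -subr_le0; apply: le_trans h q2.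
Qed.

(** Gibbs' inequality against the counting weight on [D]: splitting one cell into at most [k] parts
    raises the entropy by at most its mass times [ln k]. *)
Lemma ent_split (I : finType) (D : {pred I}) (p : I -> R) (k : nat) :
  (forall i, 0 <= p i) -> (#|D| <= k)%N ->
  (\sum_(i in D) p i) * ln (\sum_(i in D) p i) - \sum_(i in D) p i * ln (p i) <=
  (\sum_(i in D) p i) * ln k%:R.
Proof.
move=> p0 Dk; set Ps := \sum_(i in D) p i.
have Ps0 : 0 <= Ps by exact: sumr_ge0.
have [Pz|Pn] := eqVneq Ps 0.
  rewrite Pz !mul0r sub0r big1 ?oppr0// => i iD.
  move/eqP: Pz; rewrite /Ps psumr_eq0// => /allP/(_ i (mem_index_enum _))/implyP/(_ iD)/eqP->.
  by rewrite mul0r.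
have g1 i : 0 <= (if i \in D then p i else 0) by case: ifP.
have g2 i : 0 <= (if i \in D then 1 else 0) :> R by case: ifP.
have g3 i : 0 < (if i \in D then p i else 0) -> 0 < (if i \in D then 1 else 0) :> R.
  by case: ifP => //; rewrite ltxx.
have := gibbs g1 g2 g3; rewrite -!big_mkcond /= -/Ps.
rewrite (_ : \sum_i _ = - \sum_(i in D) p i * ln (p i)); last first.
  rewrite -sumrN [RHS]big_mkcond; apply: eq_bigr => i _.
  by case: ifP => iD; rewrite ?ln1 ?sub0r ?mulrN// mul0r.
rewrite mulrBr sumr_const => h.
have P1 : 0 < Ps by rewrite lt_def Pn.
have D0 : (0 < #|D|)%N.
  rewrite lt0n; apply/negP => /eqP/card0_eq D0; move: P1; rewrite /Ps big1 ?ltxx// => i.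
  by rewrite D0.
have : Ps * ln (#|D|%:R) <= Ps * ln k%:R.
  rewrite ler_wpM2l// ler_ln ?posrE ?ltr0n ?ler_nat//; exact: leq_trans Dk.
by move: h; move: (Ps * ln Ps) (\sum_(_ in _) _) (Ps * ln _) (Ps * ln _) => *; lra.
Qed.

End FiniteEntropy.

Section FinitelyAdditive.
Context {R : realType} {X : Type}.

(** One calculus has to serve Borel probabilities, finite weighted averages of point masses, and the
    ultrafilter limit of these, for which only finite additivity is available. *)
Record fap (alg : set (set X)) (pr : set X -> R) : Prop := Fap {
  fap_T : alg setT;
  fap_C : forall D, alg D -> alg (~` D);
  fap_I : forall D E, alg D -> alg E -> alg (D `&` E);
  fap_ge0 : forall D, alg D -> 0 <= pr D;
  fap_1 : pr setT = 1;
  fap_U : forall D E, alg D -> alg E -> D `&` E = set0 -> pr (D `|` E) = pr D + pr E }.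

Variables (alg : set (set X)) (pr : set X -> R).
Hypothesis fp : fap alg pr.

Lemma alg0 : alg set0.
Proof. by rewrite -setCT; apply: (fap_C fp); exact: (fap_T fp). Qed.

Lemma algU D E : alg D -> alg E -> alg (D `|` E).
Proof.
move=> aD aE; rewrite -[D]setCK -[E]setCK -setCI; apply: (fap_C fp).
by apply: (fap_I fp); apply: (fap_C fp).
Qed.

Lemma pr0 : pr set0 = 0.
Proof.
have := fap_U fp alg0 alg0 (setI0 set0); rewrite setU0 => h.
by apply: (addrI (pr set0)); rewrite addr0.
Qed.

Lemma pr_le D E : alg D -> alg E -> D `<=` E -> pr D <= pr E.
Proof.
move=> aD aE DE; have -> : E = D `|` (E `&` ~` D) by rewrite -setDE setDUK.
have aED : alg (E `&` ~` D) by apply: (fap_I fp) => //; exact: (fap_C fp).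
rewrite (fap_U fp)//; first by rewrite lerDl (fap_ge0 fp).
by rewrite setICA setICr setI0.
Qed.

Definition adapted (I : finType) (a : X -> I) := forall i, alg (a @^-1` [set i]).

Definition law (I : finType) (a : X -> I) (i : I) := pr (a @^-1` [set i]).

Definition entropy (I : finType) (a : X -> I) := ent (law a).

Lemma law_ge0 (I : finType) (a : X -> I) i : adapted a -> 0 <= law a i.
Proof. by move=> ad; exact: (fap_ge0 fp). Qed.

Lemma entropy_ge0 (I : finType) (a : X -> I) : adapted a -> 0 <= entropy a.
Proof.
move=> ha; rewrite /entropy /ent oppr_ge0; apply: sumr_le0 => i _.
rewrite mulr_ge0_le0//; first exact: (fap_ge0 fp).
by apply: ln_le0; rewrite -(fap_1 fp); apply: pr_le => //; exact: (fap_T fp).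
Qed.

Lemma pr_partition (I : finType) (a : X -> I) D : adapted a -> alg D ->
  pr D = \sum_i pr (D `&` a @^-1` [set i]).
Proof.
move=> ad aD.
have h (s : seq I) : uniq s -> alg (D `&` [set x | a x \in s]) /\
    pr (D `&` [set x | a x \in s]) = \sum_(i <- s) pr (D `&` a @^-1` [set i]).
  elim: s => [|i s IH] /=.
    move=> _; rewrite big_nil (_ : _ `&` _ = set0); first by split; [exact: alg0|exact: pr0].
    by apply/seteqP; split=> // x [].
  move=> /andP[nis /IH[h1 h2]].
  have e : D `&` [set x | a x \in i :: s] = (D `&` a @^-1` [set i]) `|` (D `&` [set x | a x \in s]).
    apply/seteqP; split=> x /=; rewrite inE.
      by move=> [Dx /orP[/eqP e|e]]; [left|right].
    by move=> [[Dx ->]|[Dx ->]]; rewrite ?eqxx ?orbT.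
  have a1 : alg (D `&` a @^-1` [set i]) by apply: (fap_I fp).
  rewrite e big_cons; split; first exact: algU.
  rewrite (fap_U fp)// ?h2//; apply/seteqP; split=> // x [[_ /= ->] [_ /=]].
  by rewrite (negbTE nis).
have [_] := h (index_enum I) (index_enum_uniq I).
rewrite (_ : D `&` _ = D)//; apply/seteqP; split=> x; first by case.
by move=> Dx; split=> //=; rewrite mem_index_enum.
Qed.

Lemma law_sum1 (I : finType) (a : X -> I) : adapted a -> \sum_i law a i = 1.
Proof.
move=> ad; rewrite -(fap_1 fp) (pr_partition ad (fap_T fp)).
by apply: eq_bigr => i _; rewrite setTI.
Qed.

Lemma adapted_pair (I J : finType) (a : X -> I) (b : X -> J) :
  adapted a -> adapted b -> adapted (fun x => (a x, b x)).
Proof.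
move=> ha hb [i j]; rewrite (_ : _ @^-1` _ = a @^-1` [set i] `&` b @^-1` [set j]).
  exact: (fap_I fp).
by apply/seteqP; split=> x /= [-> ->].
Qed.

Lemma law_pairr (I J : finType) (a : X -> I) (b : X -> J) j : adapted a -> adapted b ->
  law b j = \sum_i law (fun x => (a x, b x)) (i, j).
Proof.
move=> ha hb; rewrite /law (pr_partition ha (hb j)); apply: eq_bigr => i _.
by congr pr; apply/seteqP; split=> x /= [-> ->].
Qed.

Lemma law_comp (I K : finType) (c : X -> K) (h : K -> I) i : adapted c -> alg ((h \o c) @^-1` [set i]) /\
  law (h \o c) i = \sum_(k | h k == i) law c k.
Proof.
move=> hc; have E (s : seq K) : alg [set x | c x \in s].
  elim: s => [|k s IH]; first by rewrite (_ : [set x | _] = set0); [exact: alg0|apply/seteqP; split].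
  rewrite (_ : [set x | _] = c @^-1` [set k] `|` [set x | c x \in s]); first exact: algU.
  by apply/seteqP; split=> x /=; rewrite inE; [move=> /orP[/eqP|]; [left|right]|move=> [->|->]; rewrite ?eqxx ?orbT].
have ai : alg ((h \o c) @^-1` [set i]).
  rewrite (_ : _ @^-1` _ = [set x | c x \in enum [pred k | h k == i]]) ?E//.
  by apply/seteqP; split=> x /=; rewrite mem_enum inE => /eqP.
split=> //; rewrite {1}/law (pr_partition hc ai) [RHS]big_mkcond; apply: eq_bigr => k _.
case: ifPn => [/eqP hk|/eqP hk].
  congr pr; apply/seteqP; split=> x /=; first by case.
  by move=> ->.
rewrite -pr0; congr pr; apply/seteqP; split=> // x /= [h1 h2].
by apply: hk; rewrite -h2.
Qed.

Lemma law_expect (I K : finType) (c : X -> K) (h : K -> I) (F : I -> R) : adapted c ->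
  \sum_k law c k * F (h k) = \sum_i law (h \o c) i * F i.
Proof.
move=> hc; rewrite (partition_big h xpredT)//=; apply: eq_bigr => i _.
have [_ ->] := law_comp h i hc; rewrite mulr_suml.
by apply: eq_bigr => k /eqP->.
Qed.

Lemma factor_comp (I K : finType) (a : X -> I) (c : X -> K) :
  (forall x y, c x = c y -> a x = a y) -> exists h : K -> I, a = h \o c.
Proof.
move=> ac; have [[x0 _]|no] := EM (exists x : X, True).
  exists (fun k => xget (a x0) [set i | exists x, c x = k /\ a x = i]).
  apply/funext => x /=; case: xgetP => [i _ [y [/ac + <-]]//|/(_ (a x))[]].
  by exists x.
have [[i _]|ni] := EM (exists i : I, True).
  by exists (fun=> i); apply/funext => x; case: no; exists x.
have [[k _]|nk] := EM (exists k : K, True).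
  exfalso; have := fap_1 fp; rewrite (_ : setT = set0) ?pr0.
    by move=> /esym/eqP; rewrite oner_eq0.
  by apply/seteqP; split=> // x _; case: no; exists x.
by exists (fun k => False_rect _ (nk (ex_intro _ k Logic.I))); apply/funext => x; case: no; exists x.
Qed.

Lemma adapted_factor (I K : finType) (a : X -> I) (c : X -> K) : adapted c ->
  (forall x y, c x = c y -> a x = a y) -> adapted a.
Proof. by move=> hc /factor_comp[h ->] i; have [] := law_comp h i hc. Qed.

Lemma entropy_factor (I K : finType) (a : X -> I) (c : X -> K) : adapted c ->
  (forall x y, c x = c y -> a x = a y) -> entropy a <= entropy c.
Proof.
move=> hc /factor_comp[h ->]; rewrite /entropy /ent lerN2.
have le k : law c k <= law (h \o c) (h k).
  have [_ ->] := law_comp h (h k) hc; rewrite (bigD1 k)//= lerDl.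
  by apply: sumr_ge0 => ? _; exact: law_ge0.
rewrite -(law_expect h (fun i => ln (law (h \o c) i)) hc).
apply: ler_sum => k _; have [->|nz] := eqVneq (law c k) 0; first by rewrite !mul0r.
have pz : 0 < law c k by rewrite lt_def nz law_ge0.
by rewrite ler_wpM2l ?law_ge0// ler_ln ?posrE//; exact: lt_le_trans (le k).
Qed.

Lemma entropy_same (I K : finType) (a : X -> I) (c : X -> K) : adapted c ->
  (forall x y, c x = c y <-> a x = a y) -> entropy a = entropy c.
Proof.
move=> hc h; have ha : adapted a by apply: (adapted_factor hc) => x y /h.
by apply/le_anti; rewrite !entropy_factor// => x y /h.
Qed.

(** Strong subadditivity: the joint law is compared with the weights making [a] and [b] independent
    given [c]. Their total mass is at most 1, and their cross-entropy is the combination of the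
    three other entropies. *)
Lemma entropy_submod (I J K : finType) (a : X -> I) (b : X -> J) (c : X -> K) :
  adapted a -> adapted b -> adapted c ->
  entropy (fun x => ((a x, b x), c x)) + entropy c <=
  entropy (fun x => (a x, c x)) + entropy (fun x => (b x, c x)).
Proof.
move=> ha hb hc.
pose abc x := ((a x, b x), c x); pose ac x := (a x, c x); pose bc x := (b x, c x).
have habc : adapted abc by apply: adapted_pair => //; exact: adapted_pair.
have hac : adapted ac by exact: adapted_pair.
have hbc : adapted bc by exact: adapted_pair.
pose h1 (t : I * J * K) := (t.1.1, t.2); pose h2 (t : I * J * K) := (t.1.2, t.2).
pose q (t : I * J * K) := law ac (h1 t) * law bc (h2 t) / law c t.2.
have pos (L : finType) (h : I * J * K -> L) t : 0 < law abc t -> 0 < law (h \o abc) (h t).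
  move=> t0; apply: lt_le_trans t0 _; have [_ ->] := law_comp h (h t) habc.
  by rewrite (bigD1 t)//= lerDl; apply: sumr_ge0 => ? _; exact: law_ge0.
have q0 t : 0 <= q t by rewrite divr_ge0 ?mulr_ge0 ?law_ge0.
have pq t : 0 < law abc t -> 0 < q t.
  by move=> t0; rewrite divr_gt0 ?mulr_gt0//; [exact: (pos _ h1)|exact: (pos _ h2)|exact: (pos _ snd)].
have q1 : \sum_t q t <= 1.
  rewrite -(law_sum1 hc) -(pair_bigA _ (fun ij k => q (ij, k))) exchange_big /=.
  apply: ler_sum => k _.
  rewrite -(pair_bigA _ (fun i j => q ((i, j), k))) /= /q /h1 /h2 /=.
  under eq_bigr do rewrite -mulr_suml -mulr_sumr.
  rewrite -!mulr_suml -(law_pairr k ha hc) -(law_pairr k hb hc).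
  by have [->|nz] := eqVneq (law c k) 0; rewrite ?mul0r// mulfK.
have := ent_cross (fun t => law_ge0 t habc) q0 pq (law_sum1 habc) q1.
rewrite -lerBrDr => h; apply: le_trans h _; rewrite le_eqVlt; apply/orP; left; apply/eqP.
rewrite /entropy /ent.
suff -> : \sum_i law abc i * ln (q i) = \sum_i law ac i * ln (law ac i) +
    \sum_i law bc i * ln (law bc i) - \sum_i law c i * ln (law c i) by ring.
rewrite -(law_expect h1 (fun i => ln (law ac i)) habc) -(law_expect h2 (fun i => ln (law bc i)) habc).
rewrite -(law_expect snd (fun i => ln (law c i)) habc) -big_split -sumrB /=.
apply: eq_bigr => t _; rewrite -mulrDr -mulrBr.
have [->|nz] := eqVneq (law abc t) 0; first by rewrite !mul0r.
have t0 : 0 < law abc t by rewrite lt_def nz law_ge0.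
congr (_ * _); rewrite /q ln_div ?lnM ?posrE ?mulr_gt0//;
  by [exact: (pos _ h1)|exact: (pos _ h2)|exact: (pos _ snd)].
Qed.

Lemma entropy_le_card (I : finType) (a : X -> I) : adapted a -> entropy a <= ln #|I|%:R.
Proof.
move=> ha; have := @gibbs R I (law a) (fun=> 1) (fun i => law_ge0 i ha) (fun=> ler01) (fun _ _ => ltr01).
rewrite (law_sum1 ha) mul1r ln1 subr0 sumr_const; under eq_bigr do rewrite sub0r mulrN.
by rewrite sumrN.
Qed.

Lemma entropy_sub (I J : finType) (a : X -> I) (b : X -> J) : adapted a -> adapted b ->
  entropy (fun x => (a x, b x)) <= entropy a + entropy b.
Proof.
move=> ha hb.
pose tt' (x : X) := tt.
have hc : adapted tt'.
  move=> i; rewrite (_ : _ @^-1` _ = setT); first exact: (fap_T fp).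
  by apply/seteqP; split=> // x _; case: i.
have := entropy_submod ha hb hc.
have -> : entropy tt' = 0.
  have e : law tt' tt = 1 by have := law_sum1 hc; rewrite (big_pred1 tt)// => -[].
  by rewrite /entropy /ent big1 ?oppr0// => -[] _; rewrite e ln1 mulr0.
rewrite addr0 => h; apply: le_trans (_ : _ <= entropy (fun x => ((a x, b x), tt' x))) _.
  by apply: entropy_factor => [|x y [-> ->]//]; apply: adapted_pair => //; exact: adapted_pair.
apply: le_trans h _; apply: lerD; apply: entropy_factor => // x y; by move=> ->.
Qed.

End FinitelyAdditive.

End Entropy.
Import Entropy.

(** * Subadditive sequences *)

Section Fekete.
Context {R : realType}.

(** The limit is an infimum; the second conclusion, valid at every finite [m], is what the entropy
    estimates rely on. *)
Lemma fekete (u : nat -> R) : (forall m, 0 <= u m) ->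
  (forall m k, u (m + k)%N <= u m + u k) ->
  exists2 L : R, (u m / m%:R) @[m --> \oo] --> L & forall m, (0 < m)%N -> L * m%:R <= u m.
Proof.
move=> u0 sub; pose S := [set u m / m%:R | m in [set m | (0 < m)%N]].
have S0 : has_inf S.
  split; first by exists (u 1%N / 1%:R); exists 1%N.
  by exists 0 => _ [m _ <-]; rewrite divr_ge0.
have low m : (0 < m)%N -> inf S <= u m / m%:R.
  by move=> m0; apply: ge_inf; [case: S0|exists m].
have mult m q : u (q * m)%N <= q%:R * u m + u 0%N.
  elim: q => [|q IH]; first by rewrite mul0n mul0r add0r.
  rewrite mulSn; apply: le_trans (sub _ _) _.
  by rewrite -natr1 mulrDl mul1r [q%:R * _ + _]addrC -addrA lerD2l.
exists (inf S); last by move=> m m0; rewrite -ler_pdivlMr ?ltr0n//; exact: low.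
apply/cvgrPdist_le => e e0.
have e2 : 0 < e / 2 by rewrite divr_gt0.
have [_ [m m0 <-] hm] := inf_adherent e2 S0.
(* Covers the remainder of the division by [m], whatever it is, and the term [u 0] left over by
   [mult]. *)
pose c := u 0%N + \sum_(r < m) u r.
have c0 : 0 <= c by rewrite addr_ge0// sumr_ge0.
near=> k; have k0 : (0 < k)%N by near: k; exists 1%N.
have k1 : 0 < k%:R :> R by rewrite ltr0n.
rewrite ler0_norm ?subr_le0 ?low// opprB lerBlDr.
have h : u k <= (k %/ m)%:R * u m + c.
  rewrite {1}(divn_eq k m); apply: le_trans (sub _ _) _.
  apply: le_trans (lerD (mult _ _) (lexx _)) _; rewrite -addrA lerD2l lerD2l.
  have km : (k %% m < m)%N by rewrite ltn_mod.
  by rewrite (bigD1 (Ordinal km))//= lerDl sumr_ge0.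
rewrite ler_pdivrMr//; apply: le_trans h _.
have h1 : (k %/ m)%:R * u m <= k%:R * (inf S + e / 2).
  apply: (@le_trans _ _ ((k %/ m)%:R * (m%:R * (inf S + e / 2)))).
    rewrite ler_wpM2l// -ler_pdivrMl ?ltr0n// mulrC; exact: ltW.
  rewrite mulrA -natrM ler_wpM2r ?ler_nat ?leq_divM//.
  rewrite addr_ge0 ?(ltW e2)//; apply: lb_le_inf; first by case: S0.
  by move=> _ [j _ <-]; rewrite divr_ge0.
have h2 : c <= k%:R * (e / 2).
  have kc : c / (e / 2) < k%:R.
    near: k; exists (Num.truncn (c / (e / 2))).+1 => // k /= hk.
    apply: lt_le_trans (truncnS_gt _) _; by rewrite ler_nat.
  by rewrite -ler_pdivrMr// ltW.
apply: le_trans (lerD h1 h2) _.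
by rewrite -mulrDr mulrC -addrA -splitr [e + _]addrC.
Unshelve. all: by end_near. Qed.

End Fekete.

Lemma cond_arith {R : realType} (x y z e p q u f md d : R) :
  u <= q + md -> y + e <= z + p -> z + q <= u + f -> x <= y -> p - e = d ->
  x <= f + (md + d).
Proof. by move=> *; lra. Qed.

(** * Entropy of words along an orbit *)

Section Words.
Context {R : realType} {X : Type}.
Variables (alg : set (set X)) (pr : set X -> R) (f : X -> X).
Hypotheses (fp : fap alg pr) (algf : forall D, alg D -> alg (f @^-1` D)).
Notation entropy := (@entropy R X pr).
Notation adapted := (@adapted X alg).

Definition word (I : finType) (h : X -> X) (a : X -> I) m (x : X) : {ffun 'I_m -> I} :=
  [ffun j => a (iter (nat_of_ord j) h x)].

Lemma wordP (I : finType) h (a : X -> I) m x y :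
  word h a m x = word h a m y <-> forall j, (j < m)%N -> a (iter j h x) = a (iter j h y).
Proof.
split=> [/ffunP e j jm|e]; first by have := e (Ordinal jm); rewrite !ffunE.
by apply/ffunP => j; rewrite !ffunE e.
Qed.

Lemma alg_iter k D : alg D -> alg (iter k f @^-1` D).
Proof. by elim: k => // k IH /IH /algf; rewrite -comp_preimage; congr alg; apply/seteqP; split=> x; rewrite /= -iterSr. Qed.
Lemma adapted_iter (I : finType) (a : X -> I) k : adapted a -> adapted (a \o iter k f).
Proof. by move=> ha i; exact: (alg_iter k (ha i)). Qed.
Arguments adapted_iter {I a} k _ _.

Lemma word_add (I : finType) h (a : X -> I) m k x y :
  word h a (m + k) x = word h a (m + k) y <->
  (word h a m x, word h a k (iter m h x)) = (word h a m y, word h a k (iter m h y)).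
Proof.
split=> [/wordP e|[/wordP e1 /wordP e2]].
  congr pair; apply/wordP => j jm; first by rewrite e// ltn_addr.
  by rewrite -!iterD e// addnC ltn_add2l.
apply/wordP => j jmk; have [jm|mj] := ltnP j m; first exact: e1.
by rewrite -(subnK mj) !iterD e2// ltn_subLR.
Qed.

Lemma adapted_word (I : finType) (a : X -> I) m : adapted a -> adapted (word f a m).
Proof.
move=> ha; elim: m => [|m IH].
  move=> i; rewrite (_ : _ @^-1` _ = setT); first exact: (fap_T fp).
  by apply/seteqP; split=> // x _; apply/ffunP => -[].
apply: (adapted_factor fp (c := fun x => (word f a m x, a (iter m f x)))).
  by apply: (adapted_pair fp) => //; exact: adapted_iter.
move=> x y [/wordP e1 e2]; apply/wordP => j; rewrite ltnS leq_eqVlt => /orP[/eqP->//|].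
exact: e1.
Qed.
Arguments adapted_word {I a} m _ _.

Lemma entropy_word_block (I : finType) (a : X -> I) r m J : adapted a ->
  entropy (word f a (r + J * m)) <= entropy (word f a r) +
    \sum_(j < J) entropy (word f a m \o iter (r + j * m) f).
Proof.
move=> ha; elim: J => [|J IH].
  rewrite big_ord0 addr0 mul0n addn0; exact: lexx.
rewrite big_ord_recr /= addrA mulSnr addnA.
have h1 := adapted_word (r + J * m) ha.
have h2 := adapted_iter (r + J * m) (adapted_word m ha).
rewrite (entropy_same fp (adapted_pair fp h1 h2)); last first.
  by move=> x y; split=> [/word_add|e]; [|apply/word_add].
apply: le_trans (entropy_sub fp h1 h2) _; exact: lerD.
Qed.

Section Invariant.
Hypothesis inv : forall D, alg D -> pr (f @^-1` D) = pr D.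

Lemma inv_iter k D : alg D -> pr (iter k f @^-1` D) = pr D.
Proof.
move=> aD; elim: k => // k IH; rewrite -[RHS]IH -[RHS]inv; last exact: alg_iter.
by congr pr; apply/seteqP; split=> x; rewrite /= -iterSr.
Qed.

Lemma entropy_iter (I : finType) (a : X -> I) k : adapted a ->
  entropy (a \o iter k f) = entropy a.
Proof.
move=> ha; rewrite /Entropy.entropy /ent; congr (- _); apply: eq_bigr => i _.
by rewrite /Entropy.law (_ : _ @^-1` _ = iter k f @^-1` (a @^-1` [set i]))// inv_iter.
Qed.

Lemma entropy_word_sub (I : finType) (a : X -> I) m k : adapted a ->
  entropy (word f a (m + k)) <= entropy (word f a m) + entropy (word f a k).
Proof.
move=> ha; have h1 := adapted_word m ha; have h2 := adapted_word k ha.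
have h3 := adapted_iter m h2.
rewrite (entropy_same fp (adapted_pair fp h1 h3)); last first.
  by move=> x y; split=> [/word_add|e]; [|apply/word_add].
by apply: le_trans (entropy_sub fp h1 h3) _; rewrite entropy_iter.
Qed.

(** Lengthening the joint word by one letter costs at most the letter of [b] given its past plus the
    letter of [a] given the simultaneous letter of [b]; each of the two bounds is an instance of
    strong subadditivity. *)
Lemma entropy_cond (I J : finType) (a : X -> I) (b : X -> J) m : adapted a -> adapted b ->
  entropy (word f a m) <= entropy (word f b m) +
    m%:R * (entropy (fun x => (a x, b x)) - entropy b).
Proof.
move=> ha hb; set d := _ - entropy b.
have hA k := adapted_word k ha; have hB k := adapted_word k hb.
suff : entropy (fun x => (word f a m x, word f b m x)) <= entropy (word f b m) + m%:R * d.
  apply: le_trans; apply: (entropy_factor fp); first exact: (adapted_pair fp).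
  by move=> x y [].
elim: m => [|m IH].
  rewrite mul0r addr0; apply: (entropy_factor fp) => // x y _.
  by congr pair; apply/ffunP => -[].
pose A := word f a m; pose Bw := word f b m; pose a' x := a (iter m f x); pose b' x := b (iter m f x).
have ha' : adapted a' by exact: adapted_iter.
have hb' : adapted b' by exact: adapted_iter.
have ed : entropy (fun x => (a' x, b' x)) - entropy b' = d.
  rewrite /d -(entropy_iter m (adapted_pair fp ha hb)) -(entropy_iter m hb) //.
have s1 := entropy_submod fp (adapted_pair fp (hA m) (hB m)) ha' hb'.
have s2 := entropy_submod fp (hA m) hb' (hB m).
have e1 : entropy (fun x => (word f a m.+1 x, word f b m.+1 x)) <=
    entropy (fun x => (((A x, Bw x), a' x), b' x)).
  apply: (entropy_factor fp).
    apply: (adapted_pair fp) => //; apply: (adapted_pair fp) => //; exact: (adapted_pair fp).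
  move=> x y [/wordP eA /wordP eB ea eb]; congr pair; apply/wordP => j;
    rewrite ltnS leq_eqVlt => /orP[/eqP->//|]; by [exact: eA|exact: eB].
have e2 : entropy (fun x => ((A x, Bw x), b' x)) = entropy (fun x => ((A x, b' x), Bw x)).
  apply: (entropy_same fp); first by apply: (adapted_pair fp) => //; exact: (adapted_pair fp).
  by move=> x y; split=> -[-> -> ->].
have e3 : entropy (word f b m.+1) = entropy (fun x => (b' x, Bw x)).
  apply: (entropy_same fp); first exact: (adapted_pair fp).
  move=> x y; split=> [[eb /wordP eB]|/wordP e].
    by apply/wordP => j; rewrite ltnS leq_eqVlt => /orP[/eqP->//|]; exact: eB.
  congr pair; first exact: e.
  by apply/wordP => j jm; apply: e; exact: ltnW.
rewrite e3 -natr1 mulrDl mul1r; rewrite e2 in s1.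
exact: (cond_arith IH s1 s2 e1 ed).
Qed.

Lemma entropy_word_fekete (I : finType) (a : X -> I) : adapted a ->
  exists2 L : R, (entropy (word f a m) / m%:R) @[m --> \oo] --> L &
    forall m, (0 < m)%N -> L * m%:R <= entropy (word f a m).
Proof.
move=> ha; apply: fekete; last by move=> m k; exact: entropy_word_sub.
by move=> m; apply: (entropy_ge0 fp); exact: adapted_word.
Qed.

End Invariant.

Lemma word_power (I : finType) (a : X -> I) k m : adapted a ->
  entropy (word (iter k f) (word f a k) m) = entropy (word f a (m * k)).
Proof.
move=> ha; apply: (entropy_same fp); first exact: adapted_word.
have it j x : iter j (iter k f) x = iter (j * k) f x.
  by elim: j => //= j ->; rewrite mulSn iterD.
move=> x y; split=> /wordP e; apply/wordP => j jm.
  apply/wordP => i ik; rewrite !it -!iterD; apply: e.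
  by rewrite (leq_trans (_ : _ < j.+1 * k)%N) ?leq_mul2r ?jm ?orbT// mulSn ltn_add2r.
have k0 : (0 < k)%N by rewrite lt0n; apply: contraTneq jm => ->; rewrite muln0.
have := e (j %/ k)%N; rewrite ltn_divLR// => /(_ jm)/wordP/(_ (j %% k)%N).
by rewrite ltn_mod => /(_ k0); rewrite !it -!iterD addnC -divn_eq.
Qed.

End Words.

Lemma cvg_natV {R : realType} : (m%:R^-1 : R) @[m --> \oo] --> 0.
Proof.
apply/cvgrVy; first by near=> m; rewrite invr_gt0 ltr0n; near: m; exact: nbhs_infty_gt.
by under [unstable.inv_fun _]eq_fun do rewrite invrK; exact: cvgr_idn.
Unshelve. all: end_near. Qed.

(** * Measure-theoretic entropy expressed by words *)

Section EntropyBridge.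
Context {d : measure_display} {T : measurableType d} {R : realType}.
Variables (mu : probability T R) (f : T -> T).
Hypotheses (mf : measurable_fun setT f)
  (inv : forall D, measurable D -> mu (f @^-1` D) = mu D).

Definition prob (D : set T) : R := fine (mu D).

Lemma prob_fap : fap measurable prob.
Proof.
split; rewrite /prob.
- exact: measurableT.
- by move=> D; exact: measurableC.
- by move=> D E; exact: measurableI.
- by move=> D mD; apply: fine_ge0.
- by rewrite probability_setT.
- move=> D E mD mE DE; rewrite measureU// fineD//; exact: fin_num_measure.
Qed.

Lemma prob_inv D : measurable D -> prob (f @^-1` D) = prob D.
Proof. by move=> mD; rewrite /prob inv. Qed.
Lemma measurable_pre D : measurable D -> measurable (f @^-1` D).
Proof. by move=> mD; rewrite -[f @^-1` D]setTI; exact: mf. Qed.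

Lemma partition_map k (xi : 'I_k -> set T) : measurable_partition xi ->
  exists2 a : T -> 'I_k, adapted measurable a & forall i, a @^-1` [set i] = xi i.
Proof.
move=> [mxi tr cov].
have h x : exists i, xi i x by have : setT x by []; rewrite -cov => -[i _ xix]; exists i.
have [a ha] := choice h.
have e i : a @^-1` [set i] = xi i.
  apply/seteqP; split=> [x <-//|x xix]; apply: contrapT => ne.
  by apply: ne; apply: (tr _ _ I I); exists x.
by exists a => // i; rewrite e.
Qed.

Lemma join_entropy_word k (a : T -> 'I_k) (xi : 'I_k -> set T) m :
  (forall i, a @^-1` [set i] = xi i) ->
  join_entropy mu f xi m = entropy prob (word f a m).
Proof.
move=> ha; rewrite /join_entropy /entropy /ent; congr (- _); apply: eq_bigr => s _ /=.
suff -> : \bigcap_(j in [set: 'I_m]) (iter j f @^-1` xi (s j)) = word f a m @^-1` [set s] by [].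
apply/seteqP; split=> x /=.
  by move=> h; apply/ffunP => j; rewrite ffunE; have := h j I; rewrite /= -ha.
by move=> <- j _ /=; rewrite ffunE -ha.
Qed.

(** The limit defining the partition entropy is an infimum by subadditivity, so it bounds every word
    length from below. *)
Lemma partition_entropy_le k (xi : 'I_k -> set T) : measurable_partition xi ->
  exists2 a : T -> 'I_k, adapted measurable a &
  forall m, (0 < m)%N -> partition_entropy mu f xi * m%:R <= entropy prob (word f a m).
Proof.
move=> /partition_map[a aa ha]; exists a => //.
have [L cL hL] := entropy_word_fekete prob_fap measurable_pre prob_inv aa.
suff -> : partition_entropy mu f xi = L by [].
apply: cvg_lim => //; apply: cvg_trans cL; apply: near_eq_cvg.
by near=> m; rewrite (join_entropy_word _ ha).
Unshelve. all: end_near. Qed.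

(** A defect [c0] that does not grow with [m] disappears in the limit; this is where the bounded
    errors of the lower bound are absorbed. *)
Lemma ks_entropy_ge (I : finType) (a : T -> I) (c c0 : R) : adapted measurable a ->
  (forall m, (0 < m)%N -> c * m%:R - c0 <= entropy prob (word f a m)) ->
  (c%:E <= ks_entropy mu f)%E.
Proof.
move=> aa h; pose xi (i : 'I_#|I|) := a @^-1` [set enum_val i].
have mp : measurable_partition xi.
  split=> [i|i j _ _ [x [/= h1 h2]]|]; first exact: aa.
    by apply: enum_val_inj; rewrite -h1.
  by apply/seteqP; split=> // x _; exists (enum_rank (a x)) => //; rewrite /xi /= enum_rankK.
apply: le_trans (_ : (partition_entropy mu f xi)%:E <= _)%E; last first.
  by apply: ereal_sup_ubound; exists #|I|, xi.
have ha i : (enum_rank \o a) @^-1` [set i] = xi i.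
  by apply/seteqP; split=> x /=; [move=> <-; rewrite /xi/= enum_rankK|
     rewrite /xi/= => ->; rewrite enum_valK].
have aa' : adapted measurable (enum_rank \o a) by move=> i; rewrite ha; apply: aa.
have [L cL _] := entropy_word_fekete prob_fap measurable_pre prob_inv aa'.
have eL : partition_entropy mu f xi = L.
  apply: cvg_lim => //; apply: cvg_trans cL; apply: near_eq_cvg.
  by near=> m; rewrite (join_entropy_word _ ha).
rewrite eL lee_fin.
have cv : (c - c0 / m%:R @[m --> \oo] --> c)%classic.
  rewrite -[X in _ --> X]subr0; apply: cvgB; first exact: cvg_cst.
  by rewrite -[X in _ --> X](mulr0 c0); apply: cvgZl_tmp; exact: cvg_natV.
apply: ler_cvg_to cv cL _; near=> m.
have m0 : (0 < m)%N by near: m; exact: nbhs_infty_gt.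
rewrite ler_pdivlMr ?ltr0n// mulrBl divfK ?pnatr_eq0 -?lt0n//.
apply: le_trans (h m m0) _; rewrite le_eqVlt; apply/orP; left; apply/eqP.
have ww := adapted_word (m := m) prob_fap measurable_pre aa'.
apply: (entropy_same prob_fap ww).
move=> x y; rewrite !wordP; split=> E j jm; last by rewrite /= E.
by apply: enum_rank_inj; exact: E.
Unshelve. all: end_near. Qed.

Lemma measurable_adapted d' (U : measurableType d') (I : finType) (a : T -> I) (s : I -> U) :
  adapted measurable a -> measurable_fun setT (s \o a).
Proof.
move=> aa _ E _; rewrite setTI.
have -> : (s \o a) @^-1` E = \bigcup_(i in [set i | E (s i)]) a @^-1` [set i].
  by apply/seteqP; split=> [x Ex|x [i /= Ei e]]; [exists (a x)|rewrite e].
by apply: fin_bigcup_measurable => // i _; exact: aa.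
Qed.

Lemma integral_law (I : finType) (a : T -> I) (s : I -> R) : adapted measurable a ->
  (forall i, 0 <= s i) -> (\int[mu]_(x in setT) (s (a x))%:E = (\sum_i law prob a i * s i)%:E)%E.
Proof.
move=> aa s0.
under eq_integral => x _.
  rewrite (_ : (s (a x))%:E = \sum_(i <- index_enum I) (s i * \1_(a @^-1` [set i]) x)%:E)%E.
    over.
  rewrite sumEFin; congr EFin; rewrite (bigD1 (a x))//= indicE mem_set// mulr1.
  rewrite big1 ?addr0// => i ne; rewrite indicE memNset ?mulr0//= => e.
  by rewrite e eqxx in ne.
rewrite ge0_integral_sum//; last 2 first.
- move=> i; apply/measurable_EFinP; apply: measurable_funM; first exact: measurable_cst.
  by apply: measurable_indic; exact: aa.
- by move=> i x _; rewrite lee_fin mulr_ge0// indicE.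
rewrite -sumEFin; apply: eq_bigr => i _.
under eq_integral do rewrite EFinM.
rewrite ge0_integralZl//; last 2 first.
- by apply/measurable_EFinP; apply: measurable_indic; exact: aa.
- by rewrite lee_fin.
have mi := aa i.
rewrite integral_indic// setIT EFinM muleC; congr (_ * _)%E; rewrite /law /prob fineK//.
exact: fin_num_measure.
Qed.

End EntropyBridge.

(** * Regularity of Borel measures, and displacement under the torsion-free group *)

Section QuotientMeasure.
Context {R : realType} {g : geometry} {n : nat} {P : coxeter_polyhedron R g n}.
Context {W' : matrix_group R n} {K : polyhedral_complex P}.
Context {A : set (cplx_point K)} {f : 'rV[R]_n.+2 -> cplx_point K}.
Notation V := 'rV[R]_n.+2.
Implicit Types (x y z : V) (r : V * V) (w u : 'M[R]_n.+2) (s t e : R).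
Notation M := (@model_space R g n).
Notation W := (coxeter_group P).
Notation Y := (T1Y g W').
Notation bY := (borel_T1Y g W').
Notation tile := (tile P).
Notation ctr := (ctr P).
Implicit Types (C D O : set Y).
Hypotheses (fA : tessellation_isometry f A) (W'sub : W' `<=` W) (W'fin : finite_index W' W).

Lemma measurable_flow t : measurable_fun setT (quotient_flow t : bY -> bY).
Proof.
apply: (@measurability _ _ bY bY _ _ (@open Y)) => // _ [U oU <-]; rewrite setTI.
apply: sub_sigma_algebra; apply: open_comp => // y _.
exact: (continuous_quotient_flow W'sub).
Qed.

Section Regularity.
Variable mu : probability bY R.
Let G (E : set bY) := forall e, 0 < e -> exists C O, [/\ closed C, open O, C `<=` E,
  E `<=` O & (mu (O `\` C) <= e%:E)%E].

Let measurable_op O : open O -> measurable (O : set bY).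
Proof. exact: sub_sigma_algebra. Qed.

Let measurable_cl C : closed C -> measurable (C : set bY).
Proof. by move=> cC; rewrite -(setCK C); apply: measurableC; apply: measurable_op; exact: closed_openC. Qed.

Let approx (F : (set bY)^nat) O e : (forall i, closed (F i)) -> {homo F : n m / (n <= m)%N >-> (n <= m)%O} ->
  open O -> 0 < e -> O `<=` \bigcup_i F i ->
  exists N, (mu (O `\` F N) <= e%:E)%E.
Proof.
move=> cF hF oO e0 OF.
have cv : (mu \o (fun i => O `\` F i)) x @[x --> \oo] --> mu (\bigcap_i (O `\` F i)).
  apply: nonincreasing_cvg_mu.
  - by rewrite ltey_eq fin_num_measure//; apply: measurableD; [exact: measurable_op|exact: measurable_cl].
  - by move=> i; apply: measurableD; [exact: measurable_op|exact: measurable_cl].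
  - by apply: bigcap_measurable => // i _; apply: measurableD; [exact: measurable_op|exact: measurable_cl].
  - by move=> i j ij; apply/subsetPset => x [Ox nF]; split=> // Fx; apply: nF; have /subsetPset := hF _ _ ij; exact.
have z : \bigcap_i (O `\` F i) = set0.
  apply/seteqP; split=> // x h; have [Ox _] := h 0%N Logic.I.
  by have [i _ Fx] := OF _ Ox; have [_] := h i Logic.I.
rewrite z measure0 in cv.
have : \forall i \near \oo, (mu (O `\` F i) < e%:E)%E.
  by apply: (cv [set y | (y < e%:E)%E]); exact: (@nbhs_open_ereal_lt R 0 (fun=> e) e0).
by move=> [N _ /(_ N (leqnn _)) /ltW]; exists N.
Qed.

Lemma regular_open O : open O -> G O.
Proof.
move=> oO e e0; pose F (i : nat) := ~` [set y | dset (~` O) y < i.+1%:R^-1].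
have cF i : closed (F i) by apply: open_closedC; exact: (dset_lt_open W'sub).
have hF : {homo F : n m / (n <= m)%N >-> (n <= m)%O}.
  move=> i j ij; apply/subsetPset => x h h'; apply: h; apply: lt_le_trans h' _.
  by rewrite lef_pV2 ?posrE// ler_nat.
have FO i : F i `<=` O.
  by move=> y h; apply: contrapT => nO; apply: h; rewrite /= (dset_in W'sub).
have OF : O `<=` \bigcup_i F i.
  move=> y Oy; have pos : 0 < dset (~` O) y by apply: (dset_gt0 W'sub) => //; exact: open_closedC.
  have [i _ /(_ i (leqnn _)) hi] := near_infty_natSinv_lt (PosNum pos).
  by exists i => // h; have := lt_trans hi h; rewrite ltxx.
have [N hN] := approx cF hF oO e0 OF.
by exists (F N), O; split.
Qed.

(** Sets approximable by closed sets from inside and open sets from outside form a sigma-algebra,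
    which contains the open sets because [dset] exhausts them by closed ones. *)
Lemma regular_measurable (E : set bY) : measurable E -> G E.
Proof.
apply: smallest_sub; last by move=> O; exact: regular_open.
split.
- move=> e e0; exists set0, set0; split=> //; try exact: closed0; try exact: open0.
  by rewrite setDv measure0 lee_fin ltW.
- move=> D hE e e0; have [C [U [cC oU CE EU h]]] := hE e e0.
  exists (~` U), (~` C); split; try exact: open_closedC; try exact: closed_openC.
  + by rewrite setTD; exact: subsetC.
  + by rewrite setTD; exact: subsetC.
  + by rewrite (_ : _ `\` _ = U `\` C)// setDE setCK setIC.
move=> {}E hE e e0.
have /choice[CO hCO] : forall i, exists CO : set Y * set Y, [/\ closed CO.1, open CO.2,
    CO.1 `<=` E i, E i `<=` CO.2 & (mu (CO.2 `\` CO.1) <= (e / 2 / (2 ^ i.+1)%:R)%:E)%E].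
  move=> i; have ei : 0 < e / 2 / (2 ^ i.+1)%:R by rewrite !divr_gt0// ltr0n expn_gt0.
  by have [C [U h]] := hE i _ ei; exists (C, U).
pose F N := \bigcup_(i < N) (CO i).1; pose U := \bigcup_i (CO i).1; pose O := \bigcup_i (CO i).2.
have oO : open O by apply: bigcup_open => i _; have [] := hCO i.
have cF N : closed (F N) by apply: closed_bigcup => // i _; have [] := hCO i.
have mC i : measurable ((CO i).1 : set bY) by apply: measurable_cl; have [] := hCO i.
have mO i : measurable ((CO i).2 : set bY) by apply: measurable_op; have [] := hCO i.
have mF N : measurable (F N : set bY) by exact: measurable_cl.
have mU : measurable (U : set bY) by apply: bigcup_measurable.
have hF : {homo F : n m / (n <= m)%N >-> (n <= m)%O}.
  by move=> i j ij; apply/subsetPset => x [k /= ki Cx]; exists k => //=; exact: leq_trans ki ij.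
have cv : (mu \o (fun i => U `\` F i)) x @[x --> \oo] --> mu (\bigcap_i (U `\` F i)).
  apply: nonincreasing_cvg_mu.
  - by rewrite ltey_eq fin_num_measure//; exact: measurableD.
  - by move=> i; exact: measurableD.
  - by apply: bigcap_measurable => // i _; exact: measurableD.
  - by move=> i j ij; apply/subsetPset => x [Ox nF]; split=> // Fx; apply: nF; have /subsetPset := hF _ _ ij; exact.
have z : \bigcap_i (U `\` F i) = set0.
  apply/seteqP; split=> // x h; have [[k _ Cx] _] := h 0%N Logic.I.
  by have [_] := h k.+1 Logic.I; apply; exists k => /=.
rewrite z measure0 in cv.
have [N _ /(_ N (leqnn _)) hN] : \forall i \near \oo, (mu (U `\` F i) < (e / 2)%:E)%E.
  by apply: (cv [set y | (y < (e / 2)%:E)%E]); apply: (@nbhs_open_ereal_lt R 0 (fun=> e / 2)); rewrite divr_gt0.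
exists (F N), O; split=> //.
- by move=> x [i _ Cx]; exists i => //; have [_ _ + _ _] := hCO i; apply.
- by move=> x [i _ Cx]; exists i => //; have [_ _ _ + _] := hCO i; apply.
have sub : O `\` F N `<=` (\bigcup_i ((CO i).2 `\` (CO i).1)) `|` (U `\` F N).
  move=> x [[i _ Ox] nF]; have [Cx|nC] := EM ((CO i).1 x); [right; split=> //; by exists i|].
  by left; exists i.
have mB : measurable (\bigcup_i ((CO i).2 `\` (CO i).1) : set bY).
  by apply: bigcup_measurable => i _; exact: measurableD.
apply: le_trans (_ : mu ((\bigcup_i ((CO i).2 `\` (CO i).1)) `|` (U `\` F N)) <= _)%E.
  apply: le_measure => //; rewrite inE; first by apply: measurableD => //; exact: measurable_op.
  by apply: measurableU => //; exact: measurableD.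
apply: le_trans (measureU2 _ _ _) _ => //; first exact: measurableD.
rewrite [e in leRHS](splitr e) EFinD; apply: leeD; last exact: ltW.
have e2 : 0 <= e / 2 by rewrite divr_ge0// ltW.
have mD i : measurable ((CO i).2 `\` (CO i).1 : set bY) by exact: measurableD.
apply: le_trans (measure_sigma_subadditive mu mD mB (@subset_refl _ _)) _.
apply: le_trans (lee_nneseries _ _) (epsilon_trick0 xpredT e2).
- by move=> i _ _; exact: measure_ge0.
- by move=> i _; have [] := hCO i.
Qed.

End Regularity.

Section Displacement.
Let W1' : W 1 := @W1 R g n P.
Hypothesis W'tf : torsion_free W'.

(* An element of [W] fixing a point of [P] permutes the finitely many tiles
   around it, hence has finite order. *)
Lemma fixed_point_torsion u y : W u -> M y -> y *m u = y -> exists2 k, (0 < k)%N & u ^+ k = 1.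
Proof.
move=> Wu My fix_y; pose h k := u ^+ k.
have Wh k : W (h k) by elim: k => [|k IH]; rewrite /h ?expr0 ?exprS; [exact: W1'|exact: WM].
have fh k : y *m h k = y.
  elim: k => [|k IH]; first by rewrite /h expr0 mulmx1.
  by rewrite /h exprS (mulmxA y u) fix_y.
have hin k : [set w | W w /\ dist g y (ctr w) <= dist g y (ctr 1)] (h k).
  split; first exact: Wh.
  by rewrite -{1}(fh k) -[h k]mul1r ctr_mul mul1r (W_dist (Wh k))//; exact: (ctr_M W1').
have fin := finite_ctr fA (dist g y (ctr 1)) My.
have [inj|/existsNP[i /existsNP[j /not_implyP[eij nij]]]] := EM (injective h).
  have /infinite_nat[] : finite_set [set: nat].
  apply: (sub_finite_set _ (finite_preimage (in2W inj) fin)) => k _; exact: hin.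
wlog ij : i j eij nij / (i < j)%N.
  move=> wl; have [ij|ji|//] := ltngtP i j; first exact: (wl _ _ eij nij ij).
  exact: (wl _ _ (esym eij) (nesym nij) ji).
exists (j - i)%N; first by rewrite subn_gt0.
have Ui : h i \is a GRing.unit by exact: W_unit.
apply: (mulrI Ui); rewrite mulr1 /h -exprD subnKC ?(ltnW ij)//; exact: esym eij.
Qed.

(** After conjugation the moved point lies in [P]. Only finitely many elements of [W] move a point
    of [P] by at most 1; those of infinite order have a positive minimal displacement on the compact
    [P], since a fixed point would force torsion. Conjugates of nontrivial elements of [W'] are of
    this kind. *)
Lemma displacement : exists2 e, 0 < e & forall w x, mgroup_set W' w -> w <> 1 -> M x ->
  e <= dist g x (x *m w).
Proof.
have [D D0 hD] := @tile_diam R g n P.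
(* A displacement of at most 1 somewhere on [P] puts the centre of [u] within [1 + 2 * D] of the
   base centre. *)
pose X := [set u | [/\ W u, dist g (ctr 1) (ctr u) <= 1 + 2 * D &
  forall k, (0 < k)%N -> u ^+ k <> 1]].
have finX : finite_set X.
  by apply: (sub_finite_set _ (finite_ctr fA (1 + 2 * D) (ctr_M W1'))) => u [].
have PM y : polyhedron P y -> M y by case.
have [e e0 he] : exists2 e, 0 < e & forall u, X u -> forall y, polyhedron P y -> e <= kap g y (y *m u).
  apply: (finite_radius (Q := fun u e => forall y, polyhedron P y -> e <= kap g y (y *m u)) finX).
    by move=> u r s h sr y Py; apply: le_trans sr _; exact: h.
  move=> u [Wu _ tu].
  have ck : continuous (fun y : V => kap g y (y *m u)).
    by apply: continuous_kap; [move=> ?; exact: cvg_id|exact: continuous_mulmx].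
  apply: (compact_pos (@poly_compact _ _ _ P)).
    by move=> a; apply: open_comp (@open_gt _ a) => y _; exact: ck.
  move=> y Py; have My := PM _ Py; have Myu := WMM Wu My.
  rewrite ltNge; apply/negP => k0; have [k k1 k2] : exists2 k, (0 < k)%N & u ^+ k = 1.
    apply: (fixed_point_torsion Wu My); apply/esym/(dist_eq0 My Myu).
    by apply: (dist_kap My Myu (lexx 0)); apply/le_anti; rewrite chord0 expr0n k0 kap_ge0.
  exact: (tu k).
have [d /andP[d0 d1] hd] := small_arg (@continuous_chord2 R g 1) (chord2_0 1) e0.
exists d => // w x W'w w1 Mx; rewrite leNgt; apply/negP => close.
have Ww := W'sub W'w; have [v Wv [y Py exy]] := tile_cover fA Mx; have My := PM _ Py.
have Wv' := WV Wv; pose u := v * w * v^-1; have Wu : W u by exact: WM (WM Wv Ww) Wv'.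
have ed : dist g x (x *m w) = dist g y (y *m u).
  rewrite -exy -(W_dist Wv My (WMM Wu My)) /u -!mulmxA.
  by rewrite (mulVr (W_unit Wv) : v^-1 *m v = 1) mulmx1.
have Uv := W_unit Wv.
have uk k : u ^+ k = v * w ^+ k * v^-1.
  elim: k => [|k IH]; first by rewrite !expr0 mulr1 divrr.
  by rewrite !exprS IH /u !mulrA mulrVK.
have Xu : X u.
  split=> //.
    have t1 : tile 1 y by exists y => //; rewrite /= mulmx1.
    have tu : tile u (y *m u) by exists y.
    have a1 := hD _ _ W1' t1; have a2 := hD _ _ Wu tu.
    have := dist_triangle (ctr_M W1') My (ctr_M Wu); have := dist_triangle My (WMM Wu My) (ctr_M Wu).
    rewrite (distC (ctr_M W1') My) -ed; lra.
  move=> k k0 uk1; apply: w1; apply: (W'tf (k := k)) => //.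
  have : v * w ^+ k * v^-1 = v * 1 * v^-1 by rewrite -uk uk1 mulr1 divrr.
  by move/(mulIr (_ : v^-1 \is a GRing.unit)); rewrite unitrV => /(_ Uv) /(mulrI Uv).
have := he _ Xu _ Py; rewrite leNgt => /negP; apply.
by apply: lt_trans hd; rewrite mul1r (kap_lt_dist My (WMM Wu My) (ltW d0)) -ed.
Qed.

End Displacement.

End QuotientMeasure.

(** * Level sets of small mass *)

Section LightLevel.
Context {R : realType} {X : Type}.
Variables (nu : set X -> R) (h : X -> R).
Hypothesis fp : fap setT nu.

Lemma fap_sub (D E : set X) : nu (D `|` E) <= nu D + nu E.
Proof.
have -> : D `|` E = D `|` (E `&` ~` D) by rewrite setUIr setUCr setIT.
rewrite (fap_U fp)//; first by rewrite lerD2l; apply: (pr_le fp) => // x [].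
by rewrite setICA setICr setI0.
Qed.

Lemma fap_le (D E : set X) : D `<=` E -> nu D <= nu E.
Proof. exact: (pr_le fp). Qed.

(* Some level set of [h] between [a] and [b] has arbitrarily light neighbourhoods:
   halve the mass repeatedly. *)
Lemma light_level a b : a < b -> exists2 r, a < r < b & forall e, 0 < e ->
  exists s t, s < r < t /\ nu [set x | s < h x < t] < e.
Proof.
move=> ab; pose m (st : R * R) := nu [set x | st.1 <= h x < st.2].
pose q (st : R * R) := (st.2 - st.1) / 4.
pose L st := (st.1 + q st, st.1 + q st *+ 2); pose U st := (st.1 + q st *+ 2, st.1 + q st *+ 3).
pose step st := if m (L st) <= m (U st) then L st else U st.
pose z k := iter k step (a, b).
have half (st : R * R) : st.1 < st.2 -> [/\ st.1 < (step st).1, (step st).1 < (step st).2,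
    (step st).2 < st.2 & m (step st) *+ 2 <= m st].
  move=> lt; have q0 : 0 < q st by rewrite divr_gt0// subr_gt0.
  have q4 : st.2 = st.1 + q st *+ 4 by rewrite -mulr_natr /q divfK// subrKC.
  have sum : m (L st) + m (U st) <= m st.
    rewrite -(fap_U fp)//; last first.
      apply/seteqP; split=> // x [/= /andP[_ h1] /andP[h2 _]].
      by move: (lt_le_trans h1 h2); rewrite ltxx.
    apply: fap_le => x /= [] /andP[h1 h2]; apply/andP; split.
    - by apply: le_trans h1; rewrite lerDl ltW.
    - by apply: lt_le_trans h2 _; rewrite q4 lerD2l ler_pMn2l.
    - by apply: le_trans h1; rewrite lerDl mulrn_wge0// ltW.
    - by apply: lt_le_trans h2 _; rewrite q4 lerD2l ler_pMn2l.
  rewrite /step; case: ifPn => [le|]; [|rewrite -ltNge => /ltW le]; split => /=.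
  - by rewrite ltrDl.
  - by rewrite ltrD2l mulr2n ltrDl.
  - by rewrite q4 ltrD2l ltr_pMn2l.
  - by rewrite mulr2n (le_trans _ sum)// lerD2l.
  - by rewrite ltrDl mulrn_wgt0.
  - by rewrite ltrD2l ltr_pMn2l.
  - by rewrite q4 ltrD2l ltr_pMn2l.
  - by rewrite mulr2n (le_trans _ sum)// lerD2r.
have z_lt k : (z k).1 < (z k).2 by elim: k => [//|k IH]; have [] := half _ IH.
have zP k : [/\ (z k).1 < (z k.+1).1, (z k.+1).1 < (z k.+1).2, (z k.+1).2 < (z k).2 &
  m (z k.+1) *+ 2 <= m (z k)] := half _ (z_lt k).
have z1 k j : (z k).1 <= (z (k + j)%N).1.
  elim: j => [|j IH]; first by rewrite addn0.
  by rewrite addnS (le_trans IH)// ltW//; have [] := zP (k + j)%N.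
have z2 k j : (z (k + j)%N).2 <= (z k).2.
  elim: j => [|j IH]; first by rewrite addn0.
  by rewrite addnS (le_trans _ IH)// ltW//; have [] := zP (k + j)%N.
have z12 k j : (z k).1 <= (z j).2.
  by rewrite (le_trans (z1 k j))// (le_trans (ltW (z_lt _)))// addnC.
pose E := range (fun k => (z k).1); pose r := sup E.
have hs : has_sup E by split; [exists (z 0%N).1, 0%N|exists (z 0%N).2 => _ [k _ <-]].
have rl k : (z k).1 < r.
  apply: lt_le_trans (_ : (z k.+1).1 <= _); first by have [] := zP k.
  by apply: ub_le_sup; [case: hs|exists k.+1].
have ru k : r < (z k).2.
  apply: le_lt_trans (_ : _ <= (z k.+1).2) _; last by have [] := zP k.
  by apply: ge_sup; [case: hs|move=> _ [j _ <-]].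
exists r; first by rewrite (rl 0%N) (ru 0%N).
move=> e e0.
have mk k : m (z k) * 2 ^+ k <= 1.
  elim: k => [|k IH]; first by rewrite mulr1 -(fap_1 fp); exact: fap_le.
  by apply: le_trans IH; rewrite exprS mulrA ler_wpM2r ?exprn_ge0// mulr_natr; have [] := zP k.
have [k hk] : exists k, (2 ^+ k)^-1 < e.
  exists (Num.truncn e^-1); rewrite invf_plt ?posrE ?exprn_gt0//.
  apply: lt_le_trans (truncnS_gt _) _; rewrite -natrX ler_nat; exact: ltn_expl.
exists (z k).1, (z k).2; rewrite rl ru; split=> //.
apply: le_lt_trans hk; rewrite -[leRHS]mul1r ler_pdivlMr ?exprn_gt0//.
apply: le_trans (mk k); rewrite ler_wpM2r ?exprn_ge0//; apply: fap_le => x /= /andP[/ltW -> ->//].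
Qed.

End LightLevel.

(** * From a finitely additive probability to a Borel measure *)

Section Extension.
Context {R : realType} {g : geometry} {n : nat} {P : coxeter_polyhedron R g n}.
Context {W' : matrix_group R n} {K : polyhedral_complex P}.
Context {A : set (cplx_point K)} {f : 'rV[R]_n.+2 -> cplx_point K}.
Notation W := (coxeter_group P).
Notation Y := (T1Y g W').
Notation bY := (borel_T1Y g W').
Implicit Types (C D E F N O : set Y) (r s t e : R).
Hypotheses (fA : tessellation_isometry f A) (W'sub : W' `<=` W) (W'fin : finite_index W' W).
Variable nu : set Y -> R.
Hypothesis fp : fap setT nu.

Definition bdry E := closure E `&` closure (~` E).

(** The continuity sets of [nu]. Asking for light open neighbourhoods of the boundary, rather than
    for a boundary of mass zero, is the form suited to finite additivity. *)
Definition null E := forall e, 0 < e -> exists N, [/\ open N, bdry E `<=` N & nu N < e].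

Lemma nullC E : null E -> null (~` E).
Proof. by move=> h e /h[N [oN bN lN]]; exists N; split=> //; rewrite /bdry setCK setIC. Qed.

Lemma nullI D E : null D -> null E -> null (D `&` E).
Proof.
move=> hD hE e e0; have e2 : 0 < e / 2 by rewrite divr_gt0.
have [N [oN bN lN]] := hD _ e2; have [U [oU bU lU]] := hE _ e2.
exists (N `|` U); split; first exact: openU.
  move=> y [/closureI[c1 c1']]; rewrite setCI closureU => -[c2|c2]; [left; exact: bN|right; exact: bU].
by rewrite (le_lt_trans (fap_sub fp _ _))// [ltRHS]splitr ltrD.
Qed.

Lemma null0 : null set0.
Proof.
move=> e e0; exists set0; split; first exact: open0.
  by rewrite /bdry closure0 set0I.
by rewrite (pr0 fp).
Qed.

Lemma nullU D E : null D -> null E -> null (D `|` E).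
Proof. by move=> /nullC hD /nullC hE; rewrite -[D `|` E]setCK setCU; apply/nullC/nullI. Qed.

Lemma null_level C a b : a < b -> exists2 r, a < r < b & null [set y | dset C y < r].
Proof.
move=> ab; have [r rab hr] := light_level (dset C) fp ab; exists r => // e /hr[s [t [/andP[sr rt] h]]].
exists [set y | s < dset C y < t]; split=> //.
  rewrite (_ : mkset _ = [set y | s < dset C y] `&` [set y | dset C y < t]).
    by apply: openI; [exact: (dset_gt_open W'sub)|exact: (dset_lt_open W'sub)].
  by apply/seteqP; split=> y /=; [move=> /andP[]|move=> [-> ->]].
move=> y [c1 c2] /=; apply/andP; split.
  apply: lt_le_trans sr _; rewrite leNgt; apply/negP => lt.
  have [z [/= nz hz]] := c2 _ (open_nbhs_nbhs (conj (dset_lt_open W'sub C r) lt)).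
  by apply: nz.
apply: le_lt_trans rt; rewrite leNgt; apply/negP => lt.
have [z [/= nz hz]] := c1 _ (open_nbhs_nbhs (conj (dset_gt_open W'sub C r) lt)).
by move: (lt_trans nz hz); rewrite ltxx.
Qed.

(** A copy of the quotient whose measurable sets are the [null] sets. The proof [fp] is part of the
    type because the algebra axioms are proved from it. *)
Definition null_type (_ : fap setT nu) : Type := Y.
HB.instance Definition _ := Pointed.on (null_type fp).
HB.instance Definition _ := isAlgebraOfSets.Build default_measure_display (null_type fp)
  null0 nullU nullC.

Definition nuE (E : set (null_type fp)) : \bar R := (nu E)%:E.

Lemma nuE_ge0 E : (0 <= nuE E)%E.
Proof. by rewrite lee_fin; exact: (fap_ge0 fp). Qed.

Lemma nuE_additive : measure_function.semi_additive nuE.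
Proof.
move=> F k mF tF _; elim: k => [|k IH].
  by rewrite !big_ord0 /nuE (pr0 fp).
rewrite !big_ord_recr /= -IH /nuE (fap_U fp)//.
apply/seteqP; split=> // y []; rewrite -bigcup_mkord => -[i /= ik Fi] Fk.
by have := tF i k Logic.I Logic.I (ex_intro _ y (conj Fi Fk)) => e; move: ik; rewrite e ltnn.
Qed.

HB.instance Definition _ := isContent.Build _ _ _ nuE nuE_ge0 nuE_additive.

Lemma fap_bigcup (F : nat -> set Y) k : nu (\bigcup_(i < k) F i) <= \sum_(i < k) nu (F i).
Proof.
elim: k => [|k IH]; first by rewrite bigcup_mkord big_ord0 big_ord0 (pr0 fp).
rewrite bigcup_mkord !big_ord_recr /= -bigcup_mkord.
by apply: le_trans (fap_sub fp _ _) _; rewrite lerD2r.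
Qed.

(* Compactness: a set of [null_type] is approximated by compact sets from the
   inside, and the sets covering it by open sets from the outside. *)
Lemma nuE_sub : measurable_subset_sigma_subadditive nuE.
Proof.
move=> E F nF nE EF; apply/lee_addgt0Pr => e e0; have e2 : 0 < e / 2 by rewrite divr_gt0.
have [N [oN bN lN]] := nE _ e2.
have /choice[U hU] i : exists U, [/\ open U, bdry (F i) `<=` U & nu U < e / 2 / (2 ^ i.+1)%:R].
  by apply: nF; rewrite !divr_gt0// ltr0n expn_gt0.
pose O i := interior (F i) `|` U i.
have oO i : open (O i) by apply: openU; [exact: open_interior|have [] := hU i].
have FO i : F i `<=` O i.
  move=> y Fy; have [iy|ny] := EM (interior (F i) y); [by left|right].
  have [_ bU _] := hU i; apply: bU; split; first exact: subset_closure.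
  by rewrite closure_setC.
pose C := closure E `\` N.
have CE : C `<=` E.
  move=> y [cE nN]; apply: contrapT => ne; apply: nN; apply: bN; split=> //.
  exact: subset_closure.
have cC : compact C.
  apply: (subclosed_compact _ (compact_Y fA W'sub W'fin)) => //.
  by apply: closedI; [exact: closed_closure|exact: open_closedC].
have [k hk] : exists k, C `<=` \bigcup_(i < k) O i.
  have /compact_near_coveringP cn := cC.
  have [|k _ hk] := cn nat \oo (fun k y => (\bigcup_(i < k) O i) y) _.
    move=> y /CE/EF[i _ /FO Oy].
    exists (O i, [set m | (i < m)%N]); first split.
    - by apply: open_nbhs_nbhs; split; [exact: oO|exact: Oy].
    - by exists i.+1.
    by move=> [x m] [/= Ox im]; exists i.
  by exists k => y; exact: (hk k (leqnn k)).
have le1 : nu E <= \sum_(i < k) nu (F i) + \sum_(i < k) e / 2 / (2 ^ i.+1)%:R + e / 2.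
  apply: le_trans (_ : nu (\bigcup_(i < k) O i `|` N) <= _).
    apply: (fap_le fp) => y Ey; have [Ny|nN] := EM (N y); [by right|left; apply: hk].
    by split=> //; exact: subset_closure.
  apply: le_trans (fap_sub fp _ _) _; apply: lerD; last exact: ltW.
  apply: le_trans (fap_bigcup _ _) _; rewrite -big_split; apply: ler_sum => i _.
  apply: le_trans (fap_sub fp _ _) _; have [_ _ lU] := hU i; apply: lerD; last exact: ltW.
  by apply: (fap_le fp); exact: interior_subset.
have le2 : (\sum_(i < k) e / 2 / (2 ^ i.+1)%:R <= e / 2)%R.
  rewrite -lee_fin -sumEFin; apply: le_trans (epsilon_trick0 xpredT (ltW e2)).
  rewrite -(big_mkord xpredT (fun i => (e / 2 / (2 ^ i.+1)%:R)%:E)).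
  by apply: nneseries_lim_ge => i _ _; rewrite lee_fin ltW// !divr_gt0// ltr0n expn_gt0.
apply: le_trans (_ : (\sum_(i < k) nuE (F i) + e%:E <= _)%E); last first.
  rewrite leeD2r// -(big_mkord xpredT (fun i => nuE (F i))).
  by apply: nneseries_lim_ge => i _ _; exact: nuE_ge0.
rewrite sumEFin -EFinD lee_fin; apply: le_trans le1 _.
by rewrite -addrA lerD2l [leRHS]splitr lerD2r.
Qed.

HB.instance Definition _ := Content_SigmaSubAdditive_isMeasure.Build _ _ _ nuE nuE_sub.

Definition bnull : set (set bY) := [set E : set Y | @measurable _ bY E /\ null E].

(** The closed sets exhausting [O] are cut at generic levels [r i < i.+1%:R^-1], which makes them
    continuity sets; such sets therefore generate the Borel sets. *)
Lemma open_null O : open O -> <<s bnull>> O.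
Proof.
move=> oO; have /choice[r hr] (i : nat) : exists r, 0 < r < i.+1%:R^-1 /\ null [set y | dset (~` O) y < r].
  have [|r h1 h2] := @null_level (~` O) 0 i.+1%:R^-1; first by rewrite invr_gt0.
  by exists r.
have -> : O = \bigcup_i ~` [set y | dset (~` O) y < r i].
  apply/seteqP; split=> y.
    move=> Oy; have pos : 0 < dset (~` O) y by apply: (dset_gt0 W'sub) => //; exact: open_closedC.
    have [i _ /(_ i (leqnn _)) hi] := near_infty_natSinv_lt (PosNum pos).
    exists i => //= h; have [/andP[_ h1] _] := hr i.
    by have := lt_trans (lt_trans hi h) h1; rewrite ltxx.
  move=> [i _ h]; apply: contrapT => nO; apply: h => /=.
  by rewrite (dset_in W'sub)//; have [/andP[]] := hr i.
have [s0 sC sU] : sigma_algebra setT <<s bnull>> by exact: smallest_sigma_algebra.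
apply: sU => i; apply: sub_sigma_algebra; split; last by apply: nullC; have [] := hr i.
by apply: measurableC; apply: sub_sigma_algebra; exact: (dset_lt_open W'sub).
Qed.

Lemma borel_bnull (E : set bY) : measurable E -> <<s bnull>> E.
Proof.
apply: smallest_sub; first exact: smallest_sigma_algebra.
exact: open_null.
Qed.

Lemma borel_null (E : set bY) : measurable E -> <<s null>> E.
Proof.
move=> /borel_bnull; apply: smallest_sub; first exact: smallest_sigma_algebra.
by move=> D [_ nD]; exact: sub_sigma_algebra.
Qed.

Definition ext (E : set bY) : \bar R := measure_extension nuE E.

Lemma ext_null E : null E -> ext E = (nu E)%:E.
Proof. by move=> nE; rewrite /ext /measure_extension measurable_mu_extE. Qed.
Lemma ext0 : ext set0 = 0%E.
Proof. by rewrite ext_null ?(pr0 fp)//; exact: null0. Qed.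
Lemma ext_ge0 E : (0 <= ext E)%E.
Proof. exact: measure_ge0. Qed.

Lemma ext_sigma_additive : semi_sigma_additive ext.
Proof.
move=> F mF tF mU; apply: (@measure_semi_sigma_additive _ _ _ (measure_extension nuE)) => //.
  by move=> i; apply: borel_null; exact: mF.
exact: borel_null.
Qed.

HB.instance Definition _ := isMeasure.Build _ _ _ ext ext0 ext_ge0 ext_sigma_additive.

Lemma ext_setT : ext setT = 1%E.
Proof. by rewrite ext_null ?(fap_1 fp)// -setC0; apply: nullC; exact: null0. Qed.

HB.instance Definition _ := Measure_isProbability.Build _ _ _ ext ext_setT.

Lemma extension : exists mu : probability bY R, forall E, null E -> mu E = (nu E)%:E.
Proof. by exists ext; exact: ext_null. Qed.

End Extension.

(** * Invariance of the limit measure *)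

Section Limit.
Context {R : realType} {g : geometry} {n : nat} {P : coxeter_polyhedron R g n}.
Context {W' : matrix_group R n} {K : polyhedral_complex P}.
Context {A : set (cplx_point K)} {f : 'rV[R]_n.+2 -> cplx_point K}.
Notation W := (coxeter_group P).
Notation UT := (@unit_tangent_set R g n).
Notation prj := (@prj R g n W').
Notation lft := (@lft R g n W').
Notation qf := (@quotient_flow R g n W').
Notation Y := (T1Y g W').
Notation bY := (borel_T1Y g W').
Implicit Types (C D E N O : set Y) (r s t e d : R).
Hypotheses (fA : tessellation_isometry f A) (W'sub : W' `<=` W) (W'fin : finite_index W' W).
Variable nu : set Y -> R.
Hypothesis fp : fap setT nu.
Notation null := (null nu).
Notation bnull := (bnull nu).

Definition fat E d : set Y := [set y | dset E y < d].

Lemma fat_sub E d : 0 < d -> E `<=` fat E d.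
Proof. by move=> d0 y Ey; rewrite /fat /= (dset_in W'sub). Qed.

Lemma fat_fat E d : fat (fat E (d / 2)) (d / 2) `<=` fat E d.
Proof.
move=> y; rewrite /fat /= -(prj_lft y); set p := lft y; have Up : UT p := UT_lft y.
have [d1|d1] := leP (d / 2) 1; last first.
  by move=> _; apply: le_lt_trans (dset_le1 E (prj p)) _; move: d1; rewrite ltr_pdivlMr//; lra.
move=> /(dset_lt W'sub Up)-/(_ d1)[q [Uq h1 h2]].
by rewrite [ltRHS]splitr (le_lt_trans (dset_lip W'sub E Up Uq))// ltrD.
Qed.

Lemma fat_closed C O : closed C -> open O -> C `<=` O -> exists2 d, 0 < d & fat C d `<=` O.
Proof.
move=> cC oO CO; have [|e e0 he] := closed_separated fA W'sub W'fin cC (open_closedC oO).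
  by apply/seteqP; split=> // y [/CO].
exists (Num.min e 1); first by rewrite lt_min e0 ltr01.
move=> y; rewrite /fat /= -(prj_lft y); set p := lft y; have Up : UT p := UT_lft y.
have m1 : Num.min e 1 <= 1 by rewrite ge_min lexx orbT.
move=> /(dset_lt W'sub Up)-/(_ m1)[q [Uq Cq h2]]; apply: contrapT => nO.
have := he q p Uq Up Cq nO; rewrite rhoC// leNgt => /negP; apply.
by apply: lt_le_trans h2 _; rewrite ge_min lexx.
Qed.

(** The closure of [E] lies in the open set formed by its interior and a light neighbourhood of its
    boundary; compactness leaves room there for a whole fattening. *)
Lemma fat_null E e : null E -> 0 < e -> exists2 d, 0 < d & nu (fat E d) <= nu E + e.
Proof.
move=> nE e0; have [N [oN bN lN]] := nE _ e0.
have [|d d0 hd] := @fat_closed (closure E) (interior E `|` N) (@closed_closure _ _) (openU (@open_interior _ _) oN).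
  move=> y cy; have [iy|ny] := EM (interior E y); [by left|right]; apply: bN; split=> //.
  by rewrite closure_setC.
exists d => //; apply: le_trans (_ : nu (E `|` N) <= _).
  apply: (fap_le fp) => y h; have [|iE|Ny] := hd y _; [|by left; exact: interior_subset|by right].
  rewrite /fat /=; apply: le_lt_trans h; rewrite -(prj_lft y); have Up := UT_lft y.
  rewrite leNgt; apply/negP => h; have h' := lt_le_trans h (dset_le1 _ _).
  have [q [Uq Eq hq]] := dset_lt W'sub Up h (dset_le1 _ _).
  have := dset_le W'sub Up Uq (subset_closure Eq).
  by rewrite leNgt hq.
by rewrite (le_trans (fap_sub fp _ _))// lerD2l ltW.
Qed.

(** Compactness covers the space by finitely many balls with property [G] and generic radii. A point
    is coded by the first ball containing it, so each cell is a Boolean combination of continuity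
    sets inside one ball. *)
Lemma fine_partition (G : set Y -> Prop) : (forall D E, D `<=` E -> G E -> G D) ->
  (forall y : Y, exists2 e, 0 < e & G (fat [set y] e)) ->
  exists (I : finType) (a : Y -> I), forall i, bnull (a @^-1` [set i]) /\ G (a @^-1` [set i]).
Proof.
move=> Gd Gb.
have /choice[r hr] (y : Y) : exists r, [/\ 0 < r, null (fat [set y] r) & G (fat [set y] r)].
  have [e e0 Ge] := Gb y; have [r /andP[r0 re] nr] := null_level W'sub fp [set y] e0.
  by exists r; split=> //; apply: Gd Ge => z h; exact: lt_trans h re.
have [s hs] : exists s : seq Y, forall y, exists2 b, b \in s & fat [set b] (r b) y.
  have := compact_Y fA W'sub W'fin; rewrite compact_cover => cY.
  have [||D' _ hD] := cY Y setT (fun b => fat [set b] (r b)).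
  - by move=> b _; exact: (dset_lt_open W'sub).
  - by move=> a _; exists a => //; apply: fat_sub => //; have [] := hr a.
  exists (finmap.enum_fset D') => a.
  by have [b bD hb] := hD a Logic.I; exists b.
pose B k := fat [set nth point s k] (r (nth point s k)).
pose idx y := find (fun b => `[< fat [set b] (r b) y >]) s.
have hat y : (idx y < size s)%N -> B (idx y) y.
  by rewrite -has_find => h; apply/asboolP; exact: (nth_find point h).
have hidx y : (idx y < size s)%N.
  by rewrite -has_find; apply/hasP; have [b bs hb] := hs y; exists b => //; apply/asboolP.
pose a y := Ordinal (hidx y).
have atom i : a @^-1` [set i] = B i `&` \bigcap_(k < i) ~` B k.
  apply/seteqP; split=> y /=.
    move=> <-; split=> [|k /= ki]; first exact: hat.
    by have := before_find point ki => /asboolPn.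
  move=> [Bi nB]; apply/val_inj => /=; rewrite /idx; have [lt|gt|//] := ltngtP (idx y) i.
    by exfalso; exact: (nB _ lt (hat _ (hidx y))).
  by have := before_find point gt => /asboolPn.
exists 'I_(size s), a => i; split; last first.
  by rewrite atom; have [_ _ +] := hr (nth point s i); apply: Gd => y [].
have Bb k : bnull (B k).
  split; last by have [] := hr (nth point s k).
  by apply: sub_sigma_algebra; exact: (dset_lt_open W'sub).
have bI D E : bnull D -> bnull E -> bnull (D `&` E).
  by move=> [mD nD] [mE nE]; split; [exact: measurableI|exact: nullI].
have bC D : bnull D -> bnull (~` D).
  by move=> [mD nD]; split; [exact: measurableC|exact: nullC].
rewrite atom; apply: (bI) => //; elim: (nat_of_ord i) => [|k IH].
  rewrite (_ : \bigcap_(_ < _) _ = setT); last by apply/seteqP; split=> // y _ k.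
  by split; [exact: measurableT|rewrite -setC0; apply: nullC; exact: null0].
rewrite (_ : \bigcap_(_ < _) _ = (\bigcap_(j < k) ~` B j) `&` ~` B k); first by apply: (bI) => //; exact: bC.
apply/seteqP; split=> y h.
  by split; [move=> j jk; apply: h; exact: ltnW|by apply: (h k) => /=].
by move=> j; rewrite /= ltnS leq_eqVlt => /predU1P[->|jk]; [case: h|case: h => + _; exact].
Qed.

Hypothesis qi : forall t d E, 0 <= t -> 0 < d -> nu (qf t @^-1` E) <= nu (fat E d).

Lemma null_flow t E : 0 <= t -> null E -> null (qf t @^-1` E).
Proof.
move=> t0 nE e e0; have [N [oN bN lN]] := nE _ e0.
have cb : closed (bdry E) by apply: closedI; exact: closed_closure.
have [d d0 hd] := fat_closed cb oN bN; have d2 : 0 < d / 2 by rewrite divr_gt0.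
exists (qf t @^-1` fat (bdry E) (d / 2)); split.
- apply: open_comp; last exact: (dset_lt_open W'sub).
  by move=> y _; exact: (continuous_quotient_flow W'sub).
- have sub D : closure (qf t @^-1` D) `<=` qf t @^-1` closure D.
    move=> y cy U nU; have := continuous_quotient_flow W'sub nU => nU'.
    by have [z [z1 z2]] := cy _ nU'; exists (qf t z).
  by move=> y [c1 c2]; apply: fat_sub => //; split; exact: sub.
apply: le_lt_trans lN; apply: le_trans (qi _ t0 d2) _; apply: (fap_le fp).
exact: subset_trans (@fat_fat _ _) hd.
Qed.

(** Averages over a grid of times are invariant only up to a fattening, as in [qi]. For continuity
    sets the fattening can be shrunk away, which gives one inequality, and the complement gives the
    other. *)
Lemma nu_flow t E : 0 <= t -> null E -> nu (qf t @^-1` E) = nu E.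
Proof.
move=> t0 nE.
have le D : null D -> nu (qf t @^-1` D) <= nu D.
  move=> nD; apply/ler_addgt0Pr => e /(fat_null nD)[d d0 h].
  exact: le_trans (qi _ t0 d0) h.
have comp D : nu (~` D) = 1 - nu D.
  have : nu (D `|` ~` D) = nu D + nu (~` D) by rewrite (fap_U fp)// setICr.
  by rewrite setUCr (fap_1 fp) => ->; rewrite addrC addKr.
apply/le_anti; rewrite le//=.
by have := le _ (nullC nE); rewrite (_ : _ @^-1` _ = ~` (qf t @^-1` E))// !comp lerD2l lerN2.
Qed.

(** For [0 <= t] the measure and its image agree on [bnull], which is stable under intersection and
    generates the Borel sets; negative times follow by inverting the flow. *)
Lemma invariant_limit : exists2 mu : probability bY R, flow_invariant mu &
  forall E, null E -> mu E = (nu E)%:E.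
Proof.
have [mu hmu] := extension fA W'sub W'fin fp; exists mu => //.
have pos t (E : set bY) : 0 <= t -> measurable E -> mu (qf t @^-1` E) = mu E.
  move=> t0 mE; have mq := measurable_flow W'sub t.
  apply/esym; apply: (@g_sigma_algebra_measure_unique _ _ bY bnull _ (fun=> setT) _ _ mu (pushforward mu (qf t))).
  - by move=> D [].
  - by move=> _; split; [exact: measurableT|rewrite -setC0; apply: nullC; exact: null0].
  - by apply/seteqP; split=> // y _; exists 0%N.
  - by move=> D E' [mD nD] [mE' nE']; split; [exact: measurableI|exact: nullI].
  - move=> D [mD nD]; have nD' : null (qf t @^-1` D) by exact: null_flow.
    by rewrite -[LHS]/(mu D) -[RHS]/(mu (qf t @^-1` D)) (hmu _ nD) (hmu _ nD') nu_flow.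
  - by move=> _; rewrite ltey_eq fin_num_measure//; exact: measurableT.
  - exact: (borel_bnull W'sub fp mE).
move=> t E mE; have [/pos->//|/ltW t0] := leP 0 t.
have mq := measurable_pre (measurable_flow W'sub t) mE.
rewrite -(pos (- t) _ _ mq) ?oppr_ge0//; congr (mu _); apply/seteqP; split=> y /=;
  by rewrite (quotient_flowD W'sub) addNr (quotient_flow0 W'sub).
Qed.

End Limit.

(** * Ultrafilter limits and empirical measures *)

Section Ultralimit.
Context {R : realType}.
Variable U : set_system nat.
Hypothesis UU : UltraFilter U.

Lemma bounded_ultra_cvg (x : nat -> R) c : (forall k, `|x k| <= c) ->
  exists l : R, x k @[k --> U] --> l.
Proof.
move=> hx; have PU : ProperFilter U by exact: ultra_proper.
have cI := @segment_compact R (- c) c.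
have [|l [_ cl]] := cI (fmap x U) _ _.
  change (U (x @^-1` [set` `[- c, c]])); rewrite (_ : _ @^-1` _ = setT); first exact: filterT.
  by apply/seteqP; split=> // k _; rewrite /= in_itv/= -ler_norml.
exists l => V nV; have [//|h] := in_ultra_setVsetC (x @^-1` V) UU.
by have [z [/= nz Vz]] := cl (~` V) V h nV.
Qed.

End Ultralimit.

Section Empirical.
Context {R : realType} {X : Type}.

Definition emp (J : finType) (s : J -> R) (z : J -> X) (E : set X) : R :=
  \sum_(j | `[< E (z j) >]) s j.

Lemma emp_fap (J : finType) (s : J -> R) (z : J -> X) : (forall j, 0 <= s j) ->
  \sum_j s j = 1 -> fap setT (emp s z).
Proof.
move=> s0 s1; split=> //.
- by move=> D _; apply: sumr_ge0.
- by rewrite -s1; apply: eq_bigl => j; apply/asboolP.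
move=> D E _ _ DE; rewrite /emp (bigID (fun j => `[< D (z j) >])) /=; congr (_ + _);
  apply: eq_bigl => j; apply/idP/idP.
- by move=> /andP[].
- by move=> Dz; rewrite Dz andbT; apply/asboolP; left; exact/asboolP.
- by move=> /andP[/asboolP[h|h] /asboolPn nD]; [case: nD|exact/asboolP].
- move=> /asboolP Ez; apply/andP; split; first by apply/asboolP; right.
  by apply/asboolPn => Dz; have : (D `&` E) (z j) by []; rewrite DE.
Qed.

Lemma emp_le1 (J : finType) (s : J -> R) (z : J -> X) E : (forall j, 0 <= s j) ->
  \sum_j s j = 1 -> 0 <= emp s z E <= 1.
Proof.
move=> s0 s1; have fp := emp_fap z s0 s1; rewrite (fap_ge0 fp)//= -(fap_1 fp).
exact: (fap_le fp).
Qed.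

(** Coding points by cells forgets at most the choice among the [k] points of a cell, which is worth
    [ln k]. *)
Lemma emp_entropy (J I : finType) (s : J -> R) (z : J -> X) (a : X -> I) (k : nat) :
  (forall j, 0 <= s j) -> \sum_j s j = 1 ->
  (forall j0, (#|[pred j | a (z j) == a (z j0)]| <= k)%N) ->
  ent s - ln k%:R <= entropy (emp s z) a.
Proof.
move=> s0 s1 hk.
have lawE i : law (emp s z) a i = \sum_(j in [pred j | a (z j) == i]) s j.
  by apply: eq_bigl => j; rewrite inE; apply/asboolP/eqP.
have k0 : 0 <= ln k%:R :> R by case: k hk => [|k] _; [rewrite ln0|rewrite ln_ge0// ler1n].
have split i : law (emp s z) a i * ln (law (emp s z) a i) -
    \sum_(j in [pred j | a (z j) == i]) s j * ln (s j) <= law (emp s z) a i * ln k%:R.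
  have [[j0 /eqP e0]|no] := EM (exists j0, a (z j0) == i).
    have h : (#|[pred j | a (z j) == i]| <= k)%N by rewrite -e0.
    by rewrite lawE; exact: (ent_split s0 h).
  have z0 F : \sum_(j in [pred j | a (z j) == i]) F j = 0 :> R.
    by apply: big1 => j; rewrite inE => h; case: no; exists j.
  by rewrite !lawE !z0 !mul0r subrr.
have e1 : ent s = - \sum_i \sum_(j in [pred j | a (z j) == i]) s j * ln (s j).
  by rewrite /ent (partition_big (fun j => a (z j)) xpredT).
have l1 : \sum_i law (emp s z) a i = 1.
  rewrite -s1 [RHS](partition_big (fun j => a (z j)) xpredT)//=.
  by apply: eq_bigr => i _; rewrite lawE.
have : \sum_i (law (emp s z) a i * ln (law (emp s z) a i) -
    \sum_(j in [pred j | a (z j) == i]) s j * ln (s j)) <= \sum_i law (emp s z) a i * ln k%:R.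
  by apply: ler_sum => i _; exact: split.
rewrite sumrB -mulr_suml l1 mul1r.
rewrite e1 /entropy /ent; move: (\sum_i \sum_(_ in _) _) (\sum_i _ * _) (ln _) => u v w; lra.
Qed.

(** Concavity of entropy: each component is compared, by cross-entropy, with the law of the
    average. *)
Lemma entropy_avg (I : finType) (Q : nat) (pr : 'I_Q -> set X -> R) (p : set X -> R) (a : X -> I) :
  (0 < Q)%N -> (forall l, fap setT (pr l)) -> (forall E, p E = Q%:R^-1 * \sum_l pr l E) ->
  \sum_l entropy (pr l) a <= Q%:R * entropy p a.
Proof.
move=> Q0 fpl pE; have Qn : Q%:R != 0 :> R by rewrite pnatr_eq0 -lt0n.
have lE i : Q%:R * law p a i = \sum_l law (pr l) a i by rewrite /law pE mulrA divff// mul1r.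
have ad l : adapted setT a by [].
have l0 l i : 0 <= law (pr l) a i by exact: (law_ge0 (fpl l)).
have Qp : 0 < Q%:R :> R by rewrite ltr0n.
have p0 i : 0 <= law p a i by rewrite -(pmulr_rge0 _ Qp) lE sumr_ge0.
have p1 : \sum_i law p a i = 1.
  apply: (mulfI Qn); rewrite mulr_sumr (eq_bigr _ (fun i _ => lE i)) exchange_big /=.
  rewrite (eq_bigr (fun=> 1)) ?sumr_const ?card_ord ?mulr1// => l _.
  exact: (law_sum1 (fpl l)).
have pos l i : 0 < law (pr l) a i -> 0 < law p a i.
  move=> h; rewrite -(pmulr_rgt0 _ Qp) lE; apply: lt_le_trans h _.
  by rewrite (bigD1 l)//= lerDl sumr_ge0.
rewrite (_ : Q%:R * entropy p a = \sum_l - \sum_i law (pr l) a i * ln (law p a i)); last first.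
  rewrite sumrN exchange_big /= /entropy /ent mulrN mulr_sumr; congr (- _).
  by apply: eq_bigr => i _; rewrite mulrA lE mulr_suml.
apply: ler_sum => l _; apply: ent_cross => //; first exact: pos.
  exact: (law_sum1 (fpl l)).
by rewrite p1.
Qed.

(** Entropies are dominated by a cross-entropy with a fixed reference, which passes to the limit.
    The reference is half of the limit law increased by [eta], so as to be positive on cells that
    [nu] does not charge; halving costs [ln 2], and 2 leaves room for the convergence. *)
Lemma entropy_ulim (U : set_system nat) (I : finType) (pr : nat -> set X -> R) (nu : set X -> R)
  (a : X -> I) : UltraFilter U -> (forall T, fap setT (pr T)) -> fap setT nu ->
  (forall E, pr T E @[T --> U] --> nu E) ->
  \forall T \near U, entropy (pr T) a <= entropy nu a + 2.
Proof.
move=> UU fpT fpn cv; have PU : ProperFilter U by exact: ultra_proper.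
have ad : adapted setT a by [].
have n0 i : 0 <= law nu a i by exact: (law_ge0 fpn).
pose k : R := #|I|%:R; have k0 : 0 <= k by exact: ler0n.
pose eta : R := (1 + k)^-1; have eta0 : 0 < eta by rewrite invr_gt0 ltr_wpDr.
pose q i := (law nu a i + eta) / 2.
have q0 i : 0 < q i by rewrite divr_gt0// ltr_wpDl.
have q1 : \sum_i q i <= 1.
  rewrite -mulr_suml big_split /= (law_sum1 fpn ad) sumr_const -[_ *+ _]mulr_natr -/k.
  rewrite ler_pdivrMr// mul1r (_ : 2 = 1 + 1)// lerD2l /eta mulrC ler_pdivrMr ?ltr_wpDr// mul1r.
  by rewrite lerDr.
have cvs (r : seq I) : (\sum_(i <- r) law (pr T) a i * - ln (q i)) @[T --> U] -->
    \sum_(i <- r) law nu a i * - ln (q i).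
  elim: r => [|i r IH]; first by rewrite big_nil; under eq_cvg do rewrite big_nil; exact: cvg_cst.
  rewrite big_cons; under eq_cvg do rewrite big_cons.
  by apply: cvgD => //; apply: cvgZr_tmp; exact: cv.
have lim_le : \sum_i law nu a i * - ln (q i) < entropy nu a + 2.
  apply: le_lt_trans (_ : entropy nu a + ln 2 < _); last first.
    by rewrite ltrD2l; exact: ln_sublinear.
  have -> : ln 2 = \sum_i law nu a i * ln 2 by rewrite -mulr_suml (law_sum1 fpn ad) mul1r.
  rewrite /entropy /ent -sumrN -big_split /=.
  apply: ler_sum => i _; have [->|nz] := eqVneq (law nu a i) 0; first by rewrite !mul0r oppr0 addr0.
  have l0 : 0 < law nu a i by rewrite lt_def nz n0.
  rewrite -mulrN -mulrDr ler_wpM2l// /q ln_div ?posrE ?ltr_wpDl// opprB addrC lerD2r lerN2.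
  by rewrite ler_ln ?posrE ?ltr_wpDl// lerDl ltW.
have : \forall T \near U, \sum_i law (pr T) a i * - ln (q i) < entropy nu a + 2.
  by apply: (cvgr_lt _ (cvs _)).
apply: filterS => T h; apply: le_trans (ltW h).
rewrite (eq_bigr _ (fun i _ => mulrN _ _)) sumrN; apply: ent_cross => //.
- by move=> i; exact: (law_ge0 (fpT T)).
- by move=> i; exact: ltW.
- exact: (law_sum1 (fpT T)).
Qed.

End Empirical.

Lemma sum_blocks (R : realType) (F : nat -> R) a b :
  \sum_(j < a) \sum_(i < b) F (j * b + i)%N = \sum_(l < a * b) F l.
Proof.
elim: a => [|a IH]; first by rewrite !big_ord0.
by rewrite big_ord_recr IH /= mulSnr big_split_ord.
Qed.

Lemma sum_blocksC (R : realType) (F : nat -> R) a b :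
  \sum_(i < b) \sum_(j < a) F (i + j * b)%N = \sum_(l < a * b) F l.
Proof.
rewrite exchange_big /= -sum_blocks; apply: eq_bigr => j _.
by apply: eq_bigr => i _; rewrite addnC.
Qed.

(** * Volume of a chamber: monotonicity, finiteness, positivity *)

Section IteratedIntegrals.
Context {R : realType}.

(** Both integrals are suprema over the simple functions below the integrand, so the comparison is
    one of index sets and applies to the nested integrals of [volume] as they stand. *)
Lemma integral_mono (h1 h2 : R -> \bar R) : (forall s, 0 <= h1 s <= h2 s)%E ->
  (0 <= \int[lebesgue_measure]_(s in setT) h1 s <= \int[lebesgue_measure]_(s in setT) h2 s)%E.
Proof.
move=> h; have p1 s : (0 <= h1 s)%E by have /andP[] := h s.
have p2 s : (0 <= h2 s)%E by have /andP[a b] := h s; exact: le_trans a b.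
apply/andP; split; first by apply: integral_ge0 => s _.
rewrite !ge0_integralTE//; apply: le_ereal_sup => _ [k hk <-]; exists k => // s.
by apply: le_trans (hk s) _; have /andP[] := h s.
Qed.

Lemma iterated_mono d (h1 h2 : 'rV[R]_d -> \bar R) : (forall y, 0 <= h1 y <= h2 y)%E ->
  (0 <= iterated_integral h1 <= iterated_integral h2)%E.
Proof.
elim: d h1 h2 => [|d IH] h1 h2 h /=; first exact: h.
by apply: integral_mono => s; apply: IH => y; exact: h.
Qed.

(** The indicator of a cube written as a product, so that an iterated integral splits off one
    coordinate at a time. *)
Definition box d (y0 : 'rV[R]_d) (c : R) (y : 'rV[R]_d) : R :=
  \prod_(i < d) (`|y ord0 i - y0 ord0 i| <= c)%R%:R.

Lemma row_mx_ord0 d s (y : 'rV[R]_d) : (row_mx s%:M y : 'rV[R]_d.+1) ord0 ord0 = s.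
Proof. by rewrite mxE; case: splitP => // j _; rewrite (ord1 j) mxE /= ?mulr1n. Qed.

Lemma row_mx_lift d s (y : 'rV[R]_d) i : (row_mx s%:M y : 'rV[R]_d.+1) ord0 (lift ord0 i) = y ord0 i.
Proof.
rewrite mxE; case: splitP => j /=; rewrite /bump /=; first by rewrite ord1.
by move=> [/val_inj->].
Qed.

Lemma box_row d (y0 : 'rV[R]_d.+1) c s (y : 'rV[R]_d) : box y0 c (row_mx s%:M y) =
  (`|s - y0 ord0 ord0| <= c)%R%:R * box (\row_i y0 ord0 (lift ord0 i)) c y.
Proof.
rewrite /box big_ord_recl row_mx_ord0; congr (_ * _).
by apply: eq_bigr => i _; rewrite row_mx_lift mxE.
Qed.

Lemma iterated_box d (y0 : 'rV[R]_d) c k : 0 <= c -> 0 <= k ->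
  iterated_integral (fun y => (k * box y0 c y)%:E) = (k * (c * 2) ^+ d)%:E.
Proof.
move=> c0; elim: d y0 k => [|d IH] y0 k k0 /=; first by rewrite /box big_ord0 expr0.
under eq_integral => s _.
  under eq_fun => y do rewrite box_row mulrA.
  rewrite IH; last by rewrite mulr_ge0.
  over.
set a := y0 ord0 ord0; have X0 : 0 <= k * (c * 2) ^+ d by rewrite mulr_ge0// exprn_ge0// mulr_ge0.
rewrite (_ : (fun s => _) = (fun s : R => (k * (c * 2) ^+ d)%:E * (\1_`[a - c, a + c] s)%:E)%E); last first.
  apply/funext => s; rewrite -EFinM indicE mulrAC; congr (_ * _)%:E; congr (nat_of_bool _)%:R.
  by apply/idP/idP; rewrite inE /= in_itv/= -ler_distlC distrC.
rewrite ge0_integralZl//; last by apply/measurable_EFinP; exact: measurable_indic.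
rewrite integral_indic// setIT [X in (_ * X)%E](@lebesgue_measure_itv R `[a - c, a + c])/= lte_fin.
case: ltP => h; first by rewrite -EFinD -EFinM (_ : a + c - (a - c) = c * 2) ?exprSr ?mulrA//; ring.
have -> : c = 0 by lra.
by rewrite mul0r exprS mul0r !mulr0 mule0.
Qed.

End IteratedIntegrals.

Section Volume.
Context {R : realType} {g : geometry} {n : nat} {P : coxeter_polyhedron R g n} {B : building P}.
Implicit Types (u : 'M[R]_n.+2) (C D : set (cplx_point B)) (f : 'rV[R]_n.+2 -> cplx_point B).
Notation M := (@model_space R g n).
Notation W := (coxeter_group P).
Notation nrm := (facet_normal P).
Notation ctr := (ctr P).
Notation V := 'rV[R]_n.+2.
Implicit Types (t b e r : R).
Let W1' : W 1 := @W1 R g n P.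
Implicit Types (x : V) (y : 'rV[R]_n.+1).

Definition graph (y : 'rV[R]_n.+1) : V := row_mx (height g y)%:M y.

Lemma graph0 y : graph y ord0 ord0 = height g y.
Proof. exact: row_mx_ord0. Qed.
Lemma graph_lift y i : graph y ord0 (lift ord0 i) = y ord0 i.
Proof. exact: row_mx_lift. Qed.

Lemma height_sqr y : height g y ^+ 2 = 1 - curv R g * \sum_i y ord0 i ^+ 2 /\ 1 <= height g y.
Proof.
have h : 1 <= 1 - curv R g * \sum_i y ord0 i ^+ 2.
  rewrite lerDl -mulNr mulr_ge0//; first by case: g; rewrite /curv ?oppr0 ?opprK.
  by apply: sumr_ge0 => i _; exact: sqr_ge0.
split; first by rewrite sqr_sqrtr// (le_trans ler01 h).
by rewrite -[1]sqrtr1 ler_wsqrtr.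
Qed.

Lemma graphM y : M (graph y).
Proof.
have [h1 h2] := height_sqr y; split; last by rewrite graph0 (lt_le_trans ltr01).
rewrite /model_form graph0 -expr2 h1 /sdot.
by rewrite (eq_bigr _ (fun i _ => congr1 (fun x : R => x * x) (graph_lift y i))) subrK.
Qed.

Lemma graph_surj x : M x -> x = graph (\row_i x ord0 (lift ord0 i)).
Proof.
move=> [h1 h2]; set y := \row_i _; have [k1 k2] := height_sqr y.
have yi i : y ord0 i = x ord0 (lift ord0 i) by rewrite mxE.
apply/rowP => i; case: (unliftP ord0 i) => [j ->|->]; first by rewrite graph_lift yi.
rewrite graph0; apply/eqP; rewrite -(@eqrXn2 _ 2)// ?ltW// ?(lt_le_trans ltr01)//.
rewrite k1 -h1 /model_form expr2 /sdot (eq_bigr (fun i => y ord0 i ^+ 2)) ?addrK// => j _.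
by rewrite yi expr2.
Qed.

Lemma volume_mono (C D : set V) : C `<=` D -> (0 <= volume g C <= volume g D)%E.
Proof.
move=> CD; apply: iterated_mono => y; have [_ h] := height_sqr y.
have h0 : 0 <= (height g y)^-1 by rewrite invr_ge0 (le_trans ler01).
rewrite !lee_fin mulr_ge0//= ler_wpM2r// !indicE ler_nat.
by case: (boolP (_ \in C)) => // /set_mem/CD/mem_set ->.
Qed.

Lemma volume0 : volume g (@set0 V) = 0%E.
Proof.
apply/le_anti/andP; split; last by have /andP[] := volume_mono (@subset_refl _ (@set0 V)).
have := @iterated_box R n.+1 0 0 0 (lexx _) (lexx _); rewrite mul0r => h.
rewrite -[leRHS]/(0%:E) -h.
apply: (proj2 (andP _)); apply: iterated_mono => y.
by rewrite mul0r indic0 mul0r !lexx.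
Qed.

Lemma volume_fin : exists c : R, (volume g (polyhedron P) <= c%:E)%E.
Proof.
have [D D0 hD] := tile_diam (P := P); pose r := dist g basept (ctr 1) + D.
have [c c0 hc] : exists2 c, 0 <= c & forall x, polyhedron P x -> forall i, `|x ord0 (lift ord0 i)| <= c.
  pose c := 1 + chord g r ^+ 2; have s0 : 0 <= chord g r ^+ 2 by exact: sqr_ge0.
  have c0 : 0 <= c by rewrite addr_ge0.
  exists c => // x Px i; have Mx : M x by have [] := Px.
  have dr : dist g basept x <= r.
    have Mb : M basept by exact: M_basept.
    apply: le_trans (dist_triangle Mb (ctr_M W1') Mx) _; rewrite lerD2l.
    rewrite distC; [|exact: ctr_M|by []]; apply: (hD 1 x W1').
    by exists x => //; rewrite /mulmxr/= mulmx1.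
  have [h1 h2] := sdot_bound Mx dr; have [_ x0] := Mx.
  apply: coord_bound => //; last by rewrite ger0_norm; [exact: h2|exact: ltW].
  by apply: le_trans h1 _; rewrite expr2 ler_wpM2r// lerDr.
exists (1 * (c * 2) ^+ n.+1); rewrite -(iterated_box 0 c0)//.
apply: (proj2 (andP _)); apply: iterated_mono => y; have [_ h] := height_sqr y.
have h0 : 0 <= (height g y)^-1 by rewrite invr_ge0 (le_trans ler01).
rewrite !lee_fin mulr_ge0//= mul1r indicE.
case: (boolP (_ \in _)) => [/set_mem Py|_]; last by rewrite mul0r prodr_ge0.
rewrite /box big1 ?mul1r ?invf_le1// ?(lt_le_trans ltr01)// => i _.
by rewrite mxE subr0 -graph_lift hc.
Qed.

Lemma continuous_height : continuous (@height R g n).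
Proof.
move=> y; apply: (@continuous_comp _ _ _ (fun y => 1 - curv R g * \sum_i y ord0 i ^+ 2) Num.sqrt);
  last exact: sqrt_continuous.
have cs := @continuous_bigsum R _ _ (fun i (y : 'rV[R]_n.+1) => y ord0 i ^+ 2) _.
apply: (cvgB (cvg_cst _) (cvgM (cvg_cst _) (cs _ y))) => i z.
by apply: (@continuous_comp _ _ _ (fun y : 'rV[R]_n.+1 => y ord0 i) (fun t => t ^+ 2));
  [exact: coord_continuous|exact: exprn_continuous].
Qed.

(** Around an interior point there is a cube of chart coordinates on which all facet forms stay
    negative and the height, hence the density, stays controlled. *)
Lemma volume_gt0 : (0 < volume g (polyhedron P))%E.
Proof.
have [x [Mx hx]] := poly_interior P; pose y0 : 'rV[R]_n.+1 := \row_i x ord0 (lift ord0 i).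
have xE : x = graph y0 by exact: graph_surj.
have [_ h1] := height_sqr y0; have hp : 0 < height g y0 by exact: lt_le_trans ltr01 h1.
have nb1 : \forall y \near y0, height g y < height g y0 + 1.
  by apply: (cvgr_lt _ (@continuous_height y0)); rewrite ltrDl.
have cl (u : V) : continuous (fun y => lform u (graph y)).
  move=> y; rewrite (_ : (fun y => _) = (fun y => u ord0 ord0 * height g y +
      \sum_(i < n.+1) u ord0 (lift ord0 i) * y ord0 i)); last first.
    apply/funext => z; rewrite /lform big_ord_recl graph0; congr (_ + _).
    by apply: eq_bigr => i _; rewrite graph_lift.
  have c1 : continuous (fun y => u ord0 ord0 * height g y).
    by move=> z; exact: (cvgM (cvg_cst _) (@continuous_height z)).
  have c2 : continuous (fun y => \sum_(i < n.+1) u ord0 (lift ord0 i) * y ord0 i).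
    apply: continuous_bigsum => i z; exact: (cvgM (cvg_cst _) (@coord_continuous _ _ _ _ _ z)).
  exact: (cvgD (@c1 y) (@c2 y)).
have nb i : \forall y \near y0, lform (nrm i) (graph y) < 0.
  apply: (cvgr_lt _ (@cl (nrm i) y0)).
  by rewrite -xE.
have nb2 := @filterI _ _ (nbhs_filter y0) _ _ nb1 (filter_forall (nbhs_filter y0) nb).
have [e /= e0 he] := (nbhs_ballP _ _).1 nb2.
pose k := (height g y0 + 1)^-1; have k0 : 0 < k by rewrite invr_gt0 addr_gt0.
have e2 : 0 <= e / 2 by rewrite divr_ge0// ltW.
apply: lt_le_trans (_ : ((k * (e / 2 * 2) ^+ n.+1)%:E <= _)%E).
  by rewrite lte_fin mulr_gt0// exprn_gt0// mulr_gt0// divr_gt0.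
rewrite -(iterated_box y0 e2 (ltW k0)).
apply: (proj2 (andP _)); apply: iterated_mono => y; have [_ h] := height_sqr y.
have h0 : 0 <= (height g y)^-1 by rewrite invr_ge0 (le_trans ler01).
have b0 : 0 <= box y0 (e / 2) y by apply: prodr_ge0.
rewrite !lee_fin (mulr_ge0 (ltW k0) b0) /=.
have [bn|bn] := EM (forall i, `|y ord0 i - y0 ord0 i| <= e / 2); last first.
  rewrite (_ : box _ _ _ = 0) ?mulr0; first by rewrite mulr_ge0.
  have [i hi] : exists i, ~~ (`|y ord0 i - y0 ord0 i| <= e / 2).
    by apply/not_existsP => hn; apply: bn => i; have /negP := hn i; rewrite negbK.
  by rewrite /box (bigD1 i)//= (negbTE hi) mul0r.
have [y1 y2] : (height g y < height g y0 + 1) /\ forall i, lform (nrm i) (graph y) < 0.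
  apply: he; split=> // i j; rewrite ord1 /ball/= distrC; apply: le_lt_trans (bn j) _.
  by rewrite ltr_pdivrMr// ltr_pMr// ltr1n.
rewrite /box big1 ?mulr1 => [|i _]; last by rewrite bn.
rewrite indicE mem_set ?mul1r; first by rewrite /k lef_pV2 ?posrE ?ltW// ?addr_gt0 ?(lt_le_trans ltr01).
by split; [exact: graphM|move=> i; exact: ltW].
Qed.

End Volume.

Lemma abs_close (R : realType) (a b c : R) : a <= b + c -> b <= a + c -> `|a - b| <= c.
Proof. by move=> h1 h2; rewrite ler_norml; apply/andP; split; lra. Qed.

Lemma ball_arith1 (R : realType) (x y d m D r : R) : y - d <= D -> d <= r - (m + D + 1) -> x <= m ->
  x + y < r.
Proof. lra. Qed.

Lemma ball_arith2 (R : realType) (d m D r x y z : R) : - D <= y - d -> y <= z + x -> z <= m -> x < r ->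
  d <= r + (m + D + 1).
Proof. lra. Qed.
Lemma dist_arith1 {R : realType} (x b r a c : R) : x <= r -> r <= a -> c <= b + x -> c <= a + b.
Proof. lra. Qed.

Lemma dist_arith2 {R : realType} (D b a t x y z c : R) :
  x <= D -> y <= a + b -> c <= y + z -> z <= t + x -> c <= t + (a + b + D + 1).
Proof. lra. Qed.

Lemma dist_arith3 {R : realType} (D b a x c : R) : 0 < D -> x <= a + b -> c <= 1 + x ->
  c <= a + b + D + 1.
Proof. lra. Qed.
Lemma dist_arith4 {R : realType} (D b a : R) : 0 <= b -> 0 <= a -> D <= a + b + D + 1.
Proof. lra. Qed.
Lemma dist_arith5 {R : realType} (d x y z : R) : x < d / 2 -> y < d / 2 -> z <= x + y -> z <= d.
Proof. lra. Qed.

(** Where [eta] has a letter it determines [a], so the conditional entropy comes from the cell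
    [None] alone, where it is at most the mass times [ln #|I|]. *)
Lemma entropy_approx (R : realType) (X : Type) (alg : set (set X)) (pr : set X -> R)
  (I : finType) (a : X -> I) (eta : X -> option I) (d : R) :
  fap alg pr -> adapted alg a -> adapted alg eta ->
  (forall x i, eta x = Some i -> a x = i) ->
  law pr eta None * ln #|I|%:R <= d -> entropy pr (fun x => (a x, eta x)) - entropy pr eta <= d.
Proof.
move=> fp aa ae sub hd; have ap := adapted_pair fp aa ae.
set q := law pr (fun x => (a x, eta x)).
have q0 i : 0 <= q i by exact: (law_ge0 fp i ap).
have eo o : law pr eta o = \sum_i q (i, o) by exact: (law_pairr fp o aa ae).
have split o : law pr eta o * ln (law pr eta o) - \sum_i q (i, o) * ln (q (i, o)) <=
    if o is Some _ then 0 else law pr eta None * ln #|I|%:R.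
  case: o => [k|]; last first.
    by rewrite eo; apply: (ent_split (D := predT) (fun i => q0 (i, None))).
  have z i : i != k -> q (i, Some k) = 0.
    move=> ne; rewrite /q /law -(pr0 fp); congr pr; apply/seteqP; split=> // x /= [h1 h2].
    by move: ne; rewrite -h1 (sub _ _ h2) eqxx.
  rewrite eo (bigD1 k)//= big1 ?addr0; last by move=> i /z.
  by rewrite (bigD1 k)//= big1 ?addr0 ?subrr// => i /z ->; rewrite mul0r.
apply: le_trans hd; rewrite /entropy /ent opprK addrC.
have -> : \sum_i law pr (fun x => (a x, eta x)) i * ln (law pr (fun x => (a x, eta x)) i) =
    \sum_o \sum_i q (i, o) * ln (q (i, o)).
  by rewrite exchange_big /= pair_big; apply: eq_bigr => -[].
rewrite -sumrB; apply: le_trans (ler_sum _ (fun o _ => split o)) _.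
by rewrite (bigD1 None)//= big1 ?addr0// => -[].
Qed.

Lemma growth_arith (R : realType) (h F T m g1 H S c2 c l2 : R) :
  h * T <= H + m -> F * T <= S + c2 -> H + S <= 1 + (c + m * l2 + g1) ->
  (h + F) * T <= g1 + m * (l2 + 1) + (1 + c + c2).
Proof. lra. Qed.

Lemma rescale_arith (R : realType) (L e C N m r q G : R) : 0 <= L -> 0 < N -> 0 <= C -> 0 <= m ->
  m * N <= r - C -> r - C <= m * N + N -> q <= e / 2 * N -> 0 <= q -> 0 <= e ->
  L * (C + N) + C <= e / 2 * r ->
  L * (m * N) <= G + m * q + C -> (L - e) * r <= G.
Proof.
move=> L0 N0 C0 m0 h1 h2 hq q0 e0 hr hG.
have a1 : L * (r - C) <= L * (m * N + N) by exact: ler_wpM2l.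
have a2 : m * q <= m * (e / 2 * N) by exact: ler_wpM2l.
have a3 : e / 2 * (m * N) <= e / 2 * (r - C) by rewrite ler_wpM2l// divr_ge0.
have a4 : 0 <= e / 2 * C by rewrite mulr_ge0// divr_ge0.
by move: a1 a2 a3 a4 hr hG; nra.
Qed.

Lemma shift_arith {R : realType} (x y z a b c e : R) : x <= a + b -> a <= y -> b <= c + z ->
  c < e -> e <= 1 -> y <= 1 -> z <= 1 -> x <= 3.
Proof. lra. Qed.
Lemma floor_arith {R : realType} (d s k : R) : 0 <= s <= 1 -> k <= d < k + 1 -> `|d - (s + k)| <= 1.
Proof. by move=> /andP[h1 h2] /andP[h3 h4]; rewrite ler_norml; apply/andP; split; lra. Qed.

Lemma block_arith (R : realType) (x1 x2 x3 x4 x5 x6 c : R) :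
  x5 - x3 - x4 <= x6 + x1 -> x3 <= c + x2 -> x5 - x4 <= x6 + c + (x1 + x2).
Proof. lra. Qed.

Lemma lnX_nat (R : realType) (k m : nat) : ln (k%:R ^+ m) = m%:R * ln k%:R :> R.
Proof.
have [->|k0] := posnP k; first by case: m => [|m]; rewrite ?expr0 ?ln1 ?mul0r// exprS mul0r ln0// mulr0.
by rewrite lnXn ?ltr0n// mulr_natl.
Qed.

Lemma grid_arith (R : realType) (q t T : R) : 0 < T -> q <= t * T -> t * T < q + 1 ->
  `|q / T - t| *+ 2 <= 2 / T.
Proof.
move=> T0 h1 h2; have -> : q / T - t = (q - t * T) / T by rewrite mulrBl mulfK ?gt_eqF.
have iT : 0 <= T^-1 by rewrite invr_ge0 ltW.
rewrite normrM (ger0_norm iT) -[leLHS]mulr_natl mulrA ler_wpM2r//.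
by rewrite ler0_norm ?subr_le0//; lra.
Qed.

Lemma emp_expect (R : realType) (X : Type) (J I : finType) (s : J -> R) (z : J -> X) (a : X -> I)
  (v : I -> R) : \sum_j s j * v (a (z j)) = \sum_i law (emp s z) a i * v i.
Proof.
rewrite (partition_big (fun j => a (z j)) xpredT)//=; apply: eq_bigr => i _.
rewrite /law /emp mulr_suml; apply: eq_big => [j|j /eqP-> //].
by apply/eqP/asboolP.
Qed.

Lemma limit_arith (R : realType) (m lam T c0 LC K c1 E1 E2 S1 S2 LG : R) : 0 < T -> 0 <= m ->
  lam * T - c0 <= LG -> m * (LG - LC) <= m * K + T * (c1 + E1 + S1) ->
  E1 <= E2 + 2 -> S1 <= S2 + 1 -> m * (c0 + LC + K) <= T -> m * lam <= c1 + 4 + E2 + S2.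
Proof.
move=> T0 m0 h1 h2 h3 h4 h5; rewrite -(ler_pM2l T0).
have a1 : m * (lam * T - c0) <= m * LG by rewrite ler_wpM2l.
have a2 : T * (c1 + E1 + S1) <= T * (c1 + (E2 + 2) + (S2 + 1)) by rewrite ler_pM2l//; lra.
move: a1 h2 a2 h5; rewrite !(mulrDr, mulrBr, mulrDl, mulrN, mulrA, mulr1).
have -> : T * m * lam = m * lam * T by ring.
lra.
Qed.

Lemma rate_arith (R : realType) (m lam F c c4 c' x1 x2 : R) : m * lam <= c + x1 + x2 ->
  x2 <= c4 + m * F + c' -> lam * m - F * m - (c + (c4 + c')) <= x1.
Proof. by rewrite [lam * m]mulrC [F * m]mulrC; lra. Qed.

Lemma ln_grows (R : realType) (m c : R) (C : nat) : 0 <= m ->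
  \forall k \near \oo, m * (c + ln (C * k.+2)%:R) <= k.+1%:R.
Proof.
move=> m0; pose x := (C * 2)%:R * (m + 1) * 2 : R.
have m1 : 0 < m + 1 by apply: ltr_wpDl.
near=> k.
have [->|C0] := posnP C.
  rewrite mul0n ln0// addr0; apply: le_trans (_ : k%:R <= _); last by rewrite ler_nat.
  by near: k; exact: nbhs_infty_ger.
have k0 : 0 < k.+1%:R :> R by [].
have x0 : 0 < x by rewrite !mulr_gt0// ltr0n muln_gt0 C0.
have h1 : ln (C * k.+2)%:R <= ln x + k.+1%:R / ((m + 1) * 2).
  have y0 : 0 < k.+1%:R / ((m + 1) * 2) :> R by rewrite divr_gt0// mulr_gt0.
  apply: le_trans (_ : ln (x * (k.+1%:R / ((m + 1) * 2))) <= _).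
    rewrite ler_ln ?posrE ?ltr0n ?muln_gt0 ?C0//; last by rewrite mulr_gt0.
    have -> : x * (k.+1%:R / ((m + 1) * 2)) = (C * 2)%:R * k.+1%:R.
      by rewrite /x; field; rewrite lt0r_neq0.
    by rewrite -natrM ler_nat -mulnA leq_mul2l mulSn mul1n addSn ltnS leq_addl orbT.
  by rewrite lnM ?posrE// lerD2l ltW// ln_sublinear.
have h2 : m * (k.+1%:R / ((m + 1) * 2)) <= k.+1%:R / 2.
  rewrite invfM mulrA [m * _]mulrC -!mulrA ler_wpM2l// mulrA ler_piMl//.
  by rewrite ler_pdivrMr ?mul1r ?lerDl.
have h3 : m * (c + ln x) <= k.+1%:R / 2.
  rewrite ler_pdivlMr//; apply: le_trans (_ : k%:R <= _); last by rewrite ler_nat.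
  by near: k; exact: nbhs_infty_ger.
apply: le_trans (_ : m * (c + (ln x + k.+1%:R / ((m + 1) * 2))) <= _).
  by rewrite ler_wpM2l// lerD2l.
rewrite addrA mulrDr; apply: le_trans (lerD h3 h2) _; lra.
Unshelve. all: by end_near. Qed.

Lemma limn_einf_ge (R : realType) (u : (\bar R)^nat) x :
  (\forall N \near \oo, (x <= u N)%E) -> (x <= limn_einf u)%E.
Proof.
move=> h; rewrite [leRHS](_ : _ = limf_einf u \oo)// limf_einfE; apply: le_trans (ereal_sup_ubound _); last by exists [set N | (x <= u N)%E].
by apply: le_ereal_inf_tmp => _ [N hN <-].
Qed.

Lemma cvg_le (R : realType) (U : set_system nat) (x y : nat -> R) (l l' : R) : ProperFilter U ->
  x k @[k --> U] --> l -> y k @[k --> U] --> l' -> (\forall k \near U, x k <= y k) -> l <= l'.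
Proof. by move=> PU; exact: ler_cvg_to. Qed.

(** * Limits of exponential rates in the extended reals *)

Section RealAsymptotics.
Context {R : realType}.
Implicit Types (x y : \bar R) (lam r : R).

Lemma lte_split x y lam : (0 <= y)%E -> (lam%:E < x + y)%E ->
  exists a b : R, [/\ (a%:E < x)%E, (b%:E < y)%E & lam < a + b].
Proof.
case: x => [x| |]; case: y => [y| |]//= _.
- rewrite -EFinD lte_fin => h; pose e := (x + y - lam) / 3; exists (x - e), (y - e).
  have e0 : 0 < e by rewrite divr_gt0// subr_gt0.
  by rewrite !lte_fin; split; [lra|lra|rewrite /e; lra].
- by move=> _; exists (x - 1), (lam - x + 2); rewrite lte_fin ltry; split=> //; lra.
- by move=> _; exists (lam - y + 2), (y - 1); rewrite lte_fin ltry; split=> //; lra.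
- by move=> _; exists (lam + 1), 0; rewrite !ltry; split=> //; lra.
Qed.

Lemma lte_dense_left x lam : (lam%:E < x)%E -> exists2 a : R, lam < a & (a%:E < x)%E.
Proof.
case: x => [x| |]//; rewrite ?lte_fin => h; last by exists (lam + 1); rewrite ?ltry//; lra.
by exists ((lam + x) / 2); rewrite ?lte_fin; lra.
Qed.

Lemma lte_dense_right x lam : (x < lam%:E)%E -> exists2 a : R, a < lam & (x < a%:E)%E.
Proof.
case: x => [x| |]//; rewrite ?lte_fin => h; last by exists (lam - 1); rewrite ?ltNyr//; lra.
by exists ((lam + x) / 2); rewrite ?lte_fin; lra.
Qed.

Lemma ereal_cvg_squeeze (L : R -> \bar R) x :
  (forall lam, (lam%:E < x)%E -> \forall r \near +oo%R, (lam%:E <= L r)%E) ->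
  (forall lam, (x < lam%:E)%E -> \forall r \near +oo%R, (L r <= lam%:E)%E) ->
  L r @[r --> +oo%R] --> x.
Proof.
case: x => [x| |] h1 h2.
- have near e : 0 < e -> \forall r \near +oo%R, ((x - e)%:E <= L r <= (x + e)%:E)%E.
    move=> e0; have l1 : ((x - e)%:E < x%:E)%E by rewrite lte_fin ltrBlDr ltrDl.
    have l2 : (x%:E < (x + e)%:E)%E by rewrite lte_fin ltrDl.
    by apply: filterS2 (h1 _ l1) (h2 _ l2) => r -> ->.
  apply/fine_cvgP; split.
    apply: filterS (near 1 ltr01) => r /andP[a1 a2].
    by rewrite fin_numE -ltNye -ltey (lt_le_trans (ltNyr _) a1) (le_lt_trans a2 (ltry _)).
  apply/cvgrPdist_le => e e0; apply: filterS (near e e0) => r /=.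
  case: (L r) => [y| |]; rewrite ?leye_eq ?leeNy_eq ?andbF//= !lee_fin.
  by move=> /andP[a1 a2]; rewrite ler_distlC; apply/andP; split; lra.
- by apply/cvgeyPge => lam; apply: h1; rewrite ltry.
- by apply/cvgeNyPle => lam; apply: h2; rewrite ltNyr.
Qed.

Lemma near_shift (Q : R -> Prop) c : (\forall r \near +oo%R, Q r) -> \forall r \near +oo%R, Q (r + c).
Proof.
move=> [m [_ hm]]; exists (m - c); split; first by rewrite num_real.
by move=> r hr; apply: hm; rewrite -ltrBlDr.
Qed.

Lemma lne_ge (v : \bar R) a b lam r : 0 < a -> (a%:E <= v <= b%:E)%E -> 0 < r -> lam * r <= ln a ->
  (lam%:E <= r^-1%:E * lne v)%E.
Proof.
move=> a0; case: v => [v| |]/=; rewrite ?leye_eq ?leeNy_eq ?andbF// !lee_fin => /andP[av _] r0 h.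
have v0 : 0 < v by exact: lt_le_trans av.
rewrite (leNgt v 0) v0 /= -EFinM lee_fin ler_pdivlMl// mulrC; apply: le_trans h _.
by rewrite ler_ln ?posrE.
Qed.

Lemma lne_le (v : \bar R) a b lam r : 0 < a -> (a%:E <= v <= b%:E)%E -> 0 < r -> ln b <= lam * r ->
  (r^-1%:E * lne v <= lam%:E)%E.
Proof.
move=> a0; case: v => [v| |]/=; rewrite ?leye_eq ?leeNy_eq ?andbF// !lee_fin => /andP[av vb] r0 h.
have v0 : 0 < v by exact: lt_le_trans av.
rewrite (leNgt v 0) v0 /= -EFinM lee_fin ler_pdivrMl// mulrC; apply: le_trans h.
by rewrite ler_ln ?posrE// (lt_le_trans v0).
Qed.

Lemma near_linear lam lam' c : lam < lam' -> \forall r \near +oo%R, lam * r <= lam' * r + c.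
Proof.
move=> h; near=> r.
have : (- c) / (lam' - lam) <= r by near: r; apply: nbhs_pinfty_ge; rewrite num_real.
rewrite ler_pdivrMr ?subr_gt0// => h2; lra.
Unshelve. all: by end_near. Qed.

End RealAsymptotics.

(** * Weighted counting of orbit words by tiles *)

Section VariationalPrinciple.
Context {R : realType} {g : geometry} {n : nat} {P : coxeter_polyhedron R g n} {B : building P} {W' : matrix_group R n}.
Notation V := 'rV[R]_n.+2.
Implicit Types (p q : V * V) (w u v : 'M[R]_n.+2) (C D : set (cplx_point B)) (s t b e r : R).
Notation M := (@model_space R g n).
Notation W := (coxeter_group P).
Notation tile := (tile P).
Notation ctr := (ctr P).
Hypothesis regB : regular_building B.
Variables (A : set (cplx_point B)) (f : V -> cplx_point B).
Hypotheses (apA : apartment B A) (fA : tessellation_isometry f A).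
Hypotheses (W'sub : W' `<=` W) (W'fin : finite_index W' W) (W'tf : torsion_free W').
Notation UT := (@unit_tangent_set R g n).
Notation geo := (@geo R g n).
Notation lq := (@lq R g n P B f).
Notation Csum := (@Csum R g n P).
Notation rate := (@rate R g n P B f).
Notation Sep := (@Sep R g n P B f).
Notation nover := (@nover R g n P B f).
Notation Fl := (@flow_pair R g n).
Notation rho := (@rho R g n).
Notation Gsum := (@Gsum R g n P).
Notation Y := (T1Y g W').
Notation bY := (borel_T1Y g W').
Notation lft := (@lft R g n W').
Notation prj := (@prj R g n W').
Notation qf := (@quotient_flow R g n W').
Let W1' : W 1 := @W1 R g n P.
Let lqok := lq_ok regB apA fA.

Lemma iter_qf t m (y : Y) : iter m (qf t) y = qf (m%:R * t) y.
Proof.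
elim: m => [|m IH]; first by rewrite mul0r (quotient_flow0 W'sub).
by rewrite iterS IH (quotient_flowD W'sub) -natr1 mulrDl mul1r.
Qed.

Definition shell r : seq 'M[R]_n.+2 :=
  finmap.enum_fset (fset_set [set w | W w /\ dist g (ctr 1) (ctr w) <= r]).

Lemma shellP r w : w \in shell r <-> W w /\ dist g (ctr 1) (ctr w) <= r.
Proof.
have := in_fset_set (finite_ctr fA r (ctr_M W1')) w.
by move=> h; have -> : (w \in shell r) = (w \in [set w0 | W w0 /\ dist g (ctr 1) (ctr w0) <= r]) by []; rewrite inE.
Qed.

Lemma shell_uniq r : uniq (shell r).
Proof. exact: finmap.fset_uniq.
Qed.

Definition growth r : R := \sum_(w <- shell r) (nover 1 w)%:R.

Lemma growth_inj (I : finType) (D : {pred I}) (h : I -> 'M[R]_n.+2) r :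
  {in D, forall i, h i \in shell r} -> {in D &, injective h} ->
  \sum_(i in D) (nover 1 (h i))%:R <= growth r.
Proof.
move=> hD hI; pose s := [seq h i | i <- enum D].
have us : uniq s by rewrite map_inj_in_uniq ?enum_uniq// => i j; rewrite !mem_enum; exact: hI.
rewrite -big_enum /= -(big_map h xpredT (fun w => (nover 1 w)%:R)) -/s.
have /(perm_big _) -> : perm_eq s [seq w <- shell r | w \in s].
  apply: uniq_perm => // [|w]; first by rewrite filter_uniq// shell_uniq.
  rewrite mem_filter; case E: (w \in s) => //=; apply/esym.
  by move: E => /mapP[i]; rewrite mem_enum => Di ->; exact: hD.
rewrite big_filter /growth [leRHS](bigID (fun w => w \in s)) /= lerDl.
by apply: sumr_ge0 => w _; exact: ler0n.
Qed.

Lemma growth_le r s : r <= s -> growth r <= growth s.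
Proof.
move=> rs; rewrite {1}/growth (big_nth 0) big_mkord.
apply: (@growth_inj _ predT (fun i : 'I_(size (shell r)) => nth 0 (shell r) i)).
  by move=> i _; apply/shellP; have /shellP[Ww h] := mem_nth 0 (ltn_ord i);
    split=> //; exact: le_trans h rs.
by move=> i j _ _ /eqP; rewrite nth_uniq ?shell_uniq// => /eqP/val_inj.
Qed.

Lemma growth_ge1 r : 0 <= r -> 1 <= growth r.
Proof.
move=> r0; rewrite /growth (bigD1_seq 1) ?shell_uniq//=.
  rewrite (nover_self regB apA fA W1') lerDl; apply: sumr_ge0 => w _; exact: ler0n.
by apply/shellP; split=> //; rewrite distxx//; exact: (ctr_M W1').
Qed.

(** A word that occurs is represented by a geodesic, recorded by the tile of its endpoint, by net
    points near its two ends and by the places where the letter is [None]. Equal records put the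
    ends within [d], hence the geodesics within [e] throughout, which forces equal letters. So a
    tile carries boundedly many words for each pattern of [None], and there are [2 ^+ m]
    patterns. *)
Lemma count_words e : 0 < e -> exists2 c, 0 <= c &
  forall (I : finType) (eta : Y -> option I) (N m : nat) (F : {ffun 'I_m -> option I} -> R),
  (0 < N)%N ->
  (forall p q i j, UT p -> UT q -> eta (prj p) = Some i -> eta (prj q) = Some j ->
    rho p q < e -> i = j) ->
  (forall a, 0 <= F a) ->
  (forall a, F a != 0 -> exists y : Y, word (qf N%:R) eta m y = a /\
    F a <= expR (Gsum lq (- 1) (m * N)%:R (lft y))) ->
  \sum_a F a <= c * 2 ^+ m * growth ((m * N)%:R + c).
Proof.
move=> e0; have e2 : 0 < e / 2 by rewrite divr_gt0.
have [r0 hr0] := lft_bounded fA W'sub W'fin.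
have [d d0 hd] := @geodesics_close R g n _ e2; have d2 : 0 < d / 2 by rewrite divr_gt0.
have bM : @ballM R g n r0 `<=` M by move=> x [].
have [s1 hs1 ns1] := totally_bounded (@compact_ballM R g n r0) bM d2.
have PM : polyhedron P `<=` M by move=> y [].
have [s2 hs2 ns2] := totally_bounded (@poly_compact _ _ _ P) PM d2.
have [D D0 hD] := @tile_diam R g n P.
have Mb := @M_basept R g n; have Mc := ctr_M W1'.
pose b0 := dist g (@basept R n) (ctr 1).
pose r1 := `|r0| + b0 + D + 1.
have b00 : 0 <= b0 by exact: dist_ge0.
have r10 : 0 <= r1 by rewrite /r1 !addr_ge0// ltW.
have [cS cS0 hcS] := Sep_close regB apA fA r1.
(* [expR cS] compares wall sums along the geodesic with those between tile centres, the product
   counts pairs of net points, and [r1] enlarges the radius. *)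
pose c := expR cS * ((size s1).+1 * (size s2).+1)%:R + r1.
have c0 : 0 <= c by rewrite addr_ge0// mulr_ge0// expR_ge0.
exists c => // I eta N m F N0 sepd F0 hF; pose T : R := (m * N)%:R.
have T0 : 0 <= T by [].
have key a : exists k : 'I_(size s1).+1 * 'I_(size s2).+1 * 'M[R]_n.+2 * (V * V), F a != 0 ->
   [/\ UT k.2, word (qf N%:R) eta m (prj k.2) = a,
     dist g (nth 0 s1 k.1.1.1) (geo k.2 0) < d / 2 /\ (nth 0 s1 k.1.1.1) \in s1,
     exists2 x, polyhedron P x & geo k.2 T = x *m k.1.2 /\
       dist g (nth 0 s2 k.1.1.2) x < d / 2 /\ (nth 0 s2 k.1.1.2) \in s2 &
     k.1.2 \in shell (T + r1) /\ F a <= expR cS * (nover 1 k.1.2)%:R].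
  have [->|nz] := eqVneq (F a) 0; first by exists ((ord0, ord0), 0, (0, 0)).
  have [y [wy Fy]] := hF _ nz.
  have [v W'v [Up [_ pr]]] := hr0 _ (UT_lft y); set p := act (lft y) v in Up pr.
  have py : prj p = y by rewrite (prj_act W'sub W'v (UT_lft y)) prj_lft.
  have Mp0 : M (geo p 0) by exact: geoM.
  have MpT : M (geo p T) by exact: geoM.
  have b1 : @ballM R g n r0 (geo p 0) by split=> //; rewrite geo0.
  have [z1 z1s hz1] := ns1 _ b1.
  have [w Ww tw] := tile_cover fA MpT; have [x Px xw] := tw.
  have [z2 z2s hz2] := ns2 _ Px.
  have i1 : (index z1 s1 < (size s1).+1)%N by rewrite ltnS index_size.
  have i2 : (index z2 s2 < (size s2).+1)%N by rewrite ltnS index_size.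
  exists ((Ordinal i1, Ordinal i2), w, p) => _; split=> //=.
  - by rewrite py.
  - by rewrite nth_index.
  - by exists x => //; rewrite nth_index.
  have Mw := ctr_M Ww.
  have h1 : dist g (geo p T) (ctr w) <= D by exact: hD.
  have h2 : dist g (geo p 0) (geo p T) = T by rewrite dist_geo// sub0r normrN ger0_norm.
  have h3 : dist g (ctr 1) (geo p 0) <= `|r0| + b0.
    apply: dist_arith1 pr (ler_norm _) _; rewrite -[X in dist g basept X](geo0 g p) /b0 (distC Mb Mc).
    exact: dist_triangle.
  split.
    apply/shellP; split=> //.
    apply: dist_arith2 h1 h3 (dist_triangle Mc Mp0 Mw) _.
    by rewrite -[T in T + _]h2; exact: dist_triangle.
  apply: le_trans Fy _; rewrite (nover_Sep regB apA fA W1' Ww) -expRD ler_expR.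
  rewrite -py (Gsum_lft W'sub _ _ lqok Up) addrC; apply: hcS => //; first exact: geoM.
    apply: dist_arith3 D0 h3 _; have := dist_triangle (geoM (- 1) Up) Mp0 Mc.
    by rewrite dist_geo// subr0 normrN1 (distC Mp0 Mc).
  by apply: le_trans h1 _; exact: dist_arith4.
have [k hk] := choice key.
pose none (a : {ffun 'I_m -> option I}) : {ffun 'I_m -> bool} := [ffun j => a j == None].
pose kk (a : {ffun 'I_m -> option I}) := ((k a).1.1, none a).
rewrite (bigID (fun a => F a == 0)) /= big1 ?add0r; last by move=> a /eqP.
rewrite (partition_big kk xpredT)//=.
have step j : \sum_(a | (F a != 0) && (kk a == j)) F a <= expR cS * growth (T + r1).
  apply: le_trans (_ : \sum_(a in [pred a | (F a != 0) && (kk a == j)])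
      expR cS * (nover 1 (k a).1.2)%:R <= _).
    by apply: ler_sum => a /andP[nz _]; have [_ _ _ _ []] := hk _ nz.
  rewrite -mulr_sumr ler_wpM2l ?expR_ge0//; apply: growth_inj.
    by move=> a /andP[nz _]; have [_ _ _ _ []] := hk _ nz.
  move=> a a' /andP[nz /eqP ks] /andP[nz' /eqP ks'] ew.
  have [Up wp [a1 z1s] [x Px [xp [x2 z2s]]] _] := hk _ nz.
  have [Uq wq [a2 _] [x' Px' [xq [x2' z2s']]] [sh _]] := hk _ nz'.
  have [k11 k12 k2] : [/\ (k a).1.1.1 = (k a').1.1.1, (k a).1.1.2 = (k a').1.1.2 & none a = none a'].
    by have : kk a = kk a' by [rewrite ks]; rewrite /kk; case: (k a) => -[[? ?] ?] ?; case: (k a') => -[[? ?] ?] ? [].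
  rewrite ew in xp; rewrite k11 in a1 z1s; rewrite k12 in x2.
  have /shellP[Wv _] := sh; move: (k a).2 (k a').2 Up wp a1 xp Uq wq a2 xq => p q Up wp a1 xp Uq wq a2 xq.
  apply/ffunP => j1; have jm : (j1.+1 * N <= m * N)%N by rewrite leq_mul2r ltn_ord orbT.
  have T1 : 1 <= T by rewrite ler1n; apply: leq_trans jm; rewrite muln_gt0.
  have near0 : dist g (geo p 0) (geo q 0) <= d.
    have Mz := (hs1 _ z1s).1; have Mp := geoM 0 Up; have Mq := geoM 0 Uq.
    apply: dist_arith5 a1 a2 _; rewrite -(distC Mp Mz); exact: dist_triangle.
  have nearT : dist g (geo p T) (geo q T) <= d.
    have Mx := PM _ Px; have Mx' := PM _ Px'; have Mz := PM _ (hs2 _ z2s').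
    rewrite xp xq (W_dist Wv Mx Mx'); apply: dist_arith5 x2 x2' _.
    by rewrite -(distC Mx Mz); exact: dist_triangle.
  have ea p1 (b : {ffun 'I_m -> option I}) : UT p1 -> word (qf N%:R) eta m (prj p1) = b ->
      b j1 = eta (prj (Fl (j1 * N)%:R p1)).
    by move=> Up1 <-; rewrite ffunE iter_qf -natrM (quotient_flow_prj W'sub).
  (* [rho] looks one unit of time ahead; as [j1 < m] and [0 < N], the time [j1 * N + 1] is still at
     most [T]. *)
  have close : rho (Fl (j1 * N)%:R p) (Fl (j1 * N)%:R q) < e.
    rewrite /rho -!(geo0 g) !geo_flow addr0 [ltRHS]splitr; apply: ltrD; apply: (hd p q T) => //.
      by rewrite ler0n ler_nat leq_mul2r (ltnW (ltn_ord j1)) orbT.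
    rewrite addr_ge0//= natr1 ler_nat; apply: leq_trans jm.
    by rewrite mulSn -addn1 addnC leq_add2r.
  have := congr1 (fun h : {ffun 'I_m -> bool} => h j1) k2; rewrite /= !ffunE.
  have := ea _ _ Up wp; have := ea _ _ Uq wq.
  case: (a j1) (a' j1) => [i|] [i'|] //= e1 e2' _; congr Some.
  exact: (sepd _ _ _ _ (UT_flow _ Up) (UT_flow _ Uq) (esym e2') (esym e1) close).
apply: le_trans (ler_sum _ (fun j _ => step j)) _.
rewrite sumr_const -[leLHS]mulr_natr.
have -> : #|(xpredT : pred ('I_(size s1).+1 * 'I_(size s2).+1 * {ffun 'I_m -> bool}))|%:R =
    ((size s1).+1 * (size s2).+1)%:R * 2 ^+ m :> R.
  rewrite -natrX -natrM; congr (_%:R); transitivity #|{: 'I_(size s1).+1 * 'I_(size s2).+1 * {ffun 'I_m -> bool}}|.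
    exact: eq_card.
  by rewrite !card_prod !card_ord card_ffun card_bool card_ord.
have gT : growth (T + r1) <= growth (T + c).
  by apply: growth_le; rewrite lerD2l lerDr mulr_ge0// expR_ge0.
have ge0 : 0 <= growth (T + r1) by apply: sumr_ge0 => w _; exact: ler0n.
rewrite mulrAC mulrA; apply: ler_pM => //.
by rewrite ler_wpM2r ?exprn_ge0// lerDl.
Qed.

Lemma rate_qf t (y : Y) : rate (lft (qf t y)) = rate (Fl t (lft y)).
Proof.
rewrite (quotient_flowE W'sub); have [w W'w ->]   := lft_prj (W' := W') (UT_flow t (UT_lft y)).
exact: (rate_act regB apA fA _ (W'sub W'w)).
Qed.

Lemma Gsum_bound (T : nat) : exists2 c, 0 <= c & forall p, UT p -> Gsum lq (- 1) T%:R p <= c.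
Proof.
have [c c0 hc] := Csum_bound fA (T.+1)%:R lqok; exists c => // p Up.
apply: le_trans (Sep_Csum regB apA fA Up (_ : - 1 < T%:R)) _; first exact: lt_le_trans (ltrN10 _) (ler0n _ _).
by apply: hc => //; rewrite -natr1 addrC addrK.
Qed.

(** * Volumes of balls and the growth function *)

Section BallVolume.
Implicit Types (x y z : cplx_point B).
Notation lifts := (@lifts R g n P B f).

Lemma cdist_triangle x1 x2 x3 : cdist x1 x3 <= cdist x1 x2 + cdist x2 x3.
Proof.
have [A' [f' [y1 [y3 [apA' fA' [M1 M3] <- <-]]]]] := common_ap x1 x3.
have ch := chart_self 1 apA' fA'.
rewrite (cdist_chart apA' fA' M1 M3) -[y1 in dist _ y1 _](rc_chart W1' ch M1).
rewrite -[y3 in dist _ _ y3](rc_chart W1' ch M3).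
apply: le_trans (dist_triangle (rcM apA' fA' W1' _) (rcM apA' fA' W1' x2) (rcM apA' fA' W1' _)) _.
by apply: lerD; exact: (rc_cdist _ _ apA' fA' W1').
Qed.

Definition stock r : set (set (cplx_point B)) := [set D | exists2 w, w \in shell r & lifts 1 w D].

Lemma stock_chamber r : stock r `<=` @chamber R g n P B.
Proof. by move=> D [w /shellP[Ww _] h]; exact: (lifts_chamber Ww h). Qed.

Lemma stock_sum r (c : R) : 0 <= c -> \esum_(D in stock r) c%:E = (growth r * c)%:E.
Proof.
move=> c0; pose I := [set` shell r].
have -> : stock r = (fun k : 'M[R]_n.+2 * set (cplx_point B) => k.2) @` (I `*`` lifts 1).
  apply/seteqP; split=> [D [w hw h]|_ [[w D] [hw h] <-]]; first by exists (w, D).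
  by exists w.
rewrite esum_image; last first.
  move=> [w1 D1] [w2 D2] /set_mem[/= h1 l1] /set_mem[/= h2 l2] /= e.
  rewrite -e in l2 *; congr pair; have [W1 _] := (shellP _ _).1 h1; have [W2 _] := (shellP _ _).1 h2.
  exact: (lifts_uniq fA W1' W1 W2 l1 l2).
rewrite -(@esum_esum _ _ _ I (lifts 1) (fun _ _ => c%:E)); last by move=> *; rewrite lee_fin.
have inner w : I w -> \esum_(D in lifts 1 w) c%:E = ((nover 1 w)%:R * c)%:E.
  move=> /shellP[Ww _]; have hc := noverP regB apA fA W1' Ww.
  have fl : finite_set (lifts 1 w) by exists (nover 1 w).
  rewrite esum_fset//.
  rewrite fsbig_finite//= sumEFin; congr _%:E.
  by rewrite big_const_seq count_predT iter_addr addr0 (card_fset_set hc) mulr_natl.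
have fI : finite_set I by exact: finite_seq.
rewrite (eq_esum inner) esum_fset//; last by move=> *; rewrite lee_fin mulr_ge0.
by rewrite -fsbig_seq ?shell_uniq// sumEFin -mulr_suml.
Qed.

Definition vol : R := fine (volume g (polyhedron P)).

Lemma volE : volume g (polyhedron P) = vol%:E /\ 0 < vol.
Proof.
have [c hc] := volume_fin (P := P); have h0 := volume_gt0 (P := P).
have vf : volume g (polyhedron P) \is a fin_num.
  by rewrite ge0_fin_numE; [exact: le_lt_trans hc (ltry _)|exact: ltW].
by split; rewrite /vol ?fineK// -lte_fin fineK.
Qed.

Lemma stock_dist : exists2 D, 0 <= D & forall (w : 'M[R]_n.+2) C y, W w -> lifts 1 w C -> C y ->
  `|cdist (f (ctr 1)) y - dist g (ctr 1) (ctr w)| <= D.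
Proof.
have [D D0 hD] := tile_diam (P := P); exists D; first exact: ltW.
move=> w _ _ Ww [A' [f' [[apA' fA' ff'] ->]]] [z tz <-].
have Mz : M z by exact: (tileM Ww tz).
have t1 : tile 1 (ctr 1) by exact: (intile_tile W1' (ctr_in W1')).
rewrite -(ff' _ t1) (cdist_chart apA' fA' (ctr_M W1') Mz).
have h := hD _ _ Ww tz; have Mc := ctr_M W1'; have Mw := ctr_M Ww.
have h1 := dist_triangle Mc Mw Mz; have h2 := dist_triangle Mc Mz Mw.
rewrite (distC Mw Mz) in h1; by apply: abs_close; [apply: le_trans h1 _|apply: le_trans h2 _]; rewrite lerD2l.
Qed.

(** Distances in the building to points of a chamber agree up to [D] with distances between tile
    centres, so a ball contains all chambers over tiles of a slightly smaller radius and meets only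
    those over a slightly larger one. *)
Lemma cvolume_bounds x : exists c, forall r,
  ((growth (r - c) * vol)%:E <= cvolume (cball x r) <= (growth (r + c) * vol)%:E)%E.
Proof.
have [vE v0] := volE; have [D D0 hD] := stock_dist; set z := f (ctr 1) in hD.
have cb C : chamber C -> @ctype _ _ _ _ B @` C = polyhedron P.
  by move=> cC; have [h1 _ h2] := chamber_bij cC; apply/seteqP; split=> [_ [y Cy <-]|y /h2]; [exact: h1|].
have hvol r C : chamber C -> (0 <= volume g (@ctype _ _ _ _ B @` (cball x r `&` C)) <= vol%:E)%E.
  by move=> cC; rewrite -vE -(cb C cC); apply: volume_mono; apply: image_subset => y [].
exists (Num.max (cdist x z) (cdist z x) + D + 1) => r.
rewrite -!(stock_sum _ (ltW v0)); set c := Num.max _ _ + _ + _; apply/andP; split.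
  rewrite -[stock _](setIidr (@stock_chamber _)) esum_mkcondr; apply: le_esum => C cC.
  case: ifP => [/set_mem[w /shellP[Ww dw] lw]|_]; last by have /andP[] := hvol r C cC.
  have -> : cball x r `&` C = C; last by rewrite cb// vE.
  apply/setIidr => y Cy; have := hD w C y Ww lw Cy; rewrite ler_norml => /andP[_ h].
  apply: le_lt_trans (cdist_triangle _ z _) _.
  have hm : cdist x z <= Num.max (cdist x z) (cdist z x) by rewrite le_max lexx.
  exact: (ball_arith1 h dw hm).
rewrite -[stock _](setIidr (@stock_chamber _)) esum_mkcondr; apply: le_esum => C cC.
case: ifPn => [_|nC]; first by have /andP[] := hvol r C cC.
rewrite (_ : cball x r `&` C = set0) ?image_set0 ?volume0// -subset0 => y [yr Cy].
have [A' [f' [w [ch Ww CE]]]] := chamber_chart apA fA W1' cC.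
have lw : lifts 1 w C by exists A', f'.
move/negP: nC; apply; apply/mem_set; exists w => //; apply/shellP; split=> //.
have := hD w C y Ww lw Cy; rewrite ler_norml => /andP[h _].
have ht := cdist_triangle z x y.
have hm : cdist z x <= Num.max (cdist x z) (cdist z x) by rewrite le_max lexx orbT.
exact: (ball_arith2 h ht hm yr).
Qed.

End BallVolume.

(** * Entropy plus integral is at most the growth rate *)

Section Invariant.
Variable mu : probability bY R.
Hypothesis inv : flow_invariant mu.
Notation pr := (@prob _ bY R mu).
Let mrate := measurable_rate regB apA fA W'sub.

Lemma integral_flow t (h : bY -> \bar R) : measurable_fun setT h -> (forall y, 0 <= h y)%E ->
  (\int[mu]_(y in setT) h (qf t y) = \int[mu]_(y in setT) h y)%E.
Proof.
move=> mh h0; have mq := measurable_flow W'sub t.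
transitivity (\int[pushforward mu (qf t)]_(y in setT) h y)%E.
  by rewrite ge0_integral_pushforward// => y _.
by apply: eq_measure_integral => E mE _; exact: (inv t mE).
Qed.

Lemma measurable_min_rate b : measurable_fun setT (fun y : bY => (Num.min (rate (lft y)) b)%:E).
Proof.
apply/measurable_EFinP; apply: measurable_minr; first exact: mrate.
exact: measurable_cst.
Qed.

Lemma min_rate_ge0 b (y : Y) : 0 <= b -> 0 <= Num.min (rate (lft y)) b.
Proof. by move=> b0; rewrite le_min b0 (rate_ge0 regB apA fA (UT_lft y)). Qed.
Lemma measurable_GsumE b t : measurable_fun setT (fun y : bY => (Gsum lq b t (lft y))%:E).
Proof. by apply/measurable_EFinP; exact: (measurable_Gsum fA W'sub _ _ lqok). Qed.
Lemma Gsum_ge0 b t p : 0 <= Gsum lq b t p.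
Proof. exact: (wsum_ge0 lqok). Qed.

End Invariant.

(** Integrating [riemann_upper]: by invariance all terms of the Riemann sum have the same
    integral. *)
Lemma int_rate_upper : exists2 c, 0 <= c & forall (mu : probability bY R) b (T : nat),
  flow_invariant mu -> 0 <= b ->
  (T%:R%:E * \int[mu]_(y in setT) (Num.min (rate (lft y)) b)%:E <=
   \int[mu]_(y in setT) (Gsum lq (- 1) T%:R (lft y))%:E + c%:E)%E.
Proof.
have [c c0 hc] := riemann_upper regB apA fA; exists c => // mu b T inv b0.
have [N hN] := hc b T b0; have N1 : N.+1%:R != 0 :> R by [].
have N0 : 0 <= N.+1%:R^-1 :> R by [].
pose h (y : bY) : R := Num.min (rate (lft y)) b.
have h0 y : 0 <= h y by exact: min_rate_ge0.
have mh : measurable_fun setT (EFin \o h) by exact: measurable_min_rate.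
have mhq t : measurable_fun setT (fun y : bY => (h (qf t y))%:E).
  by apply: (measurableT_comp mh); exact: (measurable_flow W'sub).
have Z t : (\int[mu]_(y in setT) (N.+1%:R^-1 * h (qf t y))%:E = (N.+1%:R^-1)%:E * \int[mu]_(y in setT) (h y)%:E)%E.
  have hh (y : bY) : (0 <= (h y)%:E)%E by rewrite lee_fin.
  rewrite -(integral_flow inv t mh hh).
  exact: (@ge0_integralZl _ _ _ mu setT measurableT _ (mhq t) (N.+1%:R^-1)%:E (fun y _ => hh (qf t y)) _).
have -> : (T%:R%:E * \int[mu]_(y in setT) (h y)%:E =
    \int[mu]_(y in setT) (\sum_(j < T * N.+1) (N.+1%:R^-1 * h (qf (j.+1%:R / N.+1%:R) y))%:E))%E.
  rewrite ge0_integral_sum//; last 2 first.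
  - move=> j; under eq_fun do rewrite EFinM; apply: emeasurable_funM => //; exact: measurable_cst.
  - by move=> j y _; rewrite lee_fin mulr_ge0.
  rewrite (eq_bigr (fun=> (N.+1%:R^-1)%:E * \int[mu]_(y in setT) (h y)%:E)%E); last by move=> j _; exact: Z.
  rewrite -ge0_sume_distrl; last by move=> j _; rewrite lee_fin.
  by rewrite sumEFin; congr (_%:E * _)%E; rewrite sumr_const card_ord -(mulr_natl N.+1%:R^-1) natrM mulfK.
have -> : c%:E = (\int[mu]_(y in setT) cst c%:E y)%E by rewrite integral_cst// [X in (_ * X)%E]probability_setT mule1.
rewrite -ge0_integralD//; last 2 first.
- by move=> y _; rewrite lee_fin Gsum_ge0.
- exact: measurable_GsumE.
apply: ge0_le_integral => //.
- by move=> y _; apply: sume_ge0 => j _; rewrite lee_fin mulr_ge0.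
- apply: emeasurable_sum => j; under eq_fun do rewrite EFinM.
  by apply: emeasurable_funM => //; exact: measurable_cst.
- by apply: emeasurable_funD; [exact: measurable_GsumE|exact: measurable_cst].
move=> y _; rewrite sumEFin -EFinD lee_fin.
have Uy := UT_lft y; apply: le_trans (_ : Csum lq (lft y) 0 T%:R + c <= _).
  apply: le_trans (hN _ Uy); apply: ler_sum => j _; by rewrite /h rate_qf.
(* The wall sum starts at time -1 because [Csum] counts a crossing at time 0, which an open interval
   from 0 would miss. *)
rewrite lerD2r; have n1 : -1 < 0 :> R by rewrite oppr_lt0.
by apply: (Csum_Sep regB apA fA Uy n1) => //; exact: lt_le_trans n1 (ler0n _ _).
Qed.

(** Misiurewicz's device: by regularity each cell is shrunk to a closed subset of almost full mass.
    The closed kernels have positive mutual distance, and the points left over get the letter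
    [None]. *)
Lemma closed_kernel (mu : probability bY R) (I : finType) (a : Y -> I) :
  adapted (@measurable _ bY) a -> exists eta : Y -> option I,
  [/\ adapted (@measurable _ bY) eta,
      entropy (@prob _ bY R mu) (fun x => (a x, eta x)) - entropy (@prob _ bY R mu) eta <= 1 &
      exists2 e, 0 < e & forall p q i j, UT p -> UT q -> eta (prj p) = Some i ->
        eta (prj q) = Some j -> rho p q < e -> i = j].
Proof.
move=> aa; set pr := prob mu; have fp := prob_fap mu.
pose L : R := ln #|I|%:R.
have L0 : 0 <= L by rewrite /L; case: #|I| => [|k]; [rewrite ln0|rewrite ln_ge0// ler1n].
(* The mass lost is at most [#|I| * d], so the conditional entropy, at most [#|I| * d * L], stays
   below 1. *)
pose d : R := (#|I|.+1%:R * (L + 1))^-1.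
have d0 : 0 < d by rewrite invr_gt0 mulr_gt0// ltr_wpDl.
have /choice[C hC] i : exists C : set Y, [/\ closed C, C `<=` a @^-1` [set i] &
    (mu (a @^-1` [set i] `\` C) <= d%:E)%E].
  have [C [U [cC oU CE EU h]]] := regular_measurable W'sub mu (aa i) d0.
  exists C; split=> //; apply: le_trans h; apply: le_measure; rewrite ?inE.
  - by apply: measurableD; [exact: aa|rewrite -(setCK C); apply: measurableC; apply: sub_sigma_algebra; exact: closed_openC].
  - apply: measurableD; first exact: sub_sigma_algebra.
    by rewrite -(setCK C); apply: measurableC; apply: sub_sigma_algebra; exact: closed_openC.
  - by move=> x [Ex nC]; split=> //; exact: EU.
have mC i : measurable (C i : set bY).
  by rewrite -(setCK (C i)); apply: measurableC; apply: sub_sigma_algebra; apply: closed_openC; have [] := hC i.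
pose eta (y : Y) : option I := if `[< C (a y) y >] then Some (a y) else None.
have etaS i : eta @^-1` [set Some i] = C i.
  apply/seteqP; split=> y /=; rewrite /eta; first by case: asboolP => // h [<-].
  by move=> Cy; have [_ /(_ _ Cy) /= ay _] := hC i; rewrite ay asboolT.
have etaN i : (fun y => (a y, eta y)) @^-1` [set (i, None)] = a @^-1` [set i] `\` C i.
  apply/seteqP; split=> y /=; rewrite /eta.
    by case=> <-; case: asboolP.
  by move=> [<- nC]; rewrite asboolF.
have ae : adapted (@measurable _ bY) eta.
  move=> [i|]; first by rewrite etaS.
  have -> : eta @^-1` [set None] = \bigcup_(i in [set: I]) (a @^-1` [set i] `\` C i).
    apply/seteqP; split=> y; first by move=> /= h; exists (a y) => //; rewrite -etaN /= h.
    by move=> [i _]; rewrite -etaN /= => -[].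
  by apply: fin_bigcup_measurable => // i _; apply: measurableD => //; exact: aa.
exists eta; split=> //.
  apply: (entropy_approx fp) => //; first by move=> y i; rewrite /eta; case: ifP => // _ [].
  have le : law pr eta None <= #|I|%:R * d.
    rewrite (law_pairr fp None aa ae) -sum1_card natr_sum mulr_suml; apply: ler_sum => i _.
    rewrite mul1r /law etaN -lee_fin /pr /prob fineK; first by have [] := hC i.
    by apply: fin_num_measure; apply: measurableD => //; exact: aa.
  apply: le_trans (ler_wpM2r L0 le) _; rewrite mulrAC ler_pdivrMr ?mul1r; last first.
    by rewrite mulr_gt0// ltr_wpDl.
  by apply: ler_pM; rewrite ?ler_nat// lerDl.
have finII : finite_set [set: I * I] by exact: finite_finset.
have [e e0 he] : exists2 e, 0 < e & forall ij, [set: I * I] ij ->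
    ij.1 <> ij.2 -> forall p q, UT p -> UT q -> C ij.1 (prj p) -> C ij.2 (prj q) -> e <= rho p q.
  apply: (finite_radius (Q := fun ij e => ij.1 <> ij.2 -> forall p q, UT p -> UT q ->
    C ij.1 (prj p) -> C ij.2 (prj q) -> e <= rho p q) finII).
    by move=> ij r s h sr ne p q Up Uq Cp Cq; apply: le_trans sr _; exact: h.
  move=> [i j] _ /=; have [->|ne] := eqVneq i j; first by exists 1.
  have [ci si _] := hC i; have [cj sj _] := hC j.
  have [|e e0 he] := closed_separated fA W'sub W'fin ci cj; last by exists e => // _ p q; exact: he.
  by apply/seteqP; split=> // y [/si /= h1 /sj /= h2]; move: ne; rewrite -h1 h2 eqxx.
exists e => // p q i j Up Uq ep eq close; apply: contrapT => ne.
have Cp : C i (prj p) by rewrite -etaS.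
have Cq : C j (prj q) by rewrite -etaS.
by have := he (i, j) Logic.I ne p q Up Uq Cp Cq; rewrite leNgt close.
Qed.

Section Estimate.
Variables (mu : probability bY R) (I : finType) (a : Y -> I) (h b F : R).
Hypotheses (inv : flow_invariant mu) (aa : adapted (@measurable _ bY) a)
  (ha : forall m, (0 < m)%N -> h * m%:R <= entropy (@prob _ bY R mu) (word (qf 1) a m))
  (b0 : 0 <= b) (hF : (\int[mu]_(y in setT) (Num.min (rate (lft y)) b)%:E = F%:E)%E).
Notation pr := (@prob _ bY R mu).
Let fp : fap (@measurable _ bY) pr := prob_fap mu.

Lemma measurable_preim t (D : set bY) : measurable D -> measurable (qf t @^-1` D).
Proof. exact: (measurable_pre (measurable_flow W'sub t)). Qed.
Lemma prob_preim t (D : set bY) : measurable D -> pr (qf t @^-1` D) = pr D.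
Proof. by apply: prob_inv => E mE; exact: inv. Qed.

(** Gibbs' inequality against the weights [expR (S y)], where [y] is a point of the cell at which
    [S] is within 1 of its supremum; this is the origin of the additive 1. *)
Lemma gibbs_words (J : finType) (c : Y -> J) (S : Y -> R) (k F2 : R) :
  adapted (@measurable _ bY) c -> (forall y, 0 <= S y <= k) ->
  measurable_fun setT (fun y : bY => (S y)%:E) -> (\int[mu]_(y in setT) (S y)%:E = F2%:E)%E ->
  exists G : J -> R, [/\ forall j, 0 <= G j,
    forall j, G j != 0 -> exists y : Y, c y = j /\ G j <= expR (S y),
    entropy pr c + F2 <= 1 + ln (\sum_j G j) & 0 < \sum_j G j].
Proof.
move=> ac hS mS eF2.
have key j : exists y : Y, (exists z, c z = j) -> c y = j /\ forall z, c z = j -> S z <= S y + 1.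
  have [[z0 ez0]|no] := EM (exists z, c z = j); last by exists point => h'; case: no.
  pose E := [set S z | z in [set z | c z = j]].
  have hs : has_sup E.
    by split; [exists (S z0), z0|exists k => _ [z _ <-]; have /andP[] := hS z].
  have [_ [y cy <-] hy] := sup_adherent ltr01 hs.
  exists y => _; split=> // z cz; rewrite -lerBlDr; apply: le_trans (ltW hy); rewrite lerB//.
  by apply: ub_le_sup; [case: hs|exists z].
have [y hy] := choice key.
pose ne j := `[< exists z, c z = j >].
pose G j := if ne j then expR (S (y j)) else 0.
have G0 j : 0 <= G j by rewrite /G; case: ifP => // _; exact: expR_ge0.
pose s j := if ne j then S (y j) + 1 else 0.
have s0 j : 0 <= s j.
  by rewrite /s; case: ifP => // _; rewrite addr_ge0//; have /andP[] := hS (y j).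
have L0 j : 0 <= law pr c j by exact: (law_ge0 fp j ac).
have Lne j : 0 < law pr c j -> ne j.
  move=> lj; apply/asboolP; apply: contrapT => no; move: lj.
  suff -> : law pr c j = 0 by rewrite ltxx.
  rewrite /law -(pr0 fp); congr pr; apply/seteqP; split=> // z /= cz.
  by apply: no; exists z.
have le : F2 <= \sum_j law pr c j * s j.
  rewrite -lee_fin -eF2 -(integral_law mu ac s0); apply: ge0_le_integral => //.
  - by move=> z _; rewrite lee_fin; have /andP[] := hS z.
  - exact: (measurable_adapted (EFin \o s) ac).
  - move=> z _; rewrite lee_fin /s; have nz : ne (c z) by apply/asboolP; exists z.
    by rewrite nz; have [|_] := hy (c z); [exists z|apply].
have P1 : \sum_j law pr c j = 1 by exact: (law_sum1 fp ac).
have q0 j : 0 <= expR 1 * G j by rewrite mulr_ge0// expR_ge0.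
have qpos j : 0 < law pr c j -> 0 < expR 1 * G j.
  by move=> /Lne nj; rewrite mulr_gt0 ?expR_gt0// /G nj expR_gt0.
have GS : 0 < \sum_j G j.
  rewrite lt_def sumr_ge0// andbT; apply/eqP => z.
  have z' j : G j = 0 by apply/eqP; move: z => /eqP; rewrite psumr_eq0// => /allP/(_ j (mem_index_enum j)).
  have : \sum_j law pr c j = 0.
    apply: big1 => j _; apply/eqP; rewrite eq_le L0 andbT leNgt; apply/negP => /qpos.
    by rewrite z' mulr0 ltxx.
  by rewrite P1 => /eqP; rewrite oner_eq0.
exists G; split=> //.
  by move=> j; rewrite /G; case: ifP => [/asboolP nj _|]; [exists (y j); have [] := hy _ nj|rewrite eqxx].
have := gibbs L0 q0 qpos; rewrite P1 mul1r ln1 subr0 -mulr_sumr lnM ?posrE ?expR_gt0// expRK.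
apply: le_trans; rewrite /entropy /ent addrC -sumrN; apply: le_trans (lerD le (lexx _)) _.
rewrite -big_split /=; apply: ler_sum => j _; rewrite -mulrN -mulrDr.
have [->|nz] := eqVneq (law pr c j) 0; first by rewrite !mul0r.
have lj : 0 < law pr c j by rewrite lt_def nz L0.
by rewrite ler_wpM2l// lerD2r /s /G (Lne _ lj) lnM ?posrE ?expR_gt0// !expRK addrC.
Qed.

(** The time-[N] map is coded by words of length [N] as letters, so the loss [ln 2] of the word
    count and the loss 1 of the closed kernels occur once per block and not once per unit of
    time. *)
Lemma growth_lower N : (0 < N)%N -> exists2 c, 0 <= c & forall m, (0 < m)%N ->
  (h + F) * (m * N)%:R <= ln (growth ((m * N)%:R + c)) + m%:R * (ln 2 + 1) + c.
Proof.
move=> N0; pose a' := word (qf 1) a N.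
have aa' : adapted (@measurable _ bY) a' by apply: (adapted_word fp) => // D; exact: measurable_preim.
have [eta [ae hH [e e0 sepd]]] := closed_kernel mu aa'.
have [c1 c10 hc1] := count_words e0.
have [c2 c20 hc2] := int_rate_upper.
pose c := 1 + ln (c1 + 1) + c2 + c1.
have lc1 : 0 <= ln (c1 + 1) by rewrite ln_ge0// lerDr.
have c0 : 0 <= c by rewrite /c !addr_ge0.
exists c => // m m0; pose T := (m * N)%N.
have T0 : (0 < T)%N by rewrite muln_gt0 m0.
pose g1 := ln (growth (T%:R + c1)).
have gp r : 0 <= r -> 0 < growth r by move=> r0; apply: lt_le_trans ltr01 _; exact: growth_ge1.
have Tc1 : 0 <= T%:R + c1 by rewrite addr_ge0.
suff main : (h + F) * T%:R <= g1 + m%:R * (ln 2 + 1) + (1 + ln (c1 + 1) + c2).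
  apply: le_trans main _; rewrite -/T; apply: lerD; last by rewrite /c lerDl.
  rewrite lerD2r ler_ln ?posrE ?gp// ?addr_ge0//; apply: growth_le.
  by rewrite lerD2l /c lerDr !addr_ge0.
have [k k0 hk] := Gsum_bound T.
pose S (y : Y) := Gsum lq (- 1) T%:R (lft y).
have hS y : 0 <= S y <= k by rewrite Gsum_ge0 hk//; exact: UT_lft.
have mS : measurable_fun setT (fun y : bY => (S y)%:E) by exact: measurable_GsumE.
have [F2 eF2] : exists F2 : R, (\int[mu]_(y in setT) (S y)%:E = F2%:E)%E.
  exists (fine (\int[mu]_(y in setT) (S y)%:E)); rewrite fineK// ge0_fin_numE.
    apply: le_lt_trans (_ : \int[mu]_(y in setT) k%:E < +oo)%E.
      apply: ge0_le_integral => // [y _|y _]; last by rewrite lee_fin; have /andP[] := hS y.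
      by rewrite lee_fin; have /andP[] := hS y.
    by rewrite integral_cst// [X in (_ * X)%E]probability_setT mule1 ltry.
  by apply: integral_ge0 => y _; rewrite lee_fin; have /andP[] := hS y.
have aw : adapted (@measurable _ bY) (word (qf N%:R) eta m).
  by apply: (adapted_word fp) => // D; exact: measurable_preim.
have [G [G0 hG hE GS]] := gibbs_words aw hS mS eF2.
have := hc1 _ eta N m G N0 sepd G0 hG => hsum.
apply: (@growth_arith R h F T%:R m%:R g1 (entropy pr (word (qf N%:R) eta m)) F2 c2 (ln (c1 + 1)) (ln 2)).
- apply: le_trans (ha T0) _.
  have eN : iter N (qf 1) = qf N%:R :> (Y -> Y) by apply/funext => y; rewrite (iter_qf) mulr1.
  have mp1 (D : set bY) : measurable D -> measurable (qf 1 @^-1` D) by exact: measurable_preim.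
  rewrite -(word_power fp mp1 _ _ aa) eN -[m%:R]mulr1.
  apply: le_trans (entropy_cond fp _ _ _ aa' ae) _; last 1 first.
  + by rewrite lerD2l ler_wpM2l.
  + by move=> D; exact: measurable_preim.
  + by move=> D; exact: prob_preim.
- have := hc2 mu b T inv b0; rewrite hF eF2 -EFinM -EFinD lee_fin mulrC; exact.
apply: le_trans hE _; rewrite lerD2l.
have cpos : 0 < c1 + 1 by rewrite ltr_wpDl.
apply: le_trans (_ : ln ((c1 + 1) * 2 ^+ m * growth (T%:R + c1)) <= _); last first.
  rewrite !lnM ?posrE ?mulr_gt0 ?exprn_gt0 ?gp//= lnXn// mulr_natl.
  by rewrite /g1.
rewrite ler_ln ?posrE// ?mulr_gt0 ?exprn_gt0 ?gp//; apply: le_trans hsum _.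
by rewrite ler_wpM2r ?(ltW (gp _ Tc1))// ler_wpM2r ?exprn_ge0// lerDl.
Qed.

Lemma growth_rate_lower e : 0 < e -> \forall r \near +oo, (h + F - e) * r <= ln (growth r).
Proof.
move=> e0; pose L := h + F.
have [neg|pos] := leP (L - e) 0.
  near=> r; have r0 : 0 <= r by near: r; apply: nbhs_pinfty_ge; rewrite num_real.
  by apply: le_trans (_ : 0 <= _); [exact: mulr_le0_ge0|rewrite ln_ge0// growth_ge1].
have L0 : 0 <= L by rewrite ltW// (lt_trans e0)// -subr_gt0.
have q0 : 0 <= ln 2 + 1 :> R by rewrite addr_ge0// ln_ge0// ler1n.
(* Blocks so long that the loss [ln 2 + 1] per block is at most [e / 2] per unit of time. *)
pose N := (Num.truncn ((ln 2 + 1) / (e / 2)) : nat).+1.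
have hN : ln 2 + 1 <= e / 2 * N%:R.
  by rewrite mulrC -ler_pdivrMr ?divr_gt0// ltW// truncnS_gt.
have [c c0 hc] := growth_lower (ltn0Sn _ : (0 < N)%N).
near=> r.
have r0 : 0 <= r by near: r; apply: nbhs_pinfty_ge; rewrite num_real.
have r1 : c + N%:R <= r by near: r; apply: nbhs_pinfty_ge; rewrite num_real.
have r2 : (L * (c + N%:R) + c) / (e / 2) <= r by near: r; apply: nbhs_pinfty_ge; rewrite num_real.
have N1 : 0 < N%:R :> R by rewrite ltr0n.
have x0 : 0 <= (r - c) / N%:R by rewrite divr_ge0// subr_ge0 (le_trans _ r1)// lerDl.
pose m := Num.truncn ((r - c) / N%:R).
have /andP[m1 m2] := truncn_itv x0; rewrite -/m in m1 m2.
have hm1 : m%:R * N%:R <= r - c by rewrite -ler_pdivlMr.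
have hm2 : r - c <= m%:R * N%:R + N%:R.
  by move: m2; rewrite ltr_pdivrMr// -natr1 mulrDl mul1r => /ltW.
have m0 : (0 < m)%N.
  by rewrite truncn_gt0 ler_pdivlMr// mul1r lerBrDl.
apply: (rescale_arith (C := c) (N := N%:R) (m := m%:R) (q := ln 2 + 1)) => //.
- exact: ltW.
- by move: r2; rewrite ler_pdivrMr ?divr_gt0// [r * _]mulrC.
rewrite -natrM; apply: le_trans (hc m m0) _; rewrite lerD2r lerD2r ler_ln ?posrE.
- by apply: growth_le; rewrite natrM -lerBrDr.
- by apply: lt_le_trans ltr01 _; apply: growth_ge1 => //; rewrite addr_ge0.
- by apply: lt_le_trans ltr01 _; exact: growth_ge1.
Unshelve. all: end_near. Qed.

End Estimate.

(** The direction from the base centre to the centre of [w]; for [w = 1] every unit vector at the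
    base centre qualifies. *)
Definition aims p w := [/\ UT p, p.1 = ctr 1 & geo p (dist g (ctr 1) (ctr w)) = ctr w].

Lemma aims_exists w : W w -> exists p, aims p w.
Proof.
move=> Ww; have Mc := ctr_M W1'; have Mw := ctr_M Ww.
have [e|ne] := EM (ctr 1 = ctr w); last first.
  by have [p Up [p1 p2]] := log_exists Mc Mw ne; exists p.
have U0 := @unit_tangent_point R g n; set q0 := (_, _) in U0.
(* Any other point supplies a direction when the two centres coincide; a fixed geodesic avoids the
   base centre at time 0 or at time 1. *)
have [y My ne] : exists2 y, M y & ctr 1 <> y.
  have [e0|ne] := EM (ctr 1 = geo q0 0); last by exists (geo q0 0) => //; exact: geoM.
  exists (geo q0 1); first exact: geoM.
  rewrite e0 => e1; have := dist_geo 0 1 U0; rewrite -e1 distxx; last exact: geoM.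
  by rewrite sub0r normrN1 => /eqP; rewrite eq_sym oner_eq0.
have [p Up [p1 p2]] := log_exists Mc My ne; exists p; split=> //.
by rewrite -e distxx// geo0.
Qed.

(** * Geodesics with the same word end in nearby tiles *)

Section Follow.
Variables (r0 e s : R) (T : nat) (p q : V * V) (v : nat -> 'M[R]_n.+2).
Hypotheses (hr0 : forall w x, mgroup_set W' w -> w <> 1 -> M x -> r0 <= dist g x (x *m w))
  (e2 : e *+ 2 <= r0) (Up : UT p) (Uq : UT q)
  (hv : forall i, (i <= T)%N -> mgroup_set W' (v i) /\
    rho (Fl (s + i%:R) p) (act (Fl (s + i%:R) q) (v i)) < e).

Lemma follow_dist i : (i <= T)%N -> forall d : R, d = 0 \/ d = 1 ->
  dist g (geo p (s + i%:R + d)) (geo q (s + i%:R + d) *m v i) < e.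
Proof.
move=> iT d hu; have [Wv h] := hv iT; apply: le_lt_trans h; rewrite /rho.
have Wv' := W'sub Wv; have Uq' := UT_flow (s + i%:R) Uq.
have Up' := UT_flow (s + i%:R) Up.
have M1 t : M (geo (Fl (s + i%:R) p) t) by exact: geoM.
have M2 t : M (geo (act (Fl (s + i%:R) q) (v i)) t) by rewrite geo_act; apply: (WMM Wv'); exact: geoM.
have e0 p' : p'.1 = geo p' 0 by rewrite geo0.
rewrite e0 (e0 (act _ _)); case: hu => ->; rewrite -!geo_flow -geo_act.
  by rewrite lerDl; exact: dist_ge0.
by rewrite lerDr; exact: dist_ge0.
Qed.

(** As [rho] sees the times 0 and 1, both [v i] and [v i.+1] bring the second geodesic within [e] of
    the first at time [s + i.+1%:R]. Their quotient moves a point by less than [e *+ 2 <= r0], so it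
    is trivial. *)
Lemma follow_const i : (i <= T)%N -> v i = v 0%N.
Proof.
elim: i => [//|i IH] iT; rewrite -IH; last exact: ltnW.
have [Wv _] := hv iT; have [Wv' _] := hv (ltnW iT).
have Wa := W'sub Wv; have Wb := W'sub Wv'; have Ub := W_unit Wb.
have h1 := follow_dist iT (or_introl erefl); have h2 := follow_dist (ltnW iT) (or_intror erefl).
rewrite addr0 in h1; rewrite -addrA natr1 in h2.
set x := geo p _ in h1 h2; set y := geo q _ in h1 h2.
have Mx : M x by exact: geoM. have My : M y by exact: geoM.
have Ma := WMM Wa My; have Mb := WMM Wb My.
pose u := (v i)^-1 * v i.+1.
have [_ WM' WV'] := mgroupP W'; have [_ Wi] := WV' _ Wv'.
have W'u : mgroup_set W' u by exact: WM'.
have eu : y *m v i *m u = y *m v i.+1.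
  by rewrite -mulmxA /u (mulmxA (v i) (v i)^-1) (mulrV Ub : v i *m (v i)^-1 = 1) mul1mx.
have [u1|nu] := EM (u = 1); first by apply: (mulrI (_ : (v i)^-1 \is a GRing.unit)); rewrite ?unitrV// -/u u1 mulVr.
have := hr0 W'u nu Mb; rewrite eu leNgt => /negP[]; apply: lt_le_trans e2.
apply: le_lt_trans (dist_triangle Mb Mx Ma) _; rewrite (distC Mb Mx) mulr2n; exact: ltrD.
Qed.

(** One group element serves all times: at the start it almost fixes the base centre, at the end it
    almost carries the centre of [w'] to that of [w]. Equal integer parts of the two lengths allow a
    comparison at a common time, and 3 is the sum of three errors of size at most 1. *)
Lemma follow_shell w w' : 0 <= s <= 1 -> e <= 1 -> W w -> W w' -> aims p w -> aims q w' ->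
  dist g (ctr 1) (ctr w) <= T%:R ->
  Num.truncn (dist g (ctr 1) (ctr w)) = Num.truncn (dist g (ctr 1) (ctr w')) ->
  v 0%N \in shell 3 /\ w' * v 0%N * w^-1 \in shell 3.
Proof.
move=> s01 e1 Ww Ww' [_ p1 pw] [_ q1 qw] dT ek.
have [s0 s1] : 0 <= s /\ s <= 1 by apply/andP.
have Mc := ctr_M W1'; have Mw := ctr_M Ww; have Mw' := ctr_M Ww'.
have [Wv0 _] := hv (leq0n T); have Wv := W'sub Wv0.
have Mp t : M (geo p t) by exact: geoM.
have Mqv t : M (geo q t *m v 0%N) by apply: (WMM Wv); exact: geoM.
split.
  apply/shellP; split=> //.
  have h := follow_dist (leq0n T) (or_introl erefl); rewrite !addr0 in h.
  have -> : ctr (v 0%N) = geo q 0 *m v 0%N by rewrite -[v 0%N]mul1r ctr_mul mul1r geo0 q1.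
  have -> : ctr 1 = geo p 0 by rewrite geo0.
  have a1 : dist g (geo p 0) (geo p s) <= s by rewrite dist_geo// sub0r normrN ger0_norm.
  have a2 : dist g (geo q s *m v 0%N) (geo q 0 *m v 0%N) <= s.
    by rewrite (W_dist Wv) ?dist_geo//; try exact: geoM; rewrite subr0 ger0_norm.
  have a3 : dist g (geo p s) (geo q 0 *m v 0%N) <= dist g (geo p s) (geo q s *m v 0%N) + s.
    by apply: le_trans (dist_triangle (Mp s) (Mqv s) (Mqv 0)) _; rewrite lerD2l.
  exact: (shift_arith (dist_triangle (Mp 0) (Mp s) (Mqv 0)) a1 a3 h e1 s1 s1).
apply/shellP; split; first exact: WM (WM Ww' Wv) (WV Ww).
have WV' := WV Ww; have Ww'v := WM Ww' Wv.
rewrite ctr_mul -(distC (WMM WV' (ctr_M Ww'v)) Mc) (W_distV WV' (ctr_M Ww'v) Mc) invrK.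
have -> : ctr 1 *m w = ctr w by rewrite -ctr_mul mul1r.
rewrite (distC (ctr_M Ww'v) Mw).
pose d := dist g (ctr 1) (ctr w); pose d' := dist g (ctr 1) (ctr w'); pose k := Num.truncn d.
have d0 : 0 <= d by exact: dist_ge0.
have d0' : 0 <= d' by exact: dist_ge0.
have hk := truncn_itv d0; have hk' := truncn_itv d0'; rewrite -/k -/d -/d' -ek -/k in hk hk'.
rewrite -natr1 in hk; rewrite -natr1 in hk'.
have kT : (k <= T)%N.
  by rewrite -(ler_nat R); apply: le_trans dT; case/andP: hk.
have h := follow_dist kT (or_introl erefl); rewrite !addr0 follow_const// in h.
have -> : ctr (w' * v 0%N) = geo q d' *m v 0%N by rewrite ctr_mul qw.
have -> : ctr w = geo p d by rewrite pw.
have a1 : dist g (geo p d) (geo p (s + k%:R)) <= 1 by rewrite dist_geo//; exact: floor_arith.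
have a2 : dist g (geo q (s + k%:R) *m v 0%N) (geo q d' *m v 0%N) <= 1.
  by rewrite (W_dist Wv) ?dist_geo//; try exact: geoM; rewrite distrC; exact: floor_arith.
have a3 : dist g (geo p (s + k%:R)) (geo q d' *m v 0%N) <=
    dist g (geo p (s + k%:R)) (geo q (s + k%:R) *m v 0%N) + 1.
  by apply: le_trans (dist_triangle (Mp _) (Mqv (s + k%:R)) (Mqv d')) _; rewrite lerD2l.
exact: (shift_arith (dist_triangle (Mp d) (Mp (s + k%:R)) (Mqv d')) a1 a3 h e1 (lexx 1) (lexx 1)).
Qed.

End Follow.

(** For each integer part of the distance fix one tile with the given word. Any other such tile
    arises from it by multiplication on both sides with elements of a fixed finite ball and their
    inverses, and there are [T.+1] possible integer parts. *)
Lemma atom_bound : exists2 e, 0 < e & exists C : nat, forall (I : finType) (a : Y -> I),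
  (forall p q, UT p -> UT q -> a (prj p) = a (prj q) ->
    exists2 w, mgroup_set W' w & rho p (act q w) < e) ->
  forall (T : nat) s (J : finType) (h : J -> 'M[R]_n.+2) (z : J -> V * V) j0, 0 <= s <= 1 ->
  injective h -> (forall j, h j \in shell T%:R /\ aims (z j) (h j)) ->
  (#|[pred j | word (qf 1) a T.+1 (qf s (prj (z j))) == word (qf 1) a T.+1 (qf s (prj (z j0)))]|
    <= C * T.+1)%N.
Proof.
have [r0 r00 hr0] := displacement fA W'sub W'tf.
(* Half of the minimal displacement serves [follow_const], the bound 1 serves [follow_shell]. *)
pose e := Num.min (r0 / 2) 1.
have e0 : 0 < e by rewrite lt_min divr_gt0// ltr01.
have e1 : e <= 1 by rewrite ge_min lexx orbT.
have e2 : e *+ 2 <= r0 by rewrite -mulr_natr -ler_pdivlMr// ge_min lexx.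
pose S := shell 3; exists e => //; exists ((size S).+1 * (size S).+1)%N.
move=> I a ha T s J h z j0 s01 hinj hz.
set D := [pred j | _].
have wordE j i : a (iter i (qf 1) (qf s (prj (z j)))) = a (prj (Fl (s + i%:R) (z j))).
  have [_ [Uz _ _]] := hz j.
  by rewrite (iter_qf) (quotient_flowD W'sub) mulr1 (quotient_flow_prj W'sub).
have pair j j' : j \in D -> j' \in D -> exists v : nat -> 'M[R]_n.+2, forall i, (i <= T)%N ->
    mgroup_set W' (v i) /\ rho (Fl (s + i%:R) (z j)) (act (Fl (s + i%:R) (z j')) (v i)) < e.
  move=> /eqP Dj /eqP Dj'; have [_ [Uz _ _]] := hz j; have [_ [Uz' _ _]] := hz j'.
  have key i : exists v, (i <= T)%N -> mgroup_set W' v /\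
      rho (Fl (s + i%:R) (z j)) (act (Fl (s + i%:R) (z j')) v) < e.
    have [iT|_] := boolP (i <= T)%N; last by exists 1.
    have /wordP/(_ i) := etrans Dj (esym Dj'); rewrite !wordE ltnS => /(_ iT).
    by move=> /(ha _ _ (UT_flow _ Uz) (UT_flow _ Uz'))[v Wv hv]; exists v.
  by have [v hv] := choice key; exists v.
pose kk j := Num.truncn (dist g (ctr 1) (ctr (h j))).
have kT j : (kk j < T.+1)%N.
  have [/shellP[Wh hT] _] := hz j; rewrite ltnS -(ler_nat R); apply: le_trans hT.
  by have /andP[] := truncn_itv (dist_ge0 (ctr_M W1') (ctr_M Wh)).
pose rep k : J := odflt j0 [pick j in D | kk j == k].
have repP j : j \in D -> rep (kk j) \in D /\ kk (rep (kk j)) = kk j.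
  move=> Dj; rewrite /rep; case: pickP => [i /= /andP[Di /eqP->]//|/(_ j)].
  by rewrite Dj eqxx.
have key j : exists vu : 'M[R]_n.+2 * 'M[R]_n.+2, j \in D ->
    [/\ vu.1 \in S, vu.2 \in S & h j = vu.2 * h (rep (kk j)) * vu.1^-1].
  have [Dj|nD] := boolP (j \in D); last by exists (1, 1).
  have [Dr er] := repP _ Dj; have [v hv] := pair _ _ Dr Dj.
  have [/shellP[Wr rT] ar] := hz (rep (kk j)); have [/shellP[Wj jT] aj] := hz j.
  have [Ur _ _] := ar; have [Uj _ _] := aj.
  have [v1 v2] := follow_shell hr0 e2 Ur Uj hv s01 e1 Wr Wj ar aj rT er.
  exists (v 0%N, h j * v 0%N * (h (rep (kk j)))^-1) => _; split=> //=.
  have [Wv _] := hv 0%N (leq0n _).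
  by rewrite mulrVK ?mulrK//; [exact: (W_unit (W'sub Wv))|exact: (W_unit Wr)].
have [vu hvu] := choice key.
have idx (w : 'M[R]_n.+2) : (index w S < (size S).+1)%N by rewrite ltnS index_size.
pose F j : 'I_(size S).+1 * 'I_(size S).+1 * 'I_T.+1 :=
  (Ordinal (idx (vu j).1), Ordinal (idx (vu j).2), Ordinal (kT j)).
have Finj : {in D &, injective F}.
  move=> j j' Dj Dj' [i1 i2 ik]; apply: hinj.
  have [s1 s2 ->] := hvu _ Dj; have [s1' s2' ->] := hvu _ Dj'.
  have e3 : (vu j).1 = (vu j').1 by rewrite -(nth_index 0 s1) i1 nth_index.
  have e4 : (vu j).2 = (vu j').2 by rewrite -(nth_index 0 s2) i2 nth_index.
  by rewrite e3 e4 ik.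
by apply: leq_trans (leq_card_in _ _ Finj) _; rewrite !card_prod !card_ord.
Qed.

(** * Weighted averages along the flow *)

Section Levels.
Variable dir : 'M[R]_n.+2 -> V * V.
Hypothesis hdir : forall w, W w -> aims (dir w) w.

Section Level.
Variable k : nat.
Notation T := k.+1.
Notation N := (size (shell T%:R)).

Definition elt (j : 'I_N) := nth 1 (shell T%:R) j.

Definition wgt (j : 'I_N) : R := (nover 1 (elt j))%:R / growth T%:R.

Definition lev t : set Y -> R := emp wgt (fun j => prj (Fl t (dir (elt j)))).

(** The [T * T] grid times [l / T] fill [[0, T)]: the mesh tends to 0 while the length tends to
    infinity, which makes the limit invariant under all real times. *)
Definition mean (E : set Y) : R := (T * T)%:R^-1 * \sum_(l < T * T) lev (l%:R / T%:R) E.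

Lemma eltP j : W (elt j) /\ dist g (ctr 1) (ctr (elt j)) <= T%:R.
Proof. by apply/shellP; exact: mem_nth. Qed.
Lemma elt_inj : injective elt.
Proof. by move=> i j /eqP; rewrite nth_uniq ?shell_uniq// => /eqP/val_inj. Qed.
Lemma UT_dir j : UT (dir (elt j)).
Proof. by have [Wj _] := eltP j; have [] := hdir Wj. Qed.

Let g1 : 0 < growth T%:R.
Proof. by apply: lt_le_trans ltr01 _; exact: (growth_ge1). Qed.
Lemma wgt_ge0 j : 0 <= wgt j.
Proof. by rewrite divr_ge0// ltW. Qed.

Lemma wgt_sum1 : \sum_j wgt j = 1.
Proof.
rewrite -mulr_suml /growth (big_nth 1) big_mkord divff//.
by move: g1; rewrite /growth (big_nth 1) big_mkord => /lt0r_neq0.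
Qed.

Lemma lev_fap t : fap setT (lev t).
Proof. exact: emp_fap wgt_ge0 wgt_sum1. Qed.
Lemma lev_le1 t E : 0 <= lev t E <= 1.
Proof. exact: emp_le1 wgt_ge0 wgt_sum1. Qed.

Lemma lev_flow s t E : lev s (qf t @^-1` E) = lev (s + t) E.
Proof.
apply: eq_bigl => j; have Ud := UT_flow s (UT_dir j).
by rewrite /= (quotient_flow_prj W'sub)// flowD.
Qed.

(** The equality case of Gibbs' inequality: for these weights entropy plus mean wall sum is exactly
    the logarithm of the growth. *)
Lemma ent_wgt : ent wgt = ln (growth T%:R) - \sum_j wgt j * Sep (ctr 1) (ctr (elt j)).
Proof.
rewrite /ent -[ln _]mul1r -[X in X * ln _]wgt_sum1 mulr_suml -sumrB -sumrN; apply: eq_bigr => j _.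
have [Wj _] := eltP j; rewrite -mulrBr -mulrN; congr (_ * _).
rewrite /wgt (nover_Sep regB apA fA W1' Wj) ln_div ?posrE ?expR_gt0//.
by rewrite expRK opprB.
Qed.

Lemma mean_fap : fap setT mean.
Proof.
split=> //.
- move=> D _; rewrite mulr_ge0// sumr_ge0// => l _; by have /andP[] := lev_le1 (l%:R / T%:R) D.
- rewrite /mean (eq_bigr (fun=> 1)) => [|l _]; last exact: (fap_1 (lev_fap _)).
  by rewrite sumr_const card_ord mulVf.
move=> D E _ _ DE; rewrite /mean -mulrDr -big_split /=; congr (_ * _).
by apply: eq_bigr => l _; rewrite (fap_U (lev_fap _)).
Qed.

Lemma mean_ge0 E : 0 <= mean E <= 1.
Proof. by rewrite (fap_ge0 mean_fap)//= -(fap_1 mean_fap); exact: (fap_le mean_fap). Qed.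

(** The shift by [t] is rounded down to [q] grid steps. Rounding moves points by at most [2 / T] in
    [rho], and the [q] terms shifted out of the range, among [T * T], weigh at most [t / T]. *)
Lemma mean_shift t d E : 0 <= t -> 2 / T%:R < d ->
  mean (qf t @^-1` E) <= mean (fat E d) + t / T%:R.
Proof.
move=> t0 hd; have T0 : 0 < T%:R :> R by rewrite ltr0n.
pose q := Num.truncn (t * T%:R).
have /andP[q1 q2] : q%:R <= t * T%:R < q.+1%:R by apply: truncn_itv; rewrite mulr_ge0.
have step (l : nat) : lev (l%:R / T%:R) (qf t @^-1` E) <= lev ((l + q)%:R / T%:R) (fat E d).
  rewrite lev_flow /lev /emp [leLHS]big_mkcond [leRHS]big_mkcond; apply: ler_sum => j _.
  case: asboolP => [h1|_]; last by case: ifP => // _; exact: wgt_ge0.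
  rewrite asboolT// /fat /=; have Ud := UT_dir j.
  apply: le_lt_trans (dset_le W'sub (UT_flow _ Ud) (UT_flow _ Ud) h1) _.
  rewrite rho_flow// natrD mulrDl opprD addrACA subrr add0r -normrN opprB; apply: le_lt_trans hd.
  by rewrite distrC; apply: grid_arith => //; rewrite natr1.
have shift (F : nat -> R) m : (forall l, 0 <= F l <= 1) ->
    \sum_(l < m) F (l + q)%N <= \sum_(l < m) F l + q%:R.
  move=> hF; rewrite (_ : \sum_(l < m) F (l + q)%N = \sum_(0 + q <= l < m + q) F l); last first.
    by rewrite big_addn addnK big_mkord.
  rewrite add0n.
  apply: le_trans (_ : \sum_(0 <= l < m + q) F l <= _).
    rewrite [leRHS](@big_cat_nat _ _ _ q)//= ?leq_addl// lerDr; apply: sumr_ge0 => l _.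
    by have /andP[] := hF l.
  rewrite (@big_cat_nat _ _ _ m)//= ?leq_addr// big_mkord lerD2l.
  apply: le_trans (_ : \sum_(m <= l < m + q) 1 <= _).
    by apply: ler_sum => l _; have /andP[] := hF l.
  by rewrite big_const_nat addKn iter_addr addr0.
apply: le_trans (_ : (T * T)%:R^-1 * (\sum_(l < T * T) lev (l%:R / T%:R) (fat E d) + q%:R) <= _).
  rewrite {1}/mean ler_wpM2l//;
  apply: le_trans (_ : \sum_(l < T * T) lev ((l + q)%:R / T%:R) (fat E d) <= _).
    by apply: ler_sum => l _; exact: step.
  by apply: (shift (fun l => lev (l%:R / T%:R) (fat E d))) => l; exact: lev_le1.
rewrite mulrDr lerD2l natrM invfM -mulrA ler_pdivrMl// mulrCA divff ?lt0r_neq0// mulr1.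
by rewrite ler_pdivrMl// mulrC.
Qed.

Section Blocks.
Variables (I : finType) (a : Y -> I) (m : nat).
Hypothesis m0 : (0 < m)%N.
Notation J := (T %/ m).+1.

(** The number of blocks is one more than [T %/ m], so they reach beyond [T] whatever the offset and
    the remainder; a longer word has at least as much entropy. *)
Lemma block_entropy s (r : nat) : (r <= m)%N ->
  entropy (lev s) (word (qf 1) a T.+1) <= m%:R * ln #|I|%:R +
  \sum_(j < J) entropy (lev (s + (r + j * m)%:R)) (word (qf 1) a m).
Proof.
move=> rm; have fp := lev_fap s; have ad (I' : finType) (b : Y -> I') : adapted setT b by [].
have I0 : 0 <= ln #|I|%:R :> R by case: #|I| => [|i]; [rewrite ln0|rewrite ln_ge0// ler1n].
apply: le_trans (_ : entropy (lev s) (word (qf 1) a (r + J * m)) <= _).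
  apply: (entropy_factor fp) => // x y /wordP h; apply/wordP => j jT; apply: h.
  apply: leq_trans jT _; apply: leq_trans (leq_addl r _); exact: ltn_ceil.
apply: le_trans (entropy_word_block fp _ _ _ _ _) _ => //; apply: lerD.
  apply: le_trans (entropy_le_card fp _) _ => //; rewrite card_ffun card_ord natrX.
  by rewrite lnX_nat ler_wpM2r// ler_nat.
apply: ler_sum => j _; rewrite le_eqVlt; apply/orP; left; apply/eqP.
rewrite /entropy /ent; congr (- _); apply: eq_bigr => i _; rewrite /law comp_preimage.
have -> : iter (r + j * m) (qf 1) = qf (r + j * m)%:R :> (Y -> Y).
  by apply/funext => y; rewrite (iter_qf) mulr1.
by rewrite lev_flow.
Qed.

Let T0 : 0 < T%:R :> R. Proof. by rewrite ltr0n. Qed.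

Section Weights.
Variables (c1 cm : R).
Hypotheses (c10 : 0 <= c1)
  (hc1 : forall x y x' y', M x -> M y -> M x' -> M y' -> dist g x x' <= 1 -> dist g y y' <= 1 ->
    Sep x y <= Sep x' y' + c1)
  (hcm : forall p b c, UT p -> c <= b + m.+1%:R -> Csum lq p b c <= cm).
Notation G := (Gsum lq 0 m%:R).
Let cm0 : 0 <= cm.
Proof.
by apply: le_trans (hcm (b := 0) (c := 0) (@unit_tangent_point R g n) _); [exact: Csum_ge0 lqok|rewrite add0r].
Qed.

Lemma G_flow p t : G (Fl t p) = Sep (geo p t) (geo p (t + m%:R)).
Proof. by rewrite /Gsum !geo_flow addr0. Qed.

Lemma G_bound p : UT p -> 0 <= G p <= cm.
Proof.
move=> Up; rewrite (wsum_ge0 lqok)/=; apply: le_trans (Sep_Csum regB apA fA Up _) _.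
  by rewrite ltr0n.
by apply: hcm => //; rewrite add0r ler_nat.
Qed.

Lemma Csum_blocks p x i : UT p ->
  Csum lq p x (x + (i * m)%:R) <= \sum_(j < i) (G (Fl (x + (j * m)%:R) p) + c1).
Proof.
move=> Up; elim: i => [|i IH].
  by rewrite big_ord0 mul0n addr0 Csum_none// => t _ /andP[h1 h2]; move: (le_lt_trans h1 h2); rewrite ltxx.
rewrite big_ord_recr /=; have le1 : (i * m <= i.+1 * m)%N by rewrite leq_mul2r leqnSn orbT.
rewrite (CsumD fA lq (b := x + (i * m)%:R) Up); last by rewrite lerDl ler0n lerD2l ler_nat.
apply: lerD => //; set t := x + (i * m)%:R; rewrite G_flow.
have -> : x + (i.+1 * m)%:R = t + m%:R by rewrite mulSnr natrD addrA.
have t1 : t - 1 < t by rewrite ltrBlDr ltrDl.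
have tm : t - 1 < t + m%:R by apply: lt_le_trans t1 _; rewrite lerDl.
apply: le_trans (Csum_Sep regB apA fA Up t1 (lexx _) tm) _.
apply: hc1; try exact: geoM; last by rewrite distxx//; exact: geoM.
by rewrite dist_geo// addrAC subrr add0r normrN1.
Qed.

Lemma block_Sep p w s (r : nat) : W w -> aims p w -> dist g (ctr 1) (ctr w) <= T%:R ->
  0 <= s <= 1 -> (r <= m)%N ->
  Sep (ctr 1) (ctr w) <= cm + \sum_(j < J) (G (Fl (s + (r + j * m)%:R) p) + c1).
Proof.
move=> Ww [Up p1 pw] dT /andP[s0 s1] rm; have Mc := ctr_M W1'; have Mw := ctr_M Ww.
set d := dist g _ _ in pw dT; have d0 : 0 <= d by exact: dist_ge0.
have sum0 : 0 <= cm + \sum_(j < J) (G (Fl (s + (r + j * m)%:R) p) + c1).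
  rewrite addr_ge0// sumr_ge0// => j _; rewrite addr_ge0//.
  by have /andP[] := G_bound (UT_flow (s + (r + j * m)%:R) Up).
have [dz|dn] := eqVneq d 0.
  have <- : ctr 1 = ctr w by exact: (dist_eq0 Mc Mw).
  by rewrite /Sep (wsep_ctr W1') wsum0.
have dp : 0 < d by rewrite lt_def dn.
have e0 : ctr 1 = geo p 0 by rewrite geo0.
rewrite e0 -pw; apply: le_trans (Sep_Csum regB apA fA Up dp) _.
pose X := s + r%:R + (J * m)%:R.
have TX : T%:R <= X.
  apply: le_trans (_ : (J * m)%:R <= _); first by rewrite ler_nat ltnW// ltn_ceil.
  by rewrite lerDr addr_ge0.
have dX : d <= X by exact: le_trans dT TX.
have sr0 : 0 <= s + r%:R by rewrite addr_ge0.
apply: le_trans (_ : Csum lq p 0 X <= _).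
  by rewrite [leRHS](CsumD fA lq (b := d) Up) ?d0// lerDl; exact: Csum_ge0.
rewrite (CsumD fA lq (b := s + r%:R) Up); last by rewrite sr0/= /X lerDl.
apply: lerD.
  by apply: hcm => //; rewrite add0r -natr1 addrC lerD// ler_nat.
apply: le_trans (Csum_blocks _ _ Up) _; apply: ler_sum => j _.
by rewrite natrD addrA.
Qed.

Variable C : nat.
Hypothesis atom : forall s j0, 0 <= s <= 1 ->
  (#|[pred j | word (qf 1) a T.+1 (qf s (prj (dir (elt j)))) ==
     word (qf 1) a T.+1 (qf s (prj (dir (elt j0))))]| <= C * T.+1)%N.

Let H t := entropy (lev t) (word (qf 1) a m).
Let S t := \sum_j wgt j * G (Fl t (dir (elt j))).
Let Psi t := H t + S t + c1.
Let L := ln (growth T%:R) - ln (C * T.+1)%:R.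
Let K0 := m%:R * ln #|I|%:R + cm.

Lemma levE s (I' : finType) (b : Y -> I') :
  entropy (lev s) b = entropy (emp wgt (fun j => qf s (prj (dir (elt j))))) b.
Proof.
rewrite /entropy /ent; congr (- _); apply: eq_bigr => i _; rewrite /law /lev /emp.
by rewrite !(eq_bigl _ _ (fun j => congr1 (fun y => `[< [set x | b x = i] y >])
  (quotient_flow_prj W'sub s (UT_dir j)))).
Qed.

(** Word and wall sum are cut into the same blocks of length [m] after an initial piece of length
    [r], which [K0] pays for. Passing from tiles to words costs only [ln (C * T.+1)]. *)
Lemma block_main s (r : nat) : 0 <= s <= 1 -> (r <= m)%N ->
  L <= K0 + \sum_(j < J) Psi (s + (r + j * m)%:R).
Proof.
move=> s01 rm; have hs := emp_entropy wgt_ge0 wgt_sum1 (fun j0 => atom j0 s01).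
have hw : \sum_j wgt j * Sep (ctr 1) (ctr (elt j)) <=
    cm + \sum_(j < J) (S (s + (r + j * m)%:R) + c1).
  apply: le_trans (_ : \sum_j wgt j * (cm + \sum_(i < J) (G (Fl (s + (r + i * m)%:R) (dir (elt j))) + c1)) <= _).
    apply: ler_sum => j _; have [Wj dj] := eltP j; rewrite ler_wpM2l ?wgt_ge0//.
    by apply: block_Sep => //; exact: hdir.
  rewrite (eq_bigr _ (fun j _ => mulrDr _ _ _)) big_split /= -mulr_suml wgt_sum1 mul1r lerD2l.
  rewrite (eq_bigr _ (fun j _ => mulr_sumr _ _ _ _)) exchange_big /=; apply: ler_sum => i _.
  by rewrite (eq_bigr _ (fun j _ => mulrDr _ _ _)) big_split /= -mulr_suml wgt_sum1 mul1r.
have he := block_entropy s rm; rewrite levE in he.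
have := le_trans hs he; rewrite ent_wgt => h.
rewrite /L /K0 /Psi; rewrite (eq_bigr _ (fun j _ => esym (addrA _ _ _))) big_split /=.
exact: (block_arith h hw).
Qed.

Lemma Psi_bound t : 0 <= Psi t <= m%:R * ln #|I|%:R + cm + c1.
Proof.
have ad (I' : finType) (b : Y -> I') : adapted setT b by [].
have I0 : 0 <= ln #|I|%:R :> R by case: #|I| => [|i]; [rewrite ln0|rewrite ln_ge0// ler1n].
have S0 : 0 <= S t <= cm.
  apply/andP; split.
    by apply: sumr_ge0 => j _; rewrite mulr_ge0 ?wgt_ge0//; have /andP[] := G_bound (UT_flow t (UT_dir j)).
  rewrite -[leRHS]mul1r -wgt_sum1 mulr_suml; apply: ler_sum => j _; rewrite ler_wpM2l ?wgt_ge0//.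
  by have /andP[] := G_bound (UT_flow t (UT_dir j)).
have [S1 S2] := andP S0; have H0 : 0 <= H t by exact: (entropy_ge0 (lev_fap t)).
apply/andP; split; first by rewrite !addr_ge0.
rewrite lerD2r lerD//; apply: le_trans (entropy_le_card (lev_fap t) _) _ => //.
by rewrite card_ffun card_ord natrX lnX_nat.
Qed.

(** Summing over the offsets [r < m] makes blocks start at every integer time, and summing over
    [s = i / T] fills in the grid; concavity of entropy then moves the average onto [mean]. *)
Lemma level_bound (I2 : finType) (b : Y -> I2) (v : I2 -> R) :
  (forall p, UT p -> G p <= v (b (prj p))) ->
  m%:R * L <= m%:R * (K0 + (m%:R * ln #|I|%:R + cm + c1)) +
    T%:R * (c1 + entropy mean (word (qf 1) a m) + \sum_i law mean b i * v i).
Proof.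
move=> hv; set Bd := m%:R * ln #|I|%:R + cm + c1.
have Bd0 : 0 <= Bd by have /andP[h1 h2] := Psi_bound 0; exact: le_trans h1 h2.
have step s : 0 <= s <= 1 -> m%:R * L <= m%:R * (K0 + Bd) + \sum_(k < T) Psi (s + k%:R).
  move=> s01; apply: le_trans (_ : \sum_(r < m) (K0 + \sum_(j < J) Psi (s + (r + j * m)%:R)) <= _).
    rewrite (_ : m%:R * L = \sum_(r < m) L); last by rewrite sumr_const card_ord mulr_natl.
    by apply: ler_sum => r _; apply: block_main => //; exact: ltnW.
  rewrite big_split /= sumr_const card_ord -[K0 *+ m]mulr_natl [m%:R * (K0 + Bd)]mulrDr -addrA lerD2l.
  rewrite (sum_blocksC (fun q : nat => Psi (s + q%:R))).
  have JT : (T <= J * m)%N by rewrite ltnW// ltn_ceil.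
  rewrite -(big_mkord xpredT (fun q : nat => Psi (s + q%:R))) (@big_cat_nat _ _ _ T)//= big_mkord addrC lerD2r.
  apply: le_trans (_ : \sum_(T <= q < J * m) Bd <= _).
    by apply: ler_sum => q _; have /andP[] := Psi_bound (s + q%:R).
  rewrite big_const_nat iter_addr addr0 -[_ *+ _]mulr_natl ler_wpM2r// ler_nat.
  by rewrite leq_subLR mulSnr leq_add2r leq_divM.
have T00 : 0 < T%:R * T%:R :> R by rewrite mulr_gt0.
have sumT : T%:R * (m%:R * L) <= T%:R * (m%:R * (K0 + Bd)) + \sum_(l < T * T) Psi (l%:R / T%:R).
  have -> : \sum_(l < T * T) Psi (l%:R / T%:R) = \sum_(i < T) \sum_(k < T) Psi (i%:R / T%:R + k%:R).
    rewrite -(sum_blocksC (fun l => Psi (l%:R / T%:R)) T T); apply: eq_bigr => i _.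
    by apply: eq_bigr => q _; rewrite natrD mulrDl natrM mulfK ?lt0r_neq0.
  have cst x : T%:R * x = \sum_(i < T) x by rewrite sumr_const card_ord mulr_natl.
  rewrite !cst -big_split /=; apply: ler_sum => i _; apply: step.
  by rewrite divr_ge0//= ler_pdivrMr// mul1r ler_nat ltnW.
have hH : \sum_(l < T * T) H (l%:R / T%:R) <= T%:R * T%:R * entropy mean (word (qf 1) a m).
  rewrite -natrM; apply: (entropy_avg (pr := fun l : 'I_(T * T) => lev (l%:R / T%:R))) => // l.
  exact: lev_fap.
have hS : \sum_(l < T * T) S (l%:R / T%:R) <= T%:R * T%:R * \sum_i law mean b i * v i.
  apply: le_trans (_ : \sum_(l < T * T) \sum_i law (lev (l%:R / T%:R)) b i * v i <= _).
    apply: ler_sum => l _; rewrite -emp_expect; apply: ler_sum => j _.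
    by rewrite ler_wpM2l ?wgt_ge0//; apply: hv; exact: (UT_flow _ (UT_dir j)).
  rewrite exchange_big /= mulr_sumr le_eqVlt; apply/orP; left; apply/eqP; apply: eq_bigr => i _.
  by rewrite -mulr_suml mulrA /law /mean mulrA -natrM divff// mul1r.
rewrite -(ler_pM2l T0); apply: le_trans sumT _; rewrite [leRHS]mulrDr lerD2l mulrA.
rewrite big_split /= big_split /= sumr_const card_ord -[c1 *+ _]mulr_natl natrM.
move: hH hS; move: (\sum_(l < T * T) H _) (\sum_(l < T * T) S _) => x1 x2 h1 h2.
apply: le_trans (lerD (lerD h1 h2) (lexx _)) _.
by move: (entropy _ _) (\sum_i _) => y1 y2; rewrite le_eqVlt; apply/orP; left; apply/eqP; ring.
Qed.

End Weights.

End Blocks.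

End Level.

End Levels.

(** The mesh in [riemann_lower] depends on the point, so the Riemann sums dominate the wall sum only
    in the lower limit. Their integrals are all equal by invariance, and Fatou's lemma concludes. *)
Lemma int_Gsum_upper : exists2 c, 0 <= c & forall (mu : probability bY R) (m : nat),
  flow_invariant mu -> (0 < m)%N ->
  (\int[mu]_(y in setT) (Gsum lq 0 m%:R (lft y))%:E <=
   c%:E + m%:R%:E * \int[mu]_(y in setT) (rate (lft y))%:E)%E.
Proof.
have [c c0 hc] := riemann_lower regB apA fA; exists (c + 1); first by rewrite addr_ge0.
move=> mu m inv m0.
have r0 y : (0 <= (rate (lft y))%:E)%E by rewrite lee_fin (rate_ge0 regB apA fA (UT_lft y)).
have mr : measurable_fun setT (fun y : bY => (rate (lft y))%:E).
  by apply/measurable_EFinP; exact: (measurable_rate regB apA fA W'sub).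
have mrq t : measurable_fun setT (fun y : bY => (rate (lft (qf t y)))%:E).
  by apply: (measurableT_comp mr); exact: (measurable_flow W'sub).
pose H (N : nat) (y : bY) : \bar R :=
  (\sum_(j < m * N.+1) (N.+1%:R^-1 * rate (lft (qf (j.+1%:R / N.+1%:R) y)))%:E)%E.
have H0 N y : (0 <= H N y)%E.
  by apply: sume_ge0 => j _; rewrite EFinM mule_ge0// lee_fin invr_ge0.
have mH N : measurable_fun setT (H N).
  apply: emeasurable_sum => j; under eq_fun do rewrite EFinM.
  by apply: emeasurable_funM => //; exact: measurable_cst.
have intH N : (\int[mu]_(y in setT) H N y = m%:R%:E * \int[mu]_(y in setT) (rate (lft y))%:E)%E.
  have N1 : N.+1%:R != 0 :> R by [].
  rewrite ge0_integral_sum//; last 2 first.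
  - by move=> j; under eq_fun do rewrite EFinM; apply: emeasurable_funM => //; exact: measurable_cst.
  - by move=> j y _; rewrite EFinM mule_ge0// lee_fin invr_ge0.
  rewrite (eq_bigr (fun=> (N.+1%:R^-1)%:E * \int[mu]_(y in setT) (rate (lft y))%:E)%E); last first.
    move=> j _; rewrite -(integral_flow inv (j.+1%:R / N.+1%:R) mr r0).
    apply: (@ge0_integralZl _ _ _ mu setT measurableT _ (mrq _) (N.+1%:R^-1)%:E (fun y _ => r0 _) _).
    by rewrite lee_fin invr_ge0.
  rewrite -ge0_sume_distrl; last by move=> j _; rewrite lee_fin invr_ge0.
  by rewrite sumEFin; congr (_%:E * _)%E; rewrite sumr_const card_ord -[_ *+ _]mulr_natl natrM mulfK.
have -> : (c + 1)%:E = (\int[mu]_(y in setT) cst (c + 1)%:E y)%E.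
  by rewrite integral_cst// [X in (_ * X)%E]probability_setT mule1.
have liminf : (limn_einf (fun N => \int[mu]_(y in setT) H N y) =
    m%:R%:E * \int[mu]_(y in setT) (rate (lft y))%:E)%E.
  under eq_fun do rewrite intH; apply: (@cvg_limn_einf_sup _ _ _ _).1; exact: cvg_cst.
rewrite -liminf; have mL : measurable_fun setT (fun y => limn_einf (H^~ y)).
  rewrite (_ : (fun y => _) = -%E \o (fun y => limn_esup (-%E \o H^~ y))); last first.
    by apply/funext => y; rewrite /= limn_esupN oppeK.
  apply: measurableT_comp => //; apply: measurable_fun_limn_esup => N.
  exact: measurableT_comp.
have L0 y : (0 <= limn_einf (H^~ y))%E.
  by apply: limn_einf_ge; near=> N; exact: H0.
apply: le_trans (leeD (le_refl _) (fatou mu measurableT mH (fun N y _ => H0 N y))).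
rewrite -ge0_integralD//; last by move=> y _; rewrite lee_fin addr_ge0.
apply: ge0_le_integral => //.
- by move=> y _; rewrite lee_fin; exact: (wsum_ge0 lqok).
- exact: (measurable_GsumE).
- by apply: emeasurable_funD => //; exact: measurable_cst.
move=> y _; rewrite -leeBlDl// -EFinB; apply: limn_einf_ge.
have := hc _ m 1 (UT_lft y) ltr01; apply: filterS => N hN.
rewrite /H sumEFin lee_fin -addrA -opprD in hN *.
apply: le_trans (_ : Csum lq (lft y) 0 m%:R - (c + 1) <= _).
  by rewrite lerD2r; apply: (Sep_Csum regB apA fA (UT_lft y)); rewrite ltr0n.
apply: le_trans hN _; rewrite le_eqVlt; apply/orP; left; apply/eqP; apply: eq_bigr => j _.
by rewrite (rate_qf).
Unshelve. all: by end_near. Qed.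

Lemma flow_near p t : UT p -> exists2 e, 0 < e & forall q, UT q -> rho p q < e ->
  rho (Fl t p) (Fl t q) < 1 / 2.
Proof.
move=> Up; have Ut := UT_flow t Up; have [Z oZ hZ] := rho_lt_open (1 / 2) Ut.
have oF : open (Fl t @^-1` Z) by apply: open_comp => // y _; exact: continuous_flow.
have Fp : (Fl t @^-1` Z) p by apply/(hZ _ Ut); rewrite rhoxx// divr_gt0.
have [e e0 he] := rho_nbhs Up oF Fp; exists e => // q Uq /(he q Uq) h.
by apply/(hZ _ (UT_flow t Uq)).
Qed.

Lemma Gsum_near : exists2 c, 0 <= c & forall (m : nat) p, UT p -> exists2 e, 0 < e &
  forall q, UT q -> rho p q < e -> Gsum lq 0 m%:R p <= Gsum lq 0 m%:R q + c /\
    Gsum lq 0 m%:R q <= Gsum lq 0 m%:R p + c.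
Proof.
have [c c0 hc] := Sep_close regB apA fA 1; exists c => // m p Up.
have [e1 e10 h1] := flow_near 0 Up; have [e2 e20 h2] := flow_near m%:R Up.
exists (Num.min e1 e2); first by rewrite lt_min e10.
move=> q Uq; rewrite lt_min => /andP[/(h1 q Uq) l1 /(h2 q Uq) l2].
have far t : rho (Fl t p) (Fl t q) < 1 / 2 -> dist g (geo p t) (geo q t) <= 1 /\ dist g (geo q t) (geo p t) <= 1.
  move=> h; have -> : dist g (geo q t) (geo p t) = dist g (geo p t) (geo q t) by apply: distC; exact: geoM.
  suff: dist g (geo p t) (geo q t) <= 1 by [].
  apply: le_trans (_ : rho (Fl t p) (Fl t q) <= _); last by apply: le_trans (ltW h) _; rewrite ler_pdivrMr// mul1r ler1n.
  have e0 p' : (Fl t p').1 = geo p' t by rewrite -[t in RHS]addr0 -geo_flow geo0.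
  rewrite /rho !e0 lerDl; apply: dist_ge0; rewrite geo_flow; exact: geoM.
have [a1 a2] := far _ l1; have [b1 b2] := far _ l2.
by split; apply: hc => //; exact: geoM.
Qed.

(** The wall sum may be discontinuous, but up to a bounded error it is constant on small balls. This
    squeezes it by a simple function over continuity sets, on which the limit measure and the
    finitely additive limit agree. *)
Lemma Gsum_partition (m : nat) (c : R) (nu : set Y -> R) : fap setT nu ->
  (forall p, UT p -> exists2 e, 0 < e &
    forall q, UT q -> rho p q < e -> Gsum lq 0 m%:R p <= Gsum lq 0 m%:R q + c /\
      Gsum lq 0 m%:R q <= Gsum lq 0 m%:R p + c) ->
  exists (I : finType) (b : Y -> I) (v : I -> R), [/\ forall i, bnull nu (b @^-1` [set i]),
    forall i, 0 <= v i & forall y, Gsum lq 0 m%:R (lft y) <= v (b y) <= Gsum lq 0 m%:R (lft y) + c *+ 4].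
Proof.
move=> fp hG; pose G (E : set Y) := forall y z : Y, E y -> E z -> Gsum lq 0 m%:R (lft y) <= Gsum lq 0 m%:R (lft z) + c *+ 2.
have Gdown (D E : set Y) : D `<=` E -> G E -> G D by move=> DE h y z /DE Ey /DE Ez; exact: h.
have balls y : exists2 e, 0 < e & G (fat [set y] e).
  have [e e0 he] := hG _ (UT_lft y); exists (Num.min e 1); first by rewrite lt_min e0 ltr01.
  have near z : fat [set y] (Num.min e 1) z -> Gsum lq 0 m%:R (lft y) <= Gsum lq 0 m%:R (lft z) + c /\
      Gsum lq 0 m%:R (lft z) <= Gsum lq 0 m%:R (lft y) + c.
    rewrite /fat /= -[z]prj_lft => dz; have Uz := UT_lft z.
    have e1 : Num.min e 1 <= 1 by rewrite ge_min lexx orbT.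
    have [q [Uq qy]] := dset_lt W'sub Uz dz e1; rewrite rhoC// lt_min => /andP[rq _].
    have /(prj_eq Uq (UT_lft y))[w W'w yw] : prj q = prj (lft y) by rewrite prj_lft.
    have Ww := W'sub W'w.
    rewrite (Gsum_lft W'sub _ _ lqok Uz) yw (Gsum_act _ _ lqok Ww Uq).
    have Uzw : UT (act (lft z) w) by exact: (isom_UT (W_isom Ww) Uz).
    have := he _ Uzw; rewrite yw (rho_act (W_isom Ww))// => /(_ rq).
    by rewrite !(Gsum_act _ _ lqok Ww).
  by move=> z1 z2 /near[_ h1] /near[h2 _]; rewrite mulr2n addrA; apply: le_trans h1 _; rewrite lerD2r.
have [I [b hb]] := fine_partition fA W'sub W'fin fp Gdown balls.
pose v i := if pselect (exists y, b y = i) is left h then Gsum lq 0 m%:R (lft (sval (cid h))) + c *+ 2 else 0.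
have c0 : 0 <= c *+ 2.
  have [y] : exists y : Y, True by exists point.
  by have [_ /(_ y y erefl erefl)] := hb (b y); rewrite lerDl.
exists I, b, v; split.
- by move=> i; have [] := hb i.
- by move=> i; rewrite /v; case: pselect => // h; rewrite addr_ge0//; exact: (wsum_ge0 lqok).
move=> y; rewrite /v; case: pselect => [h|[]]; last by exists y.
case: (cid h) => z /= bz; have [_ hi] := hb (b y).
rewrite (hi y z)//= (_ : c *+ 4 = c *+ 2 + c *+ 2); last by rewrite -mulrnDr.
by rewrite [leRHS]addrA lerD2r; exact: hi.
Qed.

(** * A measure realising a prescribed growth rate *)

Section Maximizing.
Variables (lam c0 : R) (dir : 'M[R]_n.+2 -> V * V).
Hypotheses (lam0 : 0 <= lam)
  (often : forall N, exists2 k : nat, (N <= k)%N & lam * k.+1%:R - c0 <= ln (growth k.+1%:R))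
  (hdir : forall w, W w -> aims (dir w) w).
Notation mn := (mean dir).

(** An ultrafilter concentrated on the indices with large growth makes the averages converge on all
    sets simultaneously. *)
Lemma limit_distribution : exists (U : set_system nat) (nu : set Y -> R),
  [/\ UltraFilter U, U [set k | lam * k.+1%:R - c0 <= ln (growth k.+1%:R)], \oo `<=` U &
      forall E : set Y, mn k E @[k --> U] --> nu E].
Proof.
pose S := [set k : nat | lam * k.+1%:R - c0 <= ln (growth k.+1%:R)].
have PF : ProperFilter (within S \oo).
  apply: Build_ProperFilter_ex => E [N _ hN]; have [k Nk Sk] := often N.
  by exists k; apply: hN.
have [U [UU hU]] := ultraFilterLemma PF.
have bd (E : set Y) k : `|mn k E| <= 1.
  by have /andP[h1 h2] := @mean_ge0 dir k E; rewrite ger0_norm.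
have /choice[nu hnu] (E : set Y) := bounded_ultra_cvg UU (bd E).
exists U, nu; split=> //; first by apply: hU; exact: withinT.
by move=> E nE; apply: hU; exact: (cvg_within S nE).
Qed.

Section LimitDistribution.
Variables (U : set_system nat) (nu : set Y -> R).
Hypotheses (UU : UltraFilter U) (US : U [set k | lam * k.+1%:R - c0 <= ln (growth k.+1%:R)])
  (Uoo : \oo `<=` U) (cv : forall E : set Y, mn k E @[k --> U] --> nu E).

Let PU : ProperFilter U. Proof. exact: ultra_proper. Qed.

Lemma limit_fap : fap setT nu.
Proof.
have fm k := mean_fap dir k.
split=> //.
- by move=> D _; apply: (cvg_le PU (@cvg_cst _ _ _ _ _) (@cv D)); apply: nearW => k; exact: (fap_ge0 (fm k)).
- have := @cv setT; rewrite (_ : (fun k => mn k setT) = cst 1); last first.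
    by apply/funext => k; exact: (fap_1 (fm k)).
  by move=> h; apply: (cvg_unique _ h (@cvg_cst _ _ _ _ _)).
move=> D E _ _ DE; have := @cv (D `|` E).
rewrite (_ : (fun k => mn k (D `|` E)) = (fun k => mn k D + mn k E)); last first.
  by apply/funext => k; exact: (fap_U (fm k)).
by move=> h; apply: (cvg_unique _ h (cvgD (@cv D) (@cv E))).
Qed.

Lemma limit_shift t d (E : set Y) : 0 <= t -> 0 < d -> nu (qf t @^-1` E) <= nu (fat E d).
Proof.
move=> t0 d0; have ti : t / k.+1%:R @[k --> U] --> (0 : R).
  apply: cvg_trans (_ : t / k.+1%:R @[k --> \oo] --> 0); first by move=> X; exact: Uoo.
  by rewrite -[X in _ --> X](mulr0 t); apply: cvgMr; exact: cvg_harmonic.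
rewrite -[leRHS]addr0; apply: (cvg_le PU (@cv _) (cvgD (@cv (fat E d)) ti)).
have : \forall k \near U, 2 / d < k%:R by apply: Uoo; exact: nbhs_infty_gtr.
apply: filterS => k hk; apply: (mean_shift hdir) => //.
rewrite ltr_pdivrMr// mulrC -ltr_pdivrMr//; apply: lt_trans hk _; by rewrite ltr_nat.
Qed.

(** After division by the length the terms in [K] and [ln (C * k.+2)] vanish. The constant 4
    collects 2 from the entropy in the limit, 1 from the weighted sum and 1 for the vanishing
    terms. *)
Lemma limit_bound (I : finType) (a : Y -> I) (C : nat) c1 : 0 <= c1 ->
  (forall x y x' y', M x -> M y -> M x' -> M y' -> dist g x x' <= 1 -> dist g y y' <= 1 ->
    Sep x y <= Sep x' y' + c1) ->
  (forall (k : nat) s (j0 : 'I_(size (shell k.+1%:R))), 0 <= s <= 1 ->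
    (#|[pred j | word (qf 1) a k.+2 (qf s (prj (dir (@elt k j)))) ==
       word (qf 1) a k.+2 (qf s (prj (dir (@elt k j0))))]| <= C * k.+2)%N) ->
  forall (m : nat) (I2 : finType) (h : Y -> I2) (v : I2 -> R), (0 < m)%N ->
  (forall p, UT p -> Gsum lq 0 m%:R p <= v (h (prj p))) ->
  m%:R * lam <= c1 + 4 + entropy nu (word (qf 1) a m) + \sum_i law nu h i * v i.
Proof.
move=> c10 hc1 atom m I2 h v m0 hv; have [cm cm0 hcm] := Csum_bound fA m.+1%:R lqok.
pose K : R := m%:R * ln #|I|%:R + cm + (m%:R * ln #|I|%:R + cm + c1).
have near1 := entropy_ulim (word (qf 1) a m) UU (fun k => mean_fap dir k) limit_fap cv.
have cvs : \sum_i law (mn k) h i * v i @[k --> U] --> \sum_i law nu h i * v i.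
  by apply: cvg_big => [|i _]; [exact: add_continuous|exact: (cvgM (@cv (h @^-1` [set i])) (@cvg_cst _ (v i) _ U _))].
have near2 : \forall k \near U, \sum_i law (mn k) h i * v i < \sum_i law nu h i * v i + 1.
  by apply: (cvgr_lt _ cvs); rewrite ltrDl.
have near3 : \forall k \near U, m%:R * (c0 + K + ln (C * k.+2)%:R) <= k.+1%:R.
  by apply: Uoo; exact: ln_grows.
have : U setT by exact: filterT.
have [k [[[h1 h2] h3] h4]] := filter_ex (filterI (filterI (filterI near1 near2) near3) US).
have lb := level_bound hdir m0 c10 hc1 hcm (atom k) (b := h) (v := v) hv.
move=> _; apply: (limit_arith _ _ h4 lb h1 (ltW h2)) => //.
by apply: le_trans h3; rewrite ler_wpM2l// addrAC.
Qed.

End LimitDistribution.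

Lemma maximizing_measure : exists2 mu : probability bY R, flow_invariant mu &
  (lam%:E <= ks_entropy mu (qf 1) + \int[mu]_(y in setT) (rate (lft y))%:E)%E.
Proof.
have [U [nu [UU US Uoo cv]]] := limit_distribution.
have fp := limit_fap UU cv.
have qi t d (E : set Y) : 0 <= t -> 0 < d -> nu (qf t @^-1` E) <= nu (fat E d) by exact: (limit_shift UU Uoo cv).
have [mu inv hmu] := invariant_limit fA W'sub W'fin fp qi; exists mu => //.
have r0 y : (0 <= (rate (lft y))%:E)%E by rewrite lee_fin (rate_ge0 regB apA fA (UT_lft y)).
have mq := measurable_flow W'sub 1.
have inv1 (D : set bY) : measurable D -> mu (qf 1 @^-1` D) = mu D by exact: inv.
have [e e0 [C hC]] := atom_bound.
pose G (E : set Y) := forall p q, UT p -> UT q -> E (prj p) -> E (prj q) ->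
  exists2 w, mgroup_set W' w & rho p (act q w) < e.
have Gdown (D E : set Y) : D `<=` E -> G E -> G D.
  by move=> DE h p q Up Uq /DE Ep /DE Eq; exact: h.
have balls y : exists2 d, 0 < d & G (fat [set y] d).
  exists (Num.min (e / 2) 1); first by rewrite lt_min ltr01 divr_gt0.
  have d1 : Num.min (e / 2) 1 <= 1 by rewrite ge_min lexx orbT.
  have near p : UT p -> fat [set y] (Num.min (e / 2) 1) (prj p) ->
      exists p', [/\ UT p', prj p' = y & rho p p' < e / 2].
    by move=> Up /(dset_lt W'sub Up)/(_ d1)[p' [Up' py]]; rewrite lt_min => /andP[h _]; exists p'.
  move=> p q Up Uq /(near p Up)[p' [Up' py rp]] /(near q Uq)[q' [Uq' qy rq]].
  have /(prj_eq Uq' Up')[w W'w pw] : prj q' = prj p' by rewrite py qy.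
  have iw := W_isom (W'sub W'w); exists w => //.
  have Uqw := isom_UT iw Uq; apply: le_lt_trans (rho_triangle Up Up' Uqw) _.
  rewrite [X in _ + X](rhoC Up' Uqw) pw (rho_act iw Uq Uq') [ltRHS](splitr e).
  by rewrite ltrD// -pw.
have [I [a ha]] := fine_partition fA W'sub W'fin fp Gdown balls.
have [c1 c10 hc1] := Sep_close regB apA fA 1.
have atom (k : nat) s (j0 : 'I_(size (shell k.+1%:R))) : 0 <= s <= 1 ->
    (#|[pred j | word (qf 1) a k.+2 (qf s (prj (dir (@elt k j)))) ==
       word (qf 1) a k.+2 (qf s (prj (dir (@elt k j0))))]| <= C * k.+2)%N.
  move=> s01; apply: (hC I a _ k.+1 s _ (@elt k) (fun j => dir (elt j)) j0 s01) => //.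
  - by move=> p q Up Uq apq; have [_] := ha (a (prj p)); apply.
  - exact: elt_inj.
  - by move=> j; split; [exact: mem_nth|apply: hdir; have [] := eltP j].
have [c4 c40 hG] : exists2 c4, 0 <= c4 & forall m : nat, (0 < m)%N ->
    (\int[mu]_(y in setT) (Gsum lq 0 m%:R (lft y))%:E <=
     c4%:E + m%:R%:E * \int[mu]_(y in setT) (rate (lft y))%:E)%E.
  by have [c4 c40 h] := int_Gsum_upper; exists c4 => // m; exact: h.
have fpn : fap (null nu) nu.
  split; [|exact: nullC|exact: (nullI fp)|by move=> *; exact: (fap_ge0 fp)|exact: (fap_1 fp)|by move=> *; exact: (fap_U fp)].
  by rewrite -setC0; apply: nullC; exact: (null0 fp).
have aN m i : null nu (word (qf 1) a m @^-1` [set i]).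
  apply: (adapted_word fpn); first by move=> D; exact: (null_flow fA W'sub W'fin fp qi ler01).
  by move=> j; have [[]] := ha j.
have aM : adapted (@measurable _ bY) a by move=> i; have [[]] := ha i.
have ent_eq m : entropy nu (word (qf 1) a m) = entropy (prob mu) (word (qf 1) a m).
  by rewrite /entropy; congr (ent _); apply/funext => i; rewrite /law /prob (hmu _ (aN m i)).
(* An infinite integral leaves only nonnegativity of the entropy to check; the subtraction in the
   other case requires a finite value. *)
have [Ry|Rfin] := eqVneq (\int[mu]_(y in setT) (rate (lft y))%:E)%E +oo%E.
  rewrite Ry addey ?leey// gt_eqF// (lt_le_trans (ltNy0)) // (_ : 0%E = 0%:E)//.
  apply: (ks_entropy_ge mq inv1 aM (c0 := 0)) => m _; rewrite mul0r subr0.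
  by rewrite -ent_eq; exact: (entropy_ge0 fp).
have Rf : (\int[mu]_(y in setT) (rate (lft y))%:E)%E \is a fin_num.
  by rewrite ge0_fin_numE ?ltey//; exact: integral_ge0.
rewrite -(fineK Rf); set F := fine _; rewrite -leeBlDr// -EFinB.
have [cG cG0 hcG] := Gsum_near.
apply: (ks_entropy_ge mq inv1 aM (c0 := c1 + 4 + (c4 + cG *+ 4))) => m m0.
have [I2 [h [v [hn v0 hv]]]] := Gsum_partition fp (hcG m).
have hvp p : UT p -> Gsum lq 0 m%:R p <= v (h (prj p)).
  by move=> Up; rewrite -(Gsum_lft W'sub _ _ lqok Up); have /andP[] := hv (prj p).
have lb := limit_bound UU US Uoo cv c10 hc1 atom (h := h) (v := v) m0 hvp.
have hM : adapted (@measurable _ bY) h by move=> i; have [] := hn i.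
have law_eq : \sum_i law nu h i * v i = \sum_i law (prob mu) h i * v i.
  by apply: eq_bigr => i _; rewrite /law /prob hmu//; have [] := hn i.
have : ((\sum_i law (prob mu) h i * v i)%:E <= (c4 + m%:R * F + cG *+ 4)%:E)%E.
  rewrite -integral_law//; have := hG m m0; rewrite -(fineK Rf) -/F -EFinM -EFinD => hGm.
  rewrite [leRHS]EFinD; apply: le_trans (leeD hGm (le_refl _)).
  have -> : (cG *+ 4)%:E = (\int[mu]_(y in setT) cst (cG *+ 4)%:E y)%E.
    by rewrite integral_cst// [X in (_ * X)%E]probability_setT mule1.
  rewrite -ge0_integralD//; last 3 first.
  - by move=> y _; rewrite lee_fin (wsum_ge0 lqok).
  - exact: (measurable_GsumE).
  - by move=> y _; rewrite lee_fin mulrn_wge0.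
  apply: ge0_le_integral => //.
  - by move=> y _; rewrite lee_fin.
  - by apply/measurable_EFinP; exact: (measurable_adapted v hM).
  - by apply: emeasurable_funD => //; exact: (measurable_GsumE).
  by move=> y _; rewrite -EFinD lee_fin; have /andP[] := hv y.
rewrite lee_fin -ent_eq => ub; move: lb ub; rewrite law_eq.
by move: (entropy _ _) (\sum_i _) => x1 x2 h1 h2; rewrite mulrBl; exact: rate_arith h1 h2.
Qed.

End Maximizing.

(** * Comparison of pressure, growth and volume *)

Notation pressure mu :=
  (ks_entropy mu (qf 1) + \int[mu]_(y in [set: bY]) (log_q_over_l A f y)%:E)%E.

Let rE (y : bY) : log_q_over_l A f y = rate (lft y).
Proof. exact: (log_q_over_lE regB apA fA). Qed.

Let r0 (y : Y) : 0 <= rate (lft y).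
Proof. exact: (rate_ge0 regB apA fA (UT_lft y)). Qed.

(** The integral of the rate may be infinite; monotone convergence gives a bounded truncation whose
    finite integral still exceeds [b], as the counting estimate requires. *)
Lemma rate_truncation (mu : probability bY R) (b : R) :
  (b%:E < \int[mu]_(y in setT) (rate (lft y))%:E)%E ->
  exists (N : nat) (F : R), b < F /\ (\int[mu]_(y in setT) (Num.min (rate (lft y)) N%:R)%:E = F%:E)%E.
Proof.
move=> hb; pose h (N : nat) (y : bY) : \bar R := (Num.min (rate (lft y)) N%:R)%:E.
have mh N : measurable_fun setT (h N) by exact: (measurable_min_rate).
have h0 N y : (0 <= h N y)%E by rewrite lee_fin le_min r0/=.
have hN N y : (h N y <= N%:R%:E)%E by rewrite lee_fin ge_min lexx orbT.
have nd y : {homo h^~ y : m k / (m <= k)%N >-> (m <= k)%E}.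
  by move=> m k mk; rewrite lee_fin le_min !ge_min lexx/= ler_nat mk orbT.
have lim y : limn (h^~ y) = (rate (lft y))%:E.
  apply/cvg_lim => //; apply: cvg_near_cst; near=> N; rewrite /h min_l//.
  by near: N; exact: nbhs_infty_ger.
have cv := cvg_monotone_convergence (mu := mu) measurableT mh (fun N y _ => h0 N y) (fun y _ => nd y).
have [N hN'] : exists N, (b%:E < \int[mu]_(y in setT) h N y)%E.
  apply: contrapT => no; have le N : (\int[mu]_(y in setT) h N y <= b%:E)%E.
    by rewrite leNgt; apply/negP => l; apply: no; exists N.
  suff : (\int[mu]_(y in setT) (rate (lft y))%:E <= b%:E)%E by rewrite leNgt hb.
  rewrite (_ : (fun y => (rate (lft y))%:E) = (fun y : bY => limn (h^~ y))).
    exact: (cvge_le (nearW _ le) cv).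
  by apply/funext => y; rewrite lim.
have fin : (\int[mu]_(y in setT) h N y)%E \is a fin_num.
  rewrite ge0_fin_numE; last by apply: integral_ge0.
  apply: le_lt_trans (_ : (\int[mu]_(y in setT) cst N%:R%:E y < +oo)%E).
    by apply: ge0_le_integral => // y _; rewrite lee_fin.
  by rewrite integral_cst// [X in (_ * X)%E]probability_setT mule1 ltry.
by exists N, (fine (\int[mu]_(y in setT) h N y)); rewrite fineK// -lte_fin fineK.
Unshelve. all: by end_near. Qed.

Lemma growth_rate_ge (lam : R) :
  (lam%:E < ereal_sup [set pressure mu | mu in [set mu | @flow_invariant R g n W' mu]])%E ->
  \forall r \near +oo%R, lam * r <= ln (growth r).
Proof.
move=> /ereal_sup_gt[_ [mu inv <-]]; under eq_integral do rewrite rE.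
move=> /lte_split[|x1 [x2 [h1 h2 lt]]]; first by apply: integral_ge0 => y _; rewrite lee_fin.
have [_ [k [xi [mxi ->]]] hx] := ereal_sup_gt h1.
have mq := measurable_flow W'sub 1.
have inv1 (D : set bY) : measurable D -> mu (qf 1 @^-1` D) = mu D by exact: inv.
have [a aa ha] := partition_entropy_le mq inv1 mxi.
have [N [F [bF hF]]] := rate_truncation h2.
rewrite lte_fin in hx; set h := partition_entropy _ _ _ in hx ha.
have e0 : 0 < h + F - lam by lra.
apply: filterS (growth_rate_lower inv aa ha (ler0n _ N) hF e0) => r.
by rewrite opprB addrCA subrr addr0.
Qed.

(** Otherwise the growth exceeds the rate [lam] at arbitrarily large radii. Rounding these up to
    integers costs at most [|lam|], and the measure built from them has pressure at least [lam]. *)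
Lemma growth_rate_le (lam : R) :
  (ereal_sup [set pressure mu | mu in [set mu | @flow_invariant R g n W' mu]] < lam%:E)%E ->
  \forall r \near +oo%R, ln (growth r) <= lam * r.
Proof.
move=> hlam; apply: contrapT => nn.
have far (m : R) : exists2 r, m < r & lam * r < ln (growth r).
  apply: contrapT => no; apply: nn; exists m; split; first by rewrite num_real.
  by move=> r mr; rewrite leNgt; apply/negP => l; apply: no; exists r.
have /choice[dir hdir] (w : 'M[R]_n.+2) : exists p, W w -> aims p w.
  have [Ww|nw] := EM (W w); last by exists (0, 0).
  by have [p hp] := aims_exists Ww; exists p.
have often N : exists2 k : nat, (N <= k)%N & lam * k.+1%:R - `|lam| <= ln (growth k.+1%:R).
  have [r Nr hr] := far N%:R; have rr : 0 <= r by rewrite (le_trans _ (ltW Nr)).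
  have /andP[k1 k2] := truncn_itv rr; exists (Num.truncn r).
    by rewrite -ltnS -(ltr_nat R) (lt_trans Nr).
  have g1 := growth_ge1 rr; have gl := growth_le (ltW k2).
  have g2 : ln (growth r) <= ln (growth (Num.truncn r).+1%:R).
    by rewrite ler_ln ?posrE ?(lt_le_trans ltr01)// (le_trans g1).
  apply: le_trans g2; apply: le_trans (ltW hr); rewrite lerBlDr -lerBlDl -mulrBr.
  apply: le_trans (ler_norm _) _; rewrite normrM ler_piMr// ger0_norm ?subr_ge0; last exact: ltW.
  by rewrite lerBlDr -natr1 addrC lerD2l.
have [mu inv hmu] := maximizing_measure often hdir.
have : (pressure mu < lam%:E)%E.
  by apply: le_lt_trans hlam; apply: ereal_sup_ubound; exists mu.
by under eq_integral do rewrite rE; rewrite ltNge hmu.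
Qed.

(** The strict inequalities on both sides of [H] leave room for the shift of the radius by [c] and
    for [ln vol], and also cover an infinite [H]. *)
Lemma volume_growth_rate (H : \bar R) :
  (forall lam, (lam%:E < H)%E -> \forall r \near +oo%R, lam * r <= ln (growth r)) ->
  (forall lam, (H < lam%:E)%E -> \forall r \near +oo%R, ln (growth r) <= lam * r) ->
  is_volume_entropy B H.
Proof.
move=> hge hle x; have [c hc] := cvolume_bounds x.
have [_ v0] := volE.
have g1 r : 0 <= r -> 0 < growth r by move=> h; apply: lt_le_trans ltr01 (growth_ge1 h).
apply: ereal_cvg_squeeze => lam h.
  have [a la aH] := lte_dense_left h; have hs := near_shift (- c) (hge a aH).
  have hl := near_linear (- (a * c) + ln vol) la.
  near=> r.
  have r1 : 0 < r by near: r; exact: nbhs_pinfty_gt.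
  have rc : 0 <= r - c by rewrite subr_ge0; near: r; apply: nbhs_pinfty_ge; rewrite num_real.
  apply: (lne_ge _ (hc r)) => //; first by rewrite mulr_gt0// g1.
  rewrite lnM ?posrE ?g1//; apply: le_trans (_ : a * r + (- (a * c) + ln vol) <= _); first by near: r.
  by rewrite addrA -mulrBr lerD2r; near: r.
have [a la aH] := lte_dense_right h; have hs := near_shift c (hle a aH).
have hl := near_linear (- (a * c + ln vol)) la.
near=> r.
have r1 : 0 < r by near: r; exact: nbhs_pinfty_gt.
have rc : 0 <= r - c by rewrite subr_ge0; near: r; apply: nbhs_pinfty_ge; rewrite num_real.
have rc' : 0 <= r + c by rewrite -[c]opprK subr_ge0; near: r; apply: nbhs_pinfty_ge; rewrite num_real.
apply: (lne_le _ (hc r)) => //; first by rewrite mulr_gt0// g1.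
rewrite lnM ?posrE ?g1//; apply: le_trans (_ : a * r + (a * c + ln vol) <= _).
  by rewrite addrA -mulrDr lerD2r; near: r.
by rewrite -lerBrDr; near: r.
Unshelve. all: by end_near. Qed.

End VariationalPrinciple.

Theorem theorem1p1 (R : realType) (g : geometry) (n : nat)
    (P : coxeter_polyhedron R g n) (B : building P) (B_regular : regular_building B)
    (Gamma : groupType) (act : Gamma -> bspace B -> bspace B)
    (Gamma_action : geometric_action act)
    (W' : matrix_group R n) (W'_sub : W' `<=` coxeter_group P)
    (W'_index : finite_index W' (coxeter_group P))
    (W'_torsion_free : torsion_free W')
    (A : set (cplx_point B)) (A_apartment : apartment B A)
    (f : 'rV[R]_n.+2 -> cplx_point B) (f_iso : tessellation_isometry f A) :
  is_volume_entropy B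
    (ereal_sup [set (ks_entropy mu (quotient_flow 1)
                 + \int[mu]_(y in [set: borel_T1Y g W'])
                     (log_q_over_l A f y)%:E)%E
               | mu in [set mu : probability (borel_T1Y g W') R
                          | flow_invariant mu]]).
Proof.
apply: (volume_growth_rate B_regular A_apartment f_iso) => lam h.
- exact: (growth_rate_ge B_regular A_apartment f_iso W'_sub W'_index h).
- exact: (growth_rate_le B_regular A_apartment f_iso W'_sub W'_index W'_torsion_free h).
Qed.
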